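(* Let the observations be $y_t=u_t+z_t^{\gamma_n}\xi_t$, $t=1-p,\dots,n$, as described in the context. Let $\hat{\bm\beta}_n^y=(\hat\beta^y_{1n},\dots,\hat\beta^y_{pn})^T$ be an estimator of $\bm\beta$ based on $y_{1-p},\dots,y_n$, define residuals $\hat\varepsilon_t^y=y_t-\hat\beta^y_{1n}y_{t-1}-\dots-\hat\beta^y_{pn}y_{t-p}$, $t=1,\dots,n$. Fix $m\ge1$ and points $0=x_0<x_1<\dots<x_m=\infty$ with $p_j^+:=P(x_j)-P(x_{j-1})>0$, $j=1,\dots,m$. Let $B_j^+=(x_{j-1},x_j]$, $B_j^-=(-x_j,-x_{j-1}]$ (with $B_m^+=(x_{m-1},\infty)$, $B_m^-=(-\infty,-x_{m-1}]$), let $\hat\nu_j^{\pm}$ be the number of residuals $\hat\varepsilon_1^y,\dots,\hat\varepsilon_n^y$ lying in $B_j^{\pm}$, and $$\hat\chi_n^2=\sum_{j=1}^m\frac{(\hat\nu_j^+-\hat\nu_j^-)^2}{2\hat\nu_j^+}.$$ Let $F_m(x,\lambda^2)$ denote the d.f. of the noncentral chi-square distribution with $m$ degrees of freedom and noncentrality parameter $\lambda^2$, and $|\cdot|$ the Euclidean norm. Fix arbitrary finite $R\ge0$, $\Gamma\ge0$. 1. Suppose the hypothesis $\mathbb S$ holds (i.e. $\rho=0$, innovation d.f. $P$ symmetric about zero), $P$ has zero mean and finite variance and is twice differentiable with bounded second derivative, and Condition (iv) holds with $\rho=0$. Then $$\sup_{x\in\mathbb R,\ \gamma\le\Gamma}\big|\mathbb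 P(\hat\chi_n^2\le x)-F_m(x,\lambda^2)\big|\to0,\quad n\to\infty,$$ where $\lambda^2=\gamma^2\,|\mathcal P^{-1/2}\bm\delta(\Pi)|^2$. 2. Suppose the alternative $\mathbb A_n(\rho)$ holds with $\rho>0$, and Conditions (i), (ii), (iv) hold. Then $$\sup_{x\in\mathbb R,\ \gamma\le\Gamma,\ \rho\le R}\big|\mathbb P(\hat\chi_n^2\le x)-F_m(x,\lambda^2)\big|\to0,\quad n\to\infty,$$ where $$\lambda^2=\big|\mathcal P^{-1/2}\,[\rho(\bm q^+-\bm q^-)+\gamma\,\bm\delta(\Pi)]\big|^2.$$
   Context: $AR(p)$ model: $u_t=\beta_1u_{t-1}+\dots+\beta_pu_{t-p}+\varepsilon_t$, $t\in\mathbb Z$, with known order $p$, unknown $\bm\beta=(\beta_1,\dots,\beta_p)^T$ such that all roots of $z^p-\beta_1z^{p-1}-\dots-\beta_p=0$ lie inside the unit disk, and i.i.d. innovations $\{\varepsilon_t\}$ with mean $0$, finite positive variance and d.f. $G$; $\{u_t\}$ is the stationary solution. Contaminated observations: $y_t=u_t+z_t^{\gamma_n}\xi_t$, $t=1-p,\dots,n$, where $\{z_t^{\gamma_n}\}$ are i.i.d. Bernoulli with success probability $\gamma_n=\min\{1,\gamma n^{-1/2}\}$, $\gamma\ge0$ unknown; $\{\xi_t\}$ are i.i.d. with an arbitrary unknown distribution $\Pi$ (gross errors); the sequences $\{u_t\},\{z_t^{\gamma_n}\},\{\xi_t\}$ are independent. Local alternatives: for $\rho\ge0$, $\mathbb A_n(\rho)$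 means $G(x)=A_n(x):=(1-\rho_n)P(x)+\rho_nQ(x)$ with $\rho_n=\min\{1,\rho n^{-1/2}\}$, $P$ an unknown d.f. symmetric about zero, $Q$ an unknown non-symmetric d.f.; $\rho=0$ is the symmetry hypothesis $\mathbb S$: $\varepsilon_1\overset{d}{=}-\varepsilon_1$. Condition (i): $P$ and $Q$ have zero means and finite variances. Condition (ii): $P$ and $Q$ are twice differentiable with bounded second derivatives. Condition (iv): under $\mathbb A_n(\rho)$, $n^{1/2}(\hat{\bm\beta}^y_n-\bm\beta)=O_P(1)$ as $n\to\infty$, uniformly in $\rho\le R$, $\gamma\le\Gamma$ (for all finite $R,\Gamma\ge0$). Notation: $\Delta(x,\Pi)=\sum_{j=0}^p[\mathbb E\,P(x+\beta_j\xi_1)-P(x)]$ with $\beta_0=-1$; $\delta_j(\Pi)=\Delta(x_j,\Pi)-\Delta(x_{j-1},\Pi)-[\Delta(-x_{j-1},\Pi)-\Delta(-x_j,\Pi)]$, $\bm\delta(\Pi)=(\delta_1(\Pi),\dots,\delta_m(\Pi))^T$; $q_j^+=Q(x_j)-Q(x_{j-1})$, $q_j^-=Q(-x_{j-1})-Q(-x_j)$, $\bm q^{\pm}=(q_1^\pm,\dots,q_m^\pm)^T$; $\mathcal P=\mathrm{diag}\{2p_1^+,\dots,2p_m^+\}$. *)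

(* Defs.v *)
From HB Require Import structures.
From mathcomp Require Import all_boot all_order all_algebra.
From mathcomp Require Import all_classical all_reals all_analysis.
From mathcomp Require Import complex.
Set Implicit Arguments.
Unset Strict Implicit.
Unset Printing Implicit Defensive.
Import Order.TTheory GRing.Theory Num.Theory.
Import numFieldNormedType.Exports.
Local Open Scope classical_set_scope.
Local Open Scope ring_scope.

(* A d.f. is represented by its probability measure mu on R:           *)
(*   F(x) = mu (-oo, x].                                               *)
Definition cdfE (R : realType) (mu : probability R R) (x : \bar R) : R :=
  match x with
  | r%:E => fine (mu [set y : R | y <= r])
  | +oo%E => 1
  | -oo%E => 0
  end.

Definition df_of (R : realType) (mu : probability R R) (x : R) : R := cdfE mu x%:E.

Definition symmetric_law (R : realType) (mu : probability R R) : Prop :=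
  forall A : set R, measurable A -> mu [set - x | x in A] = mu A.

Definition zero_mean_finite_var (R : realType) (mu : probability R R) : Prop :=
  [/\ mu.-integrable setT (fun x : R => x%:E),
      (\int[mu]_x (x%:E) = 0)%E &
      mu.-integrable setT (fun x : R => (x ^+ 2)%:E)].

Definition twice_diff_bdd (R : realType) (F : R -> R) : Prop :=
  [/\ (forall x, derivable F x 1),
      (forall x, derivable (derive1 F) x 1) &
      exists M : R, forall x, `|derive1 (derive1 F) x| <= M].

(* AR(p) coefficients: all roots of z^p - b_1 z^(p-1) - ... - b_p lie   *)
(* inside the open unit disk.  beta i stands for beta_(i+1).           *)
Definition stable_AR (R : realType) (p : nat) (beta : 'I_p -> R) : Prop :=
  forall z : R[i],
    z ^+ p - \sum_(i < p) ((beta i)%:C)%C * z ^+ (p - i.+1) = 0 -> `|z| < 1.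

Section Prob.
Context (R : realType) (d : measure_display) (Omega : measurableType d)
        (Pr : probability Omega R).

Definition fdd_event (X : int -> Omega -> R) (s : seq int) (a : int -> R) :
  set Omega := [set w | all (fun t => X t w <= a t) s].

Definition mutually_indep (X : int -> Omega -> R) : Prop :=
  forall (s : seq int) (a : int -> R), uniq s ->
    fine (Pr (fdd_event X s a)) = \prod_(t <- s) fine (Pr [set w | X t w <= a t]).

Definition indep3 (X Y Z : int -> Omega -> R) : Prop :=
  forall (s1 s2 s3 : seq int) (a b c : int -> R),
    fine (Pr (fdd_event X s1 a `&` fdd_event Y s2 b `&` fdd_event Z s3 c)) =
    fine (Pr (fdd_event X s1 a)) * fine (Pr (fdd_event Y s2 b))
      * fine (Pr (fdd_event Z s3 c)).

Definition strictly_stationary (X : int -> Omega -> R) : Prop :=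
  forall (s : seq int) (a : int -> R) (h : int),
    Pr (fdd_event (fun t => X (t + h)) s a) = Pr (fdd_event X s a).

Definition contaminated_AR_model (p : nat) (beta : 'I_p -> R) (G : R -> R)
    (gn : R) (Pi : probability R R)
    (u eps z xi : int -> Omega -> R) : Prop :=
  [/\ (forall t, [/\ measurable_fun setT (u t), measurable_fun setT (eps t),
                    measurable_fun setT (z t) & measurable_fun setT (xi t)]),
      (forall t x, fine (Pr [set w | eps t w <= x]) = G x) /\ mutually_indep eps,
      (forall t, Pr [set w | u t w =
          \sum_(i < p) beta i * u (t - (i.+1)%:Z) w + eps t w] = 1%E)
        /\ strictly_stationary u,
      (forall t, Pr [set w | z t w = 1] = gn%:E /\ Pr [set w | z t w = 0] = (1 - gn)%:E)
        /\ mutually_indep z &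
      [/\ (forall t A, measurable A -> Pr [set w | xi t w \in A] = Pi A),
          mutually_indep xi & indep3 u z xi]].

End Prob.

Section Stat.
Context (R : realType).

Definition yobs {T : Type} (u z xi : int -> T -> R) (t : int) (w : T) : R :=
  u t w + z t w * xi t w.

Definition obs (p n : nat) (y : int -> R) : seq R :=
  [seq y (k%:Z - p%:Z + 1) | k <- iota 0 (n + p)].

Definition resid (p : nat) (bh : 'I_p -> R) (y : int -> R) (t : int) : R :=
  y t - \sum_(i < p) bh i * y (t - (i.+1)%:Z).

(* cells: xs : nat -> \bar R with xs 0 = 0, xs m = +oo;
   B_j^+ = (x_(j-1), x_j],  B_j^- = (-x_j, -x_(j-1)]. *)
Definition in_Bplus (xs : nat -> \bar R) (j : nat) (e : R) : bool :=
  ((xs j.-1 < e%:E) && (e%:E <= xs j))%E.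
Definition in_Bminus (xs : nat -> \bar R) (j : nat) (e : R) : bool :=
  ((- xs j < e%:E) && (e%:E <= - xs j.-1))%E.

Definition resids (p n : nat) (bh : 'I_p -> R) (y : int -> R) : seq R :=
  [seq resid bh y k%:Z | k <- iota 1 n].

Definition nu_plus (p n : nat) (bh : 'I_p -> R) (y : int -> R) (xs : nat -> \bar R) (j : nat) : R := (count (in_Bplus xs j) (resids n bh y))%:R.
Definition nu_minus (p n : nat) (bh : 'I_p -> R) (y : int -> R) (xs : nat -> \bar R) (j : nat) : R := (count (in_Bminus xs j) (resids n bh y))%:R.

(* chi^2 = sum_{j=1}^m (nu_j^+ - nu_j^-)^2 / (2 nu_j^+)   (x/0 = 0) *)
Definition chi2_stat (p n m : nat) (bh : 'I_p -> R) (y : int -> R)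
    (xs : nat -> \bar R) : R :=
  \sum_(1 <= j < m.+1)
     (nu_plus n bh y xs j - nu_minus n bh y xs j) ^+ 2
       / (2 * nu_plus n bh y xs j).

Definition eucl (p : nat) (v : 'I_p -> R) : R := Num.sqrt (\sum_(i < p) v i ^+ 2).

Definition rate (g : R) (n : nat) : R := Num.min 1 (g / Num.sqrt n%:R).

End Stat.

Section Noncentral.
Context (R : realType).

Definition beta_ext (p : nat) (beta : 'I_p -> R) (j : nat) : R :=
  if j is j'.+1 then (if insub j' is Some i then beta i else 0) else -1.

Definition DeltaPi (p : nat) (beta : 'I_p -> R) (muP Pi : probability R R)
    (x : \bar R) : R :=
  \sum_(0 <= j < p.+1)
     (Rintegral Pi setT (fun s => cdfE muP (x + (beta_ext beta j * s)%:E)%E)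
        - cdfE muP x).

Definition delta_j (p : nat) (beta : 'I_p -> R) (muP Pi : probability R R) (xs : nat -> \bar R) (j : nat) : R :=
  DeltaPi beta muP Pi (xs j) - DeltaPi beta muP Pi (xs j.-1)
  - (DeltaPi beta muP Pi (- xs j.-1)%E - DeltaPi beta muP Pi (- xs j)%E).

Definition p_plus (muP : probability R R) (xs : nat -> \bar R) (j : nat) : R :=
  cdfE muP (xs j) - cdfE muP (xs j.-1).
Definition q_plus (muQ : probability R R) (xs : nat -> \bar R) (j : nat) : R :=
  cdfE muQ (xs j) - cdfE muQ (xs j.-1).
Definition q_minus (muQ : probability R R) (xs : nat -> \bar R) (j : nat) : R :=
  cdfE muQ (- xs j.-1)%E - cdfE muQ (- xs j)%E.

(* |Pcal^{-1/2} v|^2 with Pcal = diag(2 p_1^+, ..., 2 p_m^+) *)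
Definition wnorm2 (m : nat) (muP : probability R R) (xs : nat -> \bar R)
    (v : nat -> R) : R :=
  \sum_(1 <= j < m.+1) v j ^+ 2 / (2 * p_plus muP xs j).

Definition chi2_kernel (k : nat) (t : R) : R :=
  powR t (k%:R / 2 - 1) * expR (- t / 2).
Definition chi2_cdf (k : nat) (x : R) : R :=
  let I1 : set R := `[0, x]%classic in
  let I2 : set R := `[0, +oo[%classic in
  fine (\int[lebesgue_measure]_(t in I1) (chi2_kernel k t)%:E)%E
  / fine (\int[lebesgue_measure]_(t in I2) (chi2_kernel k t)%:E)%E.

(* noncentral chi-square d.f. F_m(x, lam2): Poisson(lam2/2) mixture of
   central chi-square d.f.'s with m + 2k degrees of freedom *)
Definition ncchi2_cdf (m : nat) (lam2 x : R) : R :=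
  let w : R^nat := fun k : nat =>
    expR (- lam2 / 2) * (lam2 / 2) ^+ k / (k`!)%:R * chi2_cdf (m + 2 * k) x in
  limn (series w).

End Noncentral.

Section AtOmega.
Context (R : realType).

Definition est_at (p n : nat) (est : nat -> seq R -> 'I_p -> R) {T : Type}
    (u z xi : int -> T -> R) (w : T) : 'I_p -> R :=
  est n (obs p n (fun t => yobs u z xi t w)).

Definition chi2_at (p n m : nat) (est : nat -> seq R -> 'I_p -> R)
    (xs : nat -> \bar R) {T : Type} (u z xi : int -> T -> R) (w : T) : R :=
  chi2_stat n m (est_at n est u z xi w) (fun t => yobs u z xi t w) xs.

End AtOmega.

(* Main.v *)
Require Import Defs.
From HB Require Import structures.
From mathcomp Require Import all_boot all_order all_algebra.
From mathcomp Require Import all_classical all_reals all_analysis.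
From mathcomp Require Import measurable_realfun complex.
From mathcomp Require Import ring lra zify.
Set Implicit Arguments.
Unset Strict Implicit.
Unset Printing Implicit Defensive.
Import Order.TTheory GRing.Theory Num.Theory.
Import numFieldNormedType.Exports.
Local Open Scope classical_set_scope.
Local Open Scope ring_scope.

(** The statistic is nonnegative, so it suffices to prove that its Laplace
    transform at every s >= 0 converges, uniformly in the rates, to the one of the
    noncentral chi-square law: indicators of half-lines are approximated by finite
    combinations of exponentials, and the limit law has a uniform modulus of
    continuity.

    The cell frequencies of the innovations are handled by Lindeberg's replacement
    argument.  The image of exp(-s|x|^2) under the heat flow is explicit, hence the
    Gaussian side never has to be constructed: one step of the walk is compared with
    one step of time in this flow.

    The empirical distribution function of the residuals is compared with the one of
    the innovations at a fixed estimator value by splitting off a martingale, whose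
    second moment is small, from its compensator.  The latter produces the smooth
    term linear in the estimation error, which vanishes because the past is centred,
    and the contamination term, which tends to gamma times Delta.  A finite grid of
    estimator values and monotonicity of indicators give uniformity over an
    n^(-1/2)-ball, where the estimator lies by Condition (iv).

    The autoregression enters only through its moving average expansion, truncated at
    a lag growing with n, which makes the past a function of finitely many
    innovations. *)

(** * Expectation and outer probability bounds *)

(** The probability measure and the processes change with n and with the rates. Every estimate is
    therefore quantitative, and its constants, together with the index from which it holds, are
    fixed before the space is introduced; this is the source of all uniformity.

    Laplace transforms are compared because the transform of the noncentral chi-square law with
    noncentrality |x|^2 is the heat flow at time 1 and point x, started from exp(-s|.|^2). One
    family of functions thus supplies both the test functions of the replacement argument and its
    target.

    About sqrt(n) times are contaminated, and each moves a bounded indicator, so normalised counts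
    shift by an amount of order 1. Two contaminations among p + 1 given consecutive times have
    probability of order 1/n, and their total effect vanishes. Gross errors may have no moments:
    they enter only through bounded functions of them. For [u] itself only tightness is at hand, so
    its truncation is controlled in probability, while second moments are taken of the truncated
    expansion, with bounds free of the lag. *)

Definition Ex (R : realType) (d : measure_display) (Omega : measurableType d)
  (Pr : probability Omega R) (f : Omega -> R) : R := Rintegral Pr setT f.

Definition Intg (R : realType) (d : measure_display) (Omega : measurableType d)
  (Pr : probability Omega R) (f : Omega -> R) : Prop :=
  Pr.-integrable setT (EFin \o f).

(* Outer bound on a probability: it needs no measurability of the event, hence
   applies to suprema over uncountable parameter sets. *)
Definition prob_le (R : realType) (d : measure_display) (Omega : measurableType d)
  (Pr : probability Omega R) (A : set Omega) (e : R) : Prop :=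
  exists B, [/\ measurable B, A `<=` B & (Pr B <= e%:E)%E].

Section Expectation.
Context (R : realType) (d : measure_display) (Omega : measurableType d)
        (Pr : probability Omega R).
Implicit Types (f g : Omega -> R).
Local Notation E := (Ex Pr).
Local Notation I := (Intg Pr).
Local Notation mble f := (measurable_fun setT f).

Lemma Intg_measurable f : I f -> mble f.
Proof. by move=> /integrableP[/measurable_EFinP]. Qed.

Lemma Intg_bounded f (M : R) : mble f -> (forall w, `|f w| <= M) -> I f.
Proof.
move=> mf fM; apply: measurable_bounded_integrable => //.
  by rewrite (le_lt_trans (probability_le1 Pr measurableT))// ltry.
exists M; split; first exact: num_real.
by move=> x Mx y _ /=; rewrite (le_trans (fM y))// ltW.
Qed.

Lemma Intg_dom f g : mble f -> I g -> (forall w, `|f w| <= g w) -> I f.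
Proof.
move=> mf ig fg; apply: (@le_integrable _ _ _ Pr setT measurableT _ _ _ _ ig).
  exact/measurable_EFinP.
by move=> w _ /=; rewrite lee_fin (le_trans (fg w))// ler_norm.
Qed.

Lemma Intg_cst (c : R) : I (fun=> c).
Proof. exact: (@Intg_bounded _ `|c|). Qed.

Lemma IntgD f g : I f -> I g -> I (fun w => f w + g w).
Proof. by move=> If Ig; exact: (integrableD measurableT If Ig). Qed.

Lemma IntgZ (c : R) f : I f -> I (fun w => c * f w).
Proof. by move=> If; exact: (integrableZl measurableT c If). Qed.

Lemma IntgN f : I f -> I (fun w => - f w).
Proof. by move=> /(IntgZ (-1)); under eq_fun do rewrite mulN1r. Qed.

Lemma IntgB f g : I f -> I g -> I (fun w => f w - g w).
Proof. by move=> ? ?; apply: IntgD => //; exact: IntgN. Qed.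

Lemma Intg_norm f : I f -> I (fun w => `|f w|).
Proof.
by move=> If; exact: (integrable_abse If).
Qed.

Lemma Intg_sum (J : Type) (s : seq J) (P : pred J) (F : J -> Omega -> R) :
  (forall j, I (F j)) -> I (fun w => \sum_(j <- s | P j) F j w).
Proof.
move=> IF; elim: s => [|j s IH].
  by under eq_fun do rewrite big_nil; exact: Intg_cst.
under eq_fun do rewrite big_cons.
by case: (P j) => //; exact: IntgD.
Qed.

Lemma Intg_mul f g : mble f -> mble g -> I (fun w => f w ^+ 2) ->
  I (fun w => g w ^+ 2) -> I (fun w => f w * g w).
Proof.
move=> mf mg If Ig; apply: (@Intg_dom _ (fun w => f w ^+ 2 + g w ^+ 2)).
- exact: measurable_funM.
- exact: IntgD.
- move=> w; rewrite normrM -(real_normK (num_real (f w))).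
  rewrite -(real_normK (num_real (g w))).
  have := sqr_ge0 (`|f w| - `|g w|).
  have := mulr_ge0 (normr_ge0 (f w)) (normr_ge0 (g w)); nra.
Qed.

Lemma Intg_of_sqr f : mble f -> I (fun w => f w ^+ 2) -> I f.
Proof.
move=> mf If; have -> : f = (fun w => f w * 1) by apply/funext => w; rewrite mulr1.
by apply: Intg_mul => //; exact: Intg_cst.
Qed.

Lemma ExD f g : I f -> I g -> E (fun w => f w + g w) = E f + E g.
Proof. by move=> ? ?; apply: RintegralD. Qed.

Lemma ExB f g : I f -> I g -> E (fun w => f w - g w) = E f - E g.
Proof. by move=> ? ?; apply: RintegralB. Qed.

Lemma ExZ (c : R) f : I f -> E (fun w => c * f w) = c * E f.
Proof. by move=> ?; apply: RintegralZl. Qed.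

Lemma Ex_cst (c : R) : E (fun=> c) = c.
Proof. rewrite /Ex Rintegral_cst//.
by rewrite [X in fine X](_ : _ = 1%E) ?mulr1//; exact: probability_setT. Qed.

Lemma Ex_le f g : I f -> I g -> (forall w, f w <= g w) -> E f <= E g.
Proof. by move=> ? ? fg; apply: le_Rintegral. Qed.

Lemma Ex_ge0 f : (forall w, 0 <= f w) -> 0 <= E f.
Proof. by move=> f0; apply: Rintegral_ge0. Qed.

Lemma Ex_norm f : I f -> `|E f| <= E (fun w => `|f w|).
Proof. by move=> ?; apply: le_normr_Rintegral. Qed.

Lemma Ex_sum (J : Type) (s : seq J) (F : J -> Omega -> R) :
  (forall j, I (F j)) ->
  E (fun w => \sum_(j <- s) F j w) = \sum_(j <- s) E (F j).
Proof.
move=> IF; elim: s => [|j s IH].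
  by rewrite big_nil; under [X in E X]eq_fun do rewrite big_nil; exact: Ex_cst.
rewrite big_cons -IH -ExD//; last exact: Intg_sum.
by congr (E _); apply/funext => w; rewrite big_cons.
Qed.

Lemma measurable_ind (b : Omega -> bool) : mble b ->
  mble (fun w => (b w)%:R : R).
Proof.
move=> mb; apply: (@measurableT_comp _ _ _ _ _ _ (fun x : bool => (x%:R : R)) _ b) => //.
Qed.

Lemma Intg_ind (b : Omega -> bool) : mble b -> I (fun w => (b w)%:R).
Proof.
move=> mb; apply: (@Intg_bounded _ 1); first exact: measurable_ind.
by move=> w; case: (b w); rewrite ?normr0 ?normr1.
Qed.

Lemma measurable_bset (b : Omega -> bool) : mble b -> measurable [set w | b w].
Proof.
by move=> mb; have := mb measurableT [set true]; rewrite setTI; apply.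
Qed.

Lemma Ex_ind (b : Omega -> bool) : mble b ->
  E (fun w => (b w)%:R) = fine (Pr [set w | b w]).
Proof.
move=> mb; rewrite /Ex /Rintegral; congr fine.
rewrite -[X in Pr X]setIT -integral_indic//; last exact: measurable_bset.
apply: eq_integral => w _; rewrite indicE; congr (_%:R%:E).
case: (boolP (b w)) => bw; first by rewrite mem_set.
by rewrite memNset//; exact/negP.
Qed.

Lemma Pr_fine A : measurable A -> (fine (Pr A))%:E = Pr A.
Proof. by move=> mA; rewrite fineK//; exact: fin_num_measure. Qed.

Lemma prob_le_sub A B (e : R) : A `<=` B -> prob_le Pr B e -> prob_le Pr A e.
Proof. by move=> AB [C [mC BC Ce]]; exists C; split => //; exact: subset_trans BC. Qed.

Lemma prob_le_le A (e e' : R) : e <= e' -> prob_le Pr A e -> prob_le Pr A e'.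
Proof.
by move=> ee' [C [mC BC Ce]]; exists C; split => //; rewrite (le_trans Ce)// lee_fin.
Qed.

Lemma prob_leU A B (e e' : R) : prob_le Pr A e -> prob_le Pr B e' ->
  prob_le Pr (A `|` B) (e + e').
Proof.
move=> [C [mC AC Ce]] [D [mD BD De]]; exists (C `|` D); split.
- exact: measurableU.
- exact: setUSS.
- by rewrite EFinD (le_trans (measureU2 _ _ _))// leeD.
Qed.

Lemma prob_le_bigcup (J : finType) (A : J -> set Omega) (e : J -> R) :
  (forall j, prob_le Pr (A j) (e j)) ->
  prob_le Pr (fun w => exists j, A j w) (\sum_j e j).
Proof.
move=> Ae.
suff: prob_le Pr (fun w => exists2 j, j \in index_enum J & A j w) (\sum_j e j).
  by apply: prob_le_sub => w [j Aj]; exists j => //; exact: mem_index_enum.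
elim: (index_enum J) => [|j s IH].
  rewrite big_nil; exists set0; split => //; last by rewrite measure0.
  by move=> w [j]; rewrite in_nil.
rewrite big_cons; apply: (prob_le_sub _ (prob_leU (Ae j) IH)) => w [k].
by rewrite inE => /orP[/eqP ->|ks] Ak; [left|right; exists k].
Qed.

Lemma prob_le_meas A (e : R) : measurable A -> fine (Pr A) <= e -> prob_le Pr A e.
Proof. by move=> mA Ae; exists A; split => //; rewrite -Pr_fine// lee_fin. Qed.

Lemma prob_le_fine A (e : R) : measurable A -> prob_le Pr A e -> fine (Pr A) <= e.
Proof.
move=> mA [B [mB AB Be]]; rewrite -lee_fin Pr_fine// (le_trans _ Be)//.
by apply: le_measure => //; rewrite inE.
Qed.

Lemma prob_le_markov f (a e : R) : I f -> (forall w, 0 <= f w) -> 0 < a ->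
  E f <= e * a -> prob_le Pr [set w | a <= f w] e.
Proof.
move=> If f0 a0 Efe.
have mb : mble (fun w => a <= f w).
  by apply: measurable_fun_ler => //; exact: Intg_measurable.
apply: prob_le_meas; first exact: measurable_bset.
rewrite -Ex_ind// -(ler_pM2l a0) (mulrC a e) (le_trans _ Efe)// -ExZ; last first.
  exact: Intg_ind.
apply: Ex_le => //; first by apply: IntgZ; exact: Intg_ind.
by move=> w; case: (leP a (f w)) => [aw|_]; rewrite /= ?mulr1 ?mulr0.
Qed.

Lemma prob_le_chebyshev f (a e : R) : mble f -> I (fun w => f w ^+ 2) -> 0 < a ->
  E (fun w => f w ^+ 2) <= e * a ^+ 2 -> prob_le Pr [set w | a <= `|f w|] e.
Proof.
move=> mf If a0 Ef.
apply: (prob_le_sub _ (prob_le_markov If _ _ Ef)); last 2 first.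
- by move=> w; exact: sqr_ge0.
- by rewrite exprn_gt0.
- by move=> w /= aw; rewrite -[leRHS]real_normK ?num_real// lerXn2r ?nnegrE// ltW.
Qed.

(** When the square of the partial sum plus one more term is expanded, the cross terms have mean
    zero one by one. It serves the innovations, the martingale differences [mdiff], the single
    contaminations and the centred indicators. *)
Lemma Ex_sqr_orthogonal (n : nat) (X : nat -> Omega -> R) (c : nat -> R) :
  (forall t, mble (X t)) -> (forall t, I (fun w => X t w ^+ 2)) ->
  (forall s t, (s < t < n)%N -> E (fun w => X s w * X t w) = 0) ->
  (forall t, (t < n)%N -> E (fun w => X t w ^+ 2) <= c t) ->
  I (fun w => (\sum_(0 <= t < n) X t w) ^+ 2) /\
  E (fun w => (\sum_(0 <= t < n) X t w) ^+ 2) <= \sum_(0 <= t < n) c t.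
Proof.
move=> mX IX; elim: n => [|n IH] oX cX.
  rewrite big_nil; under eq_fun do rewrite big_nil expr0n/=.
  by split; [exact: Intg_cst|rewrite Ex_cst].
have [IS ES] : I (fun w => (\sum_(0 <= t < n) X t w) ^+ 2) /\
    E (fun w => (\sum_(0 <= t < n) X t w) ^+ 2) <= \sum_(0 <= t < n) c t.
  apply: IH => [s t /andP[st tn]|t tn]; [apply: oX|apply: cX].
  - by rewrite st ltnS ltnW.
  - by rewrite ltnS ltnW.
have mS : mble (fun w => \sum_(0 <= t < n) X t w).
  exact: measurable_sum.
have -> : (fun w => (\sum_(0 <= t < n.+1) X t w) ^+ 2) =
  (fun w => (\sum_(0 <= t < n) X t w) ^+ 2 + X n w ^+ 2
     + 2 * \sum_(0 <= t < n) X t w * X n w).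
  apply/funext => w; rewrite big_nat_recr//= sqrrD big_distrl/=; ring.
have Icross : I (fun w => \sum_(0 <= t < n) X t w * X n w).
  by apply: Intg_sum => t; exact: Intg_mul.
have Ic2 := IntgZ 2 Icross.
have Is2 := IntgD IS (IX n).
split; first exact: IntgD.
rewrite ExD// ExD// ExZ// Ex_sum; last by move=> t; exact: Intg_mul.
rewrite [X in 2 * X]big_nat_cond big1 ?mulr0 ?addr0; last first.
  by move=> t /andP[/andP[_ tn] _]; apply: oX; rewrite tn /=.
by rewrite big_nat_recr//= lerD// cX.
Qed.

End Expectation.

(** * Independence and decoupling *)

Section SigmaIndep.
Context (R : realType) (d : measure_display) (Omega : measurableType d)
        (Pr : probability Omega R).

(** Measurability for the sigma-algebra generated by [G] becomes ordinary measurability from the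
    type [g_sigma_algebraType G], so the usual closure properties of measurable functions apply to
    it unchanged. *)
Definition sigm (G : set (set Omega)) (f : Omega -> R) : Prop :=
  measurable_fun (setT : set (g_sigma_algebraType G))
    (f : g_sigma_algebraType G -> R).

Definition sigma_indep (G1 G2 : set (set Omega)) : Prop :=
  forall A B, <<s G1 >> A -> <<s G2 >> B -> (Pr (A `&` B) = Pr A * Pr B)%E.

(** For fixed [B] both sides are finite measures in [A]: the restriction of [Pr] to [B], and [Pr]
    scaled by [Pr B]. They agree on the pi-system [G], and uniqueness of measures does the rest. *)
Lemma pi_system_sigma_half (G : set (set Omega)) (B : set Omega) :
  G `<=` measurable -> setI_closed G -> G setT -> measurable B ->
  (forall A, G A -> (Pr (A `&` B) = Pr A * Pr B)%E) ->
  forall A, <<s G >> A -> (Pr (A `&` B) = Pr A * Pr B)%E.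
Proof.
move=> Gm GI GT mB GB A sA.
have r0 : 0 <= fine (Pr B) by apply: fine_ge0; exact: measure_ge0.
have := @g_sigma_algebra_measure_unique _ R Omega G Gm (fun=> setT) (fun=> GT) _
  (mrestr Pr mB) (mscale (NngNum r0) Pr) GI _ _ A sA.
have mscE C : mscale (NngNum r0) Pr C = (Pr C * Pr B)%E.
  by rewrite /mscale/= -[in RHS](Pr_fine Pr mB) muleC.
move=> h; rewrite -mscE; apply: h.
- by rewrite bigcup_const//; exists 0%N.
- by move=> C GC; apply: (etrans (GB _ GC)); exact/esym/mscE.
- by move=> _; apply: (le_lt_trans (probability_le1 _ _)); [exact: measurableI|exact: ltry].
Qed.

Lemma sub_sigma_measurable (G : set (set Omega)) :
  G `<=` measurable -> <<s G >> `<=` measurable.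
Proof. by move=> Gm; apply: smallest_sub => //; exact: sigma_algebra_measurable. Qed.

Lemma pi_system_sigma_indep (G1 G2 : set (set Omega)) :
  G1 `<=` measurable -> setI_closed G1 -> G1 setT ->
  G2 `<=` measurable -> setI_closed G2 -> G2 setT ->
  (forall A B, G1 A -> G2 B -> (Pr (A `&` B) = Pr A * Pr B)%E) ->
  sigma_indep G1 G2.
Proof.
move=> G1m G1I G1T G2m G2I G2T G12 A B sA sB.
have mA := sub_sigma_measurable G1m sA.
rewrite setIC muleC; apply: (pi_system_sigma_half G2m) sB => // C G2C.
rewrite setIC muleC; apply: (pi_system_sigma_half G1m) sA => //.
- exact: G2m.
- by move=> D G1D; exact: G12.
Qed.

Lemma integral_distribution_measurable (d' : measure_display)
  (T' : measurableType d') (X : {mfun Omega >-> T'}) (f : T' -> \bar R) :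
  measurable_fun setT f ->
  (\int[distribution Pr X]_y f y = \int[Pr]_w f (X w))%E.
Proof.
move=> mf; rewrite integralE [RHS]integralE; congr (_ - _)%E.
- transitivity (\int[Pr]_w ((f^\+)%E \o X) w)%E; last first.
    by apply: eq_integral => w _; rewrite /= !funeposE.
  by apply: (@ge0_integral_distribution _ _ _ _ _ Pr X) => //; exact: measurable_funepos.
- transitivity (\int[Pr]_w ((f^\-)%E \o X) w)%E; last first.
    by apply: eq_integral => w _; rewrite /= !funenegE.
  by apply: (@ge0_integral_distribution _ _ _ _ _ Pr X) => //; exact: measurable_funeneg.
Qed.

Section Decouple.
Variables (G1 G2 : set (set Omega)).
Hypotheses (G1m : G1 `<=` measurable) (G2m : G2 `<=` measurable)
  (G12 : sigma_indep G1 G2).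
Let T1 := g_sigma_algebraType G1.
Let T2 := g_sigma_algebraType G2.

Let id1 (w : Omega) : T1 := w.
Let id2 (w : Omega) : T2 := w.
Let diag (w : Omega) : T1 * T2 := (id1 w, id2 w).

Let mid1 : measurable_fun setT id1.
Proof. by move=> _ A mA; rewrite setTI; exact: (sub_sigma_measurable G1m). Qed.

Let mid2 : measurable_fun setT id2.
Proof. by move=> _ A mA; rewrite setTI; exact: (sub_sigma_measurable G2m). Qed.

Let mdiag : measurable_fun setT diag.
Proof. exact: measurable_fun_pair. Qed.

Let X1 : {mfun Omega >-> T1} :=
  MeasurableFun.Pack (MeasurableFun.Class (isMeasurableFun.Build _ _ _ _ _ mid1)).
Let X2 : {mfun Omega >-> T2} :=
  MeasurableFun.Pack (MeasurableFun.Class (isMeasurableFun.Build _ _ _ _ _ mid2)).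

Let inner (F : T1 * T2 -> R) : measurable_fun setT F ->
  (forall w1, Intg Pr (fun w2 => F (w1, w2))) -> forall w1 : T1,
  fubini_F (distribution Pr X2) (EFin \o F) w1 = (Ex Pr (fun w2 => F (w1, w2)))%:E.
Proof.
move=> mF IF2 w1; rewrite /fubini_F /Ex /Rintegral.
rewrite (@integral_distribution_measurable _ _ X2 (fun y => (F (w1, y))%:E)).
  by rewrite fineK//; apply: integrable_fin_num => //; exact: IF2.
by apply/measurable_EFinP; apply: measurableT_comp => //; exact: measurable_pair1.
Qed.

Let minner (F : T1 * T2 -> R) : measurable_fun setT F ->
  measurable_fun setT (fubini_F (distribution Pr X2) (EFin \o F)).
Proof.
move=> mF; have mEF : measurable_fun setT (EFin \o F) by exact/measurable_EFinP.
have -> : fubini_F (distribution Pr X2) (EFin \o F) =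
    (fun x => fubini_F (distribution Pr X2) ((EFin \o F)^\+)%E x -
              fubini_F (distribution Pr X2) ((EFin \o F)^\-)%E x)%E.
  by apply/funext => x; rewrite /fubini_F [LHS]integralE; congr (_ - _)%E;
    apply: eq_integral => y _; rewrite ?funeposE ?funenegE.
apply: emeasurable_funB.
- by apply: measurable_fun_fubini_tonelli_F => //; exact: measurable_funepos.
- by apply: measurable_fun_fubini_tonelli_F => //; exact: measurable_funeneg.
Qed.

(** Tonelli, applied to the positive and negative parts, keeps measurability in the first variable.
    Together with [decouple] the partial mean plays the role of a conditional expectation given
    [G1]. *)
Lemma sigm_partial_expectation (F : T1 * T2 -> R) : measurable_fun setT F ->
  (forall w1, Intg Pr (fun w2 => F (w1, w2))) ->
  sigm G1 (fun w1 => Ex Pr (fun w2 => F (w1, w2))).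
Proof.
move=> mF IF2; apply/measurable_EFinP.
rewrite (_ : _ \o _ = fubini_F (distribution Pr X2) (EFin \o F)); first exact: minner.
by apply/funext => w1; rewrite (inner mF IF2).
Qed.

(** The map sending [w] to [(w, w)], where the two copies of [Omega] carry [G1] and [G2], pushes
    [Pr] to the product of its marginals: on rectangles this is [sigma_indep]. Fubini then
    integrates the second copy with the first one frozen. *)
Lemma decouple (F : T1 * T2 -> R) :
  measurable_fun setT F -> Intg Pr (fun w => F (w, w)) ->
  (forall w1, Intg Pr (fun w2 => F (w1, w2))) ->
  Ex Pr (fun w => F (w, w)) = Ex Pr (fun w1 => Ex Pr (fun w2 => F (w1, w2))).
Proof.
move=> mF IF IF2.
pose XX : {mfun Omega >-> (T1 * T2)%type} :=
  MeasurableFun.Pack (MeasurableFun.Class (isMeasurableFun.Build _ _ _ _ _ mdiag)).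
pose m1 : probability T1 R := distribution Pr X1.
pose m2 : probability T2 R := distribution Pr X2.
pose mm : probability (T1 * T2)%type R := distribution Pr XX.
have mEF : measurable_fun setT (EFin \o F) by exact/measurable_EFinP.
have prodE X : measurable X -> (m1 \x m2)%E X = mm X.
  apply: product_measure_unique => A B mA mB.
  exact: G12.
have mmE : (\int[mm]_z (F z)%:E = \int[Pr]_w (F (w, w))%:E)%E.
  exact: (@integral_distribution _ _ _ _ _ Pr XX (EFin \o F) mEF IF).
have Iprod : (m1 \x m2)%E.-integrable setT (EFin \o F).
  have : mm.-integrable setT (EFin \o F).
    by apply: (@integrable_pushforward _ _ _ _ _ diag mdiag Pr setT).
  move=> /integrableP[_ h]; apply/integrableP; split => //.
  by rewrite (eq_measure_integral mm)// => A mA _; exact: prodE.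
rewrite {1}/Ex /Rintegral -mmE.
rewrite -(eq_measure_integral mm (m1 := (m1 \x m2)%E)); last first.
  by move=> A mA _; exact: prodE.
rewrite -(integral12_prod_meas1 Iprod).
rewrite (@integral_distribution_measurable _ _ X1); last exact: minner.
by congr fine; apply: eq_integral => w _; exact: inner.
Qed.

Lemma sigm_fst (f : Omega -> R) : sigm G1 f ->
  measurable_fun setT (fun z : T1 * T2 => f z.1).
Proof. by move=> mf; apply: (measurableT_comp mf); exact: measurable_fst. Qed.

Lemma sigm_snd (f : Omega -> R) : sigm G2 f ->
  measurable_fun setT (fun z : T1 * T2 => f z.2).
Proof. by move=> mf; apply: (measurableT_comp mf); exact: measurable_snd. Qed.

End Decouple.

Lemma sigm_measurable (G : set (set Omega)) (f : Omega -> R) :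
  G `<=` measurable -> sigm G f -> measurable_fun setT f.
Proof.
move=> Gm mf _ B mB; rewrite setTI; apply: (sub_sigma_measurable Gm).
by have := mf measurableT B mB; rewrite setTI.
Qed.

Lemma Ex_indepM (G1 G2 : set (set Omega)) (f g : Omega -> R) :
  G1 `<=` measurable -> G2 `<=` measurable -> sigma_indep G1 G2 ->
  sigm G1 f -> sigm G2 g -> Intg Pr f -> Intg Pr g ->
  Intg Pr (fun w => f w * g w) ->
  Ex Pr (fun w => f w * g w) = Ex Pr f * Ex Pr g.
Proof.
move=> G1m G2m G12 sf sg If Ig Ifg.
pose F (z : g_sigma_algebraType G1 * g_sigma_algebraType G2) := f z.1 * g z.2.
rewrite (@decouple G1 G2 G1m G2m G12 F) /F/=; last 3 first.
- apply: measurable_funM; [exact: sigm_fst|exact: sigm_snd].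
- exact: Ifg.
- by move=> w1; exact: IntgZ.
under [X in Ex Pr X]eq_fun do rewrite ExZ// mulrC.
by rewrite ExZ// mulrC.
Qed.

(* The threshold Y lives in G1 and X, with distribution function H, in G2, so
   conditionally on G1 the event X <= Y has probability H Y. *)
Lemma Ex_indep_threshold (G1 G2 : set (set Omega)) (Z Y X : Omega -> R)
  (H : R -> R) (M : R) :
  G1 `<=` measurable -> G2 `<=` measurable -> sigma_indep G1 G2 ->
  sigm G1 Z -> sigm G1 Y -> sigm G2 X -> (forall w, `|Z w| <= M) ->
  (forall x, fine (Pr [set w | X w <= x]) = H x) ->
  Ex Pr (fun w => Z w * (X w <= Y w)%R%:R) = Ex Pr (fun w => Z w * H (Y w)).
Proof.
move=> G1m G2m G12 sZ sY sX ZM HX.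
have mZ := sigm_measurable G1m sZ; have mY := sigm_measurable G1m sY.
have mX := sigm_measurable G2m sX.
have bnd (b : bool) z : `|z * (b%:R : R)| <= `|z|.
  by case: b; rewrite ?mulr1 ?mulr0 ?normr0.
pose F (z : g_sigma_algebraType G1 * g_sigma_algebraType G2) :=
  Z z.1 * (X z.2 <= Y z.1)%R%:R.
rewrite (@decouple G1 G2 G1m G2m G12 F) /F/=; last 3 first.
- apply: measurable_funM; first exact: sigm_fst.
  apply: measurable_ind; apply: measurable_fun_ler.
  + exact: sigm_snd.
  + exact: (@sigm_fst G1 G2 Y).
- apply: (@Intg_bounded _ _ _ _ _ M) => [|w]; last exact: le_trans (bnd _ _) _.
  by apply: measurable_funM => //; apply: measurable_ind; exact: measurable_fun_ler.
- move=> w1; apply: IntgZ; apply: Intg_ind; exact: measurable_fun_ler.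
congr (Ex Pr _); apply/funext => w1.
have mb : measurable_fun setT (fun w2 => X w2 <= Y w1).
  exact: measurable_fun_ler.
by rewrite ExZ; [rewrite Ex_ind// HX | exact: Intg_ind].
Qed.

End SigmaIndep.

Section IndepFamily.
Context (R : realType) (d : measure_display) (Omega : measurableType d)
        (Pr : probability Omega R) (K : eqType) (zeta : K -> Omega -> R).
Hypothesis zeta_meas : forall k, measurable_fun setT (zeta k).

Definition cyl_event (s : seq K) (a : K -> R) : set Omega :=
  [set w | all (fun k => zeta k w <= a k) s].

Definition cyl (J : K -> Prop) : set (set Omega) :=
  [set A | exists s a, (forall k, k \in s -> J k) /\ A = cyl_event s a].

Definition indep_family : Prop := forall s a, uniq s ->
  fine (Pr (cyl_event s a)) = \prod_(k <- s) fine (Pr [set w | zeta k w <= a k]).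

Lemma measurable_cyl_event s a : measurable (cyl_event s a).
Proof.
apply: measurable_bset.
elim: s => [|k s IH]; first exact: measurable_cst.
by apply: measurable_and => //; exact: measurable_fun_ler.
Qed.

Lemma cyl_measurable J : cyl J `<=` measurable.
Proof. by move=> _ [s [a [_ ->]]]; exact: measurable_cyl_event. Qed.

Lemma cyl_setT J : cyl J setT.
Proof. by exists [::], (fun=> 0); split => //; apply/seteqP; split. Qed.

(** On shared indices the two thresholds merge into their minimum. The last two clauses record that
    the others are kept, which is what disjoint index lists need. *)
Lemma cyl_event_cat s t a b : exists c,
  cyl_event s a `&` cyl_event t b = cyl_event (s ++ t) c /\
  (forall k, k \in s -> k \notin t -> c k = a k) /\
  (forall k, k \in t -> k \notin s -> c k = b k).
Proof.
exists (fun k => if k \in s then (if k \in t then Num.min (a k) (b k) else a k) else b k).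
split; last first.
  by split=> k -> /negbTE ->.
apply/seteqP; split => w; rewrite /cyl_event/= all_cat.
  move=> [/allP sw /allP tw]; apply/andP; split; apply/allP => k kin.
    rewrite kin; case: ifP => kt; last exact: sw.
    by rewrite le_min sw// tw.
  case: ifP => ks; last exact: tw.
  by rewrite kin le_min sw// tw.
move=> /andP[/allP sw /allP tw]; split; apply/allP => k kin.
  have := sw k kin; rewrite kin; case: ifP => // kt.
  by rewrite le_min => /andP[].
have := tw k kin; rewrite kin; case: ifP => // kt.
by rewrite le_min => /andP[].
Qed.

Lemma cyl_setI J : setI_closed (cyl J).
Proof.
move=> _ _ [s [a [sJ ->]]] [t [b [tJ ->]]].
have [c [-> _]] := cyl_event_cat s t a b.
exists (s ++ t), c; split => // k; rewrite mem_cat => /orP[]; [exact: sJ|exact: tJ].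
Qed.

Lemma cyl_event_undup s a : cyl_event (undup s) a = cyl_event s a.
Proof.
apply/seteqP; split => w; rewrite /cyl_event/= => /allP h; apply/allP => k ks; apply: h.
  by rewrite mem_undup.
by move: ks; rewrite mem_undup.
Qed.

(** Cylinder events form pi-systems, so the product formula is checked on them only. Duplicates are
    removed first because [indep_family] speaks of lists without repetition; disjointness of [J1]
    and [J2] keeps the concatenation free of them. *)
Lemma cyl_indep (J1 J2 : K -> Prop) : indep_family ->
  (forall k, J1 k -> J2 k -> False) -> sigma_indep Pr (cyl J1) (cyl J2).
Proof.
move=> ind J12; apply: pi_system_sigma_indep; try exact: cyl_setI; try exact: cyl_setT;
  try exact: cyl_measurable.
move=> _ _ [s0 [a [sJ ->]]] [t0 [b [tJ ->]]].
rewrite -(cyl_event_undup s0) -(cyl_event_undup t0).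
set s := undup s0; set t := undup t0.
have sJ' k : k \in s -> J1 k by rewrite mem_undup; exact: sJ.
have tJ' k : k \in t -> J2 k by rewrite mem_undup; exact: tJ.
have [c [E [ca cb]]] := cyl_event_cat s t a b.
have dst k : k \in s -> k \notin t.
  by move=> ks; apply/negP => kt; exact: (J12 k (sJ' _ ks) (tJ' _ kt)).
have dts k : k \in t -> k \notin s.
  by move=> kt; apply/negP => ks; exact: (J12 k (sJ' _ ks) (tJ' _ kt)).
rewrite E -(Pr_fine Pr (measurable_cyl_event (s ++ t) c)).
rewrite -(Pr_fine Pr (measurable_cyl_event s a)) -(Pr_fine Pr (measurable_cyl_event t b)).
rewrite -EFinM; congr EFin.
rewrite !ind ?undup_uniq//; last first.
  rewrite cat_uniq !undup_uniq/= andbT; apply/hasPn => k; exact: dts.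
rewrite big_cat/=; congr (_ * _); apply: eq_big_seq => k kin.
  by rewrite ca// dst.
by rewrite cb// dts.
Qed.

Lemma sigm_cyl J k : J k -> sigm (cyl J) (zeta k).
Proof.
move=> Jk.
apply: (measurability _ (RGenOInfty.measurableE R)) => //.
move=> _ [_ [x ->] <-]; rewrite setTI.
have -> : zeta k @^-1` `]x, +oo[%classic = ~` cyl_event [:: k] (fun=> x).
  apply/seteqP; split => w; rewrite /cyl_event/= in_itv/= !andbT.
    by rewrite ltNge => /negP.
  by move=> /negP; rewrite -ltNge.
apply: measurableC; apply: sub_sigma_algebra; exists [:: k], (fun=> x); split => //.
by move=> l; rewrite inE => /eqP ->.
Qed.

End IndepFamily.

(** * Chi-square laws and their Laplace transforms *)

Lemma exists_nat_gt (R : realType) (x : R) : exists n : nat, x < n%:R.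
Proof. by exists (Num.trunc x).+1; exact: truncnS_gt. Qed.

Section ChiSquare.
Context (R : realType).
Local Notation leb := (@lebesgue_measure R).
Local Notation D := (`[0%R, +oo[%classic : set R).
Implicit Types (k : nat) (s t x lam : R) (l : seq (R * R)).

(** The worst singularity at 0 among the chi-square kernels, that of one degree of freedom. *)
Definition rsqrt t : R := powR t (- 2^-1).

Lemma rsqrt_ge0 t : 0 <= rsqrt t. Proof. exact: powR_ge0. Qed.

Lemma measurable_rsqrt (A : set R) : measurable_fun A rsqrt.
Proof. by apply: measurable_funTS; exact: measurable_powR. Qed.

Lemma continuous_powR_pos (a : R) x : 0 < x -> 
  {for x, continuous (fun t : R => powR t a)}.
Proof.
move=> x0; apply: (@differentiable_continuous R R^o R^o); apply/derivable1_diffP.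
by apply: derivable_powR; rewrite in_itv/= andbT.
Qed.

Lemma integral_rsqrt (a b : R) : 0 < a -> a < b ->
  (\int[leb]_(t in `[a, b]) (rsqrt t)%:E = (2 * Num.sqrt b - 2 * Num.sqrt a)%:E)%E.
Proof.
move=> a0 ab; have b0 : 0 < b by apply: lt_trans ab.
pose F (t : R) := 2 * powR t (2^-1).
have FE t : 0 < t -> F t = 2 * Num.sqrt t.
  by move=> t0; rewrite /F powR12_sqrt// ltW.
rewrite -(FE b)// -(FE a)// EFinB.
have cF t : 0 < t -> {for t, continuous F}.
  move=> t0; apply: cvgMr; exact: continuous_powR_pos.
apply: continuous_FTC2 => //.
- apply: continuous_in_subspaceT => x; rewrite inE/= in_itv/= => /andP[ax _].
  by apply: continuous_powR_pos; exact: lt_le_trans ax.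
- split.
  + move=> x; rewrite in_itv/= => /andP[ax _].
    apply: derivableM; first exact: derivable_cst.
    by apply: derivable_powR; rewrite in_itv/= andbT (lt_trans a0).
  + by apply: cvg_at_right_filter; exact: cF.
  + by apply: cvg_at_left_filter; exact: cF.
- move=> x; rewrite in_itv/= => /andP[ax _].
  have x0 : 0 < x by apply: lt_trans ax.
  rewrite /F derive1Ml; last by apply: derivable_powR; rewrite in_itv/= andbT.
  rewrite powR_derive1 ?in_itv/= ?andbT// mulrA divff ?mul1r// /rsqrt.
  by congr (powR _ _); field.
Qed.

(** The primitive 2 sqrt(t) is not differentiable at 0, so the interval is exhausted by the
    intervals from [c n] to [b], with [c n] above [a]; then sqrt(b) - sqrt(c) <= sqrt(b - c). A
    bound by the length alone gives a modulus of continuity that does not depend on the position. *)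
Lemma integral_rsqrt_le (a b : R) : 0 <= a -> a < b ->
  (\int[leb]_(t in `]a, b]) (rsqrt t)%:E <= (2 * Num.sqrt (b - a))%:E)%E.
Proof.
move=> a0 ab.
pose c n : R := a + (b - a) / n.+2%:R.
have ba : 0 < b - a by rewrite subr_gt0.
have ac n : a < c n by rewrite /c ltrDl divr_gt0.
have cb n : c n < b.
  rewrite /c -ltrBrDl ltr_pdivrMr// ltr_pMr// ltr1n//.
pose F n : set R := `[c n, b]%classic.
have UF : \bigcup_n F n = `]a, b]%classic.
  apply/seteqP; split => x /=.
    move=> [n _]; rewrite /F/= !in_itv/= => /andP[cx ->]; rewrite andbT.
    exact: lt_le_trans cx.
  rewrite in_itv/= => /andP[ax xb].
  have xa : 0 < x - a by rewrite subr_gt0.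
  have [n hn] := exists_nat_gt ((b - a) / (x - a)).
  exists n => //; rewrite /F/= in_itv/= xb andbT /c -lerBrDl ler_pdivrMr//.
  rewrite ltr_pdivrMr// mulrC in hn; apply: (le_trans (ltW hn)).
  by rewrite ler_wpM2l ?ltW// ltr_nat.
have nd : nondecreasing_seq F.
  move=> m n mn; rewrite subsetEset => x; rewrite /F/= !in_itv/= => /andP[cx ->].
  rewrite andbT (le_trans _ cx)// /c lerD2l ler_pM2l// lef_pV2 ?posrE// ler_nat.
  by rewrite !ltnS.
rewrite -UF.
have cv : (\int[leb]_(t in F n) (rsqrt t)%:E)%E @[n --> \oo] -->
    (\int[leb]_(t in \bigcup_n F n) (rsqrt t)%:E)%E.
  apply: ge0_nondecreasing_set_cvg_integral => //.
  - by move=> n; exact: measurable_itv.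
  - by move=> n; apply/measurable_EFinP; exact: measurable_rsqrt.
  - by move=> n x _; rewrite lee_fin rsqrt_ge0.
rewrite -(cvg_lim _ cv)//; apply: lime_le; first by apply: cvgP; exact: cv.
near=> n; rewrite integral_rsqrt//; last by rewrite (le_lt_trans a0).
rewrite lee_fin -mulrBr ler_pM2l//.
have h1 : Num.sqrt (b - c n) <= Num.sqrt (b - a).
  by rewrite ler_wsqrtr// lerD2l lerN2 ltW.
apply: le_trans h1; rewrite lerBlDr.
have c0 : 0 <= c n by rewrite (le_trans a0)// ltW.
have bc0 : 0 <= b - c n by rewrite subr_ge0 ltW.
rewrite -[leRHS]ger0_norm ?addr_ge0 ?sqrtr_ge0// -sqrtr_sqr ler_wsqrtr//.
rewrite sqrrD !sqr_sqrtr//.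
have := mulr_ge0 (sqrtr_ge0 (b - c n)) (sqrtr_ge0 (c n)); rewrite -mulr_natr; lra.
Unshelve. all: by end_near. Qed.

Lemma measurable_chi2_kernel k (A : set R) : measurable_fun A (chi2_kernel k : R -> R).
Proof.
apply: measurable_funTS; apply: measurable_funM; first exact: measurable_powR.
by apply: measurableT_comp => //; apply: measurable_funM => //; exact: measurable_oppr.
Qed.

Lemma chi2_kernel_ge0 k t : 0 <= chi2_kernel k t.
Proof. by rewrite mulr_ge0 ?powR_ge0 ?expR_ge0. Qed.

Definition chi2_cst k : R := 1 + 4 ^+ k.+1 * (k.+1)`!%:R.

Lemma chi2_cst_ge1 k : 1 <= chi2_cst k.
Proof. by rewrite /chi2_cst lerDl mulr_ge0// exprn_ge0. Qed.

(** Half of the exponential factor is spent on the power of t: t^((k-1)/2) <= 1 + t^(k+1), and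
    (t/4)^(k+1)/(k+1)! <= e^(t/4) is one term of the exponential series. This is the origin of
    [chi2_cst]. *)
Lemma chi2_kernel_le k t : (0 < k)%N -> 0 < t ->
  chi2_kernel k t <= chi2_cst k * rsqrt t * expR (- t / 4).
Proof.
move=> k0 t0; rewrite /chi2_kernel.
have -> : k%:R / 2 - 1 = - 2^-1 + (k.-1)%:R / 2 :> R.
  by rewrite -{1}(prednK k0) -natr1; field.
rewrite powRD; last by rewrite (gt_eqF t0) implybT.
have -> : expR (- t / 2) = expR (- t / 4) * expR (- t / 4) :> R.
  by rewrite -expRD; congr expR; field.
rewrite -/(rsqrt t).
suff h : powR t (k.-1%:R / 2) * expR (- t / 4) <= chi2_cst k.
  rewrite (_ : _ * _ * (_ * _) = (powR t (k.-1%:R / 2) * expR (- t / 4)) *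
    (rsqrt t * expR (- t / 4))); last by ring.
  by rewrite -[leRHS]mulrA ler_wpM2r// mulr_ge0 ?rsqrt_ge0 ?expR_ge0.
have e0 : 0 < expR (t / 4) by exact: expR_gt0.
rewrite mulNr expRN ler_pdivrMr//.
have p1 : powR t (k.-1%:R / 2) <= 1 + t ^+ k.+1.
  have [t1|t1] := leP t 1.
    apply: (@le_trans _ _ 1); last by rewrite lerDl exprn_ge0// ltW.
    rewrite -[leRHS](_ : powR 1 (k.-1%:R / 2) = 1); last by rewrite powR1.
    by apply: ge0_ler_powR; rewrite ?nnegrE ?divr_ge0// ltW.
  apply: (@le_trans _ _ (powR t k.+1%:R)).
    apply: ler_powR; first exact: ltW.
    rewrite ler_pdivrMr// -natrM ler_nat.
    by rewrite (leq_trans (leq_pred _))// (leq_trans (leqnSn _))// leq_pmulr.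
  by rewrite powR_mulrn; [rewrite lerDr|exact: ltW].
apply: (le_trans p1).
have := @expR_ge1Dxn R (t / 4) k (divr_ge0 (ltW t0) (ler0n _ 4)).
set E := expR _ => hE.
have E1 : 1 <= E by apply: le_trans hE; rewrite lerDl divr_ge0// exprn_ge0// divr_ge0// ltW.
rewrite /chi2_cst mulrDl mul1r; apply: lerD => //.
have f0 : 0 < k.+1`!%:R :> R by rewrite ltr0n fact_gt0.
have : (t / 4) ^+ k.+1 / k.+1`!%:R <= E by apply: le_trans hE; rewrite lerDr.
rewrite ler_pdivrMr// expr_div_n ler_pdivrMr ?exprn_gt0//.
by rewrite -mulrA (mulrC (4 ^+ _)) (mulrC _ E).
Qed.

(** The majorant has two pieces with known integrals: the singular power on the unit interval, and
    the exponential density of rate 1/4, where the factor 4 undoes the normalisation. *)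
Lemma chi2_kernel_dom k t : (0 < k)%N -> 0 <= t ->
  chi2_kernel k t <= chi2_cst k * (rsqrt t * \1_(`]0%R, 1%R]%classic : set R) t) +
    4 * chi2_cst k * exponential_pdf 4^-1 t.
Proof.
move=> k0 t0; have c1 := chi2_cst_ge1 k; have c0 : 0 <= chi2_cst k by lra.
have pdfE : 4 * chi2_cst k * exponential_pdf 4^-1 t = chi2_cst k * expR (- t / 4).
  rewrite exponential_pdfE//=.
  rewrite (_ : - 4^-1 * t = - t / 4); last by field.
  by field.
rewrite pdfE; move: t0; rewrite le_eqVlt => /predU1P[<-|t0].
  rewrite indicE memNset/=; last by rewrite in_itv/= ltxx.
  rewrite !mulr0 add0r oppr0 mul0r expR0 mulr1 /chi2_kernel oppr0 mul0r expR0 mulr1.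
  apply: le_trans c1; have [->|h] := eqVneq (k%:R / 2 - 1 : R) 0; first by rewrite powRr0.
  by rewrite powR0.
apply: (le_trans (chi2_kernel_le k0 t0)); rewrite indicE.
have e1 : expR (- t / 4) <= 1 by rewrite -[leRHS]expR0 ler_expR; lra.
have [t1|t1] := leP t 1.
  rewrite mem_set/=; last by rewrite in_itv/= t0.
  rewrite mulr1 (@le_trans _ _ (chi2_cst k * rsqrt t))//.
    by rewrite ler_piMr// mulr_ge0 ?rsqrt_ge0.
  by rewrite lerDl mulr_ge0 ?expR_ge0.
rewrite memNset/=; last by rewrite in_itv/= t0/= leNgt t1.
rewrite !mulr0 add0r ler_wpM2r ?expR_ge0// ler_piMr//.
rewrite /rsqrt powRN invf_le1 ?powR_gt0//.
rewrite -[leLHS](powRr0 t); apply: ler_powR; first exact: ltW.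
by rewrite invr_ge0.
Qed.

Lemma integrable_chi2_kernel k : (0 < k)%N ->
  leb.-integrable D (EFin \o chi2_kernel k).
Proof.
move=> k0.
pose g (t : R) : R := chi2_cst k * (rsqrt t * \1_(`]0%R, 1%R]%classic : set R) t) +
    4 * chi2_cst k * exponential_pdf 4^-1 t.
have Ig : leb.-integrable setT (EFin \o g).
  have I1 : leb.-integrable setT
      (EFin \o (fun t : R => rsqrt t * \1_(`]0%R, 1%R]%classic : set R) t)).
    apply/integrableP; split.
      by apply/measurable_EFinP; apply: measurable_funM => //; exact: measurable_rsqrt.
    rewrite (_ : (\int[leb]_x _)%E = (\int[leb]_(x in `]0%R, 1%R]) (rsqrt x)%:E)%E).
      by apply: (le_lt_trans (@integral_rsqrt_le 0 1 _ _)) => //; exact: ltry.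
    rewrite [RHS]integral_mkcond; apply: eq_integral => t _.
    rewrite patchE /= indicE; case: ifP => h; rewrite ?mulr1 ?mulr0 ?normr0//.
    by rewrite ger0_norm ?rsqrt_ge0.
  have I2 : leb.-integrable setT (EFin \o (exponential_pdf (4^-1 : R))).
    apply/integrableP; split.
      by apply/measurable_EFinP; exact: measurable_exponential_pdf.
    under eq_integral do rewrite /= ger0_norm ?exponential_pdf_ge0//.
    by rewrite integral_exponential_pdf ?ltry// invr_gt0.
  exact: (integrableD measurableT (integrableZl measurableT (chi2_cst k) I1)
    (integrableZl measurableT (4 * chi2_cst k) I2)).
have mk : measurable_fun D (chi2_kernel k : R -> R) by exact: measurable_chi2_kernel.
apply: (@le_integrable _ _ _ leb D _ (EFin \o chi2_kernel k) (EFin \o g)) => //.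
- exact/measurable_EFinP.
- move=> t /=; rewrite in_itv/= andbT => t0.
  rewrite lee_fin ger0_norm ?chi2_kernel_ge0//.
  by rewrite (le_trans (chi2_kernel_dom k0 t0))// ler_norm.
- exact: integrableS Ig.
Qed.

Definition chi2_nrm k : R := Rintegral leb D (chi2_kernel k).

Lemma chi2_nrm_gt0 k : (0 < k)%N -> 0 < chi2_nrm k.
Proof.
move=> k0.
have sD : `[1%R, 2%R]%classic `<=` D.
  by move=> t /=; rewrite !in_itv/= => /andP[t1 _]; rewrite andbT (le_trans _ t1).
have Ik := integrable_chi2_kernel k0.
rewrite -lte_fin /chi2_nrm fineK; last exact: integrable_fin_num.
apply: (@lt_le_trans _ _ (\int[leb]_(t in `[1%R, 2%R]) (chi2_kernel k t)%:E)%E); last first.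
  apply: ge0_subset_integral => //.
  - by apply/measurable_EFinP; exact: measurable_chi2_kernel.
  - by move=> x _; rewrite lee_fin chi2_kernel_ge0.
apply: (@lt_le_trans _ _ (\int[leb]_(t in `[1%R, 2%R]) (cst (2^-1 * expR (-1))%:E t))%E).
  rewrite integral_cst//= lebesgue_measure_itv/= lte_fin ltr1n/=.
  by rewrite -EFinD -EFinM lte_fin !mulr_gt0 ?expR_gt0//; lra.
apply: ge0_le_integral => //.
- by move=> t _; rewrite lee_fin mulr_ge0 ?expR_ge0.
- by apply/measurable_EFinP; exact: measurable_chi2_kernel.
- move=> t /=; rewrite in_itv/= => /andP[t1 t2]; rewrite lee_fin /chi2_kernel.
  apply: ler_pM; rewrite ?expR_ge0 ?invr_ge0//; last by rewrite ler_expR; lra.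
  apply: (@le_trans _ _ (powR t (-1))).
    rewrite powR_inv1 ?lef_pV2 ?posrE//; lra.
  apply: ler_powR => //; rewrite lerBrDr addNr.
  by rewrite divr_ge0.
Qed.

(** Mean of [f] under the central chi-square law with [k] degrees of freedom. The normalisation
    stays an integral, so the Gamma function never appears. *)
Definition EK k (f : R -> R) : R :=
  Rintegral leb D (fun t => f t * chi2_kernel k t) / chi2_nrm k.

Lemma EK_integrable k (f : R -> R) (M : R) : (0 < k)%N -> measurable_fun setT f ->
  (forall t, 0 <= t -> `|f t| <= M) ->
  leb.-integrable D (EFin \o (fun t => f t * chi2_kernel k t)).
Proof.
move=> k0 mf fM; have Ik := integrable_chi2_kernel k0.
apply: (@le_integrable _ _ _ leb D _ _ (EFin \o (fun t => M * chi2_kernel k t))) => //.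
- apply/measurable_EFinP; apply: measurable_funM; first exact: measurable_funTS.
  exact: measurable_chi2_kernel.
- move=> t /=; rewrite in_itv/= andbT => t0; rewrite lee_fin !normrM.
  rewrite ler_wpM2r// (le_trans (fM t t0))// ler_norm//.
- exact: (integrableZl _ M Ik).
Qed.

Lemma EK_le k (f g : R -> R) (M M' : R) : (0 < k)%N ->
  measurable_fun setT f -> (forall t, 0 <= t -> `|f t| <= M) ->
  measurable_fun setT g -> (forall t, 0 <= t -> `|g t| <= M') ->
  (forall t, 0 <= t -> f t <= g t) -> EK k f <= EK k g.
Proof.
move=> k0 mf fM mg gM fg.
rewrite /EK; apply: ler_wpM2r; first by rewrite invr_ge0 ltW// chi2_nrm_gt0.
apply: le_Rintegral => //; [exact: EK_integrable fM|exact: EK_integrable gM|].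
move=> t /=; rewrite in_itv/= andbT => t0.
by rewrite ler_wpM2r ?chi2_kernel_ge0// fg.
Qed.

Lemma EKD k (f g : R -> R) (M M' : R) : (0 < k)%N ->
  measurable_fun setT f -> (forall t, 0 <= t -> `|f t| <= M) ->
  measurable_fun setT g -> (forall t, 0 <= t -> `|g t| <= M') ->
  EK k (fun t => f t + g t) = EK k f + EK k g.
Proof.
move=> k0 mf fM mg gM; rewrite /EK -mulrDl -RintegralD//.
- by congr (_ / _); apply: eq_Rintegral => t _; rewrite mulrDl.
- exact: EK_integrable fM.
- exact: EK_integrable gM.
Qed.

Lemma EKZ k (c : R) (f : R -> R) (M : R) : (0 < k)%N ->
  measurable_fun setT f -> (forall t, 0 <= t -> `|f t| <= M) ->
  EK k (fun t => c * f t) = c * EK k f.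
Proof.
move=> k0 mf fM; rewrite /EK mulrA -RintegralZl//.
- by congr (_ / _); apply: eq_Rintegral => t _; rewrite mulrA.
- exact: EK_integrable fM.
Qed.

Lemma EK_cst k (c : R) : (0 < k)%N -> EK k (fun=> c) = c.
Proof.
move=> k0; rewrite /EK RintegralZl//; last exact: integrable_chi2_kernel.
by rewrite mulfK// gt_eqF// chi2_nrm_gt0.
Qed.

Lemma chi2_cdfE k x : chi2_cdf k x = EK k (fun t => (t <= x)%R%:R).
Proof.
rewrite /chi2_cdf /EK /chi2_nrm /Rintegral; congr (fine _ / fine _).
rewrite (_ : `[0%R, x]%classic = D `&` [set t | t <= x]); last first.
  by apply/seteqP; split => t /=; rewrite !in_itv/= andbT => /andP.
rewrite integral_mkcondr; apply: eq_integral => t _.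
rewrite patchE; case: ifPn => [/set_mem/= ->|/negP h]; first by rewrite mul1r.
case: (leP t x) => [tx|_]; last by rewrite mul0r.
by case: h; rewrite inE.
Qed.

(** The image of Lebesgue measure under multiplication by [a], rescaled by [a], gives every interval
    its length, hence is Lebesgue measure by uniqueness. *)
Lemma lebesgue_scale (a : R) (f : R -> R) : 0 < a -> measurable_fun setT f ->
  (forall t, 0 <= f t) ->
  (\int[leb]_(t in D) (f t)%:E = \int[leb]_(t in D) (a * f (a * t))%:E)%E.
Proof.
move=> a0 mf f0.
pose phi : measurableTypeR R -> measurableTypeR R := fun t : R => a * t : R.
have mphi : measurable_fun setT phi by exact: (@measurable_funM _ R R setT (cst a) id).
have a0' : 0 <= a by exact: ltW.
have E A : measurable A -> leb A = (a%:E * pushforward leb phi A)%E.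
  move=> mA; apply: (@lebesgue_measure_unique R
    (mscale (NngNum a0') (pushforward leb phi))) => // _ [[c d] _ <-].
  suff : leb `]c, d]%classic = (a%:E * leb (phi @^-1` `]c, d]%classic))%E by [].
  have -> : phi @^-1` `]c, d]%classic = `](c / a), (d / a)]%classic.
    apply/seteqP; split => t; rewrite /phi/= !in_itv/= => /andP[h1 h2]; apply/andP; split.
    + by rewrite ltr_pdivrMr// mulrC.
    + by rewrite ler_pdivlMr// mulrC.
    + by rewrite mulrC -ltr_pdivrMr.
    + by rewrite mulrC -ler_pdivlMr.
  rewrite !lebesgue_measure_itv/= !lte_fin ltr_pM2r ?invr_gt0//.
  case: ifP => _; last by rewrite mule0.
  by rewrite -EFinD -EFinM; congr EFin; rewrite -mulrBl mulrC divfK// gt_eqF.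
have DE : D = phi @^-1` D.
  by apply/seteqP; split => t; rewrite /phi/= !in_itv/= !andbT pmulr_rge0.
under [RHS]eq_integral do rewrite EFinM.
rewrite ge0_integralZl_EFin//; last 2 first.
- by move=> t _; rewrite lee_fin.
- by apply/measurable_EFinP; apply: measurable_funTS; apply: measurableT_comp.
have mEf : measurable_fun D (EFin \o f).
  by apply/measurable_EFinP; exact: measurable_funTS.
rewrite [in RHS]DE.
have h : (\int[pushforward leb phi]_(t in D) (f t)%:E =
    \int[leb]_(t in phi @^-1` D) (f (a * t))%:E)%E.
  by apply: (ge0_integral_pushforward mphi leb _ mEf) => // y _; rewrite lee_fin.
have h2 : (\int[mscale (NngNum a0') (pushforward leb phi)]_(t in D) (f t)%:E =
    a%:E * \int[pushforward leb phi]_(t in D) (f t)%:E)%E.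
  by move=> mp; apply: ge0_integral_mscale => // y _; rewrite lee_fin.
by rewrite -h -(h2 mphi); apply: eq_measure_integral => A mA _; exact: E.
Qed.

(** Since s t + t/2 = (1 + 2s) t/2, the substitution of (1 + 2s) t for t turns the kernel into the
    damped one, up to the power k/2 of 1 + 2s whose inverse is the answer. *)
Lemma EK_exp k s : (0 < k)%N -> 0 <= s ->
  EK k (fun t => expR (- s * t)) = (Num.sqrt (1 + 2 * s))^-1 ^+ k.
Proof.
move=> k0 s0; set a := 1 + 2 * s.
have a0 : 0 < a by rewrite /a; lra.
have n0 := chi2_nrm_gt0 k0.
have ra : Num.sqrt a ^+ k = powR a (k%:R / 2).
  by rewrite -powR12_sqrt ?ltW// -powR_mulrn ?powR_ge0// -powRrM mulrC.
rewrite exprVn ra /EK.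
suff -> : Rintegral leb D (fun t => expR (- s * t) * chi2_kernel k t) =
    (powR a (k%:R / 2))^-1 * chi2_nrm k by rewrite mulfK// gt_eqF.
rewrite /chi2_nrm /Rintegral.
rewrite (@lebesgue_scale a (chi2_kernel k))//; last 2 first.
- exact: measurable_chi2_kernel.
- exact: chi2_kernel_ge0.
have -> : (\int[leb]_(t in D) (a * chi2_kernel k (a * t))%:E)%E =
    (\int[leb]_(t in D) ((powR a (k%:R / 2))%:E * (expR (- s * t) * chi2_kernel k t)%:E))%E.
  apply: eq_integral => t; rewrite inE/= in_itv/= andbT => t0.
  rewrite -EFinM; congr EFin; rewrite /chi2_kernel powRM ?(ltW a0)//.
  rewrite (_ : powR a (k%:R / 2) = a * powR a (k%:R / 2 - 1)); last first.
    by rewrite mulr_powRB1// ?ltW// divr_gt0// ltr0n.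
  have -> : expR (- (a * t) / 2) = expR (- s * t) * expR (- t / 2).
    by rewrite -expRD; congr expR; rewrite /a; field.
  by ring.
rewrite ge0_integralZl_EFin//; last 3 first.
- by move=> t _; rewrite lee_fin mulr_ge0 ?expR_ge0 ?chi2_kernel_ge0.
- apply/measurable_EFinP; apply: measurable_funM; last exact: measurable_chi2_kernel.
  apply: measurable_funTS; apply: measurableT_comp => //.
- exact: powR_ge0.
have pa : 0 < powR a (k%:R / 2) by exact: powR_gt0.
rewrite fineM//; last first.
  apply: integrable_fin_num => //; apply: (@EK_integrable k _ 1) => //.
    by apply: measurableT_comp => //.
  move=> t t0; rewrite ger0_norm ?expR_ge0// -[leRHS]expR0 ler_expR.
  by rewrite mulNr oppr_le0 mulr_ge0.
by rewrite /= mulrA mulVf ?mul1r// gt_eqF.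
Qed.

Lemma measurable_le_ind x : measurable_fun setT (fun t : R => ((t <= x)%R%:R : R)).
Proof.
apply: (@measurableT_comp _ _ _ _ _ _ (fun b : bool => (b%:R : R))) => //.
exact: measurable_fun_ler.
Qed.

Lemma bool_norm_le1 (b : bool) : `|b%:R : R| <= 1.
Proof. by case: b; rewrite ?normr1 ?normr0. Qed.

Lemma chi2_cdf_bound k x : (0 < k)%N -> 0 <= chi2_cdf k x <= 1.
Proof.
move=> k0; rewrite chi2_cdfE; apply/andP; split.
  rewrite -(@EK_cst k 0)//; apply: (@EK_le k _ _ `|0| 1) => //.
  - by move=> t _; exact: lexx.
  - exact: measurable_le_ind.
  - by move=> t _; exact: bool_norm_le1.
rewrite -[leRHS](@EK_cst k 1)//; apply: (@EK_le k _ _ 1 `|1|) => //.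
- exact: measurable_le_ind.
- by move=> t _; exact: bool_norm_le1.
- by move=> t _; case: (t <= x).
Qed.

Lemma chi2_cdf_neg k x : x < 0 -> chi2_cdf k x = 0.
Proof.
move=> x0; rewrite /chi2_cdf set_itv_ge ?integral_set0 ?mul0r//.
by rewrite bnd_simp -ltNge.
Qed.

Lemma chi2_cdf_mono k x y : (0 < k)%N -> x <= y -> chi2_cdf k x <= chi2_cdf k y.
Proof.
move=> k0 xy; rewrite !chi2_cdfE; apply: (@EK_le k _ _ 1 1) => //.
- exact: measurable_le_ind.
- by move=> t _; exact: bool_norm_le1.
- exact: measurable_le_ind.
- by move=> t _; exact: bool_norm_le1.
- move=> t _; case: (leP t x) => [tx|_]; last by case: (t <= y).
  by rewrite (le_trans tx xy).
Qed.

Lemma chi2_cdf_modulus k x y : (0 < k)%N -> 0 <= x -> x < y ->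
  chi2_cdf k y - chi2_cdf k x <= 2 * chi2_cst k / chi2_nrm k * Num.sqrt (y - x).
Proof.
move=> k0 x0 xy; have n0 := chi2_nrm_gt0 k0.
have y0 : 0 <= y by rewrite (le_trans x0)// ltW.
have Ik := integrable_chi2_kernel k0.
rewrite /chi2_cdf -mulrBl [leRHS]mulrAC; apply: ler_wpM2r.
  by rewrite invr_ge0 ltW.
have Iky : leb.-integrable (`[0%R, y]%classic : set R) (EFin \o chi2_kernel k).
  by apply: integrableS Ik => //; exact: subset_itvl.
have := @Rintegral_itvB R (chi2_kernel k) (BLeft 0) (BRight y) x Iky.
rewrite /Rintegral => ->; [|by rewrite bnd_simp|by rewrite bnd_simp ltW].
have sxy : (`]x, y]%classic : set R) `<=` D.
  by move=> t /=; rewrite !in_itv/= andbT => /andP[xt _]; rewrite (le_trans x0)// ltW.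
have c1 := chi2_cst_ge1 k.
rewrite -lee_fin fineK; last first.
  by apply: integrable_fin_num => //; apply: integrableS Ik.
apply: (@le_trans _ _ (\int[leb]_(t in `]x, y]) ((chi2_cst k)%:E * (rsqrt t)%:E))%E).
  apply: ge0_le_integral => //.
  - by move=> t _; rewrite lee_fin chi2_kernel_ge0.
  - by apply/measurable_EFinP; exact: measurable_chi2_kernel.
  - apply: measurable_funeM; apply/measurable_EFinP; exact: measurable_rsqrt.
  - move=> t /=; rewrite in_itv/= => /andP[xt _].
    have t0 : 0 < t by apply: le_lt_trans xt.
    rewrite -EFinM lee_fin (le_trans (chi2_kernel_le k0 t0))//.
    rewrite ler_piMr//; first by rewrite mulr_ge0 ?rsqrt_ge0//; lra.
    by rewrite -[leRHS]expR0 ler_expR; lra.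
rewrite ge0_integralZl_EFin//; last 3 first.
- by move=> t _; rewrite lee_fin rsqrt_ge0.
- by apply/measurable_EFinP; exact: measurable_rsqrt.
- by lra.
apply: (@le_trans _ _ ((chi2_cst k)%:E * (2 * Num.sqrt (y - x))%:E)%E).
  by apply: lee_wpmul2l; [rewrite lee_fin; lra|exact: integral_rsqrt_le].
by rewrite -EFinM lee_fin mulrA (mulrC (chi2_cst k)).
Qed.

Definition poisson_w (lam : R) (j : nat) : R :=
  expR (- lam / 2) * (lam / 2) ^+ j / j`!%:R.

(** Mean of [f] under the Poisson law of parameter [lam / 2]; [ncchi2_cdf] unfolds to this average
    of central d.f.'s. *)
Definition mix (lam : R) (f : nat -> R) : R :=
  limn (series (fun j => poisson_w lam j * f j)).

Lemma poisson_wE lam j : poisson_w lam j = expR (- lam / 2) * exp_coeff (lam / 2) j.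
Proof. by rewrite /poisson_w /exp_coeff/= mulrA. Qed.

Lemma poisson_w_ge0 lam j : 0 <= lam -> 0 <= poisson_w lam j.
Proof.
by move=> l0; rewrite /poisson_w divr_ge0// mulr_ge0 ?expR_ge0// exprn_ge0// divr_ge0.
Qed.

Lemma mix_cvg lam f (M : R) : 0 <= lam -> (forall j, `|f j| <= M) ->
  cvgn (series (fun j => poisson_w lam j * f j)).
Proof.
move=> l0 fM; apply: normed_cvg.
apply: (@series_le_cvg _ _ (fun j => M * expR (- lam / 2) * exp_coeff (lam / 2) j)).
- by move=> j; rewrite /= normr_ge0.
- move=> j; rewrite -mulrA -poisson_wE mulr_ge0 ?poisson_w_ge0//.
  exact: le_trans (normr_ge0 _) (fM 0%N).
- move=> j /=; rewrite -mulrA -poisson_wE normrM ger0_norm ?poisson_w_ge0//.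
  by rewrite mulrC ler_wpM2r ?poisson_w_ge0.
- rewrite (_ : (fun j => _) = (M * expR (- lam / 2)) *: exp_coeff (lam / 2))//.
  by apply: is_cvg_seriesZ; exact: is_cvg_series_exp_coeff.
Qed.

Lemma mixD lam f g (M M' : R) : 0 <= lam ->
  (forall j, `|f j| <= M) -> (forall j, `|g j| <= M') ->
  mix lam (fun j => f j + g j) = mix lam f + mix lam g.
Proof.
move=> l0 fM gM; rewrite /mix -limD; [|exact: mix_cvg fM|exact: mix_cvg gM].
congr (limn _); apply/funext => n; rewrite fctE /series/= -big_split/=.
by apply: eq_bigr => j _; rewrite mulrDr.
Qed.

Lemma mixZ lam (c : R) f (M : R) : 0 <= lam -> (forall j, `|f j| <= M) ->
  mix lam (fun j => c * f j) = c * mix lam f.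
Proof.
move=> l0 fM; rewrite /mix; have h := mix_cvg l0 fM.
apply: cvg_lim => //.
rewrite (_ : series _ = (fun n => c * series (fun j => poisson_w lam j * f j) n)).
  exact: cvgMr.
by apply/funext => n; rewrite /series/= mulr_sumr; apply: eq_bigr => j _; ring.
Qed.

Lemma mix_le lam f g (M M' : R) : 0 <= lam ->
  (forall j, `|f j| <= M) -> (forall j, `|g j| <= M') ->
  (forall j, f j <= g j) -> mix lam f <= mix lam g.
Proof.
move=> l0 fM gM fg; apply: lim_series_le.
- exact: mix_cvg fM.
- exact: mix_cvg gM.
- by move=> j; rewrite ler_wpM2l// poisson_w_ge0.
Qed.

Lemma mix_geom lam (r : R) : 0 <= lam -> 0 <= r <= 1 ->
  mix lam (fun j => r ^+ j) = expR (- lam / 2 * (1 - r)).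
Proof.
move=> l0 /andP[r0 r1].
rewrite (_ : - lam / 2 * (1 - r) = - lam / 2 + lam / 2 * r); last by ring.
rewrite expRD /mix [expR (lam / 2 * r)]/expR.
have h := is_cvg_series_exp_coeff (lam / 2 * r).
apply: cvg_lim => //.
rewrite (_ : series _ = (fun n => expR (- lam / 2) * series (exp_coeff (lam / 2 * r)) n)).
  exact: cvgMr.
apply/funext => n; rewrite /series/= mulr_sumr.
by apply: eq_bigr => j _; rewrite poisson_wE /exp_coeff/= [in RHS]exprMn; ring.
Qed.

Lemma mix_cst lam (c : R) : 0 <= lam -> mix lam (fun=> c) = c.
Proof.
move=> l0; have := @mix_geom lam 1 l0; rewrite subrr mulr0 expR0 => h.
rewrite (_ : (fun=> c) = (fun j => c * 1 ^+ j)); last first.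
  by apply/funext => j; rewrite expr1n mulr1.
rewrite (@mixZ _ _ _ 1)//; first by rewrite h ?mulr1// ler01 lexx.
by move=> j; rewrite expr1n normr1.
Qed.

Lemma ncchi2_cdfE m lam x : ncchi2_cdf m lam x = mix lam (fun j => chi2_cdf (m + 2 * j) x).
Proof. by []. Qed.

Definition chi2_laplace m (lam s : R) : R :=
  (Num.sqrt (1 + 2 * s))^-1 ^+ m * expR (- lam * s / (1 + 2 * s)).

(** Each extra pair of degrees of freedom multiplies the central transform by 1/(1 + 2s). The
    mixture is thus the Poisson generating function at that point, and 1 - 1/(1 + 2s) = 2s/(1 + 2s)
    gives the exponent. *)
Lemma mix_laplace m lam s : (0 < m)%N -> 0 <= lam -> 0 <= s ->
  mix lam (fun j => EK (m + 2 * j) (fun t => expR (- s * t))) = chi2_laplace m lam s.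
Proof.
move=> m0 l0 s0; have a0 : 0 < 1 + 2 * s by lra.
have i0 : 0 <= (1 + 2 * s)^-1 <= 1.
  by rewrite invr_ge0 (ltW a0)/= invf_le1//; lra.
rewrite (_ : (fun j => _) = (fun j => (Num.sqrt (1 + 2 * s))^-1 ^+ m * (1 + 2 * s)^-1 ^+ j)).
  rewrite (@mixZ _ _ _ 1)//.
    rewrite mix_geom// /chi2_laplace; congr (_ * expR _); field.
    by rewrite gt_eqF.
  by move=> j; rewrite ger0_norm ?exprn_ge0 ?exprn_ile1//; case/andP: i0.
apply/funext => j; rewrite EK_exp ?addn_gt0 ?m0// exprD; congr (_ * _).
by rewrite exprM exprVn sqr_sqrtr// ltW.
Qed.

Definition expcomb (l : seq (R * R)) t : R := \sum_(p <- l) p.1 * expR (- p.2 * t).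

Lemma expcomb_bound l t : all (fun p => 0 <= p.2) l -> 0 <= t ->
  `|expcomb l t| <= \sum_(p <- l) `|p.1|.
Proof.
move=> hl t0; rewrite /expcomb; apply: (le_trans (ler_norm_sum _ _ _)).
rewrite !big_seq; apply: ler_sum => p pl; rewrite normrM ler_piMr//.
rewrite ger0_norm ?expR_ge0// -[leRHS]expR0 ler_expR mulNr oppr_le0 mulr_ge0//.
exact: (allP hl).
Qed.

Lemma measurable_expcomb l : measurable_fun setT (expcomb l).
Proof.
apply: measurable_sum => p; apply: measurable_funM => //.
by apply: measurableT_comp => //; exact: measurable_funM.
Qed.

Lemma EK_expcomb k l : (0 < k)%N -> all (fun p => 0 <= p.2) l ->
  EK k (expcomb l) = \sum_(p <- l) p.1 * EK k (fun t => expR (- p.2 * t)).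
Proof.
move=> k0; elim: l => [|p l IH] /=.
  move=> _; rewrite big_nil -[RHS](@EK_cst k 0)//; congr (EK k _).
  by apply/funext => t; rewrite /expcomb big_nil.
move=> /andP[p0 hl]; rewrite big_cons -IH//.
have mp : measurable_fun setT (fun t : R => expR (- p.2 * t)).
  by apply: measurableT_comp => //; exact: measurable_funM.
have bp t : 0 <= t -> `|expR (- p.2 * t)| <= 1.
  move=> t0; rewrite ger0_norm ?expR_ge0// -[leRHS]expR0 ler_expR mulNr oppr_le0.
  by rewrite mulr_ge0.
rewrite -(EKZ p.1 k0 mp bp) -(@EKD _ _ _ `|p.1| (\sum_(p <- l) `|p.1|))//.
- by congr (EK k _); apply/funext => t; rewrite /expcomb big_cons.
- exact: measurable_funM.
- by move=> t t0; rewrite normrM ler_piMr// bp.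
- exact: measurable_expcomb.
- by move=> t t0; exact: expcomb_bound.
Qed.

Lemma EK_exp_norm k s : (0 < k)%N -> 0 <= s ->
  `|EK k (fun t => expR (- s * t))| <= 1.
Proof.
move=> k0 s0; rewrite EK_exp// ger0_norm ?exprn_ge0 ?invr_ge0 ?sqrtr_ge0//.
rewrite exprn_ile1 ?invr_ge0 ?sqrtr_ge0// invf_le1 ?sqrtr_gt0; last by lra.
by rewrite -[leLHS]sqrtr1 ler_wsqrtr//; lra.
Qed.

Lemma EK_expcomb_norm k l : (0 < k)%N -> all (fun p => 0 <= p.2) l ->
  `|EK k (expcomb l)| <= \sum_(p <- l) `|p.1|.
Proof.
move=> k0 hl; rewrite EK_expcomb//; apply: (le_trans (ler_norm_sum _ _ _)).
rewrite !big_seq; apply: ler_sum => q ql; rewrite normrM ler_piMr//.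
by apply: EK_exp_norm => //; exact: (allP hl).
Qed.

Lemma mix_expcomb m lam l : (0 < m)%N -> 0 <= lam -> all (fun p => 0 <= p.2) l ->
  mix lam (fun j => EK (m + 2 * j) (expcomb l)) = \sum_(p <- l) p.1 * chi2_laplace m lam p.2.
Proof.
move=> m0 l0 hl.
have k0 j : (0 < m + 2 * j)%N by rewrite addn_gt0 m0.
have -> : (fun j => EK (m + 2 * j) (expcomb l)) =
    (fun j => \sum_(p <- l) p.1 * EK (m + 2 * j) (fun t => expR (- p.2 * t))).
  by apply/funext => j; rewrite EK_expcomb.
have bE p j : 0 <= p -> `|EK (m + 2 * j) (fun t => expR (- p * t))| <= 1.
  by move=> p0; exact: EK_exp_norm.
elim: l hl => [|p l IH] /=.
  by move=> _; under eq_fun do rewrite big_nil; rewrite big_nil mix_cst.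
move=> /andP[p0 hl]; rewrite big_cons -IH// -mix_laplace//.
rewrite -(@mixZ _ _ _ 1)//; last by move=> j; exact: bE.
rewrite -(@mixD _ _ _ `|p.1| (\sum_(p <- l) `|p.1|))//.
- by congr (mix _ _); apply/funext => j; rewrite big_cons.
- by move=> j; rewrite normrM ler_piMr// bE.
- move=> j; apply: (le_trans (ler_norm_sum _ _ _)); rewrite !big_seq.
  by apply: ler_sum => q ql; rewrite normrM ler_piMr// bE// (allP hl).
Qed.

Lemma chi2_cdf_norm k x : (0 < k)%N -> `|chi2_cdf k x| <= 1.
Proof. by move=> k0; have /andP[h1 h2] := chi2_cdf_bound x k0; rewrite ger0_norm. Qed.

(** A pointwise inequality on the half-line survives [EK] and [mix], both monotone and linear, and
    on exponentials their composite is known. The noncentral d.f. is thus bounded by Laplace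
    transforms without a noncentral density. *)
Lemma ncchi2_cdf_le_expcomb m lam x l (e : R) : (0 < m)%N -> 0 <= lam ->
  all (fun p => 0 <= p.2) l ->
  (forall t, 0 <= t -> (t <= x)%R%:R <= expcomb l t + e) ->
  ncchi2_cdf m lam x <= \sum_(p <- l) p.1 * chi2_laplace m lam p.2 + e.
Proof.
move=> m0 l0 hl h; rewrite ncchi2_cdfE -(mix_expcomb m0 l0 hl) -[X in _ + X](@mix_cst lam)//.
have k0 j : (0 < m + 2 * j)%N by rewrite addn_gt0 m0.
have bq j : `|EK (m + 2 * j) (expcomb l)| <= \sum_(p <- l) `|p.1| by exact: EK_expcomb_norm.
rewrite -(mixD l0 bq (fun=> lexx `|e|)).
apply: (@mix_le _ _ _ 1 (\sum_(p <- l) `|p.1| + `|e|)) => //.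
- by move=> j; exact: chi2_cdf_norm.
- by move=> j; rewrite (le_trans (ler_normD _ _))// lerD.
move=> j; rewrite chi2_cdfE -(@EK_cst (m + 2 * j) e)//.
rewrite -(@EKD _ _ _ (\sum_(p <- l) `|p.1|) `|e|)//; last 2 first.
- exact: measurable_expcomb.
- by move=> t t0; exact: expcomb_bound.
apply: (@EK_le _ _ _ 1 (\sum_(p <- l) `|p.1| + `|e|)) => //.
- exact: measurable_le_ind.
- by move=> t _; exact: bool_norm_le1.
- by apply: measurable_funD => //; exact: measurable_expcomb.
- by move=> t t0; rewrite (le_trans (ler_normD _ _))// lerD// expcomb_bound.
Qed.

Lemma ncchi2_cdf_ge_expcomb m lam x l (e : R) : (0 < m)%N -> 0 <= lam ->
  all (fun p => 0 <= p.2) l ->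
  (forall t, 0 <= t -> expcomb l t <= (t <= x)%R%:R + e) ->
  \sum_(p <- l) p.1 * chi2_laplace m lam p.2 <= ncchi2_cdf m lam x + e.
Proof.
move=> m0 l0 hl h; rewrite ncchi2_cdfE -(mix_expcomb m0 l0 hl) -[X in _ + X](@mix_cst lam)//.
have k0 j : (0 < m + 2 * j)%N by rewrite addn_gt0 m0.
have bc j : `|chi2_cdf (m + 2 * j) x| <= 1 by exact: chi2_cdf_norm.
have bq j : `|EK (m + 2 * j) (expcomb l)| <= \sum_(p <- l) `|p.1| by exact: EK_expcomb_norm.
rewrite -(mixD l0 bc (fun=> lexx `|e|)).
apply: (@mix_le _ _ _ (\sum_(p <- l) `|p.1|) (1 + `|e|)) => //.
- by move=> j; rewrite (le_trans (ler_normD _ _))// lerD.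
move=> j; rewrite chi2_cdfE -(@EK_cst (m + 2 * j) e)//.
rewrite -(@EKD _ _ _ 1 `|e|)//; last 2 first.
- exact: measurable_le_ind.
- by move=> t _; exact: bool_norm_le1.
apply: (@EK_le _ _ _ (\sum_(p <- l) `|p.1|) (1 + `|e|)) => //.
- exact: measurable_expcomb.
- by move=> t t0; exact: expcomb_bound.
- by apply: measurable_funD => //; exact: measurable_le_ind.
- by move=> t t0; rewrite (le_trans (ler_normD _ _))// lerD// bool_norm_le1.
Qed.

(* Truncating the Poisson series leaves finitely many chi-square laws, each of
   which has a modulus of continuity. *)
Lemma ncchi2_cdf_modulus m (Lam e : R) : (0 < m)%N -> 0 <= Lam -> 0 < e ->
  exists h : R, 0 < h /\ forall lam x, 0 <= lam <= Lam -> 0 <= x ->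
    ncchi2_cdf m lam (x + h) <= ncchi2_cdf m lam x + e.
Proof.
move=> m0 L0 e0; pose c := exp_coeff (Lam / 2).
have k0 j : (0 < m + 2 * j)%N by rewrite addn_gt0 m0.
have c0 j : 0 <= c j by rewrite /c exp_coeff_ge0// divr_ge0.
have cvc := is_cvg_series_exp_coeff (Lam / 2).
have e20 : 0 < e / 2 by rewrite divr_gt0.
have [K hK] : exists K : nat, forall n, (K <= n)%N ->
    \sum_(K <= j < n) c j <= e / 2.
  have /cvgrPdist_lt/(_ _ e20)[K _ hK] := cvc.
  exists K => n Kn; have := hK K (leqnn K).
  have : series c n <= limn (series c).
    by apply: nondecreasing_cvgn_le => //; exact: nondecreasing_series.
  rewrite /series/= (big_cat_nat (n := K))//= => h1; rewrite /series/= => h2.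
  have := ler_norm (limn (series c) - \sum_(0 <= k < K) c k); lra.
pose C : R := 1 + \sum_(0 <= j < K) c j * (2 * chi2_cst (m + 2 * j) / chi2_nrm (m + 2 * j)).
have a0 j : 0 <= 2 * chi2_cst (m + 2 * j) / chi2_nrm (m + 2 * j).
  by rewrite divr_ge0 ?mulr_ge0 ?(ltW (chi2_nrm_gt0 _))// (le_trans _ (chi2_cst_ge1 _)).
have C1 : 1 <= C by rewrite /C lerDl sumr_ge0// => j _; rewrite mulr_ge0.
have C0 : 0 < C by lra.
(* Each of the first [K] d.f.'s has a square-root modulus, so together they move by at most C
   sqrt(h); this choice makes that [e / 2]. The other half pays for the tail of the exponential
   series at [Lam / 2], which dominates the Poisson weights for every [lam <= Lam]. *)
exists ((e / 2 / C) ^+ 2); split; first by rewrite exprn_gt0// divr_gt0.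
set h := (e / 2 / C) ^+ 2.
have h0 : 0 < h by rewrite exprn_gt0// divr_gt0.
have sh : Num.sqrt h = e / 2 / C by rewrite sqrtr_sqr ger0_norm// ltW// divr_gt0.
move=> lam x /andP[l0 lL] x0; rewrite !ncchi2_cdfE -lerBlDl.
have bc (y : R) j : `|chi2_cdf (m + 2 * j) y| <= 1 by exact: chi2_cdf_norm.
have bN j : `|- chi2_cdf (m + 2 * j) x| <= 1 by rewrite normrN.
have -> : - mix lam (fun j => chi2_cdf (m + 2 * j) x) =
    mix lam (fun j => - chi2_cdf (m + 2 * j) x).
  under [in RHS]eq_fun do rewrite -mulN1r.
  by rewrite (@mixZ _ _ _ 1)// mulN1r.
rewrite -(mixD l0 (bc _) bN).
have bD j : `|chi2_cdf (m + 2 * j) (x + h) - chi2_cdf (m + 2 * j) x| <= 1 + 1.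
  by rewrite (le_trans (ler_normD _ _))// lerD.
apply: limr_le; first exact: mix_cvg bD.
near=> n; rewrite /series/=.
have Kn : (K <= n)%N by near: n; exists K.
have wc j : poisson_w lam j <= c j.
  rewrite poisson_wE (@le_trans _ _ (exp_coeff (lam / 2) j))//.
    rewrite ler_piMl ?exp_coeff_ge0 ?divr_ge0// -[leRHS]expR0 ler_expR; lra.
  rewrite /c /exp_coeff/= ler_wpM2r ?invr_ge0// lerXn2r ?nnegrE ?divr_ge0//; lra.
have dj j : 0 <= chi2_cdf (m + 2 * j) (x + h) - chi2_cdf (m + 2 * j) x <= 1.
  rewrite subr_ge0 chi2_cdf_mono//=; last by rewrite lerDl ltW.
  have /andP[] := chi2_cdf_bound (x + h) (k0 j).
  by have /andP[] := chi2_cdf_bound x (k0 j); lra.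
rewrite (big_cat_nat (n := K))//= (_ : e = e / 2 + e / 2); last by field.
apply: lerD; last first.
  apply: le_trans (hK n Kn); apply: ler_sum => j _.
  have /andP[d0 d1] := dj j.
  by apply: (le_trans (ler_wpM2l (poisson_w_ge0 j l0) d1)); rewrite mulr1.
apply: (@le_trans _ _ (\sum_(0 <= j < K) c j *
    (2 * chi2_cst (m + 2 * j) / chi2_nrm (m + 2 * j)) * (e / 2 / C))).
  apply: ler_sum => j _; have /andP[d0 d1] := dj j.
  apply: (@le_trans _ _ (c j * (chi2_cdf (m + 2 * j) (x + h) - chi2_cdf (m + 2 * j) x))).
    exact: ler_wpM2r.
  rewrite -mulrA ler_wpM2l// -sh.
  have := @chi2_cdf_modulus (m + 2 * j) x (x + h) (k0 j) x0.
  by rewrite (_ : x + h - x = h); [apply; lra|ring].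
rewrite -mulr_suml mulrA ler_pdivrMr// mulrC ler_wpM2l ?(ltW e20)//.
by rewrite /C lerDr.
Unshelve. all: by end_near. Qed.

Lemma ncchi2_cdf_bound m lam x : (0 < m)%N -> 0 <= lam -> 0 <= ncchi2_cdf m lam x <= 1.
Proof.
move=> m0 l0; rewrite ncchi2_cdfE.
have k0 j : (0 < m + 2 * j)%N by rewrite addn_gt0 m0.
have b j : `|chi2_cdf (m + 2 * j) x| <= 1 by exact: chi2_cdf_norm.
apply/andP; split.
  rewrite -(@mix_cst lam 0)//; apply: (@mix_le _ _ _ `|0| 1) => //.
  - by move=> j; exact: lexx.
  - by move=> j; have /andP[] := chi2_cdf_bound x (k0 j).
rewrite -[leRHS](@mix_cst lam 1)//; apply: (@mix_le _ _ _ 1 `|1|) => // j.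
by have /andP[] := chi2_cdf_bound x (k0 j).
Qed.

Lemma ncchi2_cdf_neg m lam x : 0 <= lam -> x < 0 -> ncchi2_cdf m lam x = 0.
Proof.
move=> l0 x0; rewrite ncchi2_cdfE -[RHS](@mix_cst lam 0)//; congr (mix _ _).
by apply/funext => j; exact: chi2_cdf_neg.
Qed.

Lemma ncchi2_cdf_mono m lam x y : (0 < m)%N -> 0 <= lam -> x <= y ->
  ncchi2_cdf m lam x <= ncchi2_cdf m lam y.
Proof.
move=> m0 l0 xy; rewrite !ncchi2_cdfE.
have k0 j : (0 < m + 2 * j)%N by rewrite addn_gt0 m0.
apply: (@mix_le _ _ _ 1 1) => // j; [exact: chi2_cdf_norm|exact: chi2_cdf_norm|].
exact: chi2_cdf_mono.
Qed.

End ChiSquare.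

(** * Uniform passage from Laplace transforms to distribution functions *)

Section LaplaceToCdf.
Context (R : realType).
Implicit Types (m : nat) (lam s t x e : R).

Lemma expRN_le_inv x : 0 < x -> expR (- x) <= x^-1.
Proof.
move=> x0; rewrite expRN lef_pV2 ?posrE ?expR_gt0//.
by apply: le_trans (expR_ge1Dx x); rewrite lerDr.
Qed.

Lemma bernoulli_ineq (y : R) (N : nat) : 0 <= y <= 1 -> 1 - N%:R * y <= (1 - y) ^+ N.
Proof.
move=> /andP[y0 y1]; elim: N => [|N IH]; first by rewrite mul0r subr0 expr0.
rewrite exprS; apply: le_trans (ler_wpM2l _ IH); last by lra.
rewrite -natr1; have : 0 <= N%:R * y * y by rewrite !mulr_ge0.
by move=> h; nra.
Qed.

Lemma exists_expr_le (r e : R) : 0 <= r < 1 -> 0 < e -> exists j : nat, r ^+ j <= e.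
Proof.
move=> /andP[r0 r1] e0.
have : `|r| < 1 by rewrite ger0_norm.
move=> /cvg_expr /cvgrPdist_lt /(_ _ e0)[j _ hj]; exists j.
have := hj j (leqnn j); rewrite sub0r normrN ger0_norm ?exprn_ge0//.
exact: ltW.
Qed.

(* With y = 2^(-t/c), the function 1 - (1 - y^j)^(2^j) of t tends, as j grows, to
   the indicator of t <= c, because 2^j y^j tends to +oo for t < c and to 0 for
   t > c. *)
Lemma step_expcomb (a b e : R) : 0 <= a -> a < b -> 0 < e ->
  exists l : seq (R * R), all (fun p => 0 <= p.2) l /\
    forall t, 0 <= t -> ((t <= a)%R%:R <= expcomb l t + e) /\
      (expcomb l t <= (t <= b)%R%:R + e).
Proof.
move=> a0 ab e0.
pose tt := (a + b) / 2; have tt0 : 0 < tt by rewrite /tt; lra.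
(* This rate makes 2^j e^(-c j t) the j-th power of e^(c (tt - t)), so the switch takes place at the
   midpoint [tt]. Outside the interval from [a] to [b] the distance to it is at least (b - a)/2, and
   the deviation from the step is at most r^j. *)
pose c := ln 2 / tt.
have ln20 : 0 < ln 2 :> R by rewrite ln_gt0// ltr1n.
have c0 : 0 < c by rewrite divr_gt0.
pose r := expR (- (c * ((b - a) / 2))).
have r01 : 0 <= r < 1.
  rewrite expR_ge0/= -[ltRHS]expR0 ltr_expR oppr_lt0 mulr_gt0// divr_gt0// subr_gt0//.
have [j hj] := exists_expr_le r01 e0.
pose N := (2 ^ j)%N.
pose q t := 1 - (1 - expR (- (c * j%:R) * t)) ^+ N.
exists ((1, 0) :: [seq (- ((-1) ^+ i * 'C(N, i)%:R), c * j%:R * i%:R) | i <- iota 0 N.+1]).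
split.
  apply/allP => p; rewrite inE => /predU1P[->//|/mapP[i _ ->]] /=.
  by rewrite mulr_ge0// mulr_ge0// ltW.
have qE t : expcomb ((1, 0) :: [seq (- ((-1) ^+ i * 'C(N, i)%:R), c * j%:R * i%:R)
    | i <- iota 0 N.+1]) t = q t.
  rewrite /expcomb big_cons big_map [(1, 0).1]/= [(1, 0).2]/= mul1r oppr0 mul0r expR0 /q.
  congr (_ + _); rewrite exprDn -sumrN.
  rewrite -(big_mkord xpredT (fun i => - (1 ^+ (N - i) * (- expR (- (c * j%:R) * t)) ^+ i *+ 'C(N, i)))).
  rewrite /index_iota subn0; apply: eq_bigr => i _.
  rewrite [LHS]/= expr1n mul1r [in RHS]exprNn -[in RHS]mulr_natr -expRM_natr mulNr.
  rewrite (_ : - (c * j%:R * i%:R) * t = - (c * j%:R) * t * i%:R); last by ring.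
  by rewrite mulrAC.
have N2 : N%:R = 2 ^+ j :> R by rewrite natrX.
have NY t : N%:R * expR (- (c * j%:R) * t) = expR (c * (tt - t)) ^+ j.
  rewrite N2 -(@lnK R 2) ?posrE// -[in LHS]expRM_natr -expRD -expRM_natr; congr expR.
  rewrite /c; field; exact: lt0r_neq0.
have Y01 t : 0 <= t -> 0 <= expR (- (c * j%:R) * t) <= 1.
  move=> t0; rewrite expR_ge0/= -[leRHS]expR0 ler_expR mulNr oppr_le0.
  by rewrite mulr_ge0// mulr_ge0// ltW.
have q01 t : 0 <= t -> 0 <= q t <= 1.
  move=> t0; have /andP[y0 y1] := Y01 _ t0.
  rewrite /q subr_ge0 lerBlDr lerDl exprn_ge0 ?andbT ?subr_ge0//.
  by rewrite exprn_ile1// ?subr_ge0// lerBlDr lerDl.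
move=> t t0; rewrite qE; have /andP[qge0 qle1] := q01 _ t0.
have /andP[y0 y1] := Y01 _ t0.
split.
  case: (leP t a) => ta; last by rewrite addr_ge0// ltW.
  rewrite /= /q addrAC lerBrDr -lerBrDl addrAC subrr add0r.
  have P0 : 0 < N%:R * expR (- (c * j%:R) * t).
    by rewrite mulr_gt0 ?expR_gt0// ltr0n expn_gt0.
  apply: (@le_trans _ _ (expR (- (N%:R * expR (- (c * j%:R) * t))))).
    rewrite -[X in _ <= expR X]mulrN expRM_natl lerXn2r ?nnegrE ?expR_ge0 ?subr_ge0//.
    exact: expR_ge1Dx.
  apply: (le_trans (expRN_le_inv P0)); rewrite NY -exprVn -expRN.
  apply: le_trans hj; rewrite lerXn2r ?nnegrE ?expR_ge0// ler_expR lerN2 ler_wpM2l ?(ltW c0)//.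
  by rewrite /tt; lra.
case: (leP t b) => tb; first by rewrite /= (le_trans qle1)// lerDl ltW.
rewrite /= add0r.
have := bernoulli_ineq N (Y01 _ t0); rewrite NY => hB.
apply: (@le_trans _ _ (expR (c * (tt - t)) ^+ j)); first by rewrite /q; lra.
apply: le_trans hj; rewrite lerXn2r ?nnegrE ?expR_ge0// ler_expR -mulrN ler_wpM2l ?(ltW c0)//.
by rewrite /tt; lra.
Qed.

(** Each factor is at most 1 and at least 1 minus a linear term, and a product of two such numbers
    loses at most the sum of the deficits. Being uniform in [lam], the bound yields tightness of the
    limit laws. *)
Lemma chi2_laplace_ge m (Lam lam s : R) : 0 <= lam <= Lam -> 0 <= s <= 1 ->
  1 - (m%:R + Lam) * s <= chi2_laplace m lam s.
Proof.
move=> /andP[l0 lL] /andP[s0 s1]; rewrite /chi2_laplace.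
have a0 : 0 < 1 + 2 * s by lra.
have r0 : 0 < Num.sqrt (1 + 2 * s) by rewrite sqrtr_gt0.
have h1 : 1 - m%:R * s <= (Num.sqrt (1 + 2 * s))^-1 ^+ m.
  apply: (le_trans (bernoulli_ineq m _)); first by rewrite s0.
  rewrite lerXn2r ?nnegrE ?subr_ge0 ?invr_ge0 ?sqrtr_ge0//.
  rewrite -(ler_pM2r r0) mulVf ?gt_eqF//.
  have : Num.sqrt (1 + 2 * s) <= 1 + s.
    rewrite -[leRHS]ger0_norm; last by lra.
    by rewrite -sqrtr_sqr ler_wsqrtr//; nra.
  move=> h; apply: (@le_trans _ _ ((1 - s) * (1 + s))); last by nra.
  by rewrite ler_wpM2l//; lra.
have h2 : 1 - Lam * s <= expR (- lam * s / (1 + 2 * s)).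
  apply: le_trans (expR_ge1Dx _).
  rewrite lerD2l mulNr mulNr lerN2 ler_pdivrMr//.
  apply: (@le_trans _ _ (Lam * s)); first by rewrite ler_wpM2r.
  by rewrite ler_peMr ?mulr_ge0//; lra.
have h3 : (Num.sqrt (1 + 2 * s))^-1 ^+ m <= 1.
  rewrite exprn_ile1 ?invr_ge0 ?sqrtr_ge0// invf_le1//.
  by rewrite -[leLHS]sqrtr1 ler_wsqrtr//; lra.
have h4 : expR (- lam * s / (1 + 2 * s)) <= 1.
  by rewrite -[leRHS]expR0 ler_expR mulNr mulNr oppr_le0 divr_ge0 ?mulr_ge0// ltW.
have h5 : 0 <= (1 - (Num.sqrt (1 + 2 * s))^-1 ^+ m) * (1 - expR (- lam * s / (1 + 2 * s))).
  by rewrite mulr_ge0// subr_ge0.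
nra.
Qed.

(** One exponential is enough: e^(-s t) is at most the indicator of t <= x plus e^(-s x). First [s]
    is taken so small that the transform is at least 1 - e/2, then [x] so large that e^(-s x) <=
    1/(s x) = e/2. *)
Lemma ncchi2_cdf_tail m (Lam e : R) : (0 < m)%N -> 0 <= Lam -> 0 < e ->
  exists x, 0 <= x /\ forall lam, 0 <= lam <= Lam -> 1 - e <= ncchi2_cdf m lam x.
Proof.
move=> m0 L0 e0.
pose D := m%:R + Lam + 1; have D1 : 1 <= D by rewrite /D; have := ler0n R m; lra.
pose s := Num.min 1 (e / 2 / D).
have s0 : 0 < s by rewrite lt_min ltr01 !divr_gt0//; lra.
have s1 : s <= 1 by rewrite ge_min lexx.
have sD : s * D <= e / 2.
  rewrite -ler_pdivlMr; last by lra.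
  by rewrite ge_min lexx orbT.
pose x := (s * (e / 2))^-1.
have x0 : 0 < x by rewrite invr_gt0 mulr_gt0// divr_gt0.
exists x; split; first exact: ltW.
move=> lam lL; have /andP[l0 _] := lL.
have hs : all (fun p : R * R => 0 <= p.2) [:: (1, s)] by rewrite /= (ltW s0).
have := @ncchi2_cdf_ge_expcomb R m lam x [:: (1, s)] (e / 2) m0 l0 hs.
rewrite big_seq1 /= mul1r => h.
have hL := @chi2_laplace_ge m Lam lam s lL.
have {}h : chi2_laplace m lam s <= ncchi2_cdf m lam x + e / 2.
  apply: h => t t0; rewrite /expcomb big_seq1 /= mul1r.
  case: (leP t x) => tx /=.
    apply: (@le_trans _ _ 1); last by rewrite lerDl divr_ge0// ltW.
    by rewrite -[leRHS]expR0 ler_expR mulNr oppr_le0 mulr_ge0// ltW.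
  rewrite add0r mulNr; apply: (@le_trans _ _ (expR (- (s * x)))).
    by rewrite ler_expR lerN2 ler_pM2l// ltW.
  have sx0 : 0 < s * x by rewrite mulr_gt0.
  apply: (le_trans (expRN_le_inv sx0)).
  suff -> : (s * x)^-1 = e / 2 by [].
  by rewrite /x; field; rewrite !gt_eqF.
have : 1 - (m%:R + Lam) * s <= chi2_laplace m lam s by apply: hL; rewrite (ltW s0).
have : (m%:R + Lam) * s <= s * D by rewrite mulrC ler_pM2l// /D lerDl.
lra.
Qed.

Lemma ncchi2_cdf0 m lam : 0 <= lam -> ncchi2_cdf m lam 0 = 0 :> R.
Proof.
move=> l0; rewrite ncchi2_cdfE -[RHS](@mix_cst R lam 0)//; congr (mix _ _).
by apply/funext => j; rewrite /chi2_cdf set_itv1 integral_set1 mul0r.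
Qed.

(** Each exponential combination is squeezed, up to [e1], between the indicators at two consecutive
    grid points; the limit d.f. rises by at most [e1] per step, and beyond the last point both
    d.f.'s are near 1. [S] and [eta] come before [lam] and the space, which makes the conclusion
    uniform in the rates. *)
Lemma laplace_to_cdf m (Lam e : R) : (0 < m)%N -> 0 <= Lam -> 0 < e ->
  exists (S : seq R) (eta : R), [/\ 0 < eta, all (fun s => 0 <= s) S &
  forall lam, 0 <= lam <= Lam ->
  forall (d : measure_display) (Omega : measurableType d)
    (Pr : probability Omega R) (X : Omega -> R),
  measurable_fun setT X -> (forall w, 0 <= X w) ->
  (forall s, s \in S ->
     `|Ex Pr (fun w => expR (- s * X w)) - chi2_laplace m lam s| <= eta) ->
  forall x, `|fine (Pr [set w | X w <= x]) - ncchi2_cdf m lam x| <= e].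
Proof.
move=> m0 L0 e0; pose e1 := e / 8.
have e10 : 0 < e1 by rewrite divr_gt0.
have [h [h0 hmod]] := ncchi2_cdf_modulus m0 L0 e10.
have [x0 [x00 htail]] := ncchi2_cdf_tail m0 L0 e10.
have [L hL] := exists_nat_gt (x0 / h).
pose g (i : nat) : R := i%:R * h.
have gS i : g i.+1 = g i + h by rewrite /g -natr1 mulrDl mul1r.
have g0 i : 0 <= g i by rewrite mulr_ge0// ltW.
have /choice[l hl] : forall i : nat, exists l : seq (R * R), all (fun p => 0 <= p.2) l /\
    forall t, 0 <= t -> ((t <= g i)%R%:R <= expcomb l t + e1) /\
      (expcomb l t <= (t <= g i.+1)%R%:R + e1).
  by move=> i; apply: step_expcomb => //; rewrite gS ltrDl.
pose W := 1 + \sum_(i < L.+1) \sum_(p <- l i) `|p.1|.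
have Wi i : (i < L.+1)%N -> \sum_(p <- l i) `|p.1| <= W.
  move=> iL; rewrite /W (bigD1 (Ordinal iL))//=.
  rewrite addrCA lerDl addr_ge0// sumr_ge0// => k _; exact: sumr_ge0.
have W1 : 1 <= W by rewrite /W lerDl sumr_ge0// => k _; exact: sumr_ge0.
(* [W] bounds the total absolute weight of each combination, so transforms known within [e1 / W]
   determine its mean within [e1]. *)
exists (flatten [seq [seq p.2 | p <- l i] | i <- iota 0 L.+1]), (e1 / W).
split; first by rewrite divr_gt0//; lra.
  apply/allP => s /flattenP[_ /mapP[i _ ->] /mapP[p pl ->]].
  by have [/allP/(_ _ pl)] := hl i.
move=> lam lL d Omega Pr X mX X0 hS x.
have /andP[l0 _] := lL.
pose F := ncchi2_cdf m lam.
pose P y := fine (Pr [set w | X w <= y]).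
have mXy y : measurable_fun setT (fun w => X w <= y) by exact: measurable_fun_ler.
have PE y : P y = Ex Pr (fun w => (X w <= y)%R%:R) by rewrite Ex_ind.
have Pmono y z : y <= z -> P y <= P z.
  move=> yz; rewrite !PE; apply: Ex_le; [exact: Intg_ind|exact: Intg_ind|].
  by move=> w; case: (leP (X w) y) => [Xy|_]; [rewrite (le_trans Xy yz)|case: (X w <= z)].
have P01 y : 0 <= P y <= 1.
  rewrite PE; apply/andP; split; first by apply: Ex_ge0 => w; case: (X w <= y).
  rewrite -[leRHS](Ex_cst Pr 1); apply: Ex_le; [exact: Intg_ind|exact: Intg_cst|].
  by move=> w; case: (X w <= y).
have Fmono y z : y <= z -> F y <= F z by move=> yz; exact: ncchi2_cdf_mono.
have F01 y : 0 <= F y <= 1 by exact: ncchi2_cdf_bound.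
have Fstep i : F (g i.+1) <= F (g i) + e1 by rewrite gS; exact: hmod.
have mexp s : measurable_fun setT (fun w => expR (- s * X w)).
  by apply: measurableT_comp => //; exact: measurable_funM.
have Iexp s : 0 <= s -> Intg Pr (fun w => expR (- s * X w)).
  move=> s0; apply: (@Intg_bounded _ _ _ _ _ 1) => // w.
  by rewrite ger0_norm ?expR_ge0// -[leRHS]expR0 ler_expR mulNr oppr_le0 mulr_ge0.
have Imul i : Intg Pr (fun w => expcomb (l i) (X w)).
  apply: (@Intg_bounded _ _ _ _ _ (\sum_(p <- l i) `|p.1|)).
    by apply: measurableT_comp => //; exact: measurable_expcomb.
  by move=> w; apply: expcomb_bound => //; have [] := hl i.
have EQ i : (i < L.+1)%N ->
    `|Ex Pr (fun w => expcomb (l i) (X w)) - \sum_(p <- l i) p.1 * chi2_laplace m lam p.2| <= e1.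
  move=> iL.
  have -> : Ex Pr (fun w => expcomb (l i) (X w)) =
      \sum_(p <- l i) p.1 * Ex Pr (fun w => expR (- p.2 * X w)).
    have [hli _] := hl i; elim: (l i) hli => [_|p q IH /= /andP[p0 hq]].
      rewrite big_nil -[RHS](Ex_cst Pr 0); congr (Ex Pr _).
      by apply/funext => w; rewrite /expcomb big_nil.
    rewrite big_cons -IH// -ExZ; last exact: Iexp.
    rewrite -ExD.
    - by congr (Ex Pr _); apply/funext => w; rewrite /expcomb big_cons.
    - by apply: IntgZ; exact: Iexp.
    - apply: (@Intg_bounded _ _ _ _ _ (\sum_(p <- q) `|p.1|)).
        by apply: measurableT_comp => //; exact: measurable_expcomb.
      by move=> w; exact: expcomb_bound.
  rewrite -sumrB; apply: (le_trans (ler_norm_sum _ _ _)).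
  apply: (@le_trans _ _ (\sum_(p <- l i) `|p.1| * (e1 / W))).
    rewrite !big_seq; apply: ler_sum => p pl; rewrite -mulrBr normrM ler_wpM2l// hS//.
    apply/flattenP; exists [seq p.2 | p <- l i]; last exact: map_f.
    by apply/mapP; exists i => //; rewrite mem_iota.
  rewrite -mulr_suml mulrA ler_pdivrMr; last by lra.
  by rewrite mulrC ler_wpM2l ?Wi// ltW.
have up i : (i < L.+1)%N -> P (g i) <= F (g i) + 4 * e1.
  move=> iL; have [hli hq] := hl i.
  have h1 : P (g i) <= Ex Pr (fun w => expcomb (l i) (X w)) + e1.
    rewrite -[X in _ + X](Ex_cst Pr) -ExD//; last exact: Intg_cst.
    rewrite PE; apply: Ex_le; [exact: Intg_ind|by apply: IntgD => //; exact: Intg_cst|].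
    by move=> w; have [] := hq (X w) (X0 w).
  have h2 : \sum_(p <- l i) p.1 * chi2_laplace m lam p.2 <= F (g i.+1) + e1.
    by apply: ncchi2_cdf_ge_expcomb => // t t0; have [] := hq t t0.
  have := EQ i iL; rewrite ler_norml => /andP[_ h3].
  move: h1 h2 h3 (Fstep i); move: (F (g i.+1)) (F (g i)) (P (g i)) (Ex Pr _) => ? ? ? ?.
  by move: (bigop _ _ _) => ?; clear; lra.
have lo i : (i < L.+1)%N -> F (g i.+1) - 4 * e1 <= P (g i.+1).
  move=> iL; have [hli hq] := hl i.
  have h1 : Ex Pr (fun w => expcomb (l i) (X w)) <= P (g i.+1) + e1.
    rewrite -[X in _ + X](Ex_cst Pr) PE -ExD//; [|exact: Intg_ind|exact: Intg_cst].
    apply: Ex_le => //; first by apply: IntgD; [exact: Intg_ind|exact: Intg_cst].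
    by move=> w; have [] := hq (X w) (X0 w).
  have h2 : F (g i) <= \sum_(p <- l i) p.1 * chi2_laplace m lam p.2 + e1.
    by apply: ncchi2_cdf_le_expcomb => // t t0; have [] := hq t t0.
  have := EQ i iL; rewrite ler_norml => /andP[h3 _].
  move: h1 h2 h3 (Fstep i); move: (F (g i.+1)) (F (g i)) (P (g i.+1)) (Ex Pr _) => ? ? ? ?.
  by move: (bigop _ _ _) => ?; clear; lra.
have lo' i : (i < L.+1)%N -> F (g i) - 4 * e1 <= P (g i).
  case: i => [_|i iL]; last by apply: lo; exact: ltnW.
  rewrite /F /g mul0r ncchi2_cdf0//; have /andP[h1 _] := P01 0; lra.
have ee : e = 8 * e1 by rewrite /e1; field.
rewrite -/(P x) -/(F x).
have [xn|xp] := ltP x 0.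
  rewrite /F ncchi2_cdf_neg// subr0.
  suff -> : P x = 0 by rewrite normr0 ltW.
  rewrite PE -[RHS](Ex_cst Pr 0); congr (Ex Pr _); apply/funext => w.
  by rewrite leNgt (lt_le_trans xn (X0 w)).
have [i [gi gi1]] : exists i : nat, g i <= x /\ x <= g i.+1.
  exists (Num.trunc (x / h)); split.
    by rewrite /g -ler_pdivlMr// truncn_le// divr_ge0// ltW.
  by rewrite /g -ler_pdivrMr// ltW// truncnS_gt.
have [iL|iL] := ltnP i L.
  have a1 : P x <= F (g i.+1) + 4 * e1 by apply: le_trans (Pmono _ _ gi1) _; exact: up.
  have a2 : F (g i) - 4 * e1 <= P x by apply: le_trans (Pmono _ _ gi); apply: lo'; exact: ltnW.
  rewrite ler_norml ee; apply/andP.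
  move: a1 a2 e10 (Fmono _ _ gi) (Fmono _ _ gi1) (Fstep i).
  move: (F (g i.+1)) (F (g i)) (F x) (P x) (e1) => ? ? ? ? ?; clear.
  by move=> *; split; lra.
have gL : g L <= x.
  by apply: le_trans gi; rewrite /g ler_pM2r// ler_nat.
have x0L : x0 <= g L by rewrite /g -ler_pdivrMr// ltW.
have a1 := htail lam lL.
have a2 := Fmono _ _ x0L; have a3 := Fmono _ _ gL; have a4 := Pmono _ _ gL.
have a5 := lo' L (ltnSn L); have /andP[_ a6] := P01 x; have /andP[_ a7] := F01 x.
rewrite ler_norml ee; apply/andP; move: a1 a2 a3 a4 a5 a6 a7 e10; rewrite -/F.
move: (F (g L)) (F x0) (F x) (P x) (P (g L)) (e1) => ? ? ? ? ? ?; clear.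
by move=> *; split; lra.
Qed.

End LaplaceToCdf.

(** * Lindeberg's argument with the heat flow of a Gaussian *)

Lemma dist_tri3 (R : realType) (a b c e A1 A2 A3 : R) :
  `|a - b| <= A1 -> `|b - c| <= A2 -> `|c - e| <= A3 -> `|a - e| <= A1 + A2 + A3.
Proof.
move=> h1 h2 h3; rewrite (_ : a - e = (a - b) + (b - c) + (c - e)); last by ring.
by apply: (le_trans (ler_normD _ _)); rewrite lerD// (le_trans (ler_normD _ _))// lerD.
Qed.

Section Taylor.
Context (R : realType).
Implicit Types (w x y : R).

(** Dominates e^c for every [c] between 0 and [w], whatever the sign of [w]. *)
Definition mexp w : R := Num.max 1 (expR w).

Lemma mexp_ge1 w : 1 <= mexp w. Proof. by rewrite le_max lexx. Qed.

Lemma mexp_le w : mexp w <= 1 + expR w.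
Proof. by rewrite ge_max lerDl expR_ge0 lerDr ler01. Qed.

Lemma mexp_between c w : (0 <= c <= w) || (w <= c <= 0) -> mexp c <= mexp w.
Proof.
move=> /orP[/andP[c0 cw]|/andP[wc c0]].
  by rewrite /mexp ge_max le_max lexx/= le_max ler_expR cw orbT.
have -> : mexp c = 1.
  by rewrite /mexp; apply/max_idPl; rewrite -[leRHS]expR0 ler_expR.
exact: mexp_ge1.
Qed.

(** The mean value theorem between 0 and [w] turns a bound on the derivative into one of the next
    order. Applied three times, starting from the exponential, it gives the Taylor bounds below. *)
Lemma taylor_step (f f' : R -> R) k : f 0 = 0 ->
  (forall x, is_derive x 1 f (f' x)) ->
  (forall x, `|f' x| <= `|x| ^+ k * mexp x) ->
  forall w, `|f w| <= `|w| ^+ k.+1 * mexp w.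
Proof.
move=> f0 df bf w.
have cf (A : set R) : {within A, continuous f}.
  by apply: continuous_subspaceT => x; apply: differentiable_continuous;
    apply/derivable1_diffP; have [] := df x.
suff [c cw fE] : exists2 c, (0 <= c <= w) || (w <= c <= 0) & f w = f' c * w.
  rewrite fE normrM exprSr mulrAC ler_wpM2r//.
  apply: (le_trans (bf c)); apply: ler_pM; rewrite ?exprn_ge0//.
  - by rewrite (le_trans ler01 (mexp_ge1 c)).
  - rewrite lerXn2r ?nnegrE//.
    case/orP : cw => /andP[h1 h2].
      by rewrite !ger0_norm// (le_trans h1).
    by rewrite !ler0_norm ?lerN2// (le_trans h1).
  - exact: mexp_between.
have [w0|w0|<-] := ltgtP 0 w; last first.
- by exists 0; rewrite ?lexx// f0 mulr0.
- have [c] := @MVT R f f' w 0 w0 (fun x _ => df x) (cf _).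
  rewrite in_itv/= => /andP[h1 h2] h; exists c.
    by rewrite (ltW h1) (ltW h2) orbT.
  by move: h; rewrite f0 !sub0r mulrN => /eqP; rewrite eqr_opp => /eqP.
- have [c] := @MVT R f f' 0 w w0 (fun x _ => df x) (cf _).
  rewrite in_itv/= => /andP[h1 h2] h; exists c; first by rewrite (ltW h1) (ltW h2).
  by move: h; rewrite f0 !subr0.
Qed.

Lemma exp_taylor1 w : `|expR w - 1| <= `|w| * mexp w.
Proof.
have := @taylor_step (fun x => expR x - 1) (fun x => expR x) 0 _ _ _ w.
rewrite expr1; apply.
- by rewrite expR0 subrr.
- by move=> x; apply: is_derive_eq; rewrite subr0.
- move=> x; rewrite expr0 mul1r ger0_norm ?expR_ge0// /mexp le_max lexx orbT//.
Qed.

Lemma exp_taylor2 w : `|expR w - 1 - w| <= `|w| ^+ 2 * mexp w.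
Proof.
apply: (@taylor_step (fun x => expR x - 1 - x) (fun x => expR x - 1) 1).
- by rewrite expR0; ring.
- by move=> x; apply: is_derive_eq; rewrite subr0.
- by move=> x; rewrite expr1; exact: exp_taylor1.
Qed.

Lemma exp_taylor3 w : `|expR w - 1 - w - w ^+ 2 / 2| <= `|w| ^+ 3 * mexp w.
Proof.
apply: (@taylor_step (fun x => expR x - 1 - x - x ^+ 2 / 2) (fun x => expR x - 1 - x) 2).
- by rewrite expR0; ring.
- move=> x; apply: is_derive_eq; rewrite subr0; congr (_ - _).
  by rewrite !scaler0 add0r /GRing.scale/= mulr1; field.
- by move=> x; exact: exp_taylor2.
Qed.

Lemma ln1D_bound y : 0 <= y -> y - y ^+ 2 <= ln (1 + y) <= y.
Proof.
move=> y0; have h0 : 0 < 1 + y by lra.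
apply/andP; split; last first.
  by rewrite -[leRHS]expRK ler_ln ?posrE ?expR_gt0// expR_ge1Dx.
have -> : ln (1 + y) = - ln ((1 + y)^-1) by rewrite lnV ?posrE// opprK.
rewrite lerNr; apply: (@le_trans _ _ ((1 + y)^-1 - 1)).
  rewrite -[leRHS]expRK ler_ln ?posrE ?invr_gt0 ?expR_gt0//.
  by apply: le_trans (expR_ge1Dx _); rewrite addrCA subrr addr0.
rewrite lerBlDr -(ler_pM2r h0) mulVf ?gt_eqF//.
have : 0 <= y ^+ 3 by rewrite exprn_ge0.
by nra.
Qed.

Definition kap (s v : R) : R := s / (1 + 2 * s * v).

Lemma kap_bound (s v : R) : 0 < s -> 0 <= v <= 1 -> [/\ 0 < kap s v, kap s v <= s &
  s / (1 + 2 * s) <= kap s v].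
Proof.
move=> s0 /andP[v0 v1].
have a1 : 1 <= 1 + 2 * s * v by rewrite lerDl !mulr_ge0// ltW.
have a0 : 0 < 1 + 2 * s * v by lra.
split; first by rewrite divr_gt0.
  by rewrite ler_pdivrMr// ler_peMr// ltW.
rewrite /kap ler_pM2l// lef_pV2 ?posrE//; last by lra.
by rewrite lerD2l ler_piMr// mulr_ge0// ltW.
Qed.

End Taylor.

(** * The heat flow of a Gaussian function and its expansions in time and space *)

Section GaussStep.
Context (R : realType) (m : nat).
Implicit Types (x : 'I_m -> R) (s v : R).

Definition sqn x : R := \sum_j x j ^+ 2.
Definition l1n x : R := \sum_j `|x j|.

Lemma sqn_ge0 x : 0 <= sqn x.
Proof. by apply: sumr_ge0 => j _; exact: sqr_ge0. Qed.

Lemma l1n_ge0 x : 0 <= l1n x.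
Proof. exact: sumr_ge0. Qed.

Lemma le_l1n x j : `|x j| <= l1n x.
Proof. by rewrite /l1n (bigD1 j)//= lerDl sumr_ge0. Qed.

Lemma sqn_le_l1n x : sqn x <= l1n x ^+ 2.
Proof.
rewrite /sqn expr2 {1}/l1n mulr_suml; apply: ler_sum => j _.
by rewrite -(real_normK (num_real (x j))) expr2 ler_wpM2l// le_l1n.
Qed.

Lemma l1n_sqr_le x : l1n x ^+ 2 <= m%:R * sqn x.
Proof.
rewrite /l1n expr2 mulr_suml.
under eq_bigr => i _ do rewrite mulr_sumr.
apply: (@le_trans _ _ (\sum_(i < m) \sum_(j < m) (x i ^+ 2 + x j ^+ 2) / 2)).
  apply: ler_sum => i _; apply: ler_sum => j _.
  rewrite -(real_normK (num_real (x i))) -(real_normK (num_real (x j))).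
  by have := sqr_ge0 (`|x i| - `|x j|); nra.
under eq_bigr => i _ do rewrite -mulr_suml big_split/= sumr_const card_ord -/(sqn x).
rewrite -mulr_suml big_split/= sumr_const card_ord -sumrMnl -/(sqn x).
rewrite -mulr_natl; under eq_bigr do rewrite -mulr_natl.
rewrite -mulr_sumr -/(sqn x) ler_pdivrMr//.
by rewrite -mulr_natl; lra.
Qed.

(** With c' = c/(m + 1), the inequality |x|_1^2 <= m |x|^2 reduces the claim to one variable, where
    e^y >= 1 + y^2/2 beats degree four; m + 1 rather than m covers dimension 0. Degree four is what
    the second-order error in time requires. *)
Lemma gauss_poly_bound (c : R) : 0 < c -> exists C : R, 0 <= C /\
  forall x, (1 + l1n x) ^+ 4 * expR (- (c * sqn x)) <= C.
Proof.
move=> c0; pose c' := c / m.+1%:R; have c'0 : 0 < c' by rewrite divr_gt0.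
exists (8 * (1 + 2 / c' ^+ 2)); split.
  by rewrite mulr_ge0// addr_ge0// divr_ge0// sqr_ge0.
move=> x; set l := l1n x; have l0 : 0 <= l by exact: l1n_ge0.
have e0 : 0 < expR (c * sqn x) by exact: expR_gt0.
rewrite expRN ler_pdivrMr//.
have h1 : c' * l ^+ 2 <= c * sqn x.
  rewrite /c' mulrAC ler_pdivrMr// -mulrA ler_pM2l// mulrC.
  apply: (le_trans (l1n_sqr_le x)); rewrite ler_wpM2r ?sqn_ge0// ler_nat//.
have h2 : 1 + (c' * l ^+ 2) ^+ 2 / 2 <= expR (c * sqn x).
  apply: le_trans (_ : expR (c' * l ^+ 2) <= _); last by rewrite ler_expR.
  have := @expR_ge1Dxn R (c' * l ^+ 2) 1; rewrite -[2`!]/2%N; apply.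
  by rewrite mulr_ge0 ?sqr_ge0// ltW.
have h3 : (1 + l) ^+ 4 <= 8 * (1 + l ^+ 4).
  have a1 : (1 + l) ^+ 2 <= 2 * (1 + l ^+ 2) by have := sqr_ge0 (1 - l); nra.
  have a2 : ((1 + l) ^+ 2) ^+ 2 <= (2 * (1 + l ^+ 2)) ^+ 2.
    by rewrite lerXn2r ?nnegrE ?mulr_ge0 ?addr_ge0 ?sqr_ge0.
  rewrite -exprM in a2; apply: (le_trans a2).
  by have := sqr_ge0 (1 - l ^+ 2); rewrite (_ : l ^+ 4 = (l ^+ 2) ^+ 2) -?exprM//; nra.
apply: (le_trans h3); rewrite -mulrA ler_pM2l// mulrDl mul1r lerD//.
  by apply: le_trans h2; rewrite lerDl divr_ge0// sqr_ge0.
have -> : l ^+ 4 = 2 / c' ^+ 2 * ((c' * l ^+ 2) ^+ 2 / 2).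
  by field; rewrite gt_eqF.
rewrite ler_wpM2l ?divr_ge0 ?sqr_ge0//.
by apply: le_trans h2; rewrite lerDr.
Qed.

(** Closed form of the mean of exp(-s |x + sqrt(v) Z|^2) for a standard Gaussian vector Z of
    dimension [m]. The factor (1 + 2sv)^(-m/2) is written through [ln], so that everything sits in
    one exponential. *)
Definition heat s v x : R :=
  expR (- (m%:R / 2 * ln (1 + 2 * s * v)) - s / (1 + 2 * s * v) * sqn x).

Lemma heat0 s x : heat s 0 x = expR (- s * sqn x).
Proof. by rewrite /heat mulr0 addr0 ln1 mulr0 oppr0 add0r divr1 mulNr. Qed.

(** At time 1 the flow is the transform of |x + Z|^2, whose law is noncentral chi-square with
    noncentrality |x|^2. Only the two closed forms are compared. *)
Lemma heat1 s x : 0 <= s -> heat s 1 x = chi2_laplace m (sqn x) s.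
Proof.
move=> s0; have a0 : 0 < 1 + 2 * s by lra.
rewrite /heat /chi2_laplace mulr1 expRD; congr (_ * _); last first.
  by congr expR; field; rewrite gt_eqF.
rewrite -powR12_sqrt ?(ltW a0)// exprVn -powR_mulrn ?powR_ge0// -powRrM expRN.
by rewrite /powR (gt_eqF a0); congr ((expR _)^-1); field.
Qed.

Lemma heat_ge0 s v x : 0 <= heat s v x. Proof. exact: expR_ge0. Qed.

Lemma heat_le1 s v x : 0 <= s -> 0 <= v -> heat s v x <= 1.
Proof.
move=> s0 v0; have a0 : 1 <= 1 + 2 * s * v by rewrite lerDl !mulr_ge0.
rewrite /heat -[leRHS]expR0 ler_expR -opprD oppr_le0 addr_ge0//.
  by rewrite mulr_ge0 ?divr_ge0// ln_ge0.
by rewrite mulr_ge0 ?sqn_ge0// divr_ge0// (le_trans ler01 a0).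
Qed.

Lemma heat_le_gauss s v x : 0 < s -> 0 <= v <= 1 ->
  heat s v x <= expR (- (s / (1 + 2 * s) * sqn x)).
Proof.
move=> s0 v01; have [k0 ks kc] := kap_bound s0 v01; case/andP: v01 => v0 v1.
have a1 : 1 <= 1 + 2 * s * v by rewrite lerDl !mulr_ge0// ltW.
rewrite /heat ler_expR.
have h1 : 0 <= m%:R / 2 * ln (1 + 2 * s * v) by rewrite mulr_ge0 ?divr_ge0// ln_ge0.
have h2 : s / (1 + 2 * s) * sqn x <= s / (1 + 2 * s * v) * sqn x.
  by rewrite ler_wpM2r ?sqn_ge0.
by move: (s / _ * _) (s / _ * _) (m%:R / 2 * _) h1 h2 => *; lra.
Qed.

(** With y = 2kh one has 1 + 2sv = (1 + 2s(v - h))(1 + y), so the ratio of the two heat values is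
    e^th, where th is -mkh + 2k^2 h|x|^2 up to order h^2. The bracket is the first-order expansion
    in time, to be matched by the second-order one in space. *)
Lemma heat_time_step s (C : R) v (h : R) x : 0 < s ->
  (forall x, (1 + l1n x) ^+ 4 * expR (- (s / (1 + 2 * s) * sqn x)) <= C) ->
  0 < h -> h <= v <= 1 ->
  `|heat s v x - heat s (v - h) x *
      (1 - m%:R * kap s (v - h) * h + 2 * kap s (v - h) ^+ 2 * h * sqn x)|
     <= 8 * (s * (1 + s) * (m%:R + 1)) ^+ 2 * C * h ^+ 2.
Proof.
move=> s0 hC h0 /andP[hv v1].
have v01 : 0 <= v - h <= 1 by rewrite subr_ge0 hv/=; lra.
have v01' : 0 <= v <= 1 by rewrite v1 andbT; lra.
have [k0 ks kc] := kap_bound s0 v01.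
have aE : kap s (v - h) = s / (1 + 2 * s * (v - h)) by [].
move: (kap s (v - h)) aE k0 ks kc => k aE k0 ks kc.
have [a a1 aE'] : exists2 a : R, 1 <= a & a = 1 + 2 * s * (v - h).
  by exists (1 + 2 * s * (v - h)) => //; rewrite lerDl !mulr_ge0 ?subr_ge0// ltW.
have a0 : 0 < a by lra.
rewrite -aE' in aE.
have [y [y0 yE ys]] : exists y : R, [/\ 0 < y, y = 2 * k * h & y <= 2 * s * h].
  exists (2 * k * h); split => //; first by rewrite !mulr_gt0.
  by rewrite ler_pM2r// ler_pM2l.
have b0 : 0 < 1 + y by lra.
have bE : 1 + 2 * s * v = a * (1 + y).
  have sE : s = k * a by rewrite aE divfK ?gt_eqF.
  rewrite mulrDr mulr1 yE (_ : a * (2 * k * h) = 2 * (k * a) * h); last by ring.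
  by rewrite -sE aE'; ring.
have Q0 := sqn_ge0 x; have QL := sqn_le_l1n x; have l0 := l1n_ge0 x.
pose th := - (m%:R / 2 * ln (1 + y)) + k * y * sqn x / (1 + y).
have hE : heat s v x = heat s (v - h) x * expR th.
  rewrite /heat -expRD; congr expR.
  rewrite bE lnM ?posrE// -aE' /th aE; field.
  by rewrite !gt_eqF.
have /andP[ln1 ln2] := ln1D_bound (ltW y0).
have m0 : 0 <= m%:R :> R by [].
have kyQ : 0 <= k * y * sqn x by rewrite !mulr_ge0// ltW.
have fr1 : k * y * sqn x / (1 + y) <= k * y * sqn x.
  by rewrite ler_pdivrMr// ler_peMr//; lra.
have fr0 : 0 <= k * y * sqn x / (1 + y) by rewrite divr_ge0// ltW.
have fr2 : k * y * sqn x - k * y * sqn x * y <= k * y * sqn x / (1 + y).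
  rewrite ler_pdivlMr//.
  have : 0 <= k * y * sqn x * y ^+ 2 by rewrite mulr_ge0// sqr_ge0.
  by move: (k * y * sqn x) => z hz; nra.
have ksQ : k * y * sqn x <= s * y * sqn x by rewrite ler_wpM2r// ler_pM2r.
have lnp : 0 <= ln (1 + y) by rewrite ln_ge0// lerDl ltW.
have thb : `|th| <= y * (m%:R + s * sqn x).
  rewrite /th ler_norml; apply/andP; split.
    have : m%:R / 2 * ln (1 + y) <= m%:R * y.
      by rewrite -mulrA ler_wpM2l//; lra.
    have : 0 <= s * y * sqn x by apply: le_trans ksQ.
    by move: (m%:R / 2 * _) (_ / (1 + y)) fr0 => *; nra.
  have : 0 <= m%:R / 2 * ln (1 + y) by rewrite mulr_ge0 ?divr_ge0.
  have : 0 <= m%:R * y by rewrite mulr_ge0// ltW.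
  by move: (m%:R / 2 * _) (_ / (1 + y)) fr1 ksQ => *; nra.
have thd : `|th - (- (m%:R * k * h) + 2 * k ^+ 2 * h * sqn x)| <= y ^+ 2 * (m%:R + s * sqn x).
  have -> : - (m%:R * k * h) + 2 * k ^+ 2 * h * sqn x = - (m%:R / 2 * y) + k * y * sqn x.
    by rewrite yE; field.
  have e1 : m%:R / 2 * y - m%:R / 2 * y ^+ 2 <= m%:R / 2 * ln (1 + y).
    by rewrite -mulrBr ler_wpM2l// divr_ge0.
  have e2 : m%:R / 2 * ln (1 + y) <= m%:R / 2 * y by rewrite ler_wpM2l// divr_ge0.
  have e3 : k * y * sqn x * y <= s * y * sqn x * y by rewrite ler_pM2r.
  have e4 : 0 <= s * y * sqn x * y by apply: le_trans e3; rewrite mulr_ge0// ltW.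
  have e5 : 0 <= m%:R * y ^+ 2 by rewrite mulr_ge0// sqr_ge0.
  rewrite /th ler_norml; move: e1 e2 fr1 fr2 e3 e4 e5.
  move: (k * y * sqn x) (_ * ln _) (_ / (1 + y)) => A B D *; apply/andP; split; lra.
have thx : `|expR th - (1 - m%:R * k * h + 2 * k ^+ 2 * h * sqn x)| <=
    y ^+ 2 * (m%:R + 1 + s * sqn x) ^+ 2 * (1 + expR th).
  have t2 := exp_taylor2 th.
  have -> : expR th - (1 - m%:R * k * h + 2 * k ^+ 2 * h * sqn x) =
    (expR th - 1 - th) + (th - (- (m%:R * k * h) + 2 * k ^+ 2 * h * sqn x)) by ring.
  apply: (le_trans (ler_normD _ _)).
  have tsq : `|th| ^+ 2 <= (y * (m%:R + s * sqn x)) ^+ 2.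
    by rewrite lerXn2r ?nnegrE// mulr_ge0 ?addr_ge0 ?mulr_ge0// ltW.
  have M1 := mexp_le th.
  have {}t2 : `|expR th - 1 - th| <= (y * (m%:R + s * sqn x)) ^+ 2 * (1 + expR th).
    apply: (le_trans t2); apply: ler_pM; rewrite ?exprn_ge0//.
    exact: le_trans ler01 (mexp_ge1 _).
  have E0 := expR_ge0 th.
  have A0 : 0 <= m%:R + s * sqn x by rewrite addr_ge0 ?mulr_ge0// ltW.
  have y20 : 0 <= y ^+ 2 by exact: sqr_ge0.
  apply: (le_trans (lerD t2 thd)); rewrite exprMn.
  rewrite (_ : m%:R + 1 + s * sqn x = (m%:R + s * sqn x) + 1); last by ring.
  move: (m%:R + s * sqn x) A0 (expR th) E0 (y ^+ 2) y20 => A A0 E E0 Y Y0.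
  have -> : Y * (A + 1) ^+ 2 * (1 + E) = Y * A ^+ 2 * (1 + E) + Y * A +
    (Y * A * E + Y * A * (1 + E) + Y * (1 + E)) by ring.
  by rewrite lerDl !addr_ge0 ?mulr_ge0 ?addr_ge0.
rewrite hE -mulrBr normrM (ger0_norm (heat_ge0 _ _ _)).
apply: (le_trans (ler_wpM2l (heat_ge0 _ _ _) thx)).
(* The factor 1 + e^th in the remainder is harmless: heat at [v - h] times e^th is heat at [v], and
   both have the same Gaussian majorant. *)
have hh : heat s (v - h) x * (1 + expR th) <= 2 * expR (- (s / (1 + 2 * s) * sqn x)).
  rewrite mulrDr mulr1 -hE mulr_natl mulr2n; apply: lerD; exact: heat_le_gauss.
rewrite mulrCA; apply: (le_trans (ler_wpM2l _ hh)).
  by rewrite mulr_ge0// sqr_ge0.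
have P1 : (m%:R + 1 + s * sqn x) ^+ 2 <= ((m%:R + 1) * (1 + s)) ^+ 2 * (1 + l1n x) ^+ 4.
  rewrite (_ : (1 + l1n x) ^+ 4 = ((1 + l1n x) ^+ 2) ^+ 2); last by rewrite -exprM.
  rewrite -exprMn.
  have L2 : 1 + sqn x <= (1 + l1n x) ^+ 2 by nra.
  rewrite lerXn2r ?nnegrE ?addr_ge0 ?mulr_ge0 ?addr_ge0 ?sqr_ge0 ?(ltW s0)//.
  apply: (@le_trans _ _ ((m%:R + 1) * (1 + s) * (1 + sqn x))); last first.
    by rewrite ler_wpM2l// mulr_ge0 ?addr_ge0// ltW.
  have := mulr_ge0 m0 Q0; have := mulr_ge0 m0 (ltW s0); have := mulr_ge0 (ltW s0) Q0.
  have := mulr_ge0 m0 (mulr_ge0 (ltW s0) Q0).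
  by move: (sqn x) Q0 (m%:R : R) m0 => *; nra.
have Y2 : y ^+ 2 <= 4 * s ^+ 2 * h ^+ 2.
  rewrite (_ : 4 * s ^+ 2 * h ^+ 2 = (2 * s * h) ^+ 2); last by ring.
  by rewrite lerXn2r ?nnegrE// ?mulr_ge0 ?ltW.
have Eg := expR_ge0 (- (s / (1 + 2 * s) * sqn x)).
have hCx := hC x.
apply: (@le_trans _ _ (4 * s ^+ 2 * h ^+ 2 * (((m%:R + 1) * (1 + s)) ^+ 2 * (1 + l1n x) ^+ 4) *
   (2 * expR (- (s / (1 + 2 * s) * sqn x))))).
  apply: ler_wpM2r; first by rewrite mulr_ge0.
  by apply: ler_pM => //; exact: sqr_ge0.
rewrite [leLHS](_ : _ = 8 * (s * (1 + s) * (m%:R + 1)) ^+ 2 * h ^+ 2 *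
  ((1 + l1n x) ^+ 4 * expR (- (s / (1 + 2 * s) * sqn x)))); last by ring.
rewrite [leRHS]mulrAC; apply: ler_wpM2l => //.
by rewrite mulr_ge0 ?sqr_ge0// mulr_ge0// sqr_ge0.
Qed.

Lemma heat_shift s v x (d : R) (X : 'I_m -> R) :
  heat s v (fun j => x j + d * X j) = heat s v x *
    expR (- kap s v * (2 * d * (\sum_j x j * X j) + d ^+ 2 * sqn X)).
Proof.
rewrite /heat -expRD; congr expR; rewrite -/(kap s v).
have -> : sqn (fun j => x j + d * X j) =
    sqn x + (2 * d * (\sum_j x j * X j) + d ^+ 2 * sqn X).
  rewrite /sqn !mulr_sumr -!big_split/=; apply: eq_bigr => j _; ring.
ring.
Qed.

(* The second order Taylor polynomial of the shift, without the terms that are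
   already of order d ^ 3. *)
Lemma heat_shift_taylor s (C B : R) v x (d : R) (X : 'I_m -> R) : 0 < s -> 1 <= B ->
  (forall x, (1 + l1n x) ^+ 4 * expR (- (s / (1 + 2 * s) * sqn x)) <= C) ->
  0 <= v <= 1 -> 0 < d <= 1 -> (forall j, `|X j| <= B) ->
  let k := kap s v in let y := \sum_j x j * X j in
  `|heat s v (fun j => x j + d * X j) -
    heat s v x * (1 - 2 * k * d * y - k * d ^+ 2 * sqn X + 2 * k ^+ 2 * d ^+ 2 * y ^+ 2)|
  <= ((2 * s * B ^+ 2 * (m%:R + 1)) ^+ 2 +
      (2 * s * B ^+ 2 * (m%:R + 1)) ^+ 3 * (1 + (1 + m%:R * B) ^+ 3)) * C * d ^+ 3.
Proof.
move=> s0 B1 hC v01 /andP[d0 d1] XB /=.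
have [k0 ks kc] := kap_bound s0 v01.
have HE := heat_shift s v x d X.
have H0 := heat_ge0 s v x; have H0' := heat_ge0 s v (fun j => x j + d * X j).
have Hg := heat_le_gauss x s0 v01.
have Hg' := heat_le_gauss (fun j => x j + d * X j) s0 v01.
have [y yE] : exists y, y = \sum_j x j * X j by eexists.
rewrite -yE in HE *.
have l0 := l1n_ge0 x; have m0 : 0 <= m%:R :> R by [].
have B0 : 0 <= B by lra.
have yb : `|y| <= l1n x * B.
  rewrite yE; apply: (le_trans (ler_norm_sum _ _ _)); rewrite /l1n mulr_suml.
  by apply: ler_sum => j _; rewrite normrM ler_wpM2l.
have q0 := sqn_ge0 X.
have qb : sqn X <= m%:R * B ^+ 2.
  rewrite /sqn -[m in leRHS]card_ord -sum1_card natr_sum mulr_suml.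
  apply: ler_sum => j _; rewrite mul1r -(real_normK (num_real (X j))).
  by rewrite lerXn2r ?nnegrE.
(* The remainder contains [expR W], which turns heat at [x] into heat at the shifted point. That
   value decays in the norm of the shifted point, so the two norms have to be compared. *)
have ll' : l1n x <= l1n (fun j => x j + d * X j) + m%:R * B.
  have -> : m%:R * B = \sum_(j < m) B by rewrite sumr_const card_ord mulr_natl.
  rewrite /l1n -big_split/=; apply: ler_sum => j _; rewrite -lerBlDr.
  apply: (le_trans (y := `|x j| - `|d * X j|)).
    rewrite lerD2l lerN2 normrM (ger0_norm (ltW d0)).
    by apply: (le_trans _ (XB j)); rewrite ler_piMl.
  have := ler_normB (x j + d * X j) (d * X j); rewrite addrK; lra.
have l'0 := l1n_ge0 (fun j => x j + d * X j).
have Gx := hC x; have Gx' := hC (fun j => x j + d * X j).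
have {Gx}Hx : heat s v x * (1 + l1n x) ^+ 4 <= C.
  by apply: le_trans Gx; rewrite mulrC ler_wpM2l// exprn_ge0// addr_ge0.
have {Gx'}Hx' : heat s v (fun j => x j + d * X j) *
    (1 + l1n (fun j => x j + d * X j)) ^+ 4 <= C.
  by apply: le_trans Gx'; rewrite mulrC ler_wpM2l// exprn_ge0// addr_ge0.
move: (sqn X) q0 qb HE => q q0 qb; move: (kap s v) k0 ks kc => k k0 ks kc HE {yE Hg Hg'}.
move: (l1n _) (heat s v (fun j => _)) l'0 ll' H0' Hx' HE => l' H' l'0 ll' H0' Hx' HE.
move: (l1n x) (heat s v x) l0 yb ll' H0 Hx HE => l H l0 yb ll' H0 Hx HE.
pose K := 2 * s * B ^+ 2 * (m%:R + 1).
pose W := - k * (2 * d * y + d ^+ 2 * q).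
have K0 : 0 <= K by rewrite /K !mulr_ge0 ?sqr_ge0 ?addr_ge0 ?(ltW s0).
have B2 : B <= B ^+ 2 by rewrite expr2 ler_peMl.
have WK : `|W| <= K * d * (1 + l).
  rewrite /W normrM normrN (ger0_norm (ltW k0)).
  apply: (@le_trans _ _ (s * (2 * d * (l * B) + d * (m%:R * B ^+ 2)))).
    apply: ler_pM => //; first exact: ltW.
    apply: (le_trans (ler_normD _ _)); apply: lerD.
      by rewrite normrM ger0_norm ?mulr_ge0 ?(ltW d0)// ler_wpM2l ?mulr_ge0 ?(ltW d0).
    rewrite ger0_norm; last by rewrite mulr_ge0// sqr_ge0.
    apply: ler_pM => //; first exact: sqr_ge0.
    by rewrite expr2 ler_piMl ?(ltW d0).
  have -> : K * d * (1 + l) = s * d * (2 * B ^+ 2 * (m%:R + 1) * (1 + l)) by rewrite /K; ring.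
  rewrite -[leLHS]/(s * _) (_ : s * _ = s * d * (2 * (l * B) + m%:R * B ^+ 2)); last by ring.
  apply: ler_wpM2l; first by rewrite mulr_ge0// ltW.
  have h1 : l * B <= l * B ^+ 2 by rewrite ler_wpM2l.
  have h2 : 0 <= m%:R * B ^+ 2 by rewrite mulr_ge0// sqr_ge0.
  have h3 : 0 <= l * (m%:R * B ^+ 2) by rewrite mulr_ge0.
  have h4 : 0 <= B ^+ 2 by exact: sqr_ge0.
  by lra.
have t3 := exp_taylor3 W.
have dP : `|1 + W + W ^+ 2 / 2 -
    (1 - 2 * k * d * y - k * d ^+ 2 * q + 2 * k ^+ 2 * d ^+ 2 * y ^+ 2)| <=
    K ^+ 2 * d ^+ 3 * (1 + l) ^+ 2.
  have -> : 1 + W + W ^+ 2 / 2 -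
    (1 - 2 * k * d * y - k * d ^+ 2 * q + 2 * k ^+ 2 * d ^+ 2 * y ^+ 2) =
    k ^+ 2 * d ^+ 3 * (2 * y * q + d * q ^+ 2 / 2) by rewrite /W; field.
  have kd0 : 0 <= k ^+ 2 * d ^+ 3 by rewrite mulr_ge0 ?exprn_ge0 ?(ltW d0) ?(ltW k0).
  rewrite normrM (ger0_norm kd0).
  have -> : K ^+ 2 * d ^+ 3 * (1 + l) ^+ 2 =
    s ^+ 2 * d ^+ 3 * (4 * (B ^+ 2 * (m%:R + 1) * (1 + l)) ^+ 2) by rewrite /K; ring.
  apply: ler_pM => //.
    by rewrite ler_wpM2r ?exprn_ge0 ?(ltW d0)// lerXn2r ?nnegrE ?(ltW k0) ?(ltW s0).
  have aB : l * B <= B ^+ 2 * (m%:R + 1) * (1 + l).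
    have h1 : l * B <= l * B ^+ 2 by rewrite ler_wpM2l.
    have h2 : 0 <= m%:R * B ^+ 2 by rewrite mulr_ge0// sqr_ge0.
    have h3 : 0 <= l * (m%:R * B ^+ 2) by rewrite mulr_ge0.
    by have h4 := sqr_ge0 B; lra.
  have aq : m%:R * B ^+ 2 <= B ^+ 2 * (m%:R + 1) * (1 + l).
    have h2 : 0 <= m%:R * B ^+ 2 by rewrite mulr_ge0// sqr_ge0.
    have h3 : 0 <= l * (m%:R * B ^+ 2) by rewrite mulr_ge0.
    by have h4 := sqr_ge0 B; have := mulr_ge0 l0 h4; lra.
  move: (B ^+ 2 * (m%:R + 1) * (1 + l)) aB aq => A aB aq.
  have yA : `|y| <= A by apply: le_trans aB.
  have qA : q <= A by apply: le_trans aq.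
  have A0 : 0 <= A by apply: le_trans qA.
  apply: (le_trans (ler_normD _ _)).
  have e1 : `|2 * y * q| <= 2 * A ^+ 2.
    rewrite 2!normrM (ger0_norm q0) (ger0_norm (ler0n _ 2)) -mulrA ler_pM2l// expr2.
    exact: ler_pM.
  have e2 : `|d * q ^+ 2 / 2| <= A ^+ 2.
    rewrite ger0_norm; last by rewrite divr_ge0// mulr_ge0 ?sqr_ge0 ?(ltW d0).
    have : q ^+ 2 <= A ^+ 2 by rewrite lerXn2r ?nnegrE.
    have : d * q ^+ 2 <= q ^+ 2 by rewrite ler_piMl ?sqr_ge0.
    by have := sqr_ge0 A; lra.
  by have := sqr_ge0 A; lra.
have -> : H' = H * expR W by rewrite HE.
rewrite -mulrBr normrM (ger0_norm H0).
have -> : expR W - (1 - 2 * k * d * y - k * d ^+ 2 * q + 2 * k ^+ 2 * d ^+ 2 * y ^+ 2) =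
  (1 + W + W ^+ 2 / 2 - (1 - 2 * k * d * y - k * d ^+ 2 * q + 2 * k ^+ 2 * d ^+ 2 * y ^+ 2))
  + (expR W - 1 - W - W ^+ 2 / 2) by ring.
apply: (le_trans (ler_wpM2l H0 (ler_normD _ _))); rewrite mulrDr.
have P1 : H * (1 + l) ^+ 2 <= C.
  apply: le_trans Hx; rewrite ler_wpM2l// ler_weXn2l//; lra.
have P2 : H * (1 + l) ^+ 3 <= C.
  apply: le_trans Hx; rewrite ler_wpM2l// ler_weXn2l//; lra.
have P3 : H' * (1 + l) ^+ 3 <= (1 + m%:R * B) ^+ 3 * C.
  have mB0 : 0 <= m%:R * B by rewrite mulr_ge0.
  apply: (@le_trans _ _ (H' * ((1 + m%:R * B) * (1 + l')) ^+ 3)).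
    rewrite ler_wpM2l// lerXn2r ?nnegrE ?mulr_ge0 ?addr_ge0//.
    by have := mulr_ge0 mB0 l'0; lra.
  rewrite exprMn mulrCA ler_wpM2l ?exprn_ge0 ?addr_ge0//.
  apply: le_trans Hx'; rewrite ler_wpM2l// ler_weXn2l//; lra.
have d3 : 0 <= d ^+ 3 by rewrite exprn_ge0// ltW.
have Q1 : H * `|1 + W + W ^+ 2 / 2 - (1 - 2 * k * d * y - k * d ^+ 2 * q
    + 2 * k ^+ 2 * d ^+ 2 * y ^+ 2)| <= K ^+ 2 * C * d ^+ 3.
  apply: (le_trans (ler_wpM2l H0 dP)).
  rewrite [leLHS](_ : _ = K ^+ 2 * d ^+ 3 * (H * (1 + l) ^+ 2)); last by ring.
  by rewrite [leRHS]mulrAC ler_wpM2l// mulr_ge0// sqr_ge0.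
have Q2 : H * `|expR W - 1 - W - W ^+ 2 / 2| <=
    K ^+ 3 * (1 + (1 + m%:R * B) ^+ 3) * C * d ^+ 3.
  have W3 : `|W| ^+ 3 <= K ^+ 3 * d ^+ 3 * (1 + l) ^+ 3.
    rewrite -!exprMn lerXn2r ?nnegrE//.
    by rewrite mulr_ge0 ?addr_ge0// mulr_ge0// ltW.
  have {}t3 : `|expR W - 1 - W - W ^+ 2 / 2| <= K ^+ 3 * d ^+ 3 * (1 + l) ^+ 3 * (1 + expR W).
    apply: (le_trans t3); apply: ler_pM; rewrite ?exprn_ge0 ?mexp_le//.
    exact: le_trans ler01 (mexp_ge1 _).
  apply: (le_trans (ler_wpM2l H0 t3)).
  rewrite [leLHS](_ : _ = K ^+ 3 * d ^+ 3 * (H * (1 + l) ^+ 3 + H * expR W * (1 + l) ^+ 3));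
    last by ring.
  rewrite [leRHS](_ : _ = K ^+ 3 * d ^+ 3 * (C + (1 + m%:R * B) ^+ 3 * C)); last by ring.
  apply: ler_wpM2l; first by rewrite mulr_ge0// exprn_ge0.
  by apply: lerD => //; rewrite -HE.
rewrite -/K [leRHS](_ : _ = K ^+ 2 * C * d ^+ 3 +
  K ^+ 3 * (1 + (1 + m%:R * B) ^+ 3) * C * d ^+ 3); last by ring.
exact: lerD.
Qed.

End GaussStep.

(** * One replacement step and the sum over all steps *)

Section LindebergStep.
Context (R : realType) (m : nat) (d : measure_display) (Omega : measurableType d)
        (Pr : probability Omega R).
Implicit Types (x : 'I_m -> R) (X : Omega -> 'I_m -> R).

Lemma measurable_heat (d' : measure_display) (T : measurableType d') s v
  (Y : T -> 'I_m -> R) : (forall j, measurable_fun setT (fun w => Y w j)) ->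
  measurable_fun setT (fun w => heat s v (Y w) : R).
Proof.
move=> mY; apply: measurableT_comp => //; apply: measurable_funB => //.
apply: measurable_funM => //; apply: measurable_sum => j.
exact: measurable_funX.
Qed.

Definition lind_cst s (C B : R) : R :=
  ((2 * s * B ^+ 2 * (m%:R + 1)) ^+ 2 +
      (2 * s * B ^+ 2 * (m%:R + 1)) ^+ 3 * (1 + (1 + m%:R * B) ^+ 3)) * C +
  (s * m%:R * B + 2 * s ^+ 2 * B) * C + 8 * (s * (1 + s) * (m%:R + 1)) ^+ 2 * C.

(** Taking means kills the linear term of the expansion in space, and a covariance within [B * h] of
    the identity turns the quadratic one into the bracket of [heat_time_step] up to order h^3. The
    allowance [B * h] accommodates local alternatives, under which covariances are off by order
    n^(-1/2). *)
Lemma lindeberg_step s (C B : R) v x (h : R) X : 0 < s -> 1 <= B ->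
  (forall x : 'I_m -> R, (1 + l1n x) ^+ 4 * expR (- (s / (1 + 2 * s) * sqn x)) <= C) ->
  0 < h <= 1 -> h ^+ 2 <= v <= 1 ->
  (forall j, measurable_fun setT (fun w => X w j)) ->
  (forall w j, `|X w j| <= B) ->
  (forall j, Ex Pr (fun w => X w j) = 0) ->
  (forall j l, `|Ex Pr (fun w => X w j * X w l) - (j == l)%:R| <= B * h) ->
  `|Ex Pr (fun w => heat s (v - h ^+ 2) (fun j => x j + h * X w j)) - heat s v x|
    <= lind_cst s C B * h ^+ 3.
Proof.
move=> s0 B1 hC h01 /andP[hv v1] mX XB EX EXX.
have /andP[h0 h1] := h01.
have h20 : 0 < h ^+ 2 by rewrite exprn_gt0.
have v01 : 0 <= v - h ^+ 2 <= 1 by rewrite subr_ge0 hv/=; lra.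
have B0 : 0 <= B by lra.
have [k0 ks kc] := kap_bound s0 v01.
have T1 := heat_time_step x s0 hC h20 (introT andP (conj hv v1)).
have T2 w := heat_shift_taylor x s0 B1 hC v01 h01 (XB w).
have IX j : Intg Pr (fun w => X w j) by apply: (@Intg_bounded _ _ _ _ _ B).
have IXX j l : Intg Pr (fun w => X w j * X w l).
  apply: (@Intg_bounded _ _ _ _ _ (B * B)); first exact: measurable_funM.
  by move=> w; rewrite normrM ler_pM.
pose y w := \sum_j x j * X w j.
have Iy : Intg Pr y by apply: Intg_sum => j; exact: IntgZ.
have Ey : Ex Pr y = 0.
  rewrite Ex_sum; last by move=> j; exact: IntgZ.
  by rewrite big1// => j _; rewrite ExZ// EX mulr0.
have y2E w : y w ^+ 2 = \sum_j \sum_l (x j * x l) * (X w j * X w l).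
  rewrite expr2 {1}/y mulr_suml; apply: eq_bigr => j _; rewrite mulr_sumr.
  by apply: eq_bigr => l _; ring.
have Iy2 : Intg Pr (fun w => y w ^+ 2).
  under eq_fun do rewrite y2E; apply: Intg_sum => j; apply: Intg_sum => l.
  exact: IntgZ.
have Iq : Intg Pr (fun w => sqn (X w)).
  by apply: Intg_sum => j; under eq_fun do rewrite expr2.
have Ey2 : `|Ex Pr (fun w => y w ^+ 2) - sqn x| <= B * h * l1n x ^+ 2.
  have -> : Ex Pr (fun w => y w ^+ 2) =
      \sum_j \sum_l (x j * x l) * Ex Pr (fun w => X w j * X w l).
    under [X in Ex Pr X]eq_fun do rewrite y2E.
    rewrite Ex_sum; last by move=> j; apply: Intg_sum => l; exact: IntgZ.
    apply: eq_bigr => j _; rewrite Ex_sum; last by move=> l; exact: IntgZ.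
    by apply: eq_bigr => l _; rewrite ExZ.
  have -> : sqn x = \sum_j \sum_l (x j * x l) * (j == l)%:R.
    rewrite /sqn; apply: eq_bigr => j _; rewrite (bigD1 j)//= eqxx mulr1 expr2.
    by rewrite big1 ?addr0// => l /negbTE; rewrite eq_sym => ->; rewrite mulr0.
  rewrite -sumrB; apply: (le_trans (ler_norm_sum _ _ _)).
  rewrite expr2 {1}/l1n mulr_suml mulr_sumr; apply: ler_sum => j _.
  rewrite -sumrB; apply: (le_trans (ler_norm_sum _ _ _)).
  rewrite /l1n mulr_sumr mulr_sumr; apply: ler_sum => l _.
  rewrite -mulrBr normrM normrM mulrC ler_wpM2r// mulr_ge0//.
have Eq : `|Ex Pr (fun w => sqn (X w)) - m%:R| <= m%:R * B * h.
  have -> : Ex Pr (fun w => sqn (X w)) = \sum_j Ex Pr (fun w => X w j * X w j).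
    rewrite -Ex_sum; last by move=> j; exact: IXX.
    by congr (Ex Pr _); apply/funext => w; apply: eq_bigr => j _; rewrite expr2.
  have -> : m%:R = \sum_(j < m) 1 :> R by rewrite sumr_const card_ord.
  rewrite -sumrB -mulrA mulr_suml; apply: (le_trans (ler_norm_sum _ _ _)).
  by apply: ler_sum => j _; rewrite mul1r; have := EXX j j; rewrite eqxx.
set k := kap s (v - h ^+ 2) in k0 ks kc T1 T2.
pose P w := 1 - 2 * k * h * y w - k * h ^+ 2 * sqn (X w) + 2 * k ^+ 2 * h ^+ 2 * y w ^+ 2.
have I1 : Intg Pr (fun w => 2 * k * h * y w) by exact: IntgZ.
have I2 : Intg Pr (fun w => k * h ^+ 2 * sqn (X w)) by exact: IntgZ.
have I3 : Intg Pr (fun w => 2 * k ^+ 2 * h ^+ 2 * y w ^+ 2) by exact: IntgZ.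
have I01 := IntgB (Intg_cst Pr 1) I1.
have I012 := IntgB I01 I2.
have IP : Intg Pr P by exact: IntgD.
have EP : Ex Pr P = 1 - k * h ^+ 2 * Ex Pr (fun w => sqn (X w)) +
    2 * k ^+ 2 * h ^+ 2 * Ex Pr (fun w => y w ^+ 2).
  rewrite /P ExD// ExB// ExB//; last exact: Intg_cst.
  by rewrite Ex_cst !ExZ// Ey mulr0 subr0.
have Ih : Intg Pr (fun w => heat s (v - h ^+ 2) (fun j => x j + h * X w j)).
  apply: (@Intg_bounded _ _ _ _ _ 1).
    apply: measurable_heat => j; apply: measurable_funD => //.
    exact: measurable_funM.
  by move=> w; rewrite ger0_norm ?heat_ge0// heat_le1 ?(ltW s0)//; case/andP: v01.
have IHP : Intg Pr (fun w => heat s (v - h ^+ 2) x * P w) by exact: IntgZ.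
have D1 : `|Ex Pr (fun w => heat s (v - h ^+ 2) (fun j => x j + h * X w j)) -
    heat s (v - h ^+ 2) x * Ex Pr P| <=
    ((2 * s * B ^+ 2 * (m%:R + 1)) ^+ 2 +
      (2 * s * B ^+ 2 * (m%:R + 1)) ^+ 3 * (1 + (1 + m%:R * B) ^+ 3)) * C * h ^+ 3.
  rewrite -ExZ// -ExB//; apply: (le_trans (Ex_norm (IntgB Ih IHP))).
  rewrite -[leRHS](Ex_cst Pr); apply: Ex_le; [|exact: Intg_cst|exact: T2].
  by apply: Intg_norm; exact: IntgB.
have H0 := heat_ge0 s (v - h ^+ 2) x.
have l0 := l1n_ge0 x.
have HC : heat s (v - h ^+ 2) x * (1 + l1n x) ^+ 4 <= C.
  apply: le_trans (hC x); rewrite mulrC ler_wpM2l ?exprn_ge0 ?addr_ge0//.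
  exact: heat_le_gauss.
have HC1 : heat s (v - h ^+ 2) x <= C.
  apply: le_trans HC; rewrite ler_peMr// exprn_ege1//; lra.
have HC2 : heat s (v - h ^+ 2) x * l1n x ^+ 2 <= C.
  apply: le_trans HC; rewrite ler_wpM2l//.
  apply: (@le_trans _ _ ((1 + l1n x) ^+ 2)).
    by rewrite lerXn2r ?nnegrE//; lra.
  by rewrite ler_weXn2l//; lra.
have D2 : `|heat s (v - h ^+ 2) x * Ex Pr P - heat s (v - h ^+ 2) x *
      (1 - m%:R * k * h ^+ 2 + 2 * k ^+ 2 * h ^+ 2 * sqn x)| <=
    (s * m%:R * B + 2 * s ^+ 2 * B) * C * h ^+ 3.
  rewrite EP -mulrBr normrM (ger0_norm H0).
  move: (Ex Pr (fun w => sqn _)) (Ex Pr (fun w => _ ^+ 2)) Eq Ey2 => q y2 Eq Ey2.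
  have -> : 1 - k * h ^+ 2 * q + 2 * k ^+ 2 * h ^+ 2 * y2 -
      (1 - m%:R * k * h ^+ 2 + 2 * k ^+ 2 * h ^+ 2 * sqn x) =
      - (k * h ^+ 2) * (q - m%:R) + 2 * k ^+ 2 * h ^+ 2 * (y2 - sqn x) by ring.
  have kk : k ^+ 2 <= s ^+ 2 by rewrite lerXn2r ?nnegrE ?(ltW k0) ?(ltW s0).
  have e1 : `|- (k * h ^+ 2) * (q - m%:R)| <= s * h ^+ 2 * (m%:R * B * h).
    have kh0 : 0 <= k * h ^+ 2 by apply: mulr_ge0; exact: ltW.
    rewrite normrM normrN (ger0_norm kh0); apply: ler_pM => //.
    by rewrite ler_pM2r.
  have e2 : `|2 * k ^+ 2 * h ^+ 2 * (y2 - sqn x)| <= 2 * s ^+ 2 * h ^+ 2 * (B * h * l1n x ^+ 2).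
    have kh0 : 0 <= 2 * k ^+ 2 * h ^+ 2 by rewrite mulr_ge0 ?sqr_ge0// mulr_ge0 ?sqr_ge0.
    rewrite normrM (ger0_norm kh0); apply: ler_pM => //.
    by rewrite ler_pM2r// ler_pM2l.
  apply: (le_trans (ler_wpM2l H0 (ler_normD _ _))).
  apply: (le_trans (ler_wpM2l H0 (lerD e1 e2))).
  rewrite mulrDr [leRHS](_ : _ = s * m%:R * B * h ^+ 3 * C + 2 * s ^+ 2 * B * h ^+ 3 * C);
    last by ring.
  have h30 : 0 <= h ^+ 3 by rewrite exprn_ge0// ltW.
  apply: lerD.
    rewrite [leLHS](_ : _ = s * m%:R * B * h ^+ 3 * heat s (v - h ^+ 2) x); last by ring.
    by rewrite ler_wpM2l// !mulr_ge0// ltW.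
  rewrite [leLHS](_ : _ = 2 * s ^+ 2 * B * h ^+ 3 * (heat s (v - h ^+ 2) x * l1n x ^+ 2));
    last by ring.
  by rewrite ler_wpM2l// mulr_ge0// mulr_ge0// mulr_ge0// sqr_ge0.
have D3 : `|heat s (v - h ^+ 2) x *
      (1 - m%:R * k * h ^+ 2 + 2 * k ^+ 2 * h ^+ 2 * sqn x) - heat s v x| <=
    8 * (s * (1 + s) * (m%:R + 1)) ^+ 2 * C * h ^+ 3.
  rewrite distrC; apply: (le_trans T1); rewrite -exprM ler_wpM2l//.
    by rewrite mulr_ge0 ?(le_trans H0 HC1)// mulr_ge0// sqr_ge0.
  by rewrite ler_wiXn2l// ltW.
rewrite [leRHS](_ : _ = ((2 * s * B ^+ 2 * (m%:R + 1)) ^+ 2 +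
    (2 * s * B ^+ 2 * (m%:R + 1)) ^+ 3 * (1 + (1 + m%:R * B) ^+ 3)) * C * h ^+ 3 +
  (s * m%:R * B + 2 * s ^+ 2 * B) * C * h ^+ 3 +
  8 * (s * (1 + s) * (m%:R + 1)) ^+ 2 * C * h ^+ 3); last by rewrite /lind_cst; ring.
exact: dist_tri3 D1 D2 D3.
Qed.

(** Each term is independent of all earlier ones through [G] and [G']. The fixed start [x] carries
    drift and contamination, so noncentrality needs no separate argument. Summing n errors of size
    n^(-3/2) leaves n^(-1/2). *)
Lemma lindeberg_clt s (C B : R) (n : nat) x (X : nat -> Omega -> 'I_m -> R)
  (G G' : nat -> set (set Omega)) : 0 < s -> 1 <= B ->
  (forall x : 'I_m -> R, (1 + l1n x) ^+ 4 * expR (- (s / (1 + 2 * s) * sqn x)) <= C) ->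
  (0 < n)%N ->
  (forall t, G t `<=` measurable) -> (forall t, G' t `<=` measurable) ->
  (forall t, sigma_indep Pr (G t) (G' t)) ->
  (forall i t j, (i < t)%N -> sigm (G t) (fun w => X i w j)) ->
  (forall t j, sigm (G' t) (fun w => X t w j)) ->
  (forall t w j, `|X t w j| <= B) ->
  (forall t j, Ex Pr (fun w => X t w j) = 0) ->
  (forall t j l, `|Ex Pr (fun w => X t w j * X t w l) - (j == l)%:R| <=
     B / Num.sqrt n%:R) ->
  `|Ex Pr (fun w => expR (- s * sqn (fun j => x j + (\sum_(0 <= i < n) X i w j) / Num.sqrt n%:R)))
    - chi2_laplace m (sqn x) s| <= lind_cst s C B / Num.sqrt n%:R.
Proof.
move=> s0 B1 hC n0 mG mG' ind sX sX' XB EX EXX.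
pose h : R := (Num.sqrt n%:R)^-1.
have n0R : 0 < n%:R :> R by rewrite ltr0n.
have sn0 : 0 < Num.sqrt (n%:R : R) by rewrite sqrtr_gt0.
have h0 : 0 < h by rewrite invr_gt0.
have h1 : h <= 1 by rewrite invf_le1// -[leLHS]sqrtr1 ler_wsqrtr// ler1n.
have h2 : h ^+ 2 = n%:R^-1 by rewrite exprVn sqr_sqrtr// ltW.
pose S t w j := \sum_(0 <= i < t) X i w j.
(* Interpolates between the two sides: t steps of the walk, then heat for the remaining time (n -
   t)/n. *)
pose a t := Ex Pr (fun w => heat s ((n - t)%:R / n%:R) (fun j => x j + h * S t w j)).
have a0 : a 0%N = chi2_laplace m (sqn x) s.
  rewrite /a subn0 divff ?gt_eqF// -heat1 ?(ltW s0)// -[RHS](Ex_cst Pr).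
  congr (Ex Pr _); apply/funext => w; congr (heat _ _ _); apply/funext => j.
  by rewrite /S big_nil mulr0 addr0.
have an : a n = Ex Pr (fun w => expR (- s * sqn (fun j => x j +
    (\sum_(0 <= i < n) X i w j) / Num.sqrt n%:R))).
  rewrite /a subnn mul0r; congr (Ex Pr _); apply/funext => w; rewrite heat0.
  by congr (expR (_ * sqn _)); apply/funext => j; rewrite mulrC.
have mS t j : sigm (G t) (fun w => S t w j).
  rewrite /S; under eq_fun do rewrite big_seq_cond.
  rewrite /sigm.
  have : forall r : seq nat, (forall i, i \in r -> (i < t)%N) ->
      sigm (G t) (fun w => \sum_(i <- r | (i \in r) && true) X i w j).
    move=> r hr; rewrite /sigm.
    under eq_fun do rewrite -big_seq_cond.
    elim: r hr => [|i r IH] hr.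
      by under eq_fun do rewrite big_nil; exact: measurable_cst.
    under eq_fun do rewrite big_cons.
    apply: measurable_funD; first by apply: sX; apply: hr; rewrite mem_head.
    by apply: IH => i' hi'; apply: hr; rewrite inE hi' orbT.
  by apply=> i; rewrite mem_index_iota => /andP[].
have step t : (t < n)%N -> `|a t.+1 - a t| <= lind_cst s C B * h ^+ 3.
  move=> tn.
  have v1 : (n - t)%:R / n%:R - h ^+ 2 = (n - t.+1)%:R / n%:R :> R.
    have -> : (n - t)%N = (n - t.+1).+1 by rewrite -subSn.
    by rewrite h2 -natr1 mulrDl mul1r addrK.
  have vv : h ^+ 2 <= ((n - t)%:R / n%:R : R) <= 1.
    rewrite h2 -[leLHS]mul1r ler_pM2r ?invr_gt0// ler1n subn_gt0 tn/=.
    by rewrite ler_pdivrMr// mul1r ler_nat leq_subr.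
  have v10 : 0 <= (n - t.+1)%:R / n%:R :> R by rewrite divr_ge0.
  have v00 : 0 <= (n - t)%:R / n%:R :> R by rewrite divr_ge0.
  have mX' j : measurable_fun setT (fun w => X t w j) by exact: sigm_measurable (sX' t j).
  have mS' t' j : measurable_fun setT (fun w => S t' w j) by exact: sigm_measurable (mS t' j).
  (* The past sum and the new term sit in separate coordinates, so [decouple] allows the one-step
     estimate with the past frozen as starting point. *)
  pose F (z : g_sigma_algebraType (G t) * g_sigma_algebraType (G' t)) :=
    heat s ((n - t.+1)%:R / n%:R) (fun j => (x j + h * S t z.1 j) + h * X t z.2 j).
  have hb v z : 0 <= v -> `|heat s v z : R| <= 1.
    by move=> v0; rewrite ger0_norm ?heat_ge0// heat_le1// ltW.
  have mF : measurable_fun setT F.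
    apply: measurable_heat => j; apply: measurable_funD; last first.
      by apply: measurable_funM => //; exact: (@sigm_snd _ _ _ (G t) (G' t) (fun w => X t w j)).
    apply: measurable_funD => //; apply: measurable_funM => //.
    exact: (@sigm_fst _ _ _ (G t) (G' t) (fun w => S t w j)).
  have IF2 w1 : Intg Pr (fun w2 => F (w1, w2)).
    apply: (@Intg_bounded _ _ _ _ _ 1) => [|w]; last exact: hb.
    rewrite /F/=; apply: (@measurable_heat _ _ s _ (fun w2 j => _)) => j.
    by apply: measurable_funD => //; exact: measurable_funM.
  have -> : a t.+1 = Ex Pr (fun w1 => Ex Pr (fun w2 => F (w1, w2))).
    rewrite -(@decouple _ _ _ Pr (G t) (G' t) (mG t) (mG' t) (ind t) F mF _ IF2).
      congr (Ex Pr _); apply/funext => w; congr (heat _ _ _); apply/funext => j.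
      by rewrite /= /S big_nat_recr//= mulrDr addrA.
    apply: (@Intg_bounded _ _ _ _ _ 1) => [|w]; last exact: hb.
    apply: measurable_heat => j; apply: measurable_funD; last exact: measurable_funM.
    by apply: measurable_funD => //; exact: measurable_funM.
  have D1 w1 : `|Ex Pr (fun w2 => F (w1, w2)) -
      heat s ((n - t)%:R / n%:R) (fun j => x j + h * S t w1 j)| <= lind_cst s C B * h ^+ 3.
    by rewrite /F/= -v1; apply: lindeberg_step => //; rewrite h0.
  have I1 : Intg Pr (fun w1 => Ex Pr (fun w2 => F (w1, w2))).
    apply: (@Intg_bounded _ _ _ _ _ 1) => [|w].
      by apply: (@sigm_measurable _ _ _ (G t)) => //; exact: sigm_partial_expectation.
    apply: (le_trans (Ex_norm (IF2 w))); rewrite -[leRHS](Ex_cst Pr); apply: Ex_le => //.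
    - by apply: Intg_norm.
    - exact: Intg_cst.
    - by move=> w2; exact: hb.
  have I2 : Intg Pr (fun w => heat s ((n - t)%:R / n%:R) (fun j => x j + h * S t w j)).
    apply: (@Intg_bounded _ _ _ _ _ 1) => [|w]; last exact: hb.
    by apply: measurable_heat => j; apply: measurable_funD => //; exact: measurable_funM.
  rewrite /a -ExB//; apply: (le_trans (Ex_norm (IntgB I1 I2))).
  rewrite -[leRHS](Ex_cst Pr); apply: Ex_le => //.
  - by apply: Intg_norm; exact: IntgB.
  - exact: Intg_cst.
rewrite -an -a0.
have -> : a n - a 0%N = \sum_(0 <= t < n) (a t.+1 - a t) by rewrite telescope_sumr.
apply: (le_trans (ler_norm_sum _ _ _)).
apply: (@le_trans _ _ (\sum_(0 <= t < n) lind_cst s C B * h ^+ 3)).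
  by rewrite big_nat_cond [leRHS]big_nat_cond; apply: ler_sum => t /andP[/andP[_ tn] _]; exact: step.
rewrite sumr_const_nat subn0 -[leLHS]mulr_natr -mulrA.
rewrite (_ : h ^+ 3 * n%:R = h)//.
by rewrite exprSr h2 mulrAC mulVf ?mul1r// gt_eqF.
Qed.

End LindebergStep.

(** * Moving average approximation of the autoregression *)

Section LinearRecurrence.
Context (R : realType).
Local Notation C := R[i].
Local Notation nrm := (@Normc.normc R).

Definition geom_decay (a : nat -> C) : Prop :=
  exists K r : R, [/\ 0 <= K, 0 < r < 1 & forall n, nrm (a n) <= K * r ^+ n].

Lemma normc_ge0 (z : C) : 0 <= nrm z.
Proof. by case: z => a b /=; exact: sqrtr_ge0. Qed.

(** This is a first-order recurrence with geometrically small forcing. The ratio [q] lies strictly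
    between max(r, |z|) and 1, and the constant is large enough for K <= K' (q - m), which closes
    the induction. *)
Lemma geom_decay_step (z : C) (a : nat -> C) : nrm z < 1 ->
  geom_decay (fun n => a n.+1 - z * a n) -> geom_decay a.
Proof.
move=> z1 [K [r [K0 /andP[r0 r1] hb]]].
pose m := Num.max r (nrm z); have m1 : m < 1 by rewrite gt_max r1.
pose q := (m + 1) / 2.
have mz : nrm z <= m by rewrite le_max lexx orbT.
have mr : r <= m by rewrite le_max lexx.
have mq : m < q by rewrite /q; lra.
have q1 : q < 1 by rewrite /q; lra.
have q0 : 0 < q by apply: lt_trans mq; apply: lt_le_trans mr.
exists (nrm (a 0%N) + K / (q - m)), q; split.
- by rewrite addr_ge0 ?normc_ge0// divr_ge0// subr_ge0 ltW.
- by rewrite q0.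
set K' := _ + _.
have K'0 : 0 <= K' by rewrite addr_ge0 ?normc_ge0// divr_ge0// subr_ge0 ltW.
have KK : K <= K' * (q - m).
  by rewrite -ler_pdivrMr ?subr_gt0// lerDr normc_ge0.
elim=> [|n IH]; first by rewrite expr0 mulr1 lerDl divr_ge0// subr_ge0 ltW.
have -> : a n.+1 = (a n.+1 - z * a n) + z * a n by rewrite subrK.
apply: (le_trans (le_normcD _ _)); rewrite Normc.normcM.
have qn0 : 0 <= q ^+ n by rewrite exprn_ge0// ltW.
have h1 : nrm (a n.+1 - z * a n) <= K * q ^+ n.
  apply: (le_trans (hb n)); rewrite ler_wpM2l// lerXn2r ?nnegrE ?(ltW r0) ?(ltW q0)//.
  by rewrite (le_trans mr)// ltW.
have h2 : nrm z * nrm (a n) <= m * (K' * q ^+ n) by apply: ler_pM; rewrite ?normc_ge0.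
apply: (le_trans (lerD h1 h2)); rewrite exprSr mulrA mulrA -mulrDl mulrAC ler_wpM2r//.
by move: KK; rewrite mulrBr; move: (K' * q) (K' * m) (m * K') (mulrC K' m) => *; lra.
Qed.

(** The polynomial acts on sequences with the indeterminate as the shift, so that a linear factor
    can be peeled off as a first-order recurrence ([pact_XsubC]). *)
Definition pact (q : {poly C}) (a : nat -> C) (n : nat) : C :=
  \sum_(i < size q) q`_i * a (n + i)%N.

Lemma pact_widen (q : {poly C}) a n M : (size q <= M)%N ->
  pact q a n = \sum_(i < M) q`_i * a (n + i)%N.
Proof.
move=> qM; rewrite /pact (big_ord_widen _ (fun i => q`_i * a (n + i)%N) qM).
rewrite big_mkcond/=; apply: eq_bigr => i _; case: ltnP => // h.
by rewrite nth_default// mul0r.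
Qed.

Lemma pactD (q1 q2 : {poly C}) a n : pact (q1 + q2) a n = pact q1 a n + pact q2 a n.
Proof.
pose M := maxn (size q1) (size q2).
rewrite (@pact_widen (q1 + q2) _ _ M) ?size_polyD// (@pact_widen q1 _ _ M) ?leq_maxl//.
rewrite (@pact_widen q2 _ _ M) ?leq_maxr// -big_split/=.
by apply: eq_bigr => i _; rewrite coefD mulrDl.
Qed.

Lemma pactZ c (q : {poly C}) a n : pact (c *: q) a n = c * pact q a n.
Proof.
rewrite (@pact_widen (c *: q) _ _ (size q)) ?size_scale_leq// /pact mulr_sumr.
by apply: eq_bigr => i _; rewrite coefZ mulrA.
Qed.

Lemma pactXn k a n : pact 'X^k a n = a (n + k)%N.
Proof.
rewrite /pact size_polyXn (bigD1 ord_max)//= coefXn eqxx mul1r big1 ?addr0// => i ik.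
rewrite coefXn (_ : (i == k :> nat) = false) ?mul0r//.
by apply/negbTE; move: ik; apply: contra => /eqP h; apply/eqP/val_inj.
Qed.

Lemma pact_sum (I : Type) (s : seq I) (F : I -> {poly C}) a n :
  pact (\sum_(i <- s) F i) a n = \sum_(i <- s) pact (F i) a n.
Proof.
elim: s => [|i s IH]; first by rewrite !big_nil /pact size_poly0 big_ord0.
by rewrite !big_cons pactD IH.
Qed.

Lemma pact_XsubC z (q : {poly C}) a n :
  pact (('X - z%:P) * q) a n = pact q (fun k => a k.+1 - z * a k) n.
Proof.
pose M := (size q).+1.
have sM : (size (('X - z%:P) * q)%R <= M)%N.
  by apply: (leq_trans (size_polyMleq _ _)); rewrite size_XsubC /M.
rewrite (pact_widen _ _ sM) (@pact_widen q _ _ M)//.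
transitivity (\sum_(i < M) (('X * q)`_i * a (n + i)%N) - \sum_(i < M) z * (q`_i * a (n + i)%N)).
  rewrite -sumrB; apply: eq_bigr => i _; rewrite mulrBl coefB mulrBl mul_polyC coefZ.
  by rewrite mulrA.
have -> : \sum_(i < M) ('X * q)`_i * a (n + i)%N = \sum_(i < M) q`_i * a (n + i).+1.
  rewrite [q in ('X * q)]lock; rewrite (mulrC 'X) -lock big_ord_recl/= coefMX/= mul0r add0r [RHS]big_ord_recr/=.
  rewrite [q`_(size q)]nth_default// mul0r addr0; apply: eq_bigr => i _.
  by rewrite /bump/= add1n coefMX/= addnS.
by rewrite -sumrB; apply: eq_bigr => i _; rewrite mulrBr mulrCA.
Qed.

(** Decay of the forcing passes to the sequence one linear factor at a time, repeated roots
    included. *)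
Lemma pact_decay (s : seq C) a : (forall z, z \in s -> nrm z < 1) ->
  geom_decay (pact (\prod_(z <- s) ('X - z%:P)) a) -> geom_decay a.
Proof.
elim: s a => [|z s IH] a hs.
  rewrite big_nil => -[K [r [K0 r01 h]]]; exists K, r; split => // n.
  by have := h n; rewrite -(expr0 ('X : {poly C})) pactXn addn0.
rewrite big_cons => h; apply: (@geom_decay_step z); first by apply: hs; rewrite mem_head.
apply: IH => [y ys|]; first by apply: hs; rewrite inE ys orbT.
by case: h => K [r [K0 r01 h]]; exists K, r; split => // n; rewrite -pact_XsubC.
Qed.

End LinearRecurrence.

(** * Moving average coefficients of the autoregression *)

Section ARExpansion.
Context (R : realType) (p : nat) (beta : 'I_p -> R).

Definition arb (i : nat) : R := beta_ext beta i.+1.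

Lemma arbE (i : 'I_p) : arb i = beta i.
Proof. by rewrite /arb /beta_ext; case: insubP => [j _ /val_inj ->//|]; rewrite ltn_ord. Qed.

Lemma arb0 i : (p <= i)%N -> arb i = 0.
Proof. by move=> pi; rewrite /arb /beta_ext insubN// -leqNgt. Qed.

(* [arc N i] is the coefficient of u_(t-N-i) after N substitutions of the
   autoregressive equation into u_t, and [psi k] the resulting coefficient of
   eps_(t-k). *)
Fixpoint arc (N i : nat) : R :=
  if N is N'.+1 then arc N' i.+1 + arc N' 0 * arb i else (i == 0%N)%:R.

Definition psi (k : nat) : R := arc k 0.

Lemma arc_psi N i : arc N i =
  \sum_(j < N) psi (N.-1 - j)%N * arb (i + j)%N + ((i + N)%N == 0%N)%:R.
Proof.
elim: N i => [|N IH] i /=; first by rewrite big_ord0 add0r addn0.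
rewrite -/(psi N) (IH i.+1) addSn addnS !addr0 [RHS]big_ord_recl/= subn0 addn0 addrC.
congr (_ + _); apply: eq_bigr => j _; rewrite /bump/= add1n addnS addSn.
by congr (psi _ * _); lia.
Qed.

Lemma arc_out N i : (p <= i)%N -> (0 < N)%N -> arc N i = 0.
Proof.
move=> pi N0; rewrite arc_psi big1 ?add0r; first by case: N N0 => // N _; rewrite addnS.
by move=> j _; rewrite arb0 ?mulr0//; lia.
Qed.

Lemma psi_rec n : psi (n + p) =
  \sum_(i < p) beta i * psi ((n + p).-1 - i)%N + ((n + p)%N == 0%N)%:R.
Proof.
rewrite /psi {1}arc_psi add0n; congr (_ + _).
under eq_bigr do rewrite add0n.
rewrite addnC big_split_ord/= [X in _ + X]big1 ?addr0.
  by apply: eq_bigr => i _; rewrite mulrC arbE.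
by move=> j _; rewrite arb0 ?mulr0//; exact: leq_addr.
Qed.

(** The characteristic polynomial splits over [R[i]], with all roots in the disk by [stable_AR]. It
    sends [psi] to a sequence that is zero, except at index 0 when p = 0, so [pact_decay]
    applies. *)
Lemma psi_decay : stable_AR beta -> exists K r : R,
  [/\ 0 <= K, 0 < r < 1 & forall n, `|psi n| <= K * r ^+ n].
Proof.
move=> st.
pose a n : R[i] := ((psi n)%:C)%C.
suff [K [r [K0 r01 h]]] : geom_decay a.
  exists K, r; split => // n; have := h n.
  by rewrite /a /= expr0n/= addr0 sqrtr_sqr.
pose B : {poly R[i]} := 'X^p + \sum_(i < p) (- ((beta i)%:C)%C) *: 'X^(p - i.+1).
have Bs : (size (\sum_(i < p) (- ((beta i)%:C)%C) *: 'X^(p - i.+1) : {poly R[i]})%R < p.+1)%N.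
  apply: (leq_ltn_trans (size_sum _ _ _)); rewrite ltnS; apply/bigmax_leqP => i _.
  apply: (leq_trans (size_scale_leq _ _)); rewrite size_polyXn; have := ltn_ord i; lia.
have sB : size B = p.+1 by rewrite /B size_polyDl ?size_polyXn.
have mB : lead_coef B = 1 by rewrite /B lead_coefDl ?size_polyXn// lead_coefXn.
have [rs Brs] := closed_field_poly_normal B.
rewrite mB scale1r in Brs.
apply: (@pact_decay R rs).
  move=> z zs; have : B.[z] = 0.
    apply/eqP; rewrite Brs -/(root _ z) root_prod_XsubC//.
  rewrite /B hornerD hornerXn horner_sum.
  under eq_bigr do rewrite hornerZ hornerXn mulNr.
  rewrite sumrN => /st; rewrite -ltcR.
  by [].
rewrite -Brs; exists 1, 2^-1; split => //; first by apply/andP; split; lra.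
move=> n; rewrite /B pactD pactXn pact_sum.
under eq_bigr do rewrite pactZ pactXn.
have -> : a (n + p)%N + \sum_(i < p) - ((beta i)%:C)%C * a (n + (p - i.+1))%N =
    ((((n + p)%N == 0%N)%:R : R)%:C)%C.
  rewrite /a psi_rec rmorphD rmorph_sum/=.
  under [X in _ + X]eq_bigr do rewrite mulNr.
  rewrite sumrN addrAC -[RHS]add0r; congr (_ + _).
  apply/eqP; rewrite subr_eq0; apply/eqP; apply: eq_bigr => i _; rewrite rmorphM/=; congr (_ * (psi _)%:C)%C.
  by have := ltn_ord i; lia.
rewrite /= expr0n/= addr0 sqrtr_sqr mul1r.
case: n => [|n]; last by rewrite addSn/= normr0 exprn_ge0.
by rewrite expr0; case: (_ == _); rewrite ?normr1 ?normr0.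
Qed.

Lemma sum_ltn_le (c : R) N k : 0 <= c ->
  \sum_(j < N) (if (j < k)%N then c else 0) <= k%:R * c.
Proof.
move=> c0; suff -> : \sum_(j < N) (if (j < k)%N then c else 0) = (minn N k)%:R * c.
  by rewrite ler_wpM2r// ler_nat geq_minr.
elim: N => [|N IH]; first by rewrite big_ord0 min0n mul0r.
rewrite big_ord_recr/= IH; case: ltnP => h.
  by rewrite (minn_idPl h) -natr1 mulrDl mul1r.
by rewrite addr0 (minn_idPr (leqW h)).
Qed.

(** By [arc_psi] a remainder coefficient involves only the last [p] values of [psi]; this costs the
    factor r^(-p) in the constant. *)
Lemma arc_decay : stable_AR beta -> exists K r : R,
  [/\ 0 <= K, 0 < r < 1 & forall N i, `|arc N i| <= K * r ^+ N].
Proof.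
move=> /psi_decay[K [r [K0 /andP[r0 r1] h]]].
pose Bm : R := \sum_(i < p) `|beta i|.
have Bm0 : 0 <= Bm by exact: sumr_ge0.
have bB i : `|arb i| <= Bm.
  have [pi|ip] := leqP p i; first by rewrite arb0// normr0.
  by rewrite (arbE (Ordinal ip)) /Bm (bigD1 (Ordinal ip))//= lerDl sumr_ge0.
pose K' : R := p%:R * (K * Bm / r ^+ p) + 1.
have rp0 : 0 < r ^+ p by rewrite exprn_gt0.
have KB0 : 0 <= K * Bm / r ^+ p by rewrite divr_ge0 ?mulr_ge0// ltW.
exists K', r; split; [by rewrite addr_ge0// mulr_ge0|by rewrite r0|].
move=> N i; rewrite arc_psi; apply: (le_trans (ler_normD _ _)).
rewrite mulrDl mul1r; apply: lerD; last first.
  case: N => [|N]; last by rewrite addnS normr0 exprn_ge0// ltW.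
  by rewrite expr0; case: (_ == _); rewrite ?normr1 ?normr0.
apply: (@le_trans _ _ (\sum_(j < N) if (j < p)%N then K * Bm / r ^+ p * r ^+ N else 0)).
  apply: (le_trans (ler_norm_sum _ _ _)); apply: ler_sum => j _.
  case: ltnP => jp; last by rewrite arb0 ?mulr0 ?normr0//; lia.
  rewrite normrM mulrAC mulrAC -[leRHS]mulrA mulrAC -mulrA.
  rewrite [leRHS](_ : _ = (K * (r ^+ N / r ^+ p)) * Bm); last by ring.
  apply: ler_pM => //; apply: (le_trans (h _)); rewrite ler_wpM2l//.
  rewrite ler_pdivlMr// -exprD ler_wiXn2l ?(ltW r0) ?(ltW r1)//.
  by have := ltn_ord j; lia.
have c0 : 0 <= K * Bm / r ^+ p * r ^+ N by rewrite mulr_ge0// exprn_ge0// ltW.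
by rewrite -[leRHS]mulrA; exact: sum_ltn_le.
Qed.

Lemma psi_summable : stable_AR beta ->
  exists Psi : R, 0 <= Psi /\ forall N, \sum_(k < N) `|psi k| <= Psi.
Proof.
move=> /psi_decay[K [r [K0 /andP[r0 r1] h]]].
have r1' : 0 < 1 - r by rewrite subr_gt0.
exists (K / (1 - r)); split; first by rewrite divr_ge0// ltW.
move=> N; apply: (@le_trans _ _ (\sum_(k < N) K * r ^+ k)); first exact: ler_sum.
rewrite -mulr_sumr ler_wpM2l// -[leRHS]mul1r ler_pdivlMr// mulrC.
by have := subrX1 r N; have : 0 <= r ^+ N by [rewrite exprn_ge0// ltW]; rewrite mulrBl mulrBl; lra.
Qed.

(** Substituting the equation into the leading term of the remainder extracts one more innovation.
    The remainder is given p + 1 lags so that at N = 0 it is u_t itself even when p = 0; for N > 0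
    the last coefficient vanishes. *)
Lemma ar_expand (u e : int -> R) (t : int) (N : nat) :
  (forall s, u s = \sum_(i < p) beta i * u (s - i.+1%:Z) + e s) ->
  u t = \sum_(k < N) psi k * e (t - k%:Z) +
        \sum_(i < p.+1) arc N i * u (t - N%:Z - i%:Z).
Proof.
move=> h; elim: N => [|N IH].
  rewrite big_ord0 add0r big_ord_recl/= !subr0 mul1r big1 ?addr0// => i _.
  by rewrite mul0r.
have -> : \sum_(i < p.+1) arc N.+1 i * u (t - N.+1%:Z - i%:Z) =
    \sum_(i < p) arc N.+1 i * u (t - N.+1%:Z - i%:Z).
  rewrite -[RHS]addr0 big_ord_recr; congr (_ + _).
  by rewrite (@arc_out N.+1 (@ord_max p)) ?mul0r.
rewrite {1}IH (big_ord_recr N (fun k => psi k * e (t - k%:Z)))/= -addrA; congr (_ + _).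
rewrite big_ord_recl/= subr0 (h (t - N%:Z)) -/(psi N) mulrDr addrAC addrC; congr (_ + _).
rewrite mulr_sumr -big_split/=; apply: eq_bigr => i _.
rewrite /bump/= add1n arbE.
have -> : t - N.+1%:Z - i%:Z = t - N%:Z - i.+1%:Z by lia.
by rewrite -/(psi N) mulrDl addrC mulrA.
Qed.

End ARExpansion.

(** * Truncation of the moving average expansion *)

Section ARApproximation.
Context (R : realType) (p : nat) (beta : 'I_p -> R)
  (d : measure_display) (Omega : measurableType d) (Pr : probability Omega R)
  (u : int -> Omega -> R).
Hypotheses (um : forall t, measurable_fun setT (u t))
  (ust : strictly_stationary Pr u).

(** Equal to the innovation of the model only almost surely. Defined from [u], it makes the
    autoregressive equation hold at every sample point. *)
Definition innov (t : int) (w : Omega) : R :=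
  u t w - \sum_(i < p) beta i * u (t - i.+1%:Z) w.

Definition ma_approx (e : int -> Omega -> R) (N : nat) (t : int) (w : Omega) : R :=
  \sum_(k < N) psi beta k * e (t - k%:Z) w.

(** The events -k < u_0 <= k exhaust the space, so a single law is tight; stationarity transfers the
    same [K] to every time. *)
Lemma stationary_tight (e : R) : 0 < e -> exists K : R, 0 < K /\
  forall t, prob_le Pr [set w | K < `|u t w|] e.
Proof.
move=> e0.
have mle t (a : R) : measurable [set w | u t w <= a].
  by apply: measurable_bset; apply: measurable_fun_ler.
have inv t a : Pr [set w | u t w <= a] = Pr [set w | u 0 w <= a].
  have := @ust [:: 0] (fun=> a) t; rewrite /fdd_event/= add0r.
  by under eq_set do rewrite andbT; under [in RHS]eq_set do rewrite andbT.
pose F k := [set w | u 0 w <= k%:R] `\` [set w | u 0 w <= - k%:R].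
have mF k : measurable (F k) by apply: measurableD.
have cF : Pr \o F @ \oo --> Pr (\bigcup_k F k).
  apply: nondecreasing_cvg_mu => //; first exact: bigcup_measurable.
  move=> k l kl; apply/subsetPset => w [/= h1 h2]; split => /=.
    by apply: (le_trans h1); rewrite ler_nat.
  by move=> h3; apply: h2; apply: (le_trans h3); rewrite lerN2 ler_nat.
have FT : \bigcup_k F k = setT.
  apply/seteqP; split => // w _.
  have [k hk] := exists_nat_gt `|u 0 w|; exists k => //=.
  by move: hk; rewrite ltr_norml => /andP[h1 h2]; split; [exact: ltW|apply/negP; rewrite -ltNge].
rewrite FT probability_setT in cF.
have [k hk] : exists k : nat, ((1 - e)%:E < Pr (F k))%E.
  apply: contrapT => /forallNP hn.
  have : (1%E <= (1 - e)%:E :> \bar R)%E.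
    rewrite -(cvg_lim _ cF)//; apply: lime_le; first by apply/cvg_ex; exists 1%E.
    by apply: nearW => k /=; rewrite leNgt; apply/negP; exact: hn.
  by rewrite lee_fin; lra.
exists (k%:R + 1); split; first by rewrite ltr_wpDl.
move=> t.
have mk (a : R) : measurable [set w | u t w <= a] by [].
pose Ft := [set w | u t w <= k%:R] `\` [set w | u t w <= - k%:R].
have mFt : measurable Ft by apply: measurableD.
have PFt : Pr Ft = Pr (F k).
  have sb s : [set w | u s w <= - k%:R] `<=` [set w | u s w <= k%:R].
    by move=> w /= h; apply: (le_trans h); rewrite (@le_trans _ _ 0)// oppr_le0.
  rewrite /Ft /F !measureD ?fin_num_measure//; try by rewrite ltey_eq fin_num_measure.
  by rewrite !(setIidr (sb _)); congr (_ - _)%E; exact: inv.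
exists (~` Ft); split; first exact: measurableC.
  move=> w /= hw [/= h1 /negP]; rewrite -ltNge => h2.
  have : `|u t w| <= k%:R by rewrite ler_norml h1 ltW.
  by move=> h3; have := lt_le_trans hw h3; rewrite -subr_gt0; lra.
rewrite probability_setC// PFt -(fineK (fin_num_measure _ _ (mF k))) -EFinB lee_fin.
by move: hk; rewrite -(Pr_fine Pr (mF k)) lte_fin; lra.
Qed.

(** The remainder combines p + 1 values of the process with coefficients of size r^N. Tightness
    makes it small in probability, with one lag for all times. *)
Lemma ma_approx_small (delta e : R) : stable_AR beta -> 0 < delta -> 0 < e ->
  exists N : nat, forall t, prob_le Pr [set w | delta < `|u t w - ma_approx innov N t w|] e.
Proof.
move=> st d0 e0.
have [K [r [K0 /andP[r0 r1] hK]]] := arc_decay st.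
have p0 : 0 < p.+1%:R :> R by [].
have [k [k0 hk]] := stationary_tight (divr_gt0 e0 p0).
have [N hN] : exists N : nat, r ^+ N <= delta / ((K + 1) * k * p.+1%:R).
  apply: exists_expr_le; first by rewrite (ltW r0).
  by rewrite divr_gt0// !mulr_gt0// ltr_wpDl.
exists N => t.
apply: (@prob_le_sub _ _ _ _ _ (fun w => exists i : 'I_p.+1, k < `|u (t - N%:Z - i%:Z) w|)).
  move=> w /= hw; apply: contrapT => /forallNP hn.
  have : `|u t w - ma_approx innov N t w| <= delta; last by rewrite leNgt hw.
  rewrite {1}(@ar_expand _ _ beta (fun s => u s w) (fun s => innov s w) t N); last first.
    by move=> s; rewrite /innov addrC subrK.
  rewrite addrAC subrr add0r; apply: (le_trans (ler_norm_sum _ _ _)).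
  apply: (@le_trans _ _ (\sum_(i < p.+1) K * r ^+ N * k)).
    apply: ler_sum => i _; rewrite normrM; apply: ler_pM => //.
    by rewrite leNgt; apply/negP; exact: hn.
  rewrite sumr_const card_ord -mulr_natl.
  move: hN; rewrite ler_pdivlMr ?mulr_gt0 ?ltr_wpDl// => hN.
  apply: le_trans hN; rewrite [leLHS](_ : _ = r ^+ N * (K * k * p.+1%:R)); last by ring.
  rewrite ler_wpM2l ?exprn_ge0 ?(ltW r0)// ler_wpM2r// ler_wpM2r ?(ltW k0)//.
  by rewrite lerDl.
have := prob_le_bigcup (fun i : 'I_p.+1 => hk (t - N%:Z - i%:Z)).
by apply: prob_le_le; rewrite sumr_const card_ord -[leLHS]mulr_natr divfK// gt_eqF.
Qed.

End ARApproximation.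

(** * Empirical process of the residuals *)

Lemma cauchy_step (R : realType) (S Q T b y : R) : 0 <= Q -> 0 <= T -> S ^+ 2 <= Q * T ->
  (S + b * y) ^+ 2 <= (Q + `|b|) * (T + `|b| * y ^+ 2).
Proof.
move=> Q0 T0 h.
have Qy : 0 <= Q * y ^+ 2 := mulr_ge0 Q0 (sqr_ge0 y).
have h1 : `|S * y| *+ 2 <= Q * y ^+ 2 + T.
  rewrite -ler_sqr ?nnegrE ?mulrn_wge0 ?(addr_ge0 Qy T0)//.
  rewrite -[`|_| *+ 2]mulr_natr exprMn real_normK ?num_real// exprMn.
  apply: (@le_trans _ _ (Q * T * y ^+ 2 * 2 ^+ 2)).
    by rewrite ler_wpM2r ?sqr_ge0// ler_wpM2r ?sqr_ge0.
  rewrite -subr_ge0 [leRHS](_ : _ = (Q * y ^+ 2 - T) ^+ 2) ?sqr_ge0//; ring.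
have h2 : S * (b * y) *+ 2 <= `|b| * (Q * y ^+ 2 + T).
  rewrite (_ : S * (b * y) *+ 2 = b * (S * y) *+ 2); last by ring.
  apply: (@le_trans _ _ (`|b| * (`|S * y| *+ 2))); last by apply: ler_wpM2l.
  by rewrite -mulrnAr -normrMn -normrM ler_norm.
rewrite sqrrD [leRHS](_ : _ = Q * T + `|b| * (Q * y ^+ 2 + T) + `|b| ^+ 2 * y ^+ 2); last by ring.
by rewrite real_normK ?num_real// exprMn; apply: lerD => //; exact: lerD.
Qed.

(** Cauchy-Schwarz with weights |a k|. The coefficients enter only through the sum of these, so for
    moving averages the bound is uniform in the truncation lag. *)
Lemma Ex_sqr_wsum (R : realType) (d : measure_display) (Omega : measurableType d)
  (Pr : probability Omega R) (N : nat) (a : nat -> R) (X : nat -> Omega -> R) (c q : R) :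
  (forall k, measurable_fun setT (X k)) -> (forall k, Intg Pr (fun w => X k w ^+ 2)) ->
  (forall k, Ex Pr (fun w => X k w ^+ 2) <= c) -> \sum_(k < N) `|a k| <= q -> 0 <= c ->
  Intg Pr (fun w => (\sum_(k < N) a k * X k w) ^+ 2) /\
  Ex Pr (fun w => (\sum_(k < N) a k * X k w) ^+ 2) <= q ^+ 2 * c.
Proof.
move=> mX iX hX hq c0.
have cs (x : nat -> R) : (\sum_(k < N) a k * x k) ^+ 2 <=
    (\sum_(k < N) `|a k|) * \sum_(k < N) `|a k| * x k ^+ 2.
  elim: N {hq} => [|N IH]; first by rewrite !big_ord0 expr0n mul0r.
  rewrite !big_ord_recr/=; move: IH.
  have : 0 <= \sum_(k < N) `|a k| * x k ^+ 2.
    by apply: sumr_ge0 => k _; rewrite mulr_ge0// sqr_ge0.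
  have : 0 <= \sum_(k < N) `|a k| by apply: sumr_ge0.
  move: (\sum_(k < N) a k * x k) (\sum_(k < N) `|a k|) (\sum_(k < N) `|a k| * x k ^+ 2).
  by move=> S Q T Q0 T0 h; exact: cauchy_step.
have iW : Intg Pr (fun w => \sum_(k < N) `|a k| * X k w ^+ 2).
  by apply: Intg_sum => k; exact: IntgZ.
have iW2 := IntgZ (\sum_(k < N) `|a k|) iW.
have i2 : Intg Pr (fun w => (\sum_(k < N) a k * X k w) ^+ 2).
  apply: (Intg_dom _ iW2) => [|w]; last by rewrite ger0_norm ?sqr_ge0//; exact: (cs (X^~ w)).
  apply: measurable_funX; apply: measurable_sum => k.
  by apply: measurable_funM.
split=> //.
have Q0 : 0 <= \sum_(k < N) `|a k| by apply: sumr_ge0.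
apply: (le_trans (Ex_le i2 iW2 _)); first by move=> w; exact: (cs (X^~ w)).
rewrite ExZ// Ex_sum; last by move=> k; exact: IntgZ.
apply: (@le_trans _ _ ((\sum_(k < N) `|a k|) * ((\sum_(k < N) `|a k|) * c))).
  rewrite ler_wpM2l// mulr_suml; apply: ler_sum => k _; rewrite ExZ//.
  by rewrite ler_wpM2l.
rewrite mulrA -expr2 ler_wpM2r//.
by rewrite lerXn2r ?nnegrE// (le_trans Q0).
Qed.

(** Follows from |f| <= q/2 + f^2/(2q), which replaces a square root of the second moment. *)
Lemma Ex_norm_le_sqr (R : realType) (d : measure_display) (Omega : measurableType d)
  (Pr : probability Omega R) (f : Omega -> R) (q : R) :
  measurable_fun setT f -> Intg Pr (fun w => f w ^+ 2) -> 0 < q ->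
  Ex Pr (fun w => f w ^+ 2) <= q ^+ 2 -> Ex Pr (fun w => `|f w|) <= q.
Proof.
move=> mf i2 q0 h.
have ib : Intg Pr (fun w => q / 2 + (2 * q)^-1 * f w ^+ 2).
  by apply: IntgD; [exact: Intg_cst|exact: IntgZ].
apply: (@le_trans _ _ (Ex Pr (fun w => q / 2 + (2 * q)^-1 * f w ^+ 2))).
  apply: Ex_le => //; first by apply: Intg_norm; exact: Intg_of_sqr.
  move=> w; rewrite -(real_normK (num_real (f w))).
  rewrite -(ler_pM2l (_ : 0 < 2 * q)) ?mulr_gt0// mulrDr mulVKf ?gt_eqF ?mulr_gt0//.
  have := sqr_ge0 (q - `|f w|); rewrite sqrrB.
  move: (`|f w|) => y; rewrite [2 * q * (q / 2)](_ : _ = q ^+ 2); last by field.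
  by rewrite [q * y *+ 2](_ : _ = 2 * q * y); [lra|ring].
rewrite ExD; [|exact: Intg_cst|exact: IntgZ].
rewrite Ex_cst ExZ// -(ler_pM2l (_ : 0 < 2 * q)) ?mulr_gt0// mulrDr mulVKf ?gt_eqF ?mulr_gt0//.
rewrite [2 * q * (q / 2)](_ : _ = q ^+ 2); last by field.
by rewrite [2 * q * q](_ : _ = q ^+ 2 + q ^+ 2) ?lerD2l//; ring.
Qed.

(** * The family of all noise variables *)

Section Noise.
Context (R : realType) (d : measure_display) (Omega : measurableType d)
        (Pr : probability Omega R) (eps B xi : int -> Omega -> R).

(** All randomness forms one family: tag [None] for innovations, [Some true] for contamination
    indicators, [Some false] for gross errors. Independence of two groups of variables then reduces
    to disjointness of index sets. *)
Definition noise (k : option bool * int) : Omega -> R :=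
  match k.1 with None => eps k.2 | Some true => B k.2 | Some false => xi k.2 end.

Record noise_model (G : R -> R) (gn sg2 : R) (Pi : probability R R) : Prop := NoiseModel {
  nm_meas : forall k, measurable_fun setT (noise k);
  nm_indep : indep_family Pr noise;
  nm_cdf : forall t x, fine (Pr [set w | eps t w <= x]) = G x;
  nm_int : forall t, Intg Pr (fun w => eps t w ^+ 2);
  nm_mean : forall t, Ex Pr (eps t) = 0;
  nm_var : forall t, Ex Pr (fun w => eps t w ^+ 2) <= sg2;
  nm_B : forall t w, B t w = 0 \/ B t w = 1;
  nm_Bmean : forall t, Ex Pr (B t) = gn;
  nm_xi : forall t A, measurable A -> Pr [set w | xi t w \in A] = Pi A }.

(** The derivative appears only as some number [g] bounded by [L], so mixtures inherit the record
    without being differentiated. *)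
Record cdf_reg (G : R -> R) (L M2 : R) : Prop := CdfReg {
  cr_bnd : forall x, 0 <= G x <= 1;
  cr_mono : forall x y, x <= y -> G x <= G y;
  cr_meas : measurable_fun setT G;
  cr_lip : forall x y, `|G x - G y| <= L * `|x - y|;
  cr_taylor : forall x, exists g, `|g| <= L /\
    forall h, `|G (x + h) - G x - g * h| <= M2 * h ^+ 2 }.

(** Contamination variables of every time, [t] and later included, count as past, because the
    threshold compared with the innovation at [t] contains the contamination at [t]. Only
    innovations are ordered in time. *)
Definition past (t : int) (k : option bool * int) : Prop :=
  if k.1 is None then k.2 < t else True.
Definition now (t : int) (k : option bool * int) : Prop := k = (None, t).

Variables (G : R -> R) (gn sg2 L M2 : R) (Pi : probability R R).
Hypotheses (nm : noise_model G gn sg2 Pi) (cr : cdf_reg G L M2).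

Let meps t : measurable_fun setT (eps t) := nm_meas nm (None, t).
Let mB t : measurable_fun setT (B t) := nm_meas nm (Some true, t).
Let mxi t : measurable_fun setT (xi t) := nm_meas nm (Some false, t).

Lemma noise_cyl_measurable J : cyl noise J `<=` measurable.
Proof. by apply: cyl_measurable; exact: nm_meas nm. Qed.

Lemma noise_indep J1 J2 : (forall k, J1 k -> J2 k -> False) ->
  sigma_indep Pr (cyl noise J1) (cyl noise J2).
Proof. by apply: cyl_indep; [exact: nm_meas nm|exact: nm_indep nm]. Qed.

Lemma Ex_noiseM J1 J2 (f g : Omega -> R) : (forall k, J1 k -> J2 k -> False) ->
  sigm (cyl noise J1) f -> sigm (cyl noise J2) g -> Intg Pr f -> Intg Pr g ->
  Intg Pr (fun w => f w * g w) ->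
  Ex Pr (fun w => f w * g w) = Ex Pr f * Ex Pr g.
Proof.
move=> J12; apply: Ex_indepM; [exact: noise_cyl_measurable|exact: noise_cyl_measurable|].
exact: noise_indep.
Qed.

Lemma B01 t w : 0 <= B t w <= 1.
Proof. by case: (nm_B nm t w) => ->; rewrite lexx ler01. Qed.

Lemma B_norm t w : `|B t w| <= 1.
Proof. by have /andP[h1 h2] := B01 t w; rewrite ger0_norm. Qed.

Lemma Intg_B t : Intg Pr (B t).
Proof. by apply: (@Intg_bounded _ _ _ _ _ 1) => // w; exact: B_norm. Qed.

Lemma gn_ge0 : 0 <= gn.
Proof. by rewrite -(nm_Bmean nm 0); apply: Ex_ge0 => w; case/andP: (B01 0 w). Qed.

Lemma sg2_ge0 : 0 <= sg2.
Proof. by apply: le_trans (nm_var nm 0); apply: Ex_ge0 => w; exact: sqr_ge0. Qed.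

Lemma L_ge0 : 0 <= L.
Proof.
by have [g [h _]] := cr_taylor cr 0; apply: le_trans h; exact: normr_ge0.
Qed.

Lemma M2_ge0 : 0 <= M2.
Proof.
have [g [_ h]] := cr_taylor cr 0; have := h 1; rewrite expr1n mulr1.
by apply: le_trans; exact: normr_ge0.
Qed.

Lemma G_dist1 x y : `|G x - G y| <= 1.
Proof.
have /andP[a b] := cr_bnd cr x; have /andP[a' b'] := cr_bnd cr y.
by rewrite ler_norml; apply/andP; split; lra.
Qed.

Lemma Ex_xi t (f : R -> R) : measurable_fun setT f ->
  Ex Pr (fun w => f (xi t w)) = Rintegral Pi setT f.
Proof.
move=> mf.
pose X : {mfun Omega >-> R} :=
  MeasurableFun.Pack (MeasurableFun.Class (isMeasurableFun.Build _ _ _ _ _ (mxi t))).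
rewrite /Ex /Rintegral; congr fine.
have -> : (\int[Pr]_w (f (xi t w))%:E = \int[distribution Pr X]_y (f y)%:E)%E.
  rewrite (@integral_distribution_measurable _ _ _ _ _ _ X (EFin \o f))//.
  exact/measurable_EFinP.
apply: eq_measure_integral => A mA _; apply: etrans (nm_xi nm t mA); rewrite /distribution/= /pushforward.
congr (Pr _); apply/seteqP; split => w /=; rewrite inE//.
Qed.

Lemma Ex_eps_orth s t : s != t -> Ex Pr (fun w => eps s w * eps t w) = 0.
Proof.
move=> st; rewrite (@Ex_noiseM (now s) (now t)).
- by rewrite (nm_mean nm) mul0r.
- by move=> k -> [] /eqP; rewrite (negbTE st).
- exact: (@sigm_cyl _ _ _ _ noise (now s) (None, s)).
- exact: (@sigm_cyl _ _ _ _ noise (now t) (None, t)).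
- by apply: Intg_of_sqr => //; exact: nm_int nm s.
- by apply: Intg_of_sqr => //; exact: nm_int nm t.
- by apply: Intg_mul => //; [exact: nm_int nm s|exact: nm_int nm t].
Qed.

Lemma Ex_eps_sum_sqr (n : nat) (f : nat -> int) : injective f ->
  Intg Pr (fun w => (\sum_(0 <= t < n) eps (f t) w) ^+ 2) /\
  Ex Pr (fun w => (\sum_(0 <= t < n) eps (f t) w) ^+ 2) <= n%:R * sg2.
Proof.
move=> fi.
have [] := @Ex_sqr_orthogonal _ _ _ Pr n (fun t => eps (f t)) (fun=> sg2).
- by [].
- by move=> t; exact: nm_int nm (f t).
- move=> s t /andP[st _]; apply: Ex_eps_orth; apply/negP => /eqP /fi h.
  by rewrite h ltnn in st.
- by move=> t _; exact: nm_var nm (f t).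
by rewrite sumr_const_nat subn0 -[sg2 *+ n]mulr_natl => h1 h2; split.
Qed.

Section MovingAverage.
Variables (p : nat) (beta : 'I_p -> R) (N : nat) (Psi : R).
Hypothesis hPsi : forall N, \sum_(k < N) `|psi beta k| <= Psi.
Local Notation v := (ma_approx beta eps N).

Lemma measurable_v t : measurable_fun setT (v t).
Proof. by apply: measurable_sum => k; apply: measurable_funM. Qed.

Lemma Ex_v_sqr t : Intg Pr (fun w => v t w ^+ 2) /\
  Ex Pr (fun w => v t w ^+ 2) <= Psi ^+ 2 * sg2.
Proof.
apply: (@Ex_sqr_wsum _ _ _ _ N (psi beta) (fun k => eps (t - k%:Z))) => //.
- by move=> k; exact: nm_int nm _.
- by move=> k; exact: nm_var nm _.
- exact: sg2_ge0.
Qed.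

(** After exchange of the sums each lag contributes a sum of n orthogonal innovations, and [psi] is
    summable. The sum over time has order sqrt(n) rather than n; this is how centring makes the term
    linear in the estimation error negligible. *)
Lemma Ex_v_sum_sqr (n : nat) (c : int) :
  Intg Pr (fun w => (\sum_(0 <= t < n) v (t.+1%:Z - c) w) ^+ 2) /\
  Ex Pr (fun w => (\sum_(0 <= t < n) v (t.+1%:Z - c) w) ^+ 2) <= Psi ^+ 2 * (n%:R * sg2).
Proof.
have -> : (fun w => (\sum_(0 <= t < n) v (t.+1%:Z - c) w) ^+ 2) =
    (fun w => (\sum_(k < N) psi beta k * (\sum_(0 <= t < n) eps (t.+1%:Z - c - k%:Z) w)) ^+ 2).
  apply/funext => w; congr (_ ^+ 2); rewrite /ma_approx exchange_big/=.
  by apply: eq_bigr => k _; rewrite mulr_sumr.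
have inj (k : nat) : injective (fun t : nat => t.+1%:Z - c - k%:Z).
  by move=> s t; lia.
apply: (@Ex_sqr_wsum _ _ _ _ N (psi beta) (fun k w => \sum_(0 <= t < n) eps (t.+1%:Z - c - k%:Z) w)) => //.
- by move=> k; apply: measurable_sum => t; exact: meps.
- by move=> k; exact: (Ex_eps_sum_sqr n (inj k)).1.
- by move=> k; exact: (Ex_eps_sum_sqr n (inj k)).2.
- by rewrite mulr_ge0// sg2_ge0.
Qed.

End MovingAverage.

End Noise.

Lemma sqrrB_le2 (R : realType) (a b : R) : (a - b) ^+ 2 <= 2 * a ^+ 2 + 2 * b ^+ 2.
Proof.
rewrite -subr_ge0 [leRHS](_ : _ = (a + b) ^+ 2) ?sqr_ge0//; ring.
Qed.

(** * Random thresholds and their martingale part *)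

Section Levels.
Context (R : realType) (d : measure_display) (Omega : measurableType d)
        (Pr : probability Omega R) (eps B xi : int -> Omega -> R)
        (G : R -> R) (gn sg2 L M2 : R) (Pi : probability R R)
        (p : nat) (beta : 'I_p -> R) (N : nat) (Psi : R).
Hypotheses (nm : noise_model Pr eps B xi G gn sg2 Pi) (cr : cdf_reg G L M2)
  (hPsi : forall N, \sum_(k < N) `|psi beta k| <= Psi).
Local Notation v := (ma_approx beta eps N).
Local Notation E := (Ex Pr).

Let meps t : measurable_fun setT (eps t) := nm_meas nm (None, t).
Let mB t : measurable_fun setT (B t) := nm_meas nm (Some true, t).
Let mxi t : measurable_fun setT (xi t) := nm_meas nm (Some false, t).

Definition cx (t : int) (w : Omega) : R := B t w * xi t w.
Definition yv (t : int) (w : Omega) : R := v t w + cx t w.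
Definition lin (th : 'I_p -> R) (y : int -> R) (t : int) : R :=
  \sum_(i < p) th i * y (t - i.+1%:Z).
Definition l1lag (y : int -> R) (t : int) : R := \sum_(i < p) `|y (t - i.+1%:Z)|.
Definition cw (t : int) (w : Omega) : R :=
  \sum_(0 <= j < p.+1) beta_ext beta j * cx (t - j%:Z) w.
Definition cont (t : int) (w : Omega) : R := \sum_(0 <= j < p.+1) B (t - j%:Z) w.
(** A residual is at most [x] exactly when the innovation is at most x + cw + s lin(tau), where tau
    is sqrt(n) times the estimation error and [lin] is taken at the observations. Here the truncated
    process replaces [u], and the [eta] term widens the threshold to absorb both this truncation and
    the distance from tau to a grid point. *)
Definition lvl (x s : R) (th : 'I_p -> R) (eta : R) (t : int) (w : Omega) : R :=
  x + cw t w + s * (lin th (yv^~ w) t + eta * (1 + l1lag (yv^~ w) t)).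
Local Notation V1 t w := (l1lag (v^~ w) t).

Lemma l1lag_ge0 (y : int -> R) t : 0 <= l1lag y t.
Proof. by apply: sumr_ge0. Qed.

Lemma sigm_B J t : J (Some true, t) -> sigm (cyl (noise eps B xi) J) (B t).
Proof. by move=> h; exact: (@sigm_cyl _ _ _ _ (noise eps B xi) J (Some true, t)). Qed.

Lemma sigm_xi J t : J (Some false, t) -> sigm (cyl (noise eps B xi) J) (xi t).
Proof. by move=> h; exact: (@sigm_cyl _ _ _ _ (noise eps B xi) J (Some false, t)). Qed.

Lemma sigm_eps J t : J (None, t) -> sigm (cyl (noise eps B xi) J) (eps t).
Proof. by move=> h; exact: (@sigm_cyl _ _ _ _ (noise eps B xi) J (None, t)). Qed.

Lemma sigm_v J t : (forall s, s <= t -> J (None, s)) ->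
  sigm (cyl (noise eps B xi) J) (v t).
Proof.
move=> h; apply: measurable_sum => k; apply: measurable_funM => //.
by apply: sigm_eps; apply: h; lia.
Qed.

Lemma sigm_cx J t : J (Some true, t) -> J (Some false, t) ->
  sigm (cyl (noise eps B xi) J) (cx t).
Proof. by move=> h1 h2; apply: measurable_funM; [exact: sigm_B|exact: sigm_xi]. Qed.

Lemma sigm_lvl x s th eta t t' : t <= t' ->
  sigm (cyl (noise eps B xi) (past t')) (lvl x s th eta t).
Proof.
move=> tt.
have syv (i : 'I_p) : sigm (cyl (noise eps B xi) (past t')) (yv (t - i.+1%:Z)).
  apply: measurable_funD; last exact: sigm_cx.
  by apply: sigm_v => r hr; rewrite /past/=; lia.
rewrite /lvl /cw /lin /l1lag; apply: measurable_funD.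
  apply: measurable_funD => //; apply: measurable_sum => j.
  by apply: measurable_funM => //; exact: sigm_cx.
apply: measurable_funM => //; apply: measurable_funD.
  by apply: measurable_sum => i; apply: measurable_funM => //; exact: syv.
apply: measurable_funM => //; apply: measurable_funD => //.
by apply: measurable_sum => i; apply: measurableT_comp => //; exact: syv.
Qed.

Lemma lvl_measurable x s th eta t : measurable_fun setT (lvl x s th eta t).
Proof.
exact: (sigm_measurable (noise_cyl_measurable nm (J := past t)) (sigm_lvl _ _ _ _ (lexx t))).
Qed.

(** Given the past the threshold is frozen, so the bracket with [G] is the conditional mean of the
    difference of indicators: these are martingale differences. *)
Definition mdiff (x s : R) (th : 'I_p -> R) (eta : R) (t : int) (w : Omega) : R :=
  (eps t w <= lvl x s th eta t w)%R%:R - (eps t w <= x)%R%:R -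
  (G (lvl x s th eta t w) - G x).

Lemma sigm_mdiff x s th eta t t' : t < t' ->
  sigm (cyl (noise eps B xi) (past t')) (mdiff x s th eta t).
Proof.
move=> tt.
have sl := sigm_lvl x s th eta (ltW tt).
have se : sigm (cyl (noise eps B xi) (past t')) (eps t) by exact: sigm_eps.
apply: measurable_funB; last first.
  by apply: measurable_funB => //; apply: measurableT_comp => //; exact: cr_meas cr.
by apply: measurable_funB; apply: measurable_ind; apply: measurable_fun_ler.
Qed.

Lemma mdiff_measurable x s th eta t : measurable_fun setT (mdiff x s th eta t).
Proof.
have tt : t < t + 1 by rewrite ltrDl.
exact: (sigm_measurable (noise_cyl_measurable nm (J := past (t + 1))) (sigm_mdiff _ _ _ _ tt)).
Qed.

Lemma mdiff_bound x s th eta t w : `|mdiff x s th eta t w| <= 2.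
Proof.
rewrite /mdiff; apply: (le_trans (ler_normB _ _)).
rewrite [leRHS](_ : 2 = 1 + 1)//; apply: lerD; last exact: (G_dist1 cr).
by case: (eps t w <= x); case: (eps t w <= _); rewrite ?subrr ?subr0 ?sub0r ?normrN ?normr0 ?normr1.
Qed.

Lemma past_now_disj t k : past t k -> now t k -> False.
Proof. by move=> + kt; rewrite kt /past/= ltxx. Qed.

Lemma Ex_threshold t (Z Y : Omega -> R) (M : R) :
  sigm (cyl (noise eps B xi) (past t)) Z -> sigm (cyl (noise eps B xi) (past t)) Y ->
  (forall w, `|Z w| <= M) ->
  E (fun w => Z w * (eps t w <= Y w)%R%:R) = E (fun w => Z w * G (Y w)).
Proof.
move=> sZ sY hZ.
apply: (@Ex_indep_threshold _ _ _ _ (cyl (noise eps B xi) (past t))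
  (cyl (noise eps B xi) (now t)) _ _ _ _ M) => //.
- exact: noise_cyl_measurable nm _.
- exact: noise_cyl_measurable nm _.
- by apply: (noise_indep nm) => k; exact: past_now_disj.
- exact: sigm_eps.
- exact: nm_cdf nm t.
Qed.

Lemma mdiff_orth x s th eta t t' : t < t' ->
  E (fun w => mdiff x s th eta t w * mdiff x s th eta t' w) = 0.
Proof.
move=> tt.
have sD := sigm_mdiff x s th eta tt.
have mD := mdiff_measurable x s th eta t.
have iD (f : Omega -> R) : measurable_fun setT f -> (forall w, `|f w| <= 1) ->
    Intg Pr (fun w => mdiff x s th eta t w * f w).
  move=> mf hf; apply: (@Intg_bounded _ _ _ _ _ 2); first exact: measurable_funM.
  move=> w; rewrite normrM -[leRHS]mulr1; apply: ler_pM => //; exact: mdiff_bound.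
have ml := lvl_measurable x s th eta t'.
have ind1 (b : bool) : `|b%:R : R| <= 1 by case: b; rewrite ?normr0 ?normr1.
have i1 : Intg Pr (fun w => mdiff x s th eta t w * (eps t' w <= lvl x s th eta t' w)%R%:R).
  by apply: iD => //; apply: measurable_ind; exact: measurable_fun_ler.
have i2 : Intg Pr (fun w => mdiff x s th eta t w * (eps t' w <= x)%R%:R).
  by apply: iD => //; apply: measurable_ind; exact: measurable_fun_ler.
have G1 y : `|G y| <= 1 by have /andP[a b] := cr_bnd cr y; rewrite ger0_norm.
have i3 : Intg Pr (fun w => mdiff x s th eta t w * G (lvl x s th eta t' w)).
  by apply: iD => //; apply: measurableT_comp => //; exact: cr_meas cr.
have i4 : Intg Pr (fun w => mdiff x s th eta t w * G x) by apply: iD.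
have -> : (fun w => mdiff x s th eta t w * mdiff x s th eta t' w) = (fun w =>
  (mdiff x s th eta t w * (eps t' w <= lvl x s th eta t' w)%R%:R -
   mdiff x s th eta t w * (eps t' w <= x)%R%:R) -
  (mdiff x s th eta t w * G (lvl x s th eta t' w) - mdiff x s th eta t w * G x)).
  by apply/funext => w; rewrite {2}/mdiff; ring.
rewrite ExB; [|exact: IntgB|exact: IntgB].
rewrite !ExB//.
rewrite (Ex_threshold sD (sigm_lvl x s th eta (lexx t')) (mdiff_bound x s th eta t)).
have sx : sigm (cyl (noise eps B xi) (past t')) (fun=> x) by exact: measurable_cst.
rewrite (Ex_threshold sD sx (mdiff_bound x s th eta t)).
by rewrite subrr.
Qed.

(** The squared difference of indicators is the indicator that the innovation falls between [x] and
    the threshold. Written with [max] and [min], again functions of the past, it has mean E|G(lvl) -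
    G(x)|. The 4 is 2 + 2 from the square of a difference. *)
Lemma Ex_mdiff_sqr x s th eta t (hb : R) :
  E (fun w => `|G (lvl x s th eta t w) - G x|) <= hb ->
  E (fun w => mdiff x s th eta t w ^+ 2) <= 4 * hb.
Proof.
move=> hh.
set l := lvl x s th eta t.
have ml : measurable_fun setT l := lvl_measurable x s th eta t.
have mG := cr_meas cr.
have iH : Intg Pr (fun w => `|G (l w) - G x|).
  apply: Intg_norm; apply: (@Intg_bounded _ _ _ _ _ 1); last by move=> w; exact: (G_dist1 cr).
  by apply: measurable_funB => //; apply: measurableT_comp.
have smx : sigm (cyl (noise eps B xi) (past t)) (fun w => Num.max (l w) x).
  by apply: measurable_maxr => //; exact: sigm_lvl.
have smn : sigm (cyl (noise eps B xi) (past t)) (fun w => Num.min (l w) x).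
  by apply: measurable_minr => //; exact: sigm_lvl.
have mmx := sigm_measurable (noise_cyl_measurable nm (J := past t)) smx.
have mmn := sigm_measurable (noise_cyl_measurable nm (J := past t)) smn.
have i1 : Intg Pr (fun w => (eps t w <= Num.max (l w) x)%R%:R).
  by apply: Intg_ind; exact: measurable_fun_ler.
have i2 : Intg Pr (fun w => (eps t w <= Num.min (l w) x)%R%:R).
  by apply: Intg_ind; exact: measurable_fun_ler.
have bG (f : Omega -> R) : measurable_fun setT f -> Intg Pr (fun w => G (f w)).
  move=> mf; apply: (@Intg_bounded _ _ _ _ _ 1); first exact: measurableT_comp.
  by move=> w; have /andP[a b] := cr_bnd cr (f w); rewrite ger0_norm.
have s1 : sigm (cyl (noise eps B xi) (past t)) (fun=> 1 : R) by exact: measurable_cst.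
have n1 (w : Omega) : `|1 : R| <= 1 by rewrite normr1.
have eI : E (fun w => (eps t w <= Num.max (l w) x)%R%:R - (eps t w <= Num.min (l w) x)%R%:R) =
    E (fun w => `|G (l w) - G x|).
  rewrite ExB//.
  have := Ex_threshold s1 smx n1; under eq_fun do rewrite mul1r; move=> ->.
  have := Ex_threshold s1 smn n1; under eq_fun do rewrite mul1r; move=> ->.
  under eq_fun do rewrite mul1r; under [in X in _ - X]eq_fun do rewrite mul1r.
  rewrite -ExB; [|exact: bG|exact: bG]; congr (Ex Pr _); apply/funext => w.
  have [h|h] := leP (l w) x.
    by rewrite ler0_norm ?opprB// subr_le0; exact: cr_mono cr _ _ h.
  by rewrite ger0_norm// subr_ge0; exact: cr_mono cr _ _ (ltW h).
have i3 := IntgB i1 i2.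
have i4 := IntgD (IntgZ 2 i3) (IntgZ 2 iH).
apply: (@le_trans _ _ (E (fun w =>
   2 * ((eps t w <= Num.max (l w) x)%R%:R - (eps t w <= Num.min (l w) x)%R%:R) +
   2 * `|G (l w) - G x|))).
  apply: Ex_le => //.
    apply: (@Intg_bounded _ _ _ _ _ 4).
      by apply: measurable_funX; exact: mdiff_measurable.
    move=> w; rewrite normrX [leRHS](_ : 4 = 2 ^+ 2); last by ring.
    by rewrite lerXn2r ?nnegrE//; exact: mdiff_bound.
  move=> w.
  have e1 : ((eps t w <= l w)%R%:R - (eps t w <= x)%R%:R) ^+ 2 =
      (eps t w <= Num.max (l w) x)%R%:R - (eps t w <= Num.min (l w) x)%R%:R :> R.
    rewrite le_max le_min; case: (eps t w <= l w); case: (eps t w <= x);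
      by rewrite /= ?subrr ?subr0 ?sub0r ?sqrrN ?expr1n ?expr0n.
  rewrite -e1 /mdiff -/l.
  have hG := G_dist1 cr (l w) x.
  have h2 : (G (l w) - G x) ^+ 2 <= `|G (l w) - G x|.
    by rewrite -real_normK ?num_real// expr2 ler_piMl.
  by apply: (le_trans (sqrrB_le2 _ _)); rewrite lerD2l ler_wpM2l.
rewrite ExD; [|exact: IntgZ|exact: IntgZ].
by rewrite !ExZ// eI; move: hh; rewrite -/l; clear n1; move: (E _) => *; lra.
Qed.

Lemma Ex_mdiff_sum_sqr x s th eta (n : nat) (hb : R) :
  (forall t, E (fun w => `|G (lvl x s th eta t w) - G x|) <= hb) ->
  Intg Pr (fun w => (\sum_(0 <= t < n) mdiff x s th eta t.+1%:Z w) ^+ 2) /\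
  E (fun w => (\sum_(0 <= t < n) mdiff x s th eta t.+1%:Z w) ^+ 2) <= n%:R * (4 * hb).
Proof.
move=> hh.
have [] := @Ex_sqr_orthogonal _ _ _ Pr n (fun t => mdiff x s th eta t.+1%:Z) (fun=> 4 * hb).
- by move=> t; exact: mdiff_measurable.
- move=> t; apply: (@Intg_bounded _ _ _ _ _ 4).
    by apply: measurable_funX; exact: mdiff_measurable.
  move=> w; rewrite normrX [leRHS](_ : 4 = 2 ^+ 2); last by ring.
  by rewrite lerXn2r ?nnegrE//; exact: mdiff_bound.
- by move=> r t /andP[rt _]; apply: mdiff_orth; lia.
- by move=> t _; exact: Ex_mdiff_sqr.
by rewrite sumr_const_nat subn0 -[_ *+ n]mulr_natl => h1 h2; split.
Qed.

End Levels.

Lemma min1_sum_le (R : realType) (q : nat) (a : R) (b : 'I_q -> R) : 0 <= a ->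
  (forall i, 0 <= b i) -> Num.min 1 (a + \sum_i b i) <= a + \sum_i Num.min 1 (b i).
Proof.
move=> a0 b0.
have m0 i : 0 <= Num.min 1 (b i) by rewrite le_min ler01 b0.
have [[i hi]|hn] := pselect (exists i, 1 < b i).
  rewrite ge_min; apply/orP; left; rewrite (bigD1 i)//= (min_l (ltW hi)) addrCA.
  by rewrite lerDl addr_ge0// sumr_ge0.
rewrite ge_min; apply/orP; right; rewrite lerD2l; apply: ler_sum => i _.
by rewrite le_min lexx andbT leNgt; apply/negP => h; apply: hn; exists i.
Qed.

(** * Expansion of the compensator *)

Section Compensator.
Context (R : realType) (d : measure_display) (Omega : measurableType d)
        (Pr : probability Omega R) (eps B xi : int -> Omega -> R)
        (G : R -> R) (gn sg2 L M2 : R) (Pi : probability R R)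
        (p : nat) (beta : 'I_p -> R) (N : nat) (Psi : R).
Hypotheses (nm : noise_model Pr eps B xi G gn sg2 Pi) (cr : cdf_reg G L M2)
  (hPsi : forall N, \sum_(k < N) `|psi beta k| <= Psi).
Local Notation v := (ma_approx beta eps N).
Local Notation E := (Ex Pr).
Local Notation V1 t w := (l1lag p (v^~ w) t).
Local Notation yv' := (yv eps B xi beta N).
Local Notation cw' := (cw B xi beta).
Local Notation cont' := (cont B p).
Local Notation lvl' := (lvl eps B xi beta N).

Let meps t : measurable_fun setT (eps t) := nm_meas nm (None, t).
Let mB t : measurable_fun setT (B t) := nm_meas nm (Some true, t).
Let mxi t : measurable_fun setT (xi t) := nm_meas nm (Some false, t).

Lemma cont_ge0 t w : 0 <= cont' t w.
Proof. by apply: sumr_ge0 => j _; case/andP: (B01 nm (t - j%:Z) w). Qed.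

(** Indicators are 0 or 1, so a time is either clean or pays at least 1 in [cont]; errors at
    contaminated times can thus be charged to multiples of [cont]. *)
Lemma contP t w : (forall j, (j < p.+1)%N -> B (t - j%:Z) w = 0) \/ 1 <= cont' t w.
Proof.
have [h|/existsNP[j /not_implyP[jp h]]] := pselect (forall j, (j < p.+1)%N -> B (t - j%:Z) w = 0).
  by left.
right; rewrite /cont big_mkord (bigD1 (Ordinal jp))//=.
have -> : B (t - j%:Z) w = 1 by case: (nm_B nm (t - j%:Z) w).
by rewrite lerDl sumr_ge0// => i _; case/andP: (B01 nm (t - i%:Z) w).
Qed.

Lemma clean_cw t w : (forall j, (j < p.+1)%N -> B (t - j%:Z) w = 0) -> cw' t w = 0.
Proof.
move=> h; rewrite /cw big_mkord big1// => j _.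
by rewrite /cx (h j (ltn_ord j)) mul0r mulr0.
Qed.

Lemma clean_yv t w (i : 'I_p) : (forall j, (j < p.+1)%N -> B (t - j%:Z) w = 0) ->
  yv' (t - i.+1%:Z) w = v (t - i.+1%:Z) w.
Proof.
move=> h; rewrite /yv /cx (h i.+1) ?mul0r ?addr0//.
by rewrite ltnS; exact: ltn_ord.
Qed.

Lemma lin_bound (th : 'I_p -> R) (M : R) y t : (forall i, `|th i| <= M) ->
  `|lin th y t| <= M * l1lag p y t.
Proof.
move=> hM; apply: (le_trans (ler_norm_sum _ _ _)); rewrite mulr_sumr.
by apply: ler_sum => i _; rewrite normrM ler_wpM2r.
Qed.

Lemma lin_eta_bound (th : 'I_p -> R) (M eta : R) y t : (forall i, `|th i| <= M) -> 0 <= M ->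
  `|eta| <= 1 -> `|lin th y t + eta * (1 + l1lag p y t)| <= (M + 1) * (1 + l1lag p y t).
Proof.
move=> hM M0 he; have l0 := l1lag_ge0 p y t.
have l1 : 0 <= 1 + l1lag p y t by rewrite addr_ge0.
apply: (le_trans (ler_normD _ _)); rewrite mulrDl; apply: lerD.
  apply: (le_trans (lin_bound _ _ hM)); rewrite ler_wpM2l//.
  by rewrite lerDr.
by rewrite normrM (ger0_norm l1) ler_wpM2r.
Qed.

Lemma lvl_clean x s th eta t w : (forall j, (j < p.+1)%N -> B (t - j%:Z) w = 0) ->
  lvl' x s th eta t w = x + s * (lin th (v^~ w) t + eta * (1 + V1 t w)).
Proof.
move=> h; rewrite /lvl (clean_cw h) addr0.
have -> : lin th (yv'^~ w) t = lin th (v^~ w) t.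
  by apply: eq_bigr => i _; rewrite (clean_yv i h).
by have -> : l1lag p (yv'^~ w) t = V1 t w by apply: eq_bigr => i _; rewrite (clean_yv i h).
Qed.

Section PerTime.
Variables (x s M h : R) (th : 'I_p -> R) (eta : R).
Hypotheses (s0 : 0 <= s) (M0 : 0 <= M) (hth : forall i, `|th i| <= M)
  (heta : `|eta| <= h) (h1 : h <= 1).

Let eta1 : `|eta| <= 1. Proof. exact: le_trans heta h1. Qed.
Let h0 : 0 <= h. Proof. exact: le_trans (normr_ge0 _) heta. Qed.
Let L0 := L_ge0 cr.
Let M20 := M2_ge0 cr.
Let V0 t w : 0 <= 1 + V1 t w. Proof. by rewrite addr_ge0// l1lag_ge0. Qed.
Let LsC0 : 0 <= L * s * (M + 1).
Proof. by rewrite !mulr_ge0// addr_ge0. Qed.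

Lemma G_lvl_bound t w :
  `|G (lvl' x s th eta t w) - G x| <= cont' t w + L * s * (M + 1) * (1 + V1 t w).
Proof.
have [hc|hc] := contP t w; last first.
  apply: (le_trans (G_dist1 cr _ _)); apply: (le_trans hc).
  by rewrite lerDl mulr_ge0.
rewrite (lvl_clean _ _ _ _ hc); apply: (le_trans (cr_lip cr _ _)).
rewrite addrAC subrr add0r normrM (ger0_norm s0) -!mulrA.
apply: ler_wpDl; first exact: cont_ge0.
by rewrite ler_wpM2l// ler_wpM2l//; exact: lin_eta_bound.
Qed.

(** The first term comes from the widening [eta], the second is the Taylor remainder at clean times,
    the third covers contaminated times. The [min] with 1 keeps the contribution of gross errors
    bounded, as they may have no moments. *)
Definition comp_bound (t : int) (w : Omega) : R :=
  L * s * h * (1 + V1 t w) + M2 * (s * (M + 1)) ^+ 2 * (1 + V1 t w) ^+ 2 +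
  cont' t w * (2 * (L * s * (M + 1)) * (1 + V1 t w) +
     \sum_(i < p) Num.min 1 (L * s * (M + 1) * `|xi (t - i.+1%:Z) w|)).

Lemma comp_bound_le (g : R) t w : `|g| <= L ->
  (forall k, `|G (x + k) - G x - g * k| <= M2 * k ^+ 2) ->
  `|G (lvl' x s th eta t w) - G (x + cw' t w) - s * g * lin th (v^~ w) t| <= comp_bound t w.
Proof.
move=> gL hg.
have mn0 : 0 <= \sum_(i < p) Num.min 1 (L * s * (M + 1) * `|xi (t - i.+1%:Z) w|).
  by apply: sumr_ge0 => i _; rewrite le_min ler01 mulr_ge0.
have c0 := cont_ge0 t w.
have LV : 0 <= L * s * (M + 1) * (1 + V1 t w) by rewrite mulr_ge0.
have T1 : 0 <= L * s * h * (1 + V1 t w) by rewrite !mulr_ge0.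
have T2 : 0 <= M2 * (s * (M + 1)) ^+ 2 * (1 + V1 t w) ^+ 2.
  by rewrite !mulr_ge0// ?addr_ge0//; exact: l1lag_ge0.
have T3 : 0 <= 2 * (L * s * (M + 1)) * (1 + V1 t w) +
     \sum_(i < p) Num.min 1 (L * s * (M + 1) * `|xi (t - i.+1%:Z) w|).
  by rewrite addr_ge0// -mulrA mulr_ge0.
have [hc|hc] := contP t w.
  rewrite (lvl_clean _ _ _ _ hc) (clean_cw hc) addr0.
  set k := s * (lin _ _ _ + _).
  have -> : G (x + k) - G x - s * g * lin th (v^~ w) t =
      (G (x + k) - G x - g * k) + s * (g * (eta * (1 + V1 t w))) by rewrite /k; ring.
  rewrite /comp_bound; apply: ler_wpDr; first by rewrite mulr_ge0.
  rewrite [leRHS]addrC; apply: (le_trans (ler_normD _ _)); apply: lerD.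
    apply: (le_trans (hg k)); rewrite -mulrA ler_wpM2l//.
    rewrite -exprMn -real_normK ?num_real// lerXn2r ?nnegrE//.
      by rewrite mulr_ge0// mulr_ge0// addr_ge0.
    rewrite /k normrM (ger0_norm s0) -mulrA ler_wpM2l//; exact: lin_eta_bound.
  rewrite !normrM (ger0_norm s0) (ger0_norm (V0 t w)).
  rewrite [leRHS](_ : _ = s * (L * (h * (1 + V1 t w)))); last by ring.
  rewrite ler_wpM2l// ler_pM//; first by rewrite mulr_ge0.
  by rewrite ler_wpM2r.
(* A contaminated time: no expansion around [x], only the Lipschitz bound for the increment of [G]
   and a separate bound for the linear term, hence the factor 2. *)
apply: (@le_trans _ _ (2 * (L * s * (M + 1)) * (1 + V1 t w) +
     \sum_(i < p) Num.min 1 (L * s * (M + 1) * `|xi (t - i.+1%:Z) w|))); last first.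
  rewrite /comp_bound; apply: ler_wpDl; first exact: addr_ge0.
  by rewrite ler_peMl.
apply: (le_trans (ler_normB _ _)).
have hA : `|s * g * lin th (v^~ w) t| <= L * s * (M + 1) * (1 + V1 t w).
  rewrite !normrM (ger0_norm s0) [s * _]mulrC -[leRHS]mulrA.
  apply: ler_pM => //; first by rewrite mulr_ge0.
    by rewrite ler_wpM2r.
  apply: (le_trans (lin_bound _ _ hth)); apply: ler_pM => //; first exact: l1lag_ge0.
    by rewrite lerDl.
  by rewrite lerDr.
have hB : `|G (lvl' x s th eta t w) - G (x + cw' t w)| <= L * s * (M + 1) * (1 + V1 t w) +
     \sum_(i < p) Num.min 1 (L * s * (M + 1) * `|xi (t - i.+1%:Z) w|).
  apply: le_trans (min1_sum_le LV _); last by move=> i; rewrite mulr_ge0.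
  rewrite le_min (G_dist1 cr)/=.
  apply: (le_trans (cr_lip cr _ _)).
  rewrite /lvl addrAC subrr add0r normrM (ger0_norm s0) -mulr_sumr -mulrDr.
  rewrite mulrA -[leRHS]mulrA ler_wpM2l ?mulr_ge0//.
  apply: (le_trans (lin_eta_bound _ _ hth M0 eta1)).
  rewrite ler_wpM2l ?addr_ge0// -addrA lerD2l -big_split/=; apply: ler_sum => i _.
  apply: (le_trans (ler_normD _ _)); rewrite lerD2l /cx normrM ler_piMl//.
  exact: (B_norm nm).
apply: (le_trans (lerD hB hA)).
move: LV {hA hB T1 T2 T3 mn0}; move: (L * s * (M + 1)) (1 + V1 t w) (\sum_(i < p) _) => a b c _.
by rewrite [leRHS](_ : _ = a * b + c + a * b)//; ring.
Qed.

End PerTime.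

Definition cV : R := 2 + 2 * (p%:R ^+ 2 * (Psi ^+ 2 * sg2)).

Lemma measurable_V1 t : measurable_fun setT (fun w => V1 t w).
Proof.
apply: measurable_sum => i; apply: measurableT_comp => //.
exact: (measurable_v nm).
Qed.

Lemma Ex_V1_sqr t : Intg Pr (fun w => (1 + V1 t w) ^+ 2) /\
  E (fun w => (1 + V1 t w) ^+ 2) <= cV.
Proof.
have [] := @Ex_sqr_wsum _ _ _ Pr p (fun=> 1) (fun i w => `|v (t - i.+1%:Z) w|)
   (Psi ^+ 2 * sg2) p%:R.
- by move=> k; apply: measurableT_comp => //; exact: (measurable_v nm).
- by move=> k; under eq_fun do rewrite real_normK ?num_real//; exact: (Ex_v_sqr nm N hPsi _).1.
- by move=> k; under eq_fun do rewrite real_normK ?num_real//; exact: (Ex_v_sqr nm N hPsi _).2.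
- by rewrite normr1 sumr_const card_ord.
- by rewrite mulr_ge0 ?sqr_ge0// (sg2_ge0 nm).
have -> : (fun w => (\sum_(k < p) 1 * `|v (t - k.+1%:Z) w|) ^+ 2) = (fun w => V1 t w ^+ 2).
  by apply/funext => w; congr (_ ^+ 2); apply: eq_bigr => i _; rewrite mul1r.
move=> i1 e1.
have i2 := IntgD (Intg_cst Pr 2) (IntgZ 2 i1).
have le w : (1 + V1 t w) ^+ 2 <= 2 + 2 * V1 t w ^+ 2.
  by have := sqrrB_le2 1 (- V1 t w); rewrite opprK sqrrN expr1n mulr1.
have i3 : Intg Pr (fun w => (1 + V1 t w) ^+ 2).
  apply: (Intg_dom _ i2) => [|w]; last by rewrite ger0_norm ?sqr_ge0.
  by apply: measurable_funX; apply: measurable_funD => //; exact: measurable_V1.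
split=> //; apply: (le_trans (Ex_le i3 i2 le)).
rewrite ExD; [|exact: Intg_cst|exact: IntgZ].
by rewrite Ex_cst ExZ// lerD2l ler_wpM2l.
Qed.

Lemma Ex_V1 t : Intg Pr (fun w => 1 + V1 t w) /\ E (fun w => 1 + V1 t w) <= cV.
Proof.
have [i1 e1] := Ex_V1_sqr t.
have le w : 1 + V1 t w <= (1 + V1 t w) ^+ 2.
  have V0 := l1lag_ge0 p (v^~ w) t.
  by rewrite expr2 ler_peMl ?addr_ge0// lerDl.
have i2 : Intg Pr (fun w => 1 + V1 t w).
  apply: (Intg_dom _ i1) => [|w]; last first.
    by rewrite ger0_norm// addr_ge0//; exact: l1lag_ge0.
  by apply: measurable_funD => //; exact: measurable_V1.
by split=> //; apply: le_trans e1; exact: Ex_le.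
Qed.

Lemma Intg_cont t : Intg Pr (cont' t).
Proof. by apply: Intg_sum => j; exact: (Intg_B nm). Qed.

Lemma Ex_cont t : E (cont' t) = p.+1%:R * gn.
Proof.
rewrite /cont Ex_sum; last by move=> j; exact: (Intg_B nm).
under eq_bigr do rewrite (nm_Bmean nm).
by rewrite sumr_const_nat subn0 -[gn *+ _]mulr_natl.
Qed.

Lemma Ex_G_lvl (x s M eta : R) th t : 0 <= s -> 0 <= M -> (forall i, `|th i| <= M) ->
  `|eta| <= 1 ->
  E (fun w => `|G (lvl' x s th eta t w) - G x|) <= p.+1%:R * gn + L * s * (M + 1) * cV.
Proof.
move=> s0 M0 hth he.
have [iV eV] := Ex_V1 t.
apply: (@le_trans _ _ (E (fun w => cont' t w + L * s * (M + 1) * (1 + V1 t w)))).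
  apply: Ex_le.
  - apply: Intg_norm; apply: (@Intg_bounded _ _ _ _ _ 1) => [|w]; last exact: (G_dist1 cr).
    apply: measurable_funB => //; apply: measurableT_comp; first exact: cr_meas cr.
    exact: (lvl_measurable beta N nm).
  - by apply: IntgD; [exact: Intg_cont|exact: IntgZ].
  - by move=> w; exact: (G_lvl_bound x s0 M0 hth he (lexx 1)).
rewrite ExD; [|exact: Intg_cont|exact: IntgZ].
rewrite Ex_cont ExZ// lerD2l ler_wpM2l//.
by rewrite !mulr_ge0// ?addr_ge0//; exact: (L_ge0 cr).
Qed.

(** A truncated first moment of the gross errors: finite for every [Pi], and vanishing as [a] tends
    to 0. *)
Definition kapPi (a : R) : R := Rintegral Pi setT (fun y => Num.min 1 (a * `|y|)).

Lemma measurable_min1 (a : R) : measurable_fun setT (fun y : R => Num.min 1 (a * `|y|)).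
Proof.
by apply: measurable_minr => //; apply: measurable_funM.
Qed.

Lemma Intg_min1 (a : R) t : 0 <= a -> Intg Pr (fun w => Num.min 1 (a * `|xi t w|)).
Proof.
move=> a0; apply: (@Intg_bounded _ _ _ _ _ 1).
  exact: (measurableT_comp (measurable_min1 a)).
move=> w; rewrite ger0_norm; first by rewrite ge_min lexx.
by rewrite le_min ler01 mulr_ge0.
Qed.

(** The factor of [cont] contains no contamination indicator, hence is independent of each of them,
    and its small mean gets multiplied by [gn]. Summed over n times and divided by sqrt(n), the
    product is still small. *)
Lemma Ex_comp_bound (s M h : R) t : 0 <= s -> 0 <= M -> 0 <= h ->
  Intg Pr (comp_bound s M h t) /\
  E (comp_bound s M h t) <= L * s * h * cV + M2 * (s * (M + 1)) ^+ 2 * cV +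
     p.+1%:R * gn * (2 * (L * s * (M + 1)) * cV + p%:R * kapPi (L * s * (M + 1))).
Proof.
move=> s0 M0 h0.
have L0 := L_ge0 cr; have M20 := M2_ge0 cr; have g0 := gn_ge0 nm.
have a0 : 0 <= L * s * (M + 1) by rewrite !mulr_ge0// addr_ge0.
set a := L * s * (M + 1) in a0 *.
have [iV eV] := Ex_V1 t; have [iV2 eV2] := Ex_V1_sqr t.
pose f w := 2 * a * (1 + V1 t w) + \sum_(i < p) Num.min 1 (a * `|xi (t - i.+1%:Z) w|).
pose J2 (k : option bool * int) : Prop := k.1 <> Some true.
pose J1 (j : nat) (k : option bool * int) : Prop := k = (Some true, t - j%:Z).
have im : Intg Pr (fun w => \sum_(i < p) Num.min 1 (a * `|xi (t - i.+1%:Z) w|)).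
  by apply: Intg_sum => i; exact: Intg_min1.
have iF : Intg Pr f by apply: IntgD => //; exact: IntgZ.
have sF : sigm (cyl (noise eps B xi) J2) f.
  apply: measurable_funD.
    apply: measurable_funM => //; apply: measurable_funD => //.
    apply: measurable_sum => i; apply: measurableT_comp => //.
    exact: sigm_v.
  apply: measurable_sum => i; apply: (measurableT_comp (measurable_min1 a)).
  exact: sigm_xi.
have iBF j : Intg Pr (fun w => B (t - j%:Z) w * f w).
  apply: (Intg_dom _ (Intg_norm iF)) => [|w].
    by apply: measurable_funM => //; exact: Intg_measurable iF.
  by rewrite normrM ler_piMl//; exact: (B_norm nm).
have eBF j : E (fun w => B (t - j%:Z) w * f w) = gn * E f.
  rewrite (@Ex_noiseM _ _ _ _ _ _ _ _ _ _ _ nm (J1 j) J2)//.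
  - by rewrite (nm_Bmean nm).
  - by move=> k -> /=.
  - exact: sigm_B.
  - exact: (Intg_B nm).
have eF : E f <= 2 * a * cV + p%:R * kapPi a.
  rewrite /f ExD//; last exact: IntgZ.
  rewrite ExZ//; apply: lerD; first by rewrite ler_wpM2l// mulr_ge0.
  rewrite Ex_sum; last by move=> i; exact: Intg_min1.
  under eq_bigr do rewrite (Ex_xi nm _ (measurable_min1 a)).
  by rewrite sumr_const card_ord -[_ *+ p]mulr_natl.
have cE : (fun w => cont' t w * f w) = (fun w => \sum_(0 <= j < p.+1) B (t - j%:Z) w * f w).
  by apply/funext => w; rewrite /cont mulr_suml.
have iC : Intg Pr (fun w => cont' t w * f w) by rewrite cE; apply: Intg_sum => j.
have iT1 := IntgZ (L * s * h) iV; have iT2 := IntgZ (M2 * (s * (M + 1)) ^+ 2) iV2.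
have i12 := IntgD iT1 iT2.
split; first exact: IntgD.
rewrite (_ : comp_bound s M h t = fun w => (L * s * h * (1 + V1 t w) +
   M2 * (s * (M + 1)) ^+ 2 * (1 + V1 t w) ^+ 2) + cont' t w * f w)//.
rewrite ExD// ExD// !ExZ//; apply: lerD; first apply: lerD.
- by rewrite ler_wpM2l// !mulr_ge0.
- by rewrite ler_wpM2l// mulr_ge0// sqr_ge0.
rewrite cE Ex_sum//; under eq_bigr do rewrite eBF.
rewrite sumr_const_nat subn0 -[_ *+ _]mulr_natl -mulrA ler_wpM2l// ler_wpM2l//.
Qed.

End Compensator.

(* Adding the contaminations one at a time: a step changes G by its own
   single-contamination effect unless an earlier one is already present. *)
Lemma contamination_telescope (R : realType) (G : R -> R) (x : R) (b y c : nat -> R) (q : nat) :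
  (forall u v, `|G u - G v| <= 1) -> (forall j, b j = 0 \/ b j = 1) ->
  `|G (x + \sum_(0 <= j < q) c j * (b j * y j)) - G x -
    \sum_(0 <= j < q) b j * (G (x + c j * y j) - G x)| <=
  2 * \sum_(0 <= k < q) \sum_(0 <= j < k) b k * b j.
Proof.
move=> G1 b01; have b0 j : 0 <= b j by case: (b01 j) => ->.
elim: q => [|q IH]; first by rewrite !big_geq// addr0 subrr subr0 normr0 mulr0.
rewrite !big_nat_recr//=; set S := \sum_(0 <= j < q) c j * _ in IH *.
set Z := \sum_(0 <= j < q) b j * _ in IH *.
have [bq|bq] := b01 q.
  rewrite !bq !mul0r mulr0 !addr0; apply: (le_trans IH).
  by rewrite [X in _ + X]big1 ?addr0// => j _; rewrite mul0r.
rewrite !bq !mul1r mulrDr; under [X in _ + 2 * X]eq_bigr do rewrite mul1r.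
have [hz|/existsNP[j /not_implyP[jq hj]]] := pselect (forall j, (j < q)%N -> b j = 0).
  have S0 : S = 0 by rewrite /S big_mkord big1// => j _; rewrite (hz j (ltn_ord j)) mul0r mulr0.
  have Z0 : Z = 0 by rewrite /Z big_mkord big1// => j _; rewrite (hz j (ltn_ord j)) mul0r.
  rewrite S0 Z0 !add0r subrr normr0 addr_ge0// mulr_ge0//; apply: sumr_ge0 => k _ //.
  by apply: sumr_ge0 => l _; rewrite mulr_ge0.
have hs : 1 <= \sum_(0 <= j < q) b j.
  rewrite big_mkord (bigD1 (Ordinal jq))//=; have -> : b j = 1 by case: (b01 j).
  by rewrite lerDl sumr_ge0.
rewrite [X in `|X|](_ : _ = (G (x + S) - G x - Z) +
  ((G (x + (S + c q * y q)) - G (x + S)) - (G (x + c q * y q) - G x))); last by ring.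
apply: (le_trans (ler_normD _ _)); apply: lerD => //.
apply: (le_trans (ler_normB _ _)).
have h1 := G1 (x + (S + c q * y q)) (x + S); have h2 := G1 (x + c q * y q) x.
by apply: (le_trans (lerD h1 h2)); rewrite -[1 + 1]/(2 : R) ler_peMr.
Qed.

(** * Effect of single contaminations and total error of the comparison *)

Section Empirical.
Context (R : realType) (d : measure_display) (Omega : measurableType d)
        (Pr : probability Omega R) (eps B xi : int -> Omega -> R)
        (G : R -> R) (gn sg2 L M2 : R) (Pi : probability R R)
        (p : nat) (beta : 'I_p -> R) (N : nat) (Psi : R).
Hypotheses (nm : noise_model Pr eps B xi G gn sg2 Pi) (cr : cdf_reg G L M2)
  (hPsi : forall N, \sum_(k < N) `|psi beta k| <= Psi).
Local Notation v := (ma_approx beta eps N).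
Local Notation E := (Ex Pr).
Local Notation cw' := (cw B xi beta).
Local Notation lvl' := (lvl eps B xi beta N).
Local Notation mdiff' := (mdiff eps B xi G beta N).
Local Notation comp_bound' := (comp_bound eps B xi L M2 beta N).
Local Notation cV' := (cV sg2 p Psi).

Let meps t : measurable_fun setT (eps t) := nm_meas nm (None, t).
Let mB t : measurable_fun setT (B t) := nm_meas nm (Some true, t).
Let mxi t : measurable_fun setT (xi t) := nm_meas nm (Some false, t).

(** Counts the pairs of contaminated times among the p + 1 times that enter one residual. *)
Definition dbl (t : int) (w : Omega) : R :=
  \sum_(0 <= k < p.+1) \sum_(0 <= j < k) B (t - k%:Z) w * B (t - j%:Z) w.

Definition zc (x : R) (j : nat) (t : int) (w : Omega) : R :=
  B (t - j%:Z) w * (G (x + beta_ext beta j * xi (t - j%:Z) w) - G x).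

Definition muz (x : R) (j : nat) : R :=
  gn * (Rintegral Pi setT (fun y => G (x + beta_ext beta j * y)) - G x).

Lemma contamination_error x t w :
  `|G (x + cw' t w) - G x - \sum_(0 <= j < p.+1) zc x j t w| <= 2 * dbl t w.
Proof.
apply: (@contamination_telescope _ _ _ (fun j => B (t - j%:Z) w)
   (fun j => xi (t - j%:Z) w) (beta_ext beta)); first exact: (G_dist1 cr).
by move=> j; exact: nm_B nm _ w.
Qed.

Lemma Intg_BB r t : Intg Pr (fun w => B r w * B t w).
Proof.
apply: (@Intg_bounded _ _ _ _ _ 1); first exact: measurable_funM.
by move=> w; rewrite normrM -[leRHS]mulr1 ler_pM//; exact: (B_norm nm).
Qed.

Lemma Ex_BB r t : r != t -> E (fun w => B r w * B t w) = gn ^+ 2.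
Proof.
move=> rt; rewrite (@Ex_noiseM _ _ _ _ _ _ _ _ _ _ _ nm
  (fun k => k = (Some true, r)) (fun k => k = (Some true, t))).
- by rewrite !(nm_Bmean nm).
- by move=> k -> [] /eqP; rewrite (negbTE rt).
- exact: sigm_B.
- exact: sigm_B.
- exact: (Intg_B nm).
- exact: (Intg_B nm).
- exact: Intg_BB.
Qed.

Lemma Ex_dbl t : Intg Pr (dbl t) /\ E (dbl t) <= (p.+1%:R * gn) ^+ 2.
Proof.
have ii k : Intg Pr (fun w => \sum_(0 <= j < k) B (t - k%:Z) w * B (t - j%:Z) w).
  by apply: Intg_sum => j; exact: Intg_BB.
split; first exact: Intg_sum.
rewrite /dbl Ex_sum//; apply: (@le_trans _ _ (\sum_(0 <= k < p.+1) p.+1%:R * gn ^+ 2)).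
  rewrite !big_mkord; apply: ler_sum => k _.
  rewrite Ex_sum; last by move=> j; exact: Intg_BB.
  rewrite big_mkord (eq_bigr (fun=> gn ^+ 2)); last first.
    by move=> j _; apply: Ex_BB; have := ltn_ord j; lia.
  rewrite sumr_const card_ord -[_ *+ _]mulr_natl ler_wpM2r ?sqr_ge0// ler_nat.
  exact: ltnW (ltn_ord k).
by rewrite sumr_const_nat subn0 -[_ *+ _]mulr_natl exprMn mulrA -expr2.
Qed.

Let mGx (x c : R) : measurable_fun setT (fun y : R => G (x + c * y)).
Proof.
by apply: (measurableT_comp (cr_meas cr)); apply: measurable_funD => //; apply: measurable_funM.
Qed.

Let G1 x : `|G x| <= 1.
Proof. by have /andP[a b] := cr_bnd cr x; rewrite ger0_norm. Qed.

Lemma zc_measurable x j t : measurable_fun setT (zc x j t).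
Proof.
apply: measurable_funM => //; apply: measurable_funB => //.
exact: (measurableT_comp (mGx x (beta_ext beta j))).
Qed.

Lemma zc_norm x j t w : `|zc x j t w| <= B (t - j%:Z) w.
Proof.
have /andP[b0 _] := B01 nm (t - j%:Z) w.
by rewrite /zc normrM (ger0_norm b0) ler_piMr//; exact: (G_dist1 cr).
Qed.

Lemma zc_norm1 x j t w : `|zc x j t w| <= 1.
Proof.
by apply: (le_trans (zc_norm _ _ _ _)); case/andP: (B01 nm (t - j%:Z) w).
Qed.

Lemma sigm_zc x j t : sigm (cyl (noise eps B xi)
  (fun k => k = (Some true, t - j%:Z) \/ k = (Some false, t - j%:Z))) (zc x j t).
Proof.
apply: measurable_funM; first by apply: sigm_B; left.
apply: measurable_funB => //; apply: (measurableT_comp (mGx x (beta_ext beta j))).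
by apply: sigm_xi; right.
Qed.

Lemma Ex_zc x j t : E (zc x j t) = muz x j.
Proof.
have i1 : Intg Pr (fun w => G (x + beta_ext beta j * xi (t - j%:Z) w)).
  apply: (@Intg_bounded _ _ _ _ _ 1) => //.
  exact: (measurableT_comp (mGx x (beta_ext beta j))).
have i2 := IntgB i1 (Intg_cst Pr (G x)).
rewrite /zc (@Ex_noiseM _ _ _ _ _ _ _ _ _ _ _ nm
  (fun k => k = (Some true, t - j%:Z)) (fun k => k = (Some false, t - j%:Z)))//.
- rewrite (nm_Bmean nm) ExB//; last exact: Intg_cst.
  by rewrite Ex_cst (Ex_xi nm _ (mGx x (beta_ext beta j))).
- by move=> k -> [].
- exact: sigm_B.
- apply: measurable_funB => //; apply: (measurableT_comp (mGx x (beta_ext beta j))).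
  exact: sigm_xi.
- exact: (Intg_B nm).
- by apply: (@Intg_bounded _ _ _ _ _ 1); [exact: zc_measurable|exact: zc_norm1].
Qed.

Lemma gn_le1 : gn <= 1.
Proof.
rewrite -(nm_Bmean nm 0) -[leRHS](Ex_cst Pr 1).
apply: Ex_le; [exact: (Intg_B nm)|exact: Intg_cst|].
by move=> w; case/andP: (B01 nm 0 w).
Qed.

Lemma Intg_zc x j t : Intg Pr (zc x j t).
Proof. by apply: (@Intg_bounded _ _ _ _ _ 1); [exact: zc_measurable|exact: zc_norm1]. Qed.

Lemma muz_norm x j : `|muz x j| <= gn.
Proof.
rewrite -(Ex_zc x j 0); apply: (le_trans (Ex_norm (Intg_zc _ _ _))).
rewrite -(nm_Bmean nm (0 - j%:Z)); apply: Ex_le.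
- exact: Intg_norm (Intg_zc _ _ _).
- exact: (Intg_B nm).
- by move=> w; exact: zc_norm.
Qed.

(** At a fixed lag the effects of different times are independent, and each has second moment of
    order [gn], since it vanishes without contamination. Taking the lags one at a time avoids the
    dependence between lags. *)
Lemma Ex_zc_sum_sqr x j n :
  Intg Pr (fun w => (\sum_(0 <= t < n) (zc x j t.+1%:Z w - muz x j)) ^+ 2) /\
  E (fun w => (\sum_(0 <= t < n) (zc x j t.+1%:Z w - muz x j)) ^+ 2) <= n%:R * (4 * gn).
Proof.
have g0 := gn_ge0 nm; have g1 := gn_le1; have m1 := muz_norm x j.
have mz t : measurable_fun setT (fun w => zc x j t w - muz x j).
  by apply: measurable_funB => //; exact: zc_measurable.
have bz t w : `|zc x j t w - muz x j| <= 2.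
  apply: (le_trans (ler_normB _ _)); rewrite -[2]/(1 + 1 : R).
  by apply: lerD; [exact: zc_norm1|exact: le_trans m1 g1].
have iz t : Intg Pr (fun w => zc x j t w - muz x j).
  by apply: IntgB; [exact: Intg_zc|exact: Intg_cst].
have [] := @Ex_sqr_orthogonal _ _ _ Pr n (fun t w => zc x j t.+1%:Z w - muz x j) (fun=> 4 * gn).
- by move=> t; exact: mz.
- move=> t; apply: (@Intg_bounded _ _ _ _ _ 4); first exact: measurable_funX.
  move=> w; rewrite normrX [leRHS](_ : 4 = 2 ^+ 2); last by ring.
  by rewrite lerXn2r ?nnegrE.
- move=> r t /andP[rt _].
  rewrite (@Ex_noiseM _ _ _ _ _ _ _ _ _ _ _ nm
   (fun k => k = (Some true, r.+1%:Z - j%:Z) \/ k = (Some false, r.+1%:Z - j%:Z))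
   (fun k => k = (Some true, t.+1%:Z - j%:Z) \/ k = (Some false, t.+1%:Z - j%:Z)))//.
  + rewrite ExB; [|exact: Intg_zc|exact: Intg_cst].
    by rewrite Ex_zc Ex_cst subrr mul0r.
  + by move=> k [] -> [] []; lia.
  + by apply: measurable_funB => //; exact: sigm_zc.
  + by apply: measurable_funB => //; exact: sigm_zc.
  + apply: (@Intg_bounded _ _ _ _ _ (2 * 2)); first exact: measurable_funM.
    by move=> w; rewrite normrM ler_pM.
- move=> t _.
  have ib := IntgD (IntgZ 2 (Intg_B nm (t.+1%:Z - j%:Z))) (Intg_cst Pr (2 * gn)).
  apply: (@le_trans _ _ (E (fun w => 2 * B (t.+1%:Z - j%:Z) w + 2 * gn))).
    apply: Ex_le => //.
      apply: (@Intg_bounded _ _ _ _ _ 4); first exact: measurable_funX.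
      move=> w; rewrite normrX [leRHS](_ : 4 = 2 ^+ 2); last by ring.
      by rewrite lerXn2r ?nnegrE.
    move=> w; apply: (le_trans (sqrrB_le2 _ _)); apply: lerD; rewrite ler_wpM2l//.
      apply: le_trans (zc_norm x j t.+1%:Z w); rewrite -real_normK ?num_real// expr2.
      by rewrite ler_piMl// zc_norm1.
    apply: le_trans m1; rewrite -real_normK ?num_real// expr2 ler_piMl//.
    exact: le_trans (muz_norm x j) g1.
  rewrite ExD; [|by apply: IntgZ; exact: (Intg_B nm)|exact: Intg_cst].
  rewrite Ex_cst ExZ; last exact: (Intg_B nm).
  by rewrite (nm_Bmean nm); clear bz; lra.
by rewrite sumr_const_nat subn0 -[_ *+ n]mulr_natl => h1 h2; split.
Qed.

(** The four contributions are the compensator, the term linear in the estimation error, double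
    contaminations, and the fluctuation of single ones. None depends on [th] or [eta], so one Markov
    bound covers the whole grid and only the martingale needs a union bound. *)
Definition emp_err (x s M h : R) (n : nat) (w : Omega) : R :=
  s * (\sum_(0 <= t < n) comp_bound' s M h t.+1%:Z w) +
  s ^+ 2 * L * M * (\sum_(i < p) `|\sum_(0 <= t < n) v (t.+1%:Z - i.+1%:Z) w|) +
  s * (\sum_(0 <= t < n) 2 * dbl t.+1%:Z w) +
  \sum_(0 <= j < p.+1) s * `|\sum_(0 <= t < n) (zc x j t.+1%:Z w - muz x j)|.

Lemma emp_decomp (x s M h : R) (n : nat) th eta w : 0 <= s -> 0 <= M ->
  (forall i, `|th i| <= M) -> `|eta| <= h -> h <= 1 ->
  `|s * (\sum_(0 <= t < n) ((eps t.+1%:Z w <= lvl' x s th eta t.+1%:Z w)%R%:R -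
                           (eps t.+1%:Z w <= x)%R%:R)) -
    s * n%:R * \sum_(0 <= j < p.+1) muz x j| <=
  `|s * \sum_(0 <= t < n) mdiff' x s th eta t.+1%:Z w| + emp_err x s M h n w.
Proof.
move=> s0 M0 hth he h1.
have [g [gL hg]] := cr_taylor cr x.
have L0 := L_ge0 cr.
pose A t := G (lvl' x s th eta t w) - G (x + cw' t w) - s * g * lin th (v^~ w) t.
pose C t := G (x + cw' t w) - G x - \sum_(0 <= j < p.+1) zc x j t w.
rewrite (_ : s * _ - _ = s * (\sum_(0 <= t < n) mdiff' x s th eta t.+1%:Z w) +
   (s * (\sum_(0 <= t < n) A t.+1%:Z) +
    s ^+ 2 * g * (\sum_(0 <= t < n) lin th (v^~ w) t.+1%:Z) +
    s * (\sum_(0 <= t < n) C t.+1%:Z) +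
    \sum_(0 <= j < p.+1) s * (\sum_(0 <= t < n) (zc x j t.+1%:Z w - muz x j)))); last first.
  have -> : \sum_(0 <= j < p.+1) s * (\sum_(0 <= t < n) (zc x j t.+1%:Z w - muz x j)) =
      s * \sum_(0 <= t < n) \sum_(0 <= j < p.+1) (zc x j t.+1%:Z w - muz x j).
    by rewrite -mulr_sumr exchange_big.
  rewrite (_ : s * n%:R * _ = s * \sum_(0 <= t < n) \sum_(0 <= j < p.+1) muz x j); last first.
    by rewrite -mulrA; congr (_ * _); rewrite [RHS]sumr_const_nat subn0 -[RHS]mulr_natl.
  rewrite (_ : s ^+ 2 * g * _ = s * \sum_(0 <= t < n) s * g * lin th (v^~ w) t.+1%:Z); last first.
    by rewrite -mulr_sumr; ring.
  rewrite -mulrBr -!mulrDr; congr (_ * _); rewrite -sumrB -!big_split/=.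
  apply: eq_bigr => t _; rewrite /mdiff /A /C sumrB.
  move: (\sum_(0 <= j < p.+1) zc _ _ _ _) (\sum_(0 <= j < p.+1) muz _ _) => a b.
  by ring.
apply: (le_trans (ler_normD _ _)); rewrite lerD2l /emp_err.
apply: (le_trans (ler_normD _ _)); apply: lerD; last first.
  apply: (le_trans (ler_norm_sum _ _ _)); apply: ler_sum => j _.
  by rewrite normrM (ger0_norm s0).
apply: (le_trans (ler_normD _ _)); apply: lerD; last first.
  rewrite normrM (ger0_norm s0) ler_wpM2l//; apply: (le_trans (ler_norm_sum _ _ _)).
  by apply: ler_sum => t _; exact: contamination_error.
apply: (le_trans (ler_normD _ _)); apply: lerD.
  rewrite normrM (ger0_norm s0) ler_wpM2l//; apply: (le_trans (ler_norm_sum _ _ _)).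
  apply: ler_sum => t _.
  exact: (@comp_bound_le _ _ _ _ _ _ _ _ _ _ _ _ _ _ beta N nm cr x s M h th eta s0 M0 hth he h1 g t.+1%:Z w gL hg).
rewrite /lin exchange_big/= 2!normrM (ger0_norm (sqr_ge0 s)).
rewrite -[leRHS]mulrA -[leRHS]mulrA -[leLHS]mulrA ler_wpM2l ?sqr_ge0//.
apply: ler_pM => //; rewrite mulr_sumr; apply: (le_trans (ler_norm_sum _ _ _)).
by apply: ler_sum => i _; rewrite -mulr_sumr normrM ler_wpM2r.
Qed.

(** [q] stands for an upper bound of 2 sqrt(gn), the size of the normalised fluctuation of single
    contaminations. *)
Lemma Ex_emp_err (x M h q : R) (n : nat) : (0 < n)%N -> 0 <= M -> 0 <= h -> 0 < q ->
  4 * gn <= q ^+ 2 -> let r := Num.sqrt n%:R in let s := r^-1 in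
  Intg Pr (emp_err x s M h n) /\ (forall w, 0 <= emp_err x s M h n w) /\
  E (emp_err x s M h n) <=
    r * (L * s * h * cV' + M2 * (s * (M + 1)) ^+ 2 * cV' +
     p.+1%:R * gn * (2 * (L * s * (M + 1)) * cV' + p%:R * kapPi Pi (L * s * (M + 1)))) +
    L * M * p%:R * (Psi ^+ 2 * sg2 + 1) * s + r * (2 * (p.+1%:R * gn) ^+ 2) + p.+1%:R * q.
Proof.
move=> n0 M0 h0 q0 hq r s.
have r0 : 0 < r by rewrite sqrtr_gt0 ltr0n.
have s0 : 0 < s by rewrite invr_gt0.
have rr : r ^+ 2 = n%:R by rewrite sqr_sqrtr.
have sn : s * n%:R = r by rewrite -rr /s expr2 mulKf// gt_eqF.
have L0 := L_ge0 cr; have sg0 := sg2_ge0 nm.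
pose cb := L * s * h * cV' + M2 * (s * (M + 1)) ^+ 2 * cV' +
     p.+1%:R * gn * (2 * (L * s * (M + 1)) * cV' + p%:R * kapPi Pi (L * s * (M + 1))).
have icb t : Intg Pr (comp_bound' s M h t) by exact: (Ex_comp_bound N nm cr hPsi t (ltW s0) M0 h0).1.
have ecb t : E (comp_bound' s M h t) <= cb by exact: (Ex_comp_bound N nm cr hPsi t (ltW s0) M0 h0).2.
pose vs (i : 'I_p) w := \sum_(0 <= t < n) v (t.+1%:Z - i.+1%:Z) w.
pose zs (j : nat) w := \sum_(0 <= t < n) (zc x j t.+1%:Z w - muz x j).
have mvs i : measurable_fun setT (vs i).
  by apply: measurable_sum => t; exact: (measurable_v nm).
have mzs j : measurable_fun setT (zs j).
  by apply: measurable_sum => t; apply: measurable_funB => //; exact: zc_measurable.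
have ivs i : Intg Pr (fun w => `|vs i w|).
  by apply: Intg_norm; apply: Intg_of_sqr => //; exact: (Ex_v_sum_sqr nm N hPsi n i.+1%:Z).1.
have izs j : Intg Pr (fun w => `|zs j w|).
  by apply: Intg_norm; apply: Intg_of_sqr => //; exact: (Ex_zc_sum_sqr x j n).1.
set c := Psi ^+ 2 * sg2 + 1.
have c0 : 0 <= Psi ^+ 2 * sg2 by rewrite mulr_ge0 ?sqr_ge0.
have evs i : E (fun w => `|vs i w|) <= r * c.
  apply: Ex_norm_le_sqr => //.
  - exact: (Ex_v_sum_sqr nm N hPsi n i.+1%:Z).1.
  - by rewrite mulr_gt0// /c ltr_wpDl.
  apply: (le_trans (Ex_v_sum_sqr nm N hPsi n i.+1%:Z).2).
  rewrite exprMn rr mulrCA ler_wpM2l// /c sqrrD expr1n mulr1.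
  by have := sqr_ge0 (Psi ^+ 2 * sg2); move: (Psi ^+ 2 * sg2) c0 => y y0; lra.
have ezs j : E (fun w => `|zs j w|) <= r * q.
  apply: Ex_norm_le_sqr => //; first exact: (Ex_zc_sum_sqr x j n).1.
    by rewrite mulr_gt0.
  by apply: (le_trans (Ex_zc_sum_sqr x j n).2); rewrite exprMn rr ler_wpM2l.
have idb t : Intg Pr (fun w => 2 * dbl t w) by apply: IntgZ; exact: (Ex_dbl t).1.
have edb t : E (fun w => 2 * dbl t w) <= 2 * (p.+1%:R * gn) ^+ 2.
  by rewrite ExZ ?ler_wpM2l//; [exact: (Ex_dbl t).2|exact: (Ex_dbl t).1].
have iT1 : Intg Pr (fun w => s * \sum_(0 <= t < n) comp_bound' s M h t.+1%:Z w).
  by apply: IntgZ; exact: Intg_sum.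
have iT2 : Intg Pr (fun w => s ^+ 2 * L * M * \sum_(i < p) `|vs i w|).
  by apply: IntgZ; exact: Intg_sum.
have iT3 : Intg Pr (fun w => s * \sum_(0 <= t < n) 2 * dbl t.+1%:Z w).
  by apply: IntgZ; exact: Intg_sum.
have iT4 : Intg Pr (fun w => \sum_(0 <= j < p.+1) s * `|zs j w|).
  by apply: Intg_sum => j; exact: IntgZ.
have iT12 := IntgD iT1 iT2; have iT123 := IntgD iT12 iT3.
have iT := IntgD iT123 iT4.
have V0 t w : 0 <= 1 + l1lag p (v^~ w) t by rewrite addr_ge0//; exact: l1lag_ge0.
have Ls0 : 0 <= L * s * (M + 1) by rewrite !mulr_ge0 ?(ltW s0)// addr_ge0.
have M20 := M2_ge0 cr.
split; first exact: iT.
split.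
  move=> w; rewrite /emp_err !addr_ge0//.
  - rewrite mulr_ge0 ?(ltW s0)// sumr_ge0// => t _; rewrite /comp_bound.
    rewrite addr_ge0//; first rewrite addr_ge0//.
    + by rewrite mulr_ge0// mulr_ge0// mulr_ge0// ltW.
    + by rewrite mulr_ge0 ?sqr_ge0// mulr_ge0// sqr_ge0.
    rewrite mulr_ge0//; first exact: (@cont_ge0 _ _ _ _ _ _ _ _ _ _ _ p nm).
    rewrite addr_ge0//; first by rewrite mulr_ge0// mulr_ge0.
    by apply: sumr_ge0 => i _; rewrite le_min ler01 mulr_ge0.
  - by rewrite mulr_ge0 ?sumr_ge0// mulr_ge0// mulr_ge0// sqr_ge0.
  - rewrite mulr_ge0 ?(ltW s0)// sumr_ge0// => t _; rewrite mulr_ge0//.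
    apply: sumr_ge0 => k _; apply: sumr_ge0 => l _.
    by rewrite mulr_ge0//; [case/andP: (B01 nm (t.+1%:Z - k%:Z) w)|case/andP: (B01 nm (t.+1%:Z - l%:Z) w)].
  - by apply: sumr_ge0 => j _; rewrite mulr_ge0 ?(ltW s0).
rewrite -/cb (_ : emp_err x s M h n = fun w =>
   s * (\sum_(0 <= t < n) comp_bound' s M h t.+1%:Z w) +
   s ^+ 2 * L * M * (\sum_(i < p) `|vs i w|) + s * (\sum_(0 <= t < n) 2 * dbl t.+1%:Z w) +
   \sum_(0 <= j < p.+1) s * `|zs j w|)//.
rewrite ExD// ExD// ExD//; apply: lerD; first apply: lerD; first apply: lerD.
- rewrite ExZ; last exact: Intg_sum.
  rewrite Ex_sum; last by [].
  rewrite -sn -mulrA ler_wpM2l ?(ltW s0)//.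
  apply: (@le_trans _ _ (\sum_(0 <= t < n) cb)); first by apply: ler_sum => t _.
  by rewrite sumr_const_nat subn0 -[_ *+ n]mulr_natl.
- rewrite ExZ; last exact: Intg_sum.
  rewrite Ex_sum; last by [].
  rewrite [leRHS](_ : _ = s ^+ 2 * L * M * (p%:R * (r * c))); last first.
    have sr : s * r = 1 by rewrite mulVf// gt_eqF.
    by rewrite -[LHS]mulr1 -sr; ring.
  rewrite ler_wpM2l//; first by rewrite mulr_ge0// mulr_ge0// sqr_ge0.
  apply: (@le_trans _ _ (\sum_(i < p) r * c)); first by apply: ler_sum => i _.
  by rewrite sumr_const card_ord -[_ *+ p]mulr_natl.
- rewrite ExZ; last exact: Intg_sum.
  rewrite Ex_sum; last by [].
  rewrite -sn -mulrA ler_wpM2l ?(ltW s0)//.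
  apply: (@le_trans _ _ (\sum_(0 <= t < n) 2 * (p.+1%:R * gn) ^+ 2)).
    by apply: ler_sum => t _.
  by rewrite sumr_const_nat subn0 -[_ *+ n]mulr_natl.
rewrite Ex_sum; last by move=> j; exact: IntgZ.
apply: (@le_trans _ _ (\sum_(0 <= j < p.+1) q)).
  apply: ler_sum => j _; rewrite ExZ//.
  by rewrite [leRHS](_ : q = s * (r * q)) ?ler_wpM2l ?(ltW s0)// /s mulKf// gt_eqF.
by rewrite sumr_const_nat subn0 -[_ *+ _]mulr_natl.
Qed.

End Empirical.

Lemma inv_sqrt_small (R : realType) (e : R) : 0 < e -> exists N : nat, forall n, (N <= n)%N ->
  (0 < n)%N /\ (Num.sqrt n%:R : R)^-1 <= e.
Proof.
move=> e0; have [N hN] := exists_nat_gt (e ^- 2 : R).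
have N0 : (0 < N)%N.
  by rewrite -(ltr0n R); apply: le_lt_trans hN; rewrite invr_ge0 sqr_ge0.
exists N => n Nn; have n0 : (0 < n)%N := leq_trans N0 Nn; split=> //.
have r0 : 0 < Num.sqrt n%:R :> R by rewrite sqrtr_gt0 ltr0n.
rewrite -[leRHS]invrK lef_pV2 ?posrE ?invr_gt0//.
rewrite -ler_sqr ?nnegrE ?invr_ge0 ?(ltW e0) ?(ltW r0)// sqr_sqrtr// exprVn.
by apply: (le_trans (ltW hN)); rewrite ler_nat.
Qed.

Lemma small_mul (R : realType) (A b s : R) : 0 <= A -> 0 < b -> 0 <= s ->
  s <= b / (A + 1) -> s * A <= b.
Proof.
move=> A0 b0 s0; rewrite ler_pdivlMr ?ltr_wpDl// mulrDr mulr1 => h.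
by apply: le_trans h; rewrite lerDl.
Qed.

Lemma kapPi_small (R : realType) (Pi : probability R R) (e : R) : 0 < e ->
  exists a0 : R, 0 < a0 /\ forall a, 0 <= a <= a0 -> kapPi Pi a <= e.
Proof.
move=> e0.
have [K [K0 hK]] : exists K : R, 0 < K /\ prob_le Pi [set y | K < `|y|] (e / 2).
  (* Tightness of the single law [Pi] is read off from the constant process on the line under
     [Pi]. *)
  have mi (t : int) : measurable_fun setT (fun y : R => y) by exact: measurable_id.
  have st : strictly_stationary Pi (fun (_ : int) (y : R) => y) by move=> s a h.
  have [K [K0 hK]] := stationary_tight mi st (divr_gt0 e0 (ltr0Sn R 1)).
  by exists K; split => //; exact: (hK 0).
have mb : measurable_fun setT (fun y : R => K < `|y|) by apply: measurable_fun_ltr.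
exists (e / (2 * K)); split; first by rewrite divr_gt0// mulr_gt0.
move=> a /andP[a0 ha].
have i1 : Intg Pi (fun y => Num.min 1 (a * `|y|)).
  apply: (@Intg_bounded _ _ _ _ _ 1); first exact: measurable_min1.
  move=> y; rewrite ger0_norm; first by rewrite ge_min lexx.
  by rewrite le_min ler01 mulr_ge0.
have i2 : Intg Pi (fun y => (K < `|y|)%R%:R + a * K).
  by apply: IntgD; [exact: Intg_ind|exact: Intg_cst].
apply: (@le_trans _ _ (Ex Pi (fun y => (K < `|y|)%R%:R + a * K))).
  apply: Ex_le => // y; rewrite ge_min; case: ltP => h; first by rewrite lerDl mulr_ge0// ltW.
  by rewrite add0r ler_wpM2l// orbT.
rewrite ExD; [|exact: Intg_ind|exact: Intg_cst].
rewrite Ex_cst Ex_ind//.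
have h1 := prob_le_fine (measurable_bset mb) hK.
have h2 : a * K <= e / 2.
  move: ha; rewrite ler_pdivlMr ?mulr_gt0// => ha; rewrite ler_pdivlMr//.
  by rewrite -mulrA [K * 2]mulrC.
by rewrite [leRHS](_ : e = e / 2 + e / 2); [exact: lerD|field].
Qed.

Lemma emp_err_arith (R : realType) (r s L h c M2 M P gn Gam pk C q b : R) :
  r * s = 1 -> 0 <= s -> 0 <= r * gn <= Gam -> 0 <= P -> 0 <= L * (M + 1) -> 0 <= c ->
  0 <= pk -> h * (L * c) <= b -> P * Gam * pk <= b -> P * q <= b ->
  s * (M2 * (M + 1) ^+ 2 * c + P * Gam * (2 * (L * (M + 1)) * c) + C +
       2 * P ^+ 2 * Gam ^+ 2) <= b ->
  r * (L * s * h * c + M2 * (s * (M + 1)) ^+ 2 * c + P * gn * (2 * (L * s * (M + 1)) * c + pk)) +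
    C * s + r * (2 * (P * gn) ^+ 2) + P * q <= b + b + b + b.
Proof.
move=> rs s0 /andP[a0 aG] P0 LM c0 pk0 h1 h2 h3 h4.
have -> : r * (L * s * h * c + M2 * (s * (M + 1)) ^+ 2 * c + P * gn * (2 * (L * s * (M + 1)) * c + pk)) =
   (r * s) * (h * (L * c)) + (r * s) * (s * (M2 * (M + 1) ^+ 2 * c)) +
   s * (P * (r * gn) * (2 * (L * (M + 1)) * c)) + P * (r * gn) * pk by ring.
have -> : r * (2 * (P * gn) ^+ 2) = s * (2 * P ^+ 2 * (r * gn) ^+ 2).
  by rewrite -[LHS]mul1r -rs; ring.
rewrite rs !mul1r; move: (r * gn) a0 aG => a a0 aG.
have Lc : 0 <= 2 * (L * (M + 1)) * c by rewrite mulr_ge0// mulr_ge0.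
have k1 : P * a * pk <= b.
  by apply: le_trans h2; rewrite ler_wpM2r// ler_wpM2l.
have k2 : s * (P * a * (2 * (L * (M + 1)) * c)) <= s * (P * Gam * (2 * (L * (M + 1)) * c)).
  by rewrite ler_wpM2l// ler_wpM2r// ler_wpM2l.
have k3 : s * (2 * P ^+ 2 * a ^+ 2) <= s * (2 * P ^+ 2 * Gam ^+ 2).
  rewrite ler_wpM2l// ler_wpM2l ?mulr_ge0 ?sqr_ge0//.
  by rewrite lerXn2r ?nnegrE// (le_trans a0).
move: h4 k1 k2 k3 h1 h2 h3; rewrite !(mulrDr s) [C * s]mulrC.
move: (h * _) (s * (M2 * _ * _)) (s * (P * a * _)) (P * a * pk) (s * C) (s * (2 * _ * a ^+ 2)) (P * q).
by move: (s * (P * Gam * _)) (s * (2 * _ * Gam ^+ 2)) => *; lra.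
Qed.

(** * Uniformity over an n^(-1/2)-ball of estimator values *)

Section Uniform.
Context (R : realType) (p : nat) (beta : 'I_p -> R).

Lemma resid_innov (d : measure_display) (Omega : measurableType d)
  (u c : int -> Omega -> R) (bh : 'I_p -> R) (t : int) (w : Omega) :
  let y t w := u t w + c t w in
  resid bh (y^~ w) t = innov beta u t w -
    (\sum_(0 <= j < p.+1) beta_ext beta j * c (t - j%:Z) w) -
    lin (fun i => bh i - beta i) (y^~ w) t.
Proof.
move=> y; rewrite /resid /innov /lin big_nat_recl//= mulN1r subr0 opprD opprK.
have -> : \sum_(i < p) bh i * y (t - i.+1%:Z) w =
    \sum_(i < p) (bh i - beta i) * y (t - i.+1%:Z) w +
    (\sum_(i < p) beta i * u (t - i.+1%:Z) w + \sum_(i < p) beta i * c (t - i.+1%:Z) w).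
  by rewrite -!big_split/=; apply: eq_bigr => i _; rewrite /y; ring.
have -> : \sum_(0 <= i < p) beta_ext beta i.+1 * c (t - i.+1%:Z) w =
    \sum_(i < p) beta i * c (t - i.+1%:Z) w.
  by rewrite big_mkord; apply: eq_bigr => i _; rewrite -/(arb beta i) arbE.
by rewrite {1}/y; ring.
Qed.

(** The cap at [M] is there because the last mesh point may overshoot, while the bounds ask for |th|
    <= M. *)
Definition grid_pt (M h : R) (K : nat) (k : {ffun 'I_p -> 'I_K.+1}) (i : 'I_p) : R :=
  Num.min M (- M + (k i)%:R * h).

Lemma grid_bound M h K (k : {ffun 'I_p -> 'I_K.+1}) i : 0 <= M -> 0 <= h ->
  `|grid_pt M h k i| <= M.
Proof.
move=> M0 h0; rewrite ler_norml; apply/andP; split; last by rewrite ge_min lexx.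
rewrite le_min; apply/andP; split; first by rewrite (@le_trans _ _ 0)// oppr_le0.
by rewrite lerDl mulr_ge0.
Qed.

Lemma grid_near M h K (tau : 'I_p -> R) : 0 < h -> 2 * M <= K%:R * h ->
  (forall i, `|tau i| <= M) ->
  exists k : {ffun 'I_p -> 'I_K.+1}, forall i, `|tau i - grid_pt M h k i| <= h.
Proof.
move=> h0 hK ht.
pose f i := Num.truncn ((tau i + M) / h).
have t0 i : 0 <= tau i + M by have := ht i; rewrite ler_norml => /andP[]; lra.
have q0 i : 0 <= (tau i + M) / h by rewrite divr_ge0// ltW.
have fK i : (f i <= K)%N.
  rewrite -(ler_nat R); apply: (@le_trans _ _ ((tau i + M) / h)).
    by rewrite /f truncn_le.
  rewrite ler_pdivrMr//; apply: le_trans hK.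
  by have := ht i; rewrite ler_norml => /andP[]; lra.
exists [ffun i => inord (f i)] => i; rewrite /grid_pt ffunE inordK ?ltnS//.
have /andP[h1 h2] : (f i)%:R <= (tau i + M) / h < (f i).+1%:R.
  by apply: truncn_itv.
move: h1 h2; rewrite ler_pdivlMr// ltr_pdivrMr// -natr1 mulrDl mul1r => h1 h2.
rewrite min_r; last by have := ht i; rewrite ler_norml => /andP[]; lra.
by rewrite ler_norml; apply/andP; split; lra.
Qed.

(** Indicators are monotone in the threshold, so the sum at any admissible [bh] lies between the
    sums at one grid point widened by [h] and by [- h]. Truncation, [emp_err] and the martingale at
    grid points cost e/4 each. [bh] is quantified inside the event because the estimator depends on
    the whole sample. *)
Lemma emp_uniform (Pi : probability R R) (L M2 sg2 Gam x M a e : R) :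
  stable_AR beta -> 0 <= Gam -> 0 <= M -> 0 < a -> 0 < e -> 0 <= L -> 0 <= M2 -> 0 <= sg2 ->
  exists N0 : nat, forall n, (N0 <= n)%N ->
  forall (d : measure_display) (Omega : measurableType d) (Pr : probability Omega R)
    (u B xi : int -> Omega -> R) (G : R -> R) (gn : R),
  (forall t, measurable_fun setT (u t)) -> strictly_stationary Pr u ->
  noise_model Pr (innov beta u) B xi G gn sg2 Pi -> cdf_reg G L M2 ->
  gn <= Gam * (Num.sqrt n%:R)^-1 ->
  prob_le Pr [set w | exists bh : 'I_p -> R,
     (forall i, `|Num.sqrt n%:R * (bh i - beta i)| <= M) /\
     a < `|(Num.sqrt n%:R)^-1 * (\sum_(0 <= t < n)
        ((resid bh (yobs u B xi ^~ w) t.+1%:Z <= x)%R%:R - (innov beta u t.+1%:Z w <= x)%R%:R)) -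
        Num.sqrt n%:R * \sum_(0 <= j < p.+1) muz G gn Pi beta x j|] e.
Proof.
move=> st Gam0 M0 a0 e0 L0 M20 sg0.
have [Psi [Psi0 hPsi]] := psi_summable st.
pose c := cV sg2 p Psi.
have c0 : 0 <= c by rewrite /c /cV addr_ge0// !mulr_ge0 ?sqr_ge0.
(* Markov's inequality asks for a mean of at most (e/4)(a/2), which [emp_err_arith] splits into four
   equal parts. *)
pose b := a * e / 32.
have b0 : 0 < b by rewrite divr_gt0// mulr_gt0.
have Lc0 : 0 <= L * c by rewrite mulr_ge0.
pose h := Num.min 1 (b / (L * c + 1)).
have h0 : 0 < h by rewrite lt_min ltr01 divr_gt0// ltr_wpDl.
have h1 : h <= 1 by rewrite ge_min lexx.
have hb : h * (L * c) <= b by apply: small_mul => //; [exact: ltW|rewrite ge_min lexx orbT].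
have [K hK] := exists_nat_gt (2 * M / h).
have {}hK : 2 * M <= K%:R * h by rewrite -ler_pdivrMr// ltW.
pose T : finType := ({ffun 'I_p -> 'I_K.+1} * bool)%type.
pose e2 := e / 4 / #|T|.+1%:R.
have e20 : 0 < e2 by rewrite !divr_gt0.
pose P1 : R := p.+1%:R.
have P10 : 0 < P1 by rewrite ltr0n.
pose q := b / P1.
have q0 : 0 < q by rewrite divr_gt0.
pose A := M2 * (M + 1) ^+ 2 * c + P1 * Gam * (2 * (L * (M + 1)) * c) +
   L * M * p%:R * (Psi ^+ 2 * sg2 + 1) + 2 * P1 ^+ 2 * Gam ^+ 2.
have LM0 : 0 <= L * (M + 1) by rewrite mulr_ge0// addr_ge0.
have A0 : 0 <= A.
  rewrite /A !addr_ge0//; try by rewrite !mulr_ge0 ?sqr_ge0 ?(ltW P10)// ?addr_ge0.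
  by rewrite mulr_ge0//; [rewrite !mulr_ge0|rewrite addr_ge0// mulr_ge0// sqr_ge0].
pose A2 := 4 * (P1 * Gam + L * (M + 1) * c).
have A20 : 0 <= A2 by rewrite /A2 mulr_ge0// addr_ge0// mulr_ge0// ltW.
have PG0 : 0 <= P1 * Gam * p%:R by rewrite !mulr_ge0// ltW.
have [k0 [k00 hk]] := kapPi_small Pi (divr_gt0 b0 (ltr_wpDl PG0 ltr01)).
(* Collects every smallness requirement on n^(-1/2). It involves [Gam], but neither [gn], nor the
   probability space, nor the truncation lag. *)
pose sm := Num.min (Num.min (b / (A + 1)) (q ^+ 2 / (4 * Gam + 1)))
  (Num.min (k0 / (L * (M + 1) + 1)) (e2 * (a / 2) ^+ 2 / (A2 + 1))).
have aa0 : 0 < e2 * (a / 2) ^+ 2 by rewrite mulr_gt0// exprn_gt0// divr_gt0.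
have qq0 : 0 < q ^+ 2 by rewrite exprn_gt0.
have G40 : 0 <= 4 * Gam by rewrite mulr_ge0.
have sm0 : 0 < sm by rewrite /sm !lt_min; apply/andP; split; apply/andP; split; rewrite divr_gt0// ltr_wpDl.
have [N0 hN0] := inv_sqrt_small sm0.
exists N0 => n /hN0[n0 hs] d Omega Pr u B xi G gn um ust nm cr hgn.
set r := Num.sqrt n%:R in hs hgn *.
have r0 : 0 < r by rewrite sqrtr_gt0 ltr0n.
have rr : r ^+ 2 = n%:R by rewrite sqr_sqrtr.
set s := r^-1 in hs hgn *.
have s0 : 0 < s by rewrite invr_gt0.
have rs : r * s = 1 by rewrite mulfV// gt_eqF.
have sn : s * n%:R = r by rewrite -rr /s expr2 mulKf// gt_eqF.
move: hs; rewrite /sm !le_min => /andP[/andP[hs1 hs2] /andP[hs3 hs4]].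
have g0 : 0 <= gn := gn_ge0 nm.
have rg : r * gn <= Gam.
  apply: (@le_trans _ _ (r * (Gam * s))); first by rewrite ler_wpM2l// ltW.
  by rewrite mulrCA rs mulr1.
have {}hs1 := small_mul A0 b0 (ltW s0) hs1.
have {}hs2 := small_mul G40 qq0 (ltW s0) hs2.
have {}hs3 := small_mul LM0 k00 (ltW s0) hs3.
have {}hs4 := small_mul A20 aa0 (ltW s0) hs4.
have gq : 4 * gn <= q ^+ 2.
  by apply: le_trans hs2; rewrite mulrCA ler_wpM2l// mulrC.
have hkap : P1 * Gam * (p%:R * kapPi Pi (L * s * (M + 1))) <= b.
  have hk' : kapPi Pi (L * s * (M + 1)) <= b / (P1 * Gam * p%:R + 1).
    apply: hk; rewrite mulrAC mulr_ge0 ?(ltW s0)//=.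
    by rewrite mulrC.
  rewrite mulrA; apply: (@le_trans _ _ (P1 * Gam * p%:R * (b / (P1 * Gam * p%:R + 1)))).
    by rewrite ler_wpM2l.
  by rewrite mulrA ler_pdivrMr ?ltr_wpDl// mulrC ler_wpM2l ?(ltW b0)// lerDl.
pose delta := h / (M * p%:R + 1).
have Mp0 : 0 <= M * p%:R by rewrite mulr_ge0.
have d0 : 0 < delta by rewrite divr_gt0// ltr_wpDl.
have hdel : M * p%:R * delta <= h.
  by rewrite /delta mulrA ler_pdivrMr ?ltr_wpDl// mulrC ler_wpM2l ?(ltW h0)// lerDl.
pose S : finType := ('I_n * 'I_p)%type.
have e30 : 0 < e / 4 / #|S|.+1%:R by rewrite !divr_gt0.
(* The lag is chosen after n and the space, which is harmless because the moment bounds do not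
   depend on it. Closeness is needed only at the times and lags entering the n residuals. *)
have [N hN] := ma_approx_small um ust st d0 e30.
pose v := ma_approx beta (innov beta u) N.
have ev1 : prob_le Pr (fun w => exists j : S,
    delta < `|u (j.1.+1%:Z - j.2.+1%:Z) w - v (j.1.+1%:Z - j.2.+1%:Z) w|) (e / 4).
  have := prob_le_bigcup (fun j : S => hN (j.1.+1%:Z - j.2.+1%:Z)).
  apply: prob_le_le; rewrite sumr_const -[_ *+ _]mulr_natr -mulrA ler_piMr//.
    by rewrite divr_ge0// ltW.
  by rewrite mulrC ler_pdivrMr ?ltr0Sn// mul1r ler_nat.
have [iX [X0 eX]] := Ex_emp_err N nm cr hPsi x n0 M0 (ltW h0) q0 gq.
have ev2 : prob_le Pr [set w | a / 2 <= emp_err (innov beta u) B xi G gn L M2 Pi beta N x s M h n w] (e / 4).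
  apply: prob_le_markov => //; first exact: divr_gt0.
  apply: (le_trans eX); rewrite -/r -/s -/c -/P1.
  have -> : e / 4 * (a / 2) = b + b + b + b by rewrite /b; field.
  apply: (emp_err_arith (Gam := Gam)) => //.
  - exact: ltW.
  - by rewrite rg mulr_ge0// ltW.
  - rewrite mulr_ge0//; apply: Ex_ge0 => y.
    by rewrite le_min ler01 mulr_ge0// mulrAC mulr_ge0 ?(ltW s0).
  - by rewrite /q mulrC divfK// gt_eqF.
have ev3 : prob_le Pr (fun w => exists j : T, a / 2 <=
   `|s * \sum_(0 <= t < n) mdiff (innov beta u) B xi G beta N x s (grid_pt M h j.1)
       (if j.2 then h else - h) t.+1%:Z w|) (e / 4).
  have hj (j : T) : prob_le Pr [set w | a / 2 <=
     `|s * \sum_(0 <= t < n) mdiff (innov beta u) B xi G beta N x s (grid_pt M h j.1)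
       (if j.2 then h else - h) t.+1%:Z w|] e2.
    have hth i := grid_bound j.1 i M0 (ltW h0).
    have het : `|if j.2 then h else - h| <= 1.
      by case: (j.2); rewrite ?normrN gtr0_norm.
    have [i2 E2] := Ex_mdiff_sum_sqr nm cr n
      (fun t => Ex_G_lvl N nm cr hPsi x t (ltW s0) M0 hth het).
    apply: prob_le_chebyshev; last first.
    - under eq_fun do rewrite exprMn.
      rewrite ExZ//; apply: (@le_trans _ _ (s ^+ 2 * (n%:R * (4 * (P1 * gn + L * s * (M + 1) * c))))).
        by rewrite ler_wpM2l// sqr_ge0.
      rewrite (_ : s ^+ 2 * _ = (s * (s * n%:R)) * (4 * (P1 * gn + L * s * (M + 1) * c))); last by ring.
      rewrite sn mulrC [s * r]mulrC rs mulr1; apply: le_trans hs4.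
      rewrite /A2 [leRHS](_ : _ = 4 * (P1 * (Gam * s) + L * s * (M + 1) * c)); last by ring.
      by rewrite ler_wpM2l// lerD2r ler_wpM2l// ltW.
    - exact: divr_gt0.
    - by under eq_fun do rewrite exprMn; exact: IntgZ.
    - apply: measurable_funM => //; apply: measurable_sum => t.
      exact: (mdiff_measurable beta N nm cr).
  have := prob_le_bigcup hj.
  apply: prob_le_le; rewrite sumr_const -[_ *+ _]mulr_natr /e2 -mulrA ler_piMr//.
    by rewrite divr_ge0// ltW.
  by rewrite mulrC ler_pdivrMr ?ltr0Sn// mul1r ler_nat.
have e4 : e / 4 + e / 4 + e / 4 <= e by lra.
apply: (prob_le_le e4).
apply: prob_le_sub (prob_leU (prob_leU ev1 ev2) ev3).
move=> w /= [bh [hbh hlt]].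
have [j1|nj1] := pselect (exists j : S,
    delta < `|u (j.1.+1%:Z - j.2.+1%:Z) w - v (j.1.+1%:Z - j.2.+1%:Z) w|); first by left; left.
have [k hk2] := grid_near h0 hK hbh.
set tau := fun i => r * (bh i - beta i) in hk2.
set th := grid_pt M h k in hk2.
set eps := innov beta u in hlt *.
pose lv := lvl eps B xi beta N x s th.
have near (t : nat) : (t < n)%N -> lv (- h) t.+1%:Z w <=
    x + cw B xi beta t.+1%:Z w + s * lin tau (yobs u B xi ^~ w) t.+1%:Z <= lv h t.+1%:Z w.
  move=> tn.
  have hd : `|lin tau (yobs u B xi ^~ w) t.+1%:Z - lin th (yv eps B xi beta N ^~ w) t.+1%:Z| <=
      h * (1 + l1lag p (yv eps B xi beta N ^~ w) t.+1%:Z).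
    have -> : lin tau (yobs u B xi ^~ w) t.+1%:Z - lin th (yv eps B xi beta N ^~ w) t.+1%:Z =
        lin tau (fun s => u s w - v s w) t.+1%:Z +
        lin (fun i => tau i - th i) (yv eps B xi beta N ^~ w) t.+1%:Z.
      rewrite /lin -sumrB -big_split/=; apply: eq_bigr => i _.
      by rewrite /yobs /yv /cx -/v; ring.
    apply: (le_trans (ler_normD _ _)); rewrite mulrDr mulr1; apply: lerD; last exact: lin_bound.
    apply: le_trans hdel; apply: (le_trans (lin_bound _ _ hbh)).
    rewrite -mulrA ler_wpM2l//; apply: (@le_trans _ _ (\sum_(i < p) delta)).
      apply: ler_sum => i _; rewrite leNgt; apply/negP => hn; apply: nj1.
      by exists (Ordinal tn, i).
    by rewrite sumr_const card_ord -[_ *+ _]mulr_natl.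
  rewrite /lv /lvl !lerD2l !ler_pM2l//.
  by move: hd; rewrite ler_norml mulNr => /andP[]; move: (lin _ _ _) (lin _ _ _) (h * _) => *; lra.
have res (t : nat) : (resid bh (yobs u B xi ^~ w) t.+1%:Z <= x) =
    (eps t.+1%:Z w <= x + cw B xi beta t.+1%:Z w + s * lin tau (yobs u B xi ^~ w) t.+1%:Z).
  have -> : s * lin tau (yobs u B xi ^~ w) t.+1%:Z =
      lin (fun i => bh i - beta i) (yobs u B xi ^~ w) t.+1%:Z.
    rewrite /lin mulr_sumr; apply: eq_bigr => i _.
    by rewrite /tau !mulrA [s * r]mulrC rs mul1r.
  rewrite (@resid_innov _ _ u (cx B xi) bh t.+1%:Z w) -/eps.
  rewrite /cw /yobs /cx; move: (eps _ w) (\sum_(0 <= j < _) _) (lin _ _ _) => ? ? ?.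
  by apply/idP/idP; lra.
have up : s * (\sum_(0 <= t < n) ((resid bh (yobs u B xi ^~ w) t.+1%:Z <= x)%R%:R -
     (eps t.+1%:Z w <= x)%R%:R)) <= s * (\sum_(0 <= t < n) ((eps t.+1%:Z w <= lv h t.+1%:Z w)%R%:R -
     (eps t.+1%:Z w <= x)%R%:R)).
  rewrite ler_pM2l// !big_mkord; apply: ler_sum => t _; rewrite lerD2r res.
  have /andP[_ ht] := near t (ltn_ord t); rewrite ler_nat.
  by case: (leP (eps _ w) (x + _ + _)) => // h3; rewrite (le_trans h3 ht).
have lo : s * (\sum_(0 <= t < n) ((eps t.+1%:Z w <= lv (- h) t.+1%:Z w)%R%:R -
     (eps t.+1%:Z w <= x)%R%:R)) <= s * (\sum_(0 <= t < n) ((resid bh (yobs u B xi ^~ w) t.+1%:Z <= x)%R%:R -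
     (eps t.+1%:Z w <= x)%R%:R)).
  rewrite ler_pM2l// !big_mkord; apply: ler_sum => t _; rewrite lerD2r res.
  have /andP[ht _] := near t (ltn_ord t); rewrite ler_nat.
  by case: (leP (eps _ w) (lv _ _ w)) => // h3; rewrite (le_trans h3 ht).
have hth i : `|th i| <= M by exact: grid_bound (ltW h0).
have hh1 : `|h| <= h by rewrite gtr0_norm.
have hh2 : `|- h| <= h by rewrite normrN gtr0_norm.
have D1 := emp_decomp beta N nm cr x n w (ltW s0) M0 hth hh1 h1.
have D2 := emp_decomp beta N nm cr x n w (ltW s0) M0 hth hh2 h1.
rewrite sn -/eps -/lv in D1; rewrite sn -/eps -/lv in D2.
have [X1|X1] := leP (a / 2) (emp_err eps B xi G gn L M2 Pi beta N x s M h n w); first by left; right.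
right.
have [m1|m1] := leP (a / 2) `|s * \sum_(0 <= t < n) mdiff eps B xi G beta N x s th h t.+1%:Z w|.
  by exists (k, true).
have [m2|m2] := leP (a / 2) `|s * \sum_(0 <= t < n) mdiff eps B xi G beta N x s th (- h) t.+1%:Z w|.
  by exists (k, false).
exfalso; move: hlt; rewrite ltNge => /negP; apply.
move: D1 D2 up lo m1 m2 X1; rewrite !ler_norml.
move: `|_| `|_| (emp_err _ _ _ _ _ _ _ _ _ _ _ _ _ _ _ _) => A1 A3 A4.
move: (s * _) (s * _) (s * _) (r * _) => q1 q2 q3 q4.
by move=> /andP[? ?] /andP[? ?] ? ? ? ? ?; apply/andP; split; lra.
Qed.

End Uniform.

(** * Distribution functions and cell counts *)

Section CdfRegularity.
Context (R : realType).
Implicit Types (mu : probability R R) (F : R -> R).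

Lemma mean_value F : (forall x, derivable F x 1) -> forall x y : R,
  exists c, `|c - x| <= `|y - x| /\ F y - F x = derive1 F c * (y - x).
Proof.
move=> dF.
have lt_case (x y : R) : x < y -> exists c, x < c < y /\ F y - F x = derive1 F c * (y - x).
  move=> xy; have [c] := @MVT R F (derive1 F) x y xy
    (fun z _ => @DeriveDef _ _ _ z 1 F _ (dF z) (esym (derive1E F z)))
    (derivable_within_continuous (fun z _ => dF z)).
  by rewrite in_itv/= => cxy e; exists c.
move=> x y; have [xy|yx|->] := ltgtP x y.
- have [c [/andP[h1 h2] e]] := lt_case x y xy; exists c; split=> //.
  by rewrite !ger0_norm ?subr_ge0 ?(ltW h1) ?(ltW xy)// lerD2r ltW.
- have [c [/andP[h1 h2] e]] := lt_case y x yx; exists c; split.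
    by rewrite !ler0_norm ?subr_le0 ?(ltW h2) ?(ltW yx)// lerN2 lerD2r ltW.
  by rewrite -opprB e -mulrN opprB.
- by exists y; rewrite !subrr mulr0.
Qed.

Lemma measurable_ray (x : R) : measurable [set y : R | y <= x].
Proof. by apply: measurable_bset; apply: measurable_fun_ler. Qed.

Lemma df_bnd mu x : 0 <= df_of mu x <= 1.
Proof.
rewrite /df_of/= fine_ge0 ?measure_ge0//= -lee_fin Pr_fine; last exact: measurable_ray.
by apply: probability_le1; exact: measurable_ray.
Qed.

Lemma df_compl mu x : mu (~` [set y | y <= x]) = (1 - df_of mu x)%:E.
Proof.
have m := measurable_ray x.
by rewrite (probability_setC mu m) -(Pr_fine mu m) -EFinB.
Qed.

Lemma df_mono mu x y : x <= y -> df_of mu x <= df_of mu y.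
Proof.
move=> xy; rewrite /df_of/= -lee_fin !Pr_fine; try exact: measurable_ray.
apply: le_measure; rewrite ?inE; try exact: measurable_ray.
by move=> z /= /le_trans; apply.
Qed.

(** The first derivative is bounded by its own Taylor formula: with step 1 it equals an increment of
    the d.f., at most 1, up to a remainder of at most [M]. *)
Lemma df_reg mu : twice_diff_bdd (df_of mu) -> exists M, cdf_reg (df_of mu) (1 + M) M.
Proof.
move=> [d1 d2 [M hM]]; set F := df_of mu.
have M0 : 0 <= M by apply: le_trans (hM 0); exact: normr_ge0.
have tay x h : `|F (x + h) - F x - derive1 F x * h| <= M * h ^+ 2.
  have [c [hc e]] := mean_value d1 x (x + h).
  have [c' [_ e']] := mean_value d2 x c.
  rewrite addrAC subrr add0r in hc e.
  rewrite e -mulrBl e' !normrM -(real_normK (num_real h)) expr2 mulrA.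
  by rewrite ler_wpM2r// ler_pM.
have F1 x y : `|F x - F y| <= 1.
  have /andP[a b] := df_bnd mu x; have /andP[a' b'] := df_bnd mu y.
  by rewrite /F; move: (df_of mu x) (df_of mu y) a b a' b' => *; rewrite ler_norml; apply/andP; split; lra.
have dF x : `|derive1 F x| <= 1 + M.
  have := tay x 1; rewrite expr1n !mulr1 => h.
  rewrite -[derive1 F x]opprK normrN -[- _](addKr (F (x + 1) - F x)) addrC.
  apply: (le_trans (ler_normD _ _)); rewrite addrC normrN; exact: lerD.
exists M; split.
- by move=> x; exact: df_bnd.
- by move=> x y; exact: df_mono.
- apply: continuous_measurable_fun => x.
  by apply: differentiable_continuous; rewrite -derivable1_diffP.
- move=> x y; have [c [_ e]] := mean_value d1 y x.
  by rewrite e normrM ler_wpM2r.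
- by move=> x; exists (derive1 F x).
Qed.

Definition mixF (F1 F2 : R -> R) (w : R) (x : R) : R := (1 - w) * F1 x + w * F2 x.

(** The constants are added rather than averaged, so they do not depend on the weight [w], which
    varies with n and rho. *)
Lemma mix_reg F1 F2 (L1 L2 M1 M2 w : R) : 0 <= w <= 1 ->
  cdf_reg F1 L1 M1 -> cdf_reg F2 L2 M2 -> cdf_reg (mixF F1 F2 w) (L1 + L2) (M1 + M2).
Proof.
move=> /andP[w0 w1] c1 c2.
have w1' : 0 <= 1 - w by rewrite subr_ge0.
have conv (a b A B : R) : 0 <= A -> 0 <= B -> `|a| <= A -> `|b| <= B ->
    `|(1 - w) * a + w * b| <= A + B.
  move=> A0 B0 ha hb; apply: (le_trans (ler_normD _ _)); rewrite !normrM.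
  rewrite (ger0_norm w0) (ger0_norm w1'); apply: lerD.
    by apply: (@le_trans _ _ (1 * A)); [apply: ler_pM => //; lra|rewrite mul1r].
  by apply: (@le_trans _ _ (1 * B)); [apply: ler_pM => //; lra|rewrite mul1r].
have L10 := L_ge0 c1; have L20 := L_ge0 c2.
have M10 := M2_ge0 c1; have M20 := M2_ge0 c2.
split.
- move=> x; have /andP[a b] := cr_bnd c1 x; have /andP[a' b'] := cr_bnd c2 x.
  rewrite /mixF addr_ge0 ?mulr_ge0//= [leRHS](_ : 1 = (1 - w) * 1 + w * 1); last by ring.
  by apply: lerD; rewrite ler_wpM2l.
- move=> x y xy; rewrite /mixF; apply: lerD; rewrite ler_wpM2l//.
    exact: cr_mono c1 _ _ xy.
  exact: cr_mono c2 _ _ xy.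
- by apply: measurable_funD; apply: measurable_funM => //; [exact: cr_meas c1|exact: cr_meas c2].
- move=> x y; rewrite (_ : _ - _ = (1 - w) * (F1 x - F1 y) + w * (F2 x - F2 y)).
    by rewrite [leRHS]mulrDl; apply: conv; rewrite ?mulr_ge0//; [exact: cr_lip c1 _ _|exact: cr_lip c2 _ _].
  by rewrite /mixF; ring.
- move=> x; have [g1 [h1 k1]] := cr_taylor c1 x; have [g2 [h2 k2]] := cr_taylor c2 x.
  exists ((1 - w) * g1 + w * g2); split; first exact: conv.
  move=> h; rewrite (_ : _ - _ - _ = (1 - w) * (F1 (x + h) - F1 x - g1 * h) +
    w * (F2 (x + h) - F2 x - g2 * h)); last by rewrite /mixF; ring.
  by rewrite [leRHS]mulrDl; apply: conv; rewrite ?(mulr_ge0 M10) ?(mulr_ge0 M20) ?sqr_ge0.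
Qed.

Lemma cdfE_bnd mu x : 0 <= cdfE mu x <= 1.
Proof. by case: x => [r| |] /=; rewrite ?lexx ?ler01//; exact: df_bnd. Qed.

(** Symmetry gives F(-x) as 1 minus the mass of the open half-line below x. The Lipschitz bound
    excludes an atom at x, so that mass is F(x). *)
Lemma cdfE_symm mu (L M2 : R) (x : \bar R) : symmetric_law mu -> cdf_reg (df_of mu) L M2 ->
  cdfE mu (- x)%E = 1 - cdfE mu x.
Proof.
move=> sy cr; case: x => [x| |]; [|by rewrite /= subrr|by rewrite /= subr0].
have mlt : measurable [set y : R | y < x].
  by apply: measurable_bset; apply: measurable_fun_ltr.
have e1 : df_of mu (- x) = 1 - fine (mu [set y : R | y < x]).
  rewrite /df_of/=; have := @sy (~` [set y : R | y < x]) (measurableC mlt).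
  rewrite probability_setC// => e.
  have -> : [set y | y <= - x] = [set - y | y in ~` [set y : R | y < x]].
    apply/seteqP; split => y /=.
      by move=> h; exists (- y); rewrite ?opprK//; apply/negP; rewrite -leNgt; lra.
    by move=> [z /negP]; rewrite -leNgt => h <-; rewrite lerN2.
  by rewrite e fineB// fin_num_measure.
rewrite -[cdfE mu (- x%:E)%E]/(df_of mu (- x)) e1 -/(df_of mu x); congr (1 - _).
have b1 : fine (mu [set y : R | y < x]) <= df_of mu x.
  rewrite /df_of/= -lee_fin !Pr_fine//; last exact: measurable_ray.
  by apply: le_measure; rewrite ?inE//; [exact: measurable_ray|move=> y /= /ltW].
have b2 h : 0 < h -> df_of mu x <= fine (mu [set y : R | y < x]) + L * h.
  move=> h0; have : df_of mu (x - h) <= fine (mu [set y : R | y < x]).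
    rewrite /df_of/= -lee_fin !Pr_fine//; last exact: measurable_ray.
    apply: le_measure; rewrite ?inE//; [exact: measurable_ray|].
    by move=> y /= hy; apply: (le_lt_trans hy); rewrite ltrBlDr ltrDl.
  have := cr_lip cr x (x - h); rewrite opprB addrCA subrr addr0 (gtr0_norm h0).
  move=> /ler_normlW; move: (df_of mu x) (df_of mu (x - h)) (fine _) (L * h) => *; lra.
apply/eqP; rewrite eq_le b1/=; apply/ler_addgt0Pr => e e0.
have L0 := L_ge0 cr.
apply: (le_trans (b2 (e / (L + 1)) _)); first by rewrite divr_gt0// ltr_wpDl.
by rewrite lerD2l mulrA ler_pdivrMr ?ltr_wpDl// mulrC ler_wpM2l ?(ltW e0)// lerDl.
Qed.

(** * Laws whose distribution function is a mixture *)

Section MixtureLaw.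
Context (d : measure_display) (Omega : measurableType d) (Pr : probability Omega R)
  (X : Omega -> R) (muP muQ : probability R R) (w : R).
Hypotheses (mX : measurable_fun setT X) (w01 : 0 <= w <= 1)
  (hX : forall x, fine (Pr [set o | X o <= x]) = mixF (df_of muP) (df_of muQ) w x).

Let w0 : 0 <= w. Proof. by case/andP: w01. Qed.
Let w1 : 0 <= 1 - w. Proof. by case/andP: w01; rewrite subr_ge0. Qed.

(** Half-lines form a pi-system generating the Borel sets, and on them the law of [X] and the
    mixture of measures agree. This allows moments to be transferred from the d.f. alone. *)
Lemma mixture_law (A : set R) : measurable A ->
  (Pr (X @^-1` A) = (1 - w)%:E * muP A + w%:E * muQ A)%E.
Proof.
move=> mA.
pose X' : {mfun Omega >-> R} :=
  MeasurableFun.Pack (MeasurableFun.Class (isMeasurableFun.Build _ _ _ _ _ mX)).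
pose m1 := distribution Pr X'.
pose m2 := measure_add (mscale (NngNum w1) muP) (mscale (NngNum w0) muQ).
have m2E B : m2 B = ((1 - w)%:E * muP B + w%:E * muQ B)%E.
  by rewrite /m2 measure_addE /mscale.
rewrite -m2E; change (m1 A = m2 A).
have mray (x : R) : measurable `]x, +oo[%classic by exact: measurable_itv.
have := @g_sigma_algebra_measure_unique _ R R (@RGenOInfty.G R) _
  (fun n => `](- n%:R : R), +oo[%classic) _ _ m1 m2 _ _ _ A.
apply.
- by move=> B [x ->].
- by move=> n; exists (- n%:R).
- apply/seteqP; split => // x _; have [n hn] := exists_nat_gt (- x).
  by exists n => //=; rewrite in_itv/= andbT; lra.
- move=> B C [x ->] [y ->]; exists (Num.max x y).
  by apply/seteqP; split => z /=; rewrite !in_itv/= !andbT gt_max => /andP.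
- move=> B [x ->]; apply: etrans (esym (m2E _)).
  have -> : `]x, +oo[%classic = ~` [set y : R | y <= x].
    by apply/seteqP; split => y /=; rewrite in_itv/= andbT ltNge => /negP.
  have mXx : measurable [set o | X o <= x].
    by apply: measurable_bset; apply: measurable_fun_ler.
  transitivity (1 - mixF (df_of muP) (df_of muQ) w x)%:E.
    by apply: etrans (probability_setC Pr mXx) _; rewrite -hX EFinB Pr_fine.
  rewrite !df_compl.
  by rewrite -!EFinM -EFinD; congr EFin; rewrite /mixF; ring.
- by move=> n; apply: (le_lt_trans (probability_le1 _ _)); rewrite ?ltry//; exact: mray.
- have := congr1 (fun M : set (set R) => M A) (RGenOInfty.measurableE R).
  by move=> e; exact: (eq_ind _ (fun T : Prop => T) mA _ e).
Qed.

Lemma mixture_ge0 (f : R -> R) : measurable_fun setT f -> (forall x, 0 <= f x) ->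
  Intg muP f -> Intg muQ f ->
  Intg Pr (fun o => f (X o)) /\
  Ex Pr (fun o => f (X o)) = (1 - w) * Ex muP f + w * Ex muQ f.
Proof.
move=> mf f0 iP iQ.
pose X' : {mfun Omega >-> R} :=
  MeasurableFun.Pack (MeasurableFun.Class (isMeasurableFun.Build _ _ _ _ _ mX)).
pose m2 := measure_add (mscale (NngNum w1) muP) (mscale (NngNum w0) muQ).
have m2E B : m2 B = ((1 - w)%:E * muP B + w%:E * muQ B)%E.
  by rewrite /m2 measure_addE /mscale.
have mEf : measurable_fun setT (EFin \o f) by exact/measurable_EFinP.
have e1 : (\int[Pr]_o (f (X o))%:E = (1 - w)%:E * \int[muP]_x (f x)%:E + w%:E * \int[muQ]_x (f x)%:E)%E.
  rewrite -(@integral_distribution_measurable _ _ _ Pr _ _ X' (EFin \o f))//.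
  rewrite (eq_measure_integral m2); last first.
    by move=> A mA _; exact: etrans (mixture_law mA) (esym (m2E A)).
  rewrite /m2 ge0_integral_measure_add//; last by move=> x _ /=; rewrite lee_fin.
  by rewrite !ge0_integral_mscale//; move=> x _ /=; rewrite lee_fin.
have fP := integrable_fin_num measurableT iP; have fQ := integrable_fin_num measurableT iQ.
split.
  apply/integrableP; split.
    by apply/measurable_EFinP; exact: (measurableT_comp mf mX).
  under eq_integral do rewrite gee0_abs ?lee_fin//.
  rewrite [X in (X < _)%E]e1 -(fineK fP) -(fineK fQ) -!EFinM -EFinD; exact: ltry.
rewrite /Ex /Rintegral e1 fineD ?fineM//; by rewrite fin_numM.
Qed.

(** Since [mixture_ge0] handles nonnegative functions, the mean is computed on the positive and
    negative parts, whose means coincide under each component. *)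
Lemma mixture_moments : zero_mean_finite_var muP -> zero_mean_finite_var muQ ->
  [/\ Intg Pr (fun o => X o ^+ 2), Ex Pr X = 0 &
   Ex Pr (fun o => X o ^+ 2) <= Ex muP (fun x => x ^+ 2) + Ex muQ (fun x => x ^+ 2)].
Proof.
move=> [iP zP vP] [iQ zQ vQ].
have m2 : measurable_fun setT (fun x : R => x ^+ 2) by exact: measurable_funX.
have [i2 e2] := mixture_ge0 m2 (fun x => sqr_ge0 x) vP vQ.
have mp : measurable_fun setT (fun x : R => Num.max x 0) by exact: measurable_maxr.
have mn : measurable_fun setT (fun x : R => Num.max (- x) 0).
  by apply: measurable_maxr => //; exact: measurable_funN.
have dp (mu : probability R R) : mu.-integrable setT (fun x : R => x%:E) -> Intg mu (fun x => Num.max x 0).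
  move=> i; apply: (Intg_dom mp (Intg_norm i)) => x.
  by rewrite ger0_norm ?le_max ?lexx ?orbT// ge_max normr_ge0 ler_norm.
have dn (mu : probability R R) : mu.-integrable setT (fun x : R => x%:E) -> Intg mu (fun x => Num.max (- x) 0).
  move=> i; apply: (Intg_dom mn (Intg_norm i)) => x.
  by rewrite ger0_norm ?le_max ?lexx ?orbT// ge_max normr_ge0 -normrN ler_norm.
have dif (x : R) : x = Num.max x 0 - Num.max (- x) 0.
  by case: (leP x 0) => h; case: (leP (- x) 0) => h'; lra.
have zero (mu : probability R R) : mu.-integrable setT (fun x : R => x%:E) ->
    (\int[mu]_x (x%:E) = 0)%E -> Ex mu (fun x => Num.max x 0) = Ex mu (fun x => Num.max (- x) 0).
  move=> i z; apply/eqP; rewrite -subr_eq0 -ExB; [|exact: dp|exact: dn].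
  by rewrite /Ex /Rintegral; under eq_integral do rewrite -dif; rewrite z.
have m0 (x : R) : 0 <= Num.max x 0 by rewrite le_max lexx orbT.
have [ip ep] := mixture_ge0 mp m0 (dp _ iP) (dp _ iQ).
have [in_ en] := mixture_ge0 mn (fun x => m0 (- x)) (dn _ iP) (dn _ iQ).
split=> //.
  have -> : X = (fun o => Num.max (X o) 0 - Num.max (- X o) 0) by apply/funext => o; exact: dif.
  by rewrite ExB// ep en !zero// subrr.
rewrite e2; apply: lerD.
  by rewrite ler_piMl//; [apply: Ex_ge0 => x; exact: sqr_ge0|rewrite gerBl; case/andP: w01].
by rewrite ler_piMl//; [apply: Ex_ge0 => x; exact: sqr_ge0|case/andP: w01].
Qed.

End MixtureLaw.

End CdfRegularity.

(** * Cells as differences of half-lines, and the limit theorem for their counts *)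

Section Cells.
Context (R : realType).

Definition Ind (x : \bar R) (e : R) : R := ((e%:E <= x)%E)%:R.

Lemma Ind_fin (x e : R) : Ind x%:E e = (e <= x)%R%:R.
Proof. by rewrite /Ind lee_fin. Qed.

Lemma Ind01 x e : 0 <= Ind x e <= 1.
Proof. by rewrite /Ind; case: (_ <= _)%E; rewrite ?lexx ?ler01. Qed.

Lemma measurable_Ind x : measurable_fun setT (Ind x).
Proof.
case: x => [x| |].
- rewrite (_ : Ind x%:E = fun e : R => (e <= x)%R%:R); last by apply/funext => e; exact: Ind_fin.
  by apply: measurable_ind; apply: measurable_fun_ler.
- by rewrite (_ : Ind +oo%E = cst 1)//; apply/funext => e; rewrite /Ind leey.
- by rewrite (_ : Ind -oo%E = cst 0)//; apply/funext => e; rewrite /Ind leeNy_eq.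
Qed.

Lemma cell_Ind (a b : \bar R) (e : R) : (a <= b)%E ->
  (((a < e%:E) && (e%:E <= b))%E)%:R = Ind b e - Ind a e.
Proof.
move=> ab; rewrite /Ind; case: (leP (e%:E) a) => h /=.
  by rewrite (le_trans h ab) subrr.
by rewrite subr0.
Qed.

(** Indicator of B_j^+ minus indicator of B_j^-, written through four half-lines so that the
    empirical comparison applies to each of them. *)
Definition Dcell (xs : nat -> \bar R) (j : nat) (e : R) : R :=
  Ind (xs j) e - Ind (xs j.-1) e - (Ind (- xs j.-1)%E e - Ind (- xs j)%E e).

Lemma sum_count_resid (p n : nat) (bh : 'I_p -> R) (y : int -> R) (P : pred R) :
  (count P (resids n bh y))%:R = \sum_(0 <= t < n) (P (resid bh y t.+1%:Z))%:R :> R.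
Proof.
rewrite /resids -sum1_count big_map natr_sum big_mkcond/=.
have -> : iota 1 n = index_iota 1 n.+1 by rewrite /index_iota subSS subn0.
by rewrite big_add1/=; apply: eq_bigr => t _; case: (P _).
Qed.

Lemma nu_plusE (p n : nat) (bh : 'I_p -> R) (y : int -> R) xs j : (xs j.-1 <= xs j)%E ->
  nu_plus n bh y xs j = \sum_(0 <= t < n)
    (Ind (xs j) (resid bh y t.+1%:Z) - Ind (xs j.-1) (resid bh y t.+1%:Z)).
Proof.
by move=> h; rewrite /nu_plus sum_count_resid; apply: eq_bigr => t _; rewrite -cell_Ind.
Qed.

Lemma nu_minusE (p n : nat) (bh : 'I_p -> R) (y : int -> R) xs j : (xs j.-1 <= xs j)%E ->
  nu_minus n bh y xs j = \sum_(0 <= t < n)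
    (Ind (- xs j.-1)%E (resid bh y t.+1%:Z) - Ind (- xs j)%E (resid bh y t.+1%:Z)).
Proof.
move=> h; rewrite /nu_minus sum_count_resid; apply: eq_bigr => t _.
by rewrite -cell_Ind// leeN2.
Qed.

Context (muP muQ : probability R R).

Definition mixE (w : R) (x : \bar R) : R := (1 - w) * cdfE muP x + w * cdfE muQ x.

Lemma mixE_bnd w x : 0 <= w <= 1 -> 0 <= mixE w x <= 1.
Proof.
move=> /andP[w0 w1]; have /andP[a b] := cdfE_bnd muP x; have /andP[a' b'] := cdfE_bnd muQ x.
have w1' : 0 <= 1 - w by rewrite subr_ge0.
rewrite /mixE addr_ge0 ?mulr_ge0//= [leRHS](_ : 1 = (1 - w) * 1 + w * 1); last by ring.
by apply: lerD; rewrite ler_wpM2l.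
Qed.

Lemma mixE_dist w x : 0 <= w -> `|mixE w x - cdfE muP x| <= w.
Proof.
move=> w0; have /andP[a b] := cdfE_bnd muP x; have /andP[a' b'] := cdfE_bnd muQ x.
rewrite (_ : _ - _ = w * (cdfE muQ x - cdfE muP x)); last by rewrite /mixE; ring.
rewrite normrM (ger0_norm w0) ler_piMr//.
by move: (cdfE muQ x) (cdfE muP x) a b a' b' => *; rewrite ler_norml; apply/andP; split; lra.
Qed.

Section Noise.
Context (d : measure_display) (Omega : measurableType d) (Pr : probability Omega R)
  (eps B xi : int -> Omega -> R) (w gn sg2 : R) (Pi : probability R R).
Hypotheses (w01 : 0 <= w <= 1)
  (nm : noise_model Pr eps B xi (mixF (df_of muP) (df_of muQ) w) gn sg2 Pi).
Local Notation E := (Ex Pr).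

Let meps t : measurable_fun setT (eps t) := nm_meas nm (None, t).

Lemma measurable_Ind_eps x t : measurable_fun setT (fun o => Ind x (eps t o)).
Proof. by apply: (measurableT_comp (measurable_Ind x)). Qed.

Lemma Intg_Ind x t : Intg Pr (fun o => Ind x (eps t o)).
Proof.
apply: (@Intg_bounded _ _ _ _ _ 1); first exact: measurable_Ind_eps.
by move=> o; have /andP[a b] := Ind01 x (eps t o); rewrite ger0_norm.
Qed.

Lemma Ex_Ind x t : E (fun o => Ind x (eps t o)) = mixE w x.
Proof.
case: x => [x| |].
- under eq_fun do rewrite Ind_fin.
  rewrite Ex_ind; last by apply: measurable_fun_ler.
  exact: nm_cdf nm t x.
- rewrite (_ : (fun o => _) = fun=> 1).
    by rewrite Ex_cst /mixE/=; ring.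
  by apply/funext => o; rewrite /Ind leey.
- rewrite (_ : (fun o => _) = fun=> 0).
    by rewrite Ex_cst /mixE/=; ring.
  by apply/funext => o; rewrite /Ind leeNy_eq.
Qed.

Lemma Ind_cheb (x : \bar R) (n : nat) (K e : R) : (0 < n)%N -> 0 < K -> 1 <= e * K ^+ 2 ->
  prob_le Pr [set o | K <= `|(Num.sqrt n%:R)^-1 *
     \sum_(0 <= t < n) (Ind x (eps t.+1%:Z o) - mixE w x)|] e.
Proof.
move=> n0 K0 he.
have r0 : 0 < Num.sqrt n%:R :> R by rewrite sqrtr_gt0 ltr0n.
have mI t : measurable_fun setT (fun o => Ind x (eps t o) - mixE w x).
  by apply: measurable_funB => //; exact: measurable_Ind_eps.
have b1 t o : `|Ind x (eps t o) - mixE w x| <= 1.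
  have /andP[a b] := Ind01 x (eps t o); have /andP[a' b'] := mixE_bnd x w01.
  by move: (Ind _ _) (mixE _ _) a b a' b' => *; rewrite ler_norml; apply/andP; split; lra.
have i1 t : Intg Pr (fun o => Ind x (eps t o) - mixE w x).
  by apply: (@Intg_bounded _ _ _ _ _ 1) => //.
have i2 t : Intg Pr (fun o => (Ind x (eps t o) - mixE w x) ^+ 2).
  apply: (@Intg_bounded _ _ _ _ _ 1) => [|o]; first exact: measurable_funX.
  by rewrite normrX expr_le1.
have [] := @Ex_sqr_orthogonal _ _ _ Pr n (fun t o => Ind x (eps t.+1%:Z o) - mixE w x) (fun=> 1).
- by [].
- by [].
- move=> r t /andP[rt _].
  rewrite (@Ex_noiseM _ _ _ _ _ _ _ _ _ _ _ nm (now r.+1%:Z) (now t.+1%:Z))//.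
  + rewrite ExB; [|exact: Intg_Ind|exact: Intg_cst].
    by rewrite Ex_Ind Ex_cst subrr mul0r.
  + by move=> k -> []; lia.
  + apply: measurable_funB => //; apply: (measurableT_comp (measurable_Ind x)).
    exact: sigm_eps.
  + apply: measurable_funB => //; apply: (measurableT_comp (measurable_Ind x)).
    exact: sigm_eps.
  + apply: (@Intg_bounded _ _ _ _ _ 1); first exact: measurable_funM.
    by move=> o; rewrite normrM mulr_ile1.
- move=> t _; rewrite -[leRHS](Ex_cst Pr 1); apply: Ex_le => //; first exact: Intg_cst.
  by move=> o; rewrite -real_normK ?num_real// expr_le1.
move=> i3 e3; apply: prob_le_chebyshev => //.
- by apply: measurable_funM => //; apply: measurable_sum => t.
- by under eq_fun do rewrite exprMn; exact: IntgZ.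
under eq_fun do rewrite exprMn.
rewrite ExZ//; apply: le_trans he.
rewrite exprVn sqr_sqrtr// mulrC ler_pdivrMr ?ltr0n// mul1r; apply: (le_trans e3).
by rewrite sumr_const_nat subn0.
Qed.

Section Clt.
Variables (m : nat) (xs : nat -> \bar R) (L M2 : R).
Hypotheses (sy : symmetric_law muP) (crP : cdf_reg (df_of muP) L M2)
  (xs0 : xs 0%N = 0%E) (xsS : forall j, (j < m)%N -> (xs j < xs j.+1)%E)
  (pp : forall j, (1 <= j <= m)%N -> 0 < p_plus muP xs j).

(** Symmetry cancels the contribution of P, and only the part of weight [w] from Q remains;
    multiplied by sqrt(n) it becomes the drift. *)
Definition mucell (j : nat) : R := w * (q_plus muQ xs j - q_minus muQ xs j).

Lemma Ex_Dcell j t : E (fun o => Dcell xs j (eps t o)) = mucell j.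
Proof.
rewrite /Dcell ExB; [|by apply: IntgB; exact: Intg_Ind|by apply: IntgB; exact: Intg_Ind].
rewrite !ExB; [|exact: Intg_Ind|exact: Intg_Ind|exact: Intg_Ind|exact: Intg_Ind].
rewrite !Ex_Ind /mixE !(cdfE_symm _ sy crP) /mucell /q_plus /q_minus.
by ring.
Qed.

Lemma xs_le i j : (i <= j <= m)%N -> (xs i <= xs j)%E.
Proof.
elim: j => [|j IH]; first by rewrite leqn0 => /andP[/eqP ->].
rewrite leq_eqVlt => /andP[/orP[/eqP -> //|ij] jm].
by apply: (le_trans (IH _)); [apply/andP; split; lia|exact/ltW/xsS].
Qed.

Lemma Dcell_E j e : (1 <= j <= m)%N ->
  Dcell xs j e = (in_Bplus xs j e)%:R - (in_Bminus xs j e)%:R.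
Proof.
move=> jm; have h : (xs j.-1 <= xs j)%E by apply: xs_le; lia.
by rewrite /Dcell -!cell_Ind// leeN2.
Qed.

(** No value lies in the cells of two different indices, so distinct coordinates are uncorrelated up
    to the product of their means, which is small with [w]. *)
Lemma cells_disjoint j l e : (1 <= j <= m)%N -> (1 <= l <= m)%N -> (j < l)%N ->
  Dcell xs j e * Dcell xs l e = 0.
Proof.
move=> jm lm jl; rewrite !Dcell_E//.
have h0 k : (k <= m)%N -> (0 <= xs k)%E by move=> km; rewrite -xs0; apply: xs_le.
have jl1 : (xs j <= xs l.-1)%E by apply: xs_le; lia.
have j0 : (0 <= xs j.-1)%E by apply: h0; lia.
have l0 : (0 <= xs l.-1)%E by apply: h0; lia.
rewrite /in_Bplus /in_Bminus.
have [eP|eN] := leP e%:E 0%E.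
  rewrite !(ltNge _ e%:E) (le_trans eP j0) (le_trans eP l0)/= !sub0r mulrNN -natrM mulnb.
  case: (ltP (- xs j)%E e%:E) => //= h; case: (leP e%:E (- xs l.-1)%E) => h'.
    by have := lt_le_trans h h'; rewrite lteN2 ltNge jl1.
  by rewrite !andbF.
have nj : (e%:E <= - xs j.-1)%E = false.
  by apply/negbTE; rewrite -ltNge; apply: le_lt_trans eN; rewrite oppe_le0.
have nl : (e%:E <= - xs l.-1)%E = false.
  by apply/negbTE; rewrite -ltNge; apply: le_lt_trans eN; rewrite oppe_le0.
rewrite nj nl !andbF !subr0 -natrM mulnb.
case: (leP e%:E (xs j)) => h; last by rewrite andbF.
by rewrite (ltNge (xs l.-1)) (le_trans h jl1) andbF.
Qed.

Lemma Dcell_sqr j e : (1 <= j <= m)%N -> Dcell xs j e ^+ 2 =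
  (Ind (xs j) e - Ind (xs j.-1) e) + (Ind (- xs j.-1)%E e - Ind (- xs j)%E e).
Proof.
move=> jm; have h : (xs j.-1 <= xs j)%E by apply: xs_le; lia.
have h' : (- xs j <= - xs j.-1)%E by rewrite leeN2.
have j0 : (0 <= xs j.-1)%E by rewrite -xs0; apply: xs_le; lia.
rewrite Dcell_E// -!cell_Ind// -/(in_Bplus xs j e) -/(in_Bminus xs j e).
case hp : (in_Bplus xs j e); last by rewrite sub0r sqrrN add0r; case: (in_Bminus _ _ _); rewrite ?expr0n ?expr1n.
have -> : in_Bminus xs j e = false.
  apply/negbTE/negP => /andP[_ h2]; move: hp => /andP[h1 _].
  have := lt_le_trans h1 h2; rewrite ltNge (le_trans _ j0)//.
  by rewrite oppe_le0.
by rewrite subr0 addr0 expr1n.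
Qed.

Lemma Dcell_norm j e : (1 <= j <= m)%N -> `|Dcell xs j e| <= 1.
Proof.
move=> jm; rewrite Dcell_E//.
by case: (in_Bplus _ _ _); case: (in_Bminus _ _ _);
  rewrite ?subrr ?subr0 ?sub0r ?normrN ?normr0 ?normr1.
Qed.

Lemma Ex_Dcell_sqr j t : (1 <= j <= m)%N ->
  `|E (fun o => Dcell xs j (eps t o) ^+ 2) - 2 * p_plus muP xs j| <= 4 * w.
Proof.
move=> jm; have w0 : 0 <= w by case/andP: w01.
under eq_fun do rewrite Dcell_sqr//.
rewrite ExD; [|by apply: IntgB; exact: Intg_Ind|by apply: IntgB; exact: Intg_Ind].
rewrite !ExB; [|exact: Intg_Ind|exact: Intg_Ind|exact: Intg_Ind|exact: Intg_Ind].
rewrite !Ex_Ind; have := mixE_dist (xs j) w0; have := mixE_dist (xs j.-1) w0.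
have := mixE_dist (- xs j)%E w0; have := mixE_dist (- xs j.-1)%E w0.
rewrite !(cdfE_symm _ sy crP) /p_plus !ler_norml.
move: (mixE w _) (mixE w _) (mixE w _) (mixE w _) (cdfE _ _) (cdfE _ _).
by move=> ? ? ? ? ? ? /andP[? ?] /andP[? ?] /andP[? ?] /andP[? ?]; apply/andP; split; lra.
Qed.

Lemma mucell_norm j : `|mucell j| <= 2 * w.
Proof.
have w0 : 0 <= w by case/andP: w01.
rewrite /mucell normrM (ger0_norm w0) mulrC ler_wpM2r// /q_plus /q_minus.
have /andP[? ?] := cdfE_bnd muQ (xs j); have /andP[? ?] := cdfE_bnd muQ (xs j.-1).
have /andP[? ?] := cdfE_bnd muQ (- xs j)%E; have /andP[? ?] := cdfE_bnd muQ (- xs j.-1)%E.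
by rewrite ler_norml; apply/andP; split; lra.
Qed.

(** Dominates all factors 1/sqrt(2 p_j^+), through 1/sqrt(y) <= max(1, 1/y). *)
Definition Kp : R := 1 + \sum_(j < m) (2 * p_plus muP xs j.+1)^-1.

Lemma Kp_ge j : (j < m)%N -> (Num.sqrt (2 * p_plus muP xs j.+1))^-1 <= Kp.
Proof.
move=> jm; have p0 : 0 < 2 * p_plus muP xs j.+1 by rewrite mulr_gt0//; apply: pp; lia.
have p1 (i : 'I_m) : 0 <= (2 * p_plus muP xs i.+1)^-1.
  by rewrite invr_ge0 mulr_ge0// ltW//; apply: pp; rewrite ltn_ord.
have q0 : 0 < Num.sqrt (2 * p_plus muP xs j.+1) by rewrite sqrtr_gt0.
have hK : (2 * p_plus muP xs j.+1)^-1 <= \sum_(i < m) (2 * p_plus muP xs i.+1)^-1.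
  by rewrite (bigD1 (Ordinal jm))//= lerDl sumr_ge0.
have [h|h] := leP 1 (Num.sqrt (2 * p_plus muP xs j.+1)).
  by apply: (@le_trans _ _ 1); [rewrite invf_le1|rewrite lerDl sumr_ge0].
apply: (@le_trans _ _ (2 * p_plus muP xs j.+1)^-1); last by rewrite (le_trans hK)// lerDr.
by rewrite lef_pV2 ?posrE// -[leLHS](sqr_sqrtr (ltW p0)) expr2 ler_piMl// ltW.
Qed.

Lemma Kp_ge1 : 1 <= Kp.
Proof.
by rewrite lerDl sumr_ge0// => i _; rewrite invr_ge0 mulr_ge0// ltW//; apply: pp; rewrite ltn_ord.
Qed.

(** Centred and divided by sqrt(2 p_j^+), the cell differences have identity covariance up to order
    [w]. Their means and the constants [c j] form the starting point of the walk, whose squared norm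
    is the noncentrality. In the constant, [3 * Kp] bounds the terms and [8 * Rb * Kp ^+ 2] the
    covariance error. *)
Lemma clt_cells (n : nat) (Rb sL C : R) (c : nat -> R) : 0 < sL -> (0 < n)%N -> 0 <= Rb ->
  (forall x : 'I_m -> R, (1 + l1n x) ^+ 4 * expR (- (sL / (1 + 2 * sL) * sqn x)) <= C) ->
  w <= Rb * (Num.sqrt n%:R)^-1 ->
  `|E (fun o => expR (- sL * \sum_(j < m)
       ((Num.sqrt n%:R)^-1 * (\sum_(0 <= t < n) Dcell xs j.+1 (eps t.+1%:Z o)) + c j.+1) ^+ 2 /
       (2 * p_plus muP xs j.+1))) -
    chi2_laplace m (\sum_(j < m) (Num.sqrt n%:R * mucell j.+1 + c j.+1) ^+ 2 /
       (2 * p_plus muP xs j.+1)) sL| <=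
  lind_cst m sL C (1 + 3 * Kp + 8 * Rb * Kp ^+ 2) / Num.sqrt n%:R.
Proof.
move=> sL0 n0 Rb0 hC hw.
have w0 : 0 <= w by case/andP: w01.
have w1 : w <= 1 by case/andP: w01.
set r : R := Num.sqrt n%:R in hw *.
have r0 : 0 < r by rewrite sqrtr_gt0 ltr0n.
have rr : r ^+ 2 = n%:R by rewrite sqr_sqrtr.
have K1 := Kp_ge1; have K0 : 0 <= Kp by exact: le_trans K1.
have jm (j : 'I_m) : (1 <= j.+1 <= m)%N by rewrite ltn_ord.
pose q (j : 'I_m) := Num.sqrt (2 * p_plus muP xs j.+1).
have p0 (j : 'I_m) : 0 < 2 * p_plus muP xs j.+1 by rewrite mulr_gt0//; exact: pp.
have q0 j : 0 < q j by rewrite sqrtr_gt0.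
have qq j : q j ^+ 2 = 2 * p_plus muP xs j.+1 by rewrite sqr_sqrtr// ltW.
have qK j : (q j)^-1 <= Kp by exact: Kp_ge.
pose X (i : nat) (o : Omega) (j : 'I_m) : R := (Dcell xs j.+1 (eps i.+1%:Z o) - mucell j.+1) / q j.
pose x (j : 'I_m) := (r * mucell j.+1 + c j.+1) / q j.
have mD j : measurable_fun setT (Dcell xs j).
  by apply: measurable_funB; apply: measurable_funB; exact: measurable_Ind.
have mDe j t : measurable_fun setT (fun o => Dcell xs j (eps t o)).
  exact: (measurableT_comp (mD j)).
have bD (j : 'I_m) t o : `|Dcell xs j.+1 (eps t o)| <= 1 by exact: Dcell_norm.
have bmu j : `|mucell j| <= 2 by apply: (le_trans (mucell_norm j)); lra.
have iD (j : 'I_m) t : Intg Pr (fun o => Dcell xs j.+1 (eps t o)).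
  by apply: (@Intg_bounded _ _ _ _ _ 1).
have iDD (j l : 'I_m) t : Intg Pr (fun o => Dcell xs j.+1 (eps t o) * Dcell xs l.+1 (eps t o)).
  apply: (@Intg_bounded _ _ _ _ _ 1); first exact: measurable_funM.
  by move=> o; rewrite normrM mulr_ile1.
set Bc := 1 + 3 * Kp + 8 * Rb * Kp ^+ 2.
have RK0 : 0 <= 8 * Rb * Kp ^+ 2 by rewrite mulr_ge0 ?sqr_ge0// mulr_ge0.
have B1 : 1 <= Bc by rewrite /Bc -addrA lerDl addr_ge0// mulr_ge0.
have := @lindeberg_clt R m d Omega Pr sL C Bc n x X
  (fun t => cyl (noise eps B xi) (past t.+1%:Z)) (fun t => cyl (noise eps B xi) (now t.+1%:Z))
  sL0 B1 hC n0.
have -> : (\sum_(j < m) (r * mucell j.+1 + c j.+1) ^+ 2 / (2 * p_plus muP xs j.+1)) = sqn x.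
  by apply: eq_bigr => j _; rewrite /x expr_div_n qq.
have -> : (fun o => expR (- sL * \sum_(j < m)
       (r^-1 * (\sum_(0 <= t < n) Dcell xs j.+1 (eps t.+1%:Z o)) + c j.+1) ^+ 2 /
       (2 * p_plus muP xs j.+1))) =
   (fun o => expR (- sL * sqn (fun j => x j + (\sum_(0 <= i < n) X i o j) / Num.sqrt n%:R))).
  apply/funext => o; congr (expR (_ * _)); apply: eq_bigr => j _.
  rewrite -/r -qq -expr_div_n; congr (_ ^+ 2).
  have eS : \sum_(0 <= i < n) (Dcell xs j.+1 (eps i.+1%:Z o) - mucell j.+1) =
      \sum_(0 <= i < n) Dcell xs j.+1 (eps i.+1%:Z o) - r ^+ 2 * mucell j.+1.
    by rewrite [LHS]big_split/= sumrN sumr_const_nat subn0 -[_ *+ n]mulr_natl rr.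
  rewrite /x /X -mulr_suml eS.
  by field; rewrite !gt_eqF.
apply.
- by move=> t; exact: (noise_cyl_measurable nm).
- by move=> t; exact: (noise_cyl_measurable nm).
- by move=> t; apply: (noise_indep nm) => k; exact: past_now_disj.
- move=> i t j it; apply: measurable_funM => //; apply: measurable_funB => //.
  by apply: (measurableT_comp (mD j.+1)); apply: sigm_eps; rewrite /past/=; lia.
- move=> t j; apply: measurable_funM => //; apply: measurable_funB => //.
  by apply: (measurableT_comp (mD j.+1)); exact: sigm_eps.
- move=> t o j; rewrite /X normrM [`|(q j)^-1|]gtr0_norm ?invr_gt0//.
  apply: (@le_trans _ _ (3 * Kp)).
    apply: ler_pM => //; first by rewrite invr_ge0 ltW.
    apply: (le_trans (ler_normB _ _)); rewrite -[3]/(1 + 2 : R).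
    by apply: lerD; [exact: bD|exact: bmu].
  by rewrite /Bc -addrA addrCA lerDl addr_ge0.
- move=> t j; rewrite /X; under eq_fun do rewrite mulrC.
  rewrite ExZ; last by apply: IntgB; [exact: iD|exact: Intg_cst].
  rewrite ExB; [|exact: iD|exact: Intg_cst].
  by rewrite Ex_Dcell Ex_cst subrr mulr0.
move=> t j l.
have eX : E (fun o => X t o j * X t o l) =
    (q j)^-1 * (q l)^-1 * (E (fun o => Dcell xs j.+1 (eps t.+1%:Z o) * Dcell xs l.+1 (eps t.+1%:Z o)) -
      mucell j.+1 * mucell l.+1).
  have -> : (fun o => X t o j * X t o l) = (fun o => (q j)^-1 * (q l)^-1 *
    ((Dcell xs j.+1 (eps t.+1%:Z o) * Dcell xs l.+1 (eps t.+1%:Z o) -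
      mucell l.+1 * Dcell xs j.+1 (eps t.+1%:Z o)) -
     (mucell j.+1 * Dcell xs l.+1 (eps t.+1%:Z o) - mucell j.+1 * mucell l.+1))).
    by apply/funext => o; rewrite /X; ring.
  have i1 := IntgB (iDD j l t.+1%:Z) (IntgZ (mucell l.+1) (iD j t.+1%:Z)).
  have i2 := IntgB (IntgZ (mucell j.+1) (iD l t.+1%:Z)) (Intg_cst Pr (mucell j.+1 * mucell l.+1)).
  rewrite ExZ; last exact: IntgB.
  rewrite (ExB i1 i2) ExB//; last exact: IntgZ.
  rewrite ExB; [|exact: IntgZ|exact: Intg_cst].
  by rewrite (ExZ _ (iD j _)) (ExZ _ (iD l _)) Ex_cst !Ex_Dcell; ring.
have q2 : 0 <= (q j)^-1 * (q l)^-1 <= Kp ^+ 2.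
  by rewrite mulr_ge0 ?invr_ge0 ?(ltW (q0 _))//= expr2 ler_pM ?invr_ge0 ?(ltW (q0 _)).
have mm : `|mucell j.+1 * mucell l.+1| <= 4 * w.
  rewrite normrM (_ : 4 * w = (2 * w) * 2); last by ring.
  by apply: ler_pM => //; exact: mucell_norm.
apply: (@le_trans _ _ (8 * w * Kp ^+ 2)); last first.
  apply: (@le_trans _ _ (8 * Rb * Kp ^+ 2 / r)).
    rewrite [leRHS](_ : _ = 8 * (Rb * r^-1) * Kp ^+ 2); last by ring.
    by rewrite ler_wpM2r ?sqr_ge0// ler_wpM2l.
  by rewrite ler_wpM2r ?invr_ge0 ?(ltW r0)// /Bc lerDr addr_ge0// mulr_ge0.
rewrite eX; have [jl|jl] := eqVneq j l.
  rewrite -{}jl in mm q2 *.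
  have h := Ex_Dcell_sqr t.+1%:Z (jm j).
  under eq_fun do rewrite -expr2.
  move: mm; rewrite -expr2 -invfM -expr2 qq => mm.
  move: q2; rewrite -invfM -expr2 qq => /andP[q3 q4].
  move: mm h; set e := E _; set u := mucell _ ^+ 2; set P := 2 * _ => mm h.
  have P0 : 0 < P by exact: p0.
  rewrite (_ : _ - _ = P^-1 * ((e - P) - u)); last first.
    by rewrite /= mulr1n; field; rewrite gt_eqF.
  rewrite normrM (ger0_norm q3) mulrC; apply: ler_pM => //.
  apply: (le_trans (ler_normB _ _)); apply: (le_trans (lerD h mm)).
  by rewrite -mulrDl -natrD.
have -> : E (fun o => Dcell xs j.+1 (eps t.+1%:Z o) * Dcell xs l.+1 (eps t.+1%:Z o)) = 0.
  rewrite (_ : (fun o => _) = fun=> 0); first by rewrite Ex_cst.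
  apply/funext => o; have [h|h|h] := ltngtP j l.
  - by apply: cells_disjoint; rewrite ?jm.
  - by rewrite mulrC; apply: cells_disjoint; rewrite ?jm.
  - by move: jl; rewrite (val_inj h) eqxx.
rewrite subr0 sub0r normrM normrN mulrC; move: q2 => /andP[q3 q4].
rewrite (ger0_norm q3); apply: ler_pM => //; apply: (le_trans mm).
by rewrite ler_wpM2r// ler_nat.
Qed.

End Clt.

End Noise.

End Cells.

(** * The chi-square statistic *)

Lemma rateE (R : realType) (Gam : R) : 0 <= Gam -> exists N0 : nat, forall n, (N0 <= n)%N ->
  forall g, 0 <= g <= Gam -> rate g n = g * (Num.sqrt n%:R)^-1.
Proof.
move=> G0; have G1 : 0 < (Gam + 1)^-1 by rewrite invr_gt0 ltr_wpDl.
have [N0 hN] := inv_sqrt_small G1; exists N0 => n /hN[n0 hs] g /andP[g0 gG].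
have s0 : 0 <= (Num.sqrt n%:R : R)^-1 by rewrite invr_ge0 sqrtr_ge0.
rewrite /rate min_r//; apply: (@le_trans _ _ (Gam * (Gam + 1)^-1)); first exact: ler_pM.
by rewrite ler_pdivrMr ?ltr_wpDl// mul1r lerDl.
Qed.

Lemma rate01 (R : realType) (g : R) n : 0 <= g -> 0 <= rate g n <= 1.
Proof.
by move=> g0; rewrite /rate le_min ler01 divr_ge0 ?sqrtr_ge0//= ge_min lexx.
Qed.

Section Core.
Context (R : realType) (p : nat) (beta : 'I_p -> R) (muP muQ Pi : probability R R).

Lemma DeltaPi_norm x : `|DeltaPi beta muP Pi x| <= p.+1%:R.
Proof.
rewrite /DeltaPi; apply: (le_trans (ler_norm_sum _ _ _)).
apply: (@le_trans _ _ (\sum_(0 <= j < p.+1) 1)); last by rewrite sumr_const_nat subn0.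
apply: ler_sum => j _; set f := fun s => _.
have f01 s : 0 <= f s <= 1 by exact: cdfE_bnd.
have /andP[a b] := cdfE_bnd muP x.
have h0 : 0 <= Rintegral Pi setT f by apply: Ex_ge0 => s; case/andP: (f01 s).
have h1 : Rintegral Pi setT f <= 1.
  case: x @f f01 a b h0 => [x| |] f f01 a b h0.
  - rewrite -[leRHS](Ex_cst Pi 1); apply: Ex_le; [|exact: Intg_cst|by move=> s; case/andP: (f01 s)].
    apply: (@Intg_bounded _ _ _ _ _ 1); last first.
      by move=> s; have /andP[u v] := f01 s; rewrite ger0_norm.
    have -> : f = df_of muP \o (fun s => x + beta_ext beta j * s) by apply/funext.
    apply: measurableT_comp; last by apply: measurable_funD => //; apply: measurable_funM.
    by apply: nondecreasing_measurable => // u v uv; exact: df_mono.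
  - by have -> : f = (fun=> 1) by []; rewrite -[Rintegral _ _ _]/(Ex Pi (fun=> 1)) Ex_cst.
  - by have -> : f = (fun=> 0) by []; rewrite -[Rintegral _ _ _]/(Ex Pi (fun=> 0)) Ex_cst.
by move: (Rintegral _ _ _) (cdfE muP x) h0 h1 a b => *; rewrite ler_norml; apply/andP; split; lra.
Qed.

Variables (LP LQ MP MQ : R).
Hypotheses (crP : cdf_reg (df_of muP) LP MP) (crQ : cdf_reg (df_of muQ) LQ MQ).

(** The contamination effect is computed under the mixture, [DeltaPi] under P; both parts of each
    summand differ by at most [w]. *)
Lemma muz_DeltaPi (x w gn r g : R) : 0 <= w <= 1 -> r * gn = g -> 0 <= g ->
  `|r * (\sum_(0 <= j < p.+1) muz (mixF (df_of muP) (df_of muQ) w) gn Pi beta x j) -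
    g * DeltaPi beta muP Pi x%:E| <= g * (p.+1%:R * (2 * w)).
Proof.
move=> w01 rg g0; have w0 : 0 <= w by case/andP: w01.
set G := mixF _ _ w.
have crG := mix_reg w01 crP crQ.
have -> : r * (\sum_(0 <= j < p.+1) muz G gn Pi beta x j) - g * DeltaPi beta muP Pi x%:E =
   g * \sum_(0 <= j < p.+1) ((Rintegral Pi setT (fun y => G (x + beta_ext beta j * y)) - G x) -
     (Rintegral Pi setT (fun s => df_of muP (x + beta_ext beta j * s)) - df_of muP x)).
  rewrite /muz -mulr_sumr mulrA rg /DeltaPi -mulrBr -sumrB.
  by congr (_ * _); apply: eq_bigr.
rewrite normrM (ger0_norm g0) ler_wpM2l//; apply: (le_trans (ler_norm_sum _ _ _)).
apply: (@le_trans _ _ (\sum_(0 <= j < p.+1) 2 * w)); last first.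
  by rewrite sumr_const_nat subn0 -[_ *+ _]mulr_natl.
apply: ler_sum => j _.
have GP y : `|G y - df_of muP y| <= w by exact: (mixE_dist muP muQ y%:E w0).
have iG F L M : cdf_reg F L M -> Intg Pi (fun y => F (x + beta_ext beta j * y)).
  move=> cF; apply: (@Intg_bounded _ _ _ _ _ 1) => [|y].
    apply: (measurableT_comp (cr_meas cF)).
    by apply: measurable_funD => //; apply: measurable_funM.
  by have /andP[a b] := cr_bnd cF (x + beta_ext beta j * y); rewrite ger0_norm.
have i1 := iG _ _ _ crG; have i2 := iG _ _ _ crP.
have h1 : `|Ex Pi (fun y => G (x + beta_ext beta j * y)) -
    Ex Pi (fun y => df_of muP (x + beta_ext beta j * y))| <= w.
  rewrite -ExB//; apply: (le_trans (Ex_norm (IntgB i1 i2))); rewrite -[leRHS](Ex_cst Pi w).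
  by apply: Ex_le => //; [exact: Intg_norm (IntgB i1 i2)|exact: Intg_cst].
have h2 := GP x; move: h1 h2; rewrite /Ex.
move: (Rintegral _ _ _) (Rintegral _ _ _) (G x) (df_of muP x) => a b c e.
rewrite !ler_norml => /andP[? ?] /andP[? ?]; apply/andP; split; lra.
Qed.

(** At infinite endpoints indicators are constant and [DeltaPi] vanishes. At finite ones the effect
    under the mixture is replaced by the one under P, at a cost of order n^(-1/2). *)
Lemma emp_ext (sg2 Gam Rb M a e : R) (x : \bar R) :
  stable_AR beta -> 0 <= Gam -> 0 <= Rb -> 0 <= M -> 0 < a -> 0 < e -> 0 <= sg2 ->
  exists N0 : nat, forall n, (N0 <= n)%N ->
  forall (d : measure_display) (Omega : measurableType d) (Pr : probability Omega R)
    (u B xi : int -> Omega -> R) (g r : R), 0 <= g <= Gam -> 0 <= r <= Rb ->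
  (forall t, measurable_fun setT (u t)) -> strictly_stationary Pr u ->
  noise_model Pr (innov beta u) B xi (mixF (df_of muP) (df_of muQ) (rate r n)) (rate g n) sg2 Pi ->
  prob_le Pr [set w | exists bh : 'I_p -> R,
     (forall i, `|Num.sqrt n%:R * (bh i - beta i)| <= M) /\
     a < `|(Num.sqrt n%:R)^-1 * (\sum_(0 <= t < n)
        (Ind x (resid bh (yobs u B xi ^~ w) t.+1%:Z) - Ind x (innov beta u t.+1%:Z w))) -
        g * DeltaPi beta muP Pi x|] e.
Proof.
move=> st Gam0 Rb0 M0 a0 e0 sg0.
have triv n (d : measure_display) (Omega : measurableType d) (Pr : probability Omega R)
    (u B xi : int -> Omega -> R) (g : R) (i : R) : (forall e, Ind x e = i) ->
    DeltaPi beta muP Pi x = 0 ->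
    prob_le Pr [set w | exists bh : 'I_p -> R,
     (forall i, `|Num.sqrt n%:R * (bh i - beta i)| <= M) /\
     a < `|(Num.sqrt n%:R)^-1 * (\sum_(0 <= t < n)
        (Ind x (resid bh (yobs u B xi ^~ w) t.+1%:Z) - Ind x (innov beta u t.+1%:Z w))) -
        g * DeltaPi beta muP Pi x|] e.
  move=> hi hD; exists set0; split => //; last by rewrite measure0 lee_fin ltW.
  move=> w [bh [_]]; rewrite hD mulr0 subr0 big1 ?mulr0 ?normr0; first by rewrite ltNge ltW.
  by move=> t _; rewrite !hi subrr.
case: x triv => [x| |] triv; last first.
- exists 0%N => n _ d Omega Pr u B xi g r _ _ _ _ _; apply: (triv _ _ _ _ _ _ _ _ 0).
    by move=> y; rewrite /Ind leeNy_eq.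
  rewrite /DeltaPi big1// => j _.
  by rewrite -[Rintegral _ _ _]/(Ex Pi (fun=> 0)) Ex_cst subrr.
- exists 0%N => n _ d Omega Pr u B xi g r _ _ _ _ _; apply: (triv _ _ _ _ _ _ _ _ 1).
    by move=> y; rewrite /Ind leey.
  rewrite /DeltaPi big1// => j _.
  by rewrite -[Rintegral _ _ _]/(Ex Pi (fun=> 1)) Ex_cst subrr.
have a20 : 0 < a / 2 by rewrite divr_gt0.
have L0 : 0 <= LP + LQ by rewrite addr_ge0 ?(L_ge0 crP) ?(L_ge0 crQ).
have M20 : 0 <= MP + MQ by rewrite addr_ge0 ?(M2_ge0 crP) ?(M2_ge0 crQ).
have [N1 hN1] := emp_uniform Pi x st Gam0 M0 a20 e0 L0 M20 sg0.
have [N2 hN2] := rateE Gam0; have [N3 hN3] := rateE Rb0.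
pose A := Gam * (p.+1%:R * (2 * Rb)).
have A0 : 0 <= A by rewrite !mulr_ge0.
have A1 : 0 < a / 2 / (A + 1) by rewrite divr_gt0// ltr_wpDl.
have [N4 hN4] := inv_sqrt_small A1.
exists (maxn (maxn N1 N2) (maxn N3 N4)) => n; rewrite !geq_max => /andP[/andP[n1 n2] /andP[n3 n4]].
move=> d Omega Pr u B xi g r hg hr um ust nm.
have [n0 hs] := hN4 n n4; have eg := hN2 n n2 g hg; have er := hN3 n n3 r hr.
have r0 : 0 < Num.sqrt n%:R :> R by rewrite sqrtr_gt0 ltr0n.
have g0 : 0 <= g by case/andP: hg.
have r01 : 0 <= rate r n <= 1 by apply: rate01; case/andP: hr.
have crG := mix_reg r01 crP crQ.
have s0 : 0 <= (Num.sqrt n%:R : R)^-1 by rewrite invr_ge0 ltW.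
have gn : rate g n <= Gam * (Num.sqrt n%:R)^-1.
  by rewrite eg ler_wpM2r//; case/andP: hg.
apply: prob_le_sub (hN1 n n1 d Omega Pr u B xi _ _ um ust nm crG gn).
move=> w /= [bh [hb hlt]]; exists bh; split=> //.
have rg : Num.sqrt n%:R * rate g n = g by rewrite eg mulrCA mulfV ?mulr1// gt_eqF.
have := muz_DeltaPi x r01 rg g0.
have sm : g * (p.+1%:R * (2 * rate r n)) <= a / 2.
  apply: le_trans (small_mul A0 a20 s0 hs); rewrite er /A.
  rewrite [leRHS](_ : _ = Gam * (p.+1%:R * (2 * (Rb * (Num.sqrt n%:R)^-1)))); last by ring.
  case/andP: hg => _ gG; case/andP: hr => rr0 rR.
  apply: ler_pM => //; first by rewrite !mulr_ge0.
  by rewrite ler_wpM2l// ler_wpM2l// ler_wpM2r.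
move=> hd; have {}hd := le_trans hd sm.
have eI : \sum_(0 <= t < n)
        (Ind x%:E (resid bh (yobs u B xi ^~ w) t.+1%:Z) - Ind x%:E (innov beta u t.+1%:Z w)) =
  \sum_(0 <= t < n) ((resid bh (yobs u B xi ^~ w) t.+1%:Z <= x)%R%:R - (innov beta u t.+1%:Z w <= x)%R%:R).
  by apply: eq_bigr => t _; rewrite !Ind_fin.
move: hlt; rewrite eI; move: hd; move: (_^-1 * _) (Num.sqrt n%:R * _) (g * _) => q1 q2 q3 hd hlt.
rewrite ltNge; apply/negP => h; move: hlt; rewrite ltNge => /negP; apply.
rewrite (_ : q1 - q3 = (q1 - q2) + (q2 - q3)); last by ring.
apply: (le_trans (ler_normD _ _)); apply: (le_trans (lerD h hd)).
by rewrite -splitr.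
Qed.

End Core.

Lemma Ex_close (R : realType) (d : measure_display) (Omega : measurableType d)
  (Pr : probability Omega R) (f g : Omega -> R) (a q : R) :
  measurable_fun setT f -> measurable_fun setT g ->
  (forall w, 0 <= f w <= 1) -> (forall w, 0 <= g w <= 1) -> 0 <= a ->
  prob_le Pr [set w | a < `|f w - g w|] q -> `|Ex Pr f - Ex Pr g| <= a + q.
Proof.
move=> mf mg f01 g01 a0 [A [mA hA PA]].
have bd (h : Omega -> R) : (forall w, 0 <= h w <= 1) -> forall w, `|h w| <= 1.
  by move=> h01 w; have /andP[u v] := h01 w; rewrite ger0_norm.
have i1 : Intg Pr f by apply: (@Intg_bounded _ _ _ _ _ 1) => //; exact: bd.
have i2 : Intg Pr g by apply: (@Intg_bounded _ _ _ _ _ 1) => //; exact: bd.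
have mi : measurable_fun setT (\1_A : Omega -> R) by exact: measurable_indic.
have iA : Intg Pr (\1_A : Omega -> R).
  apply: (@Intg_bounded _ _ _ _ _ 1) => // w; rewrite indicE.
  by case: (_ \in _); rewrite ?normr1 ?normr0.
rewrite -ExB//; apply: (le_trans (Ex_norm (IntgB i1 i2))).
apply: (@le_trans _ _ (Ex Pr (fun w => a + \1_A w))).
  apply: Ex_le; [exact: Intg_norm (IntgB i1 i2)|by apply: IntgD => //; exact: Intg_cst|].
  move=> w; have [h|h] := leP `|f w - g w| a.
    by apply: (le_trans h); rewrite lerDl indicE; case: (_ \in _).
  rewrite indicE mem_set; last exact: hA.
  apply: (@le_trans _ _ 1); last by rewrite lerDr.
  have /andP[u v] := f01 w; have /andP[u' v'] := g01 w.
  by move: (f w) (g w) u v u' v' => *; rewrite ler_norml; apply/andP; split; lra.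
rewrite ExD//; last exact: Intg_cst.
rewrite Ex_cst lerD2l /Ex /Rintegral integral_indic// setIT.
by rewrite -lee_fin Pr_fine.
Qed.

Lemma expRN_lip (R : realType) (u v : R) : 0 <= u -> 0 <= v ->
  `|expR (- u) - expR (- v)| <= `|u - v|.
Proof.
have main (x y : R) : 0 <= x -> x <= y -> `|expR (- x) - expR (- y)| <= `|x - y|.
  move=> x0 xy.
  rewrite ger0_norm; last by rewrite subr_ge0 ler_expR lerN2.
  rewrite ler0_norm ?subr_le0// opprB.
  have -> : expR (- y) = expR (- x) * expR (- (y - x)) by rewrite -expRD; congr expR; ring.
  rewrite -[X in X - _]mulr1 -mulrBr.
  have h1 := expR_ge1Dx (- (y - x)).
  have h2 : expR (- x) <= 1 by rewrite -[leRHS]expR0 ler_expR oppr_le0.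
  apply: (@le_trans _ _ (1 * (y - x))); last by rewrite mul1r.
  apply: ler_pM; rewrite ?expR_ge0//.
    by rewrite subr_ge0 -[leRHS]expR0 ler_expR oppr_le0 subr_ge0.
  by move: (expR _) h1 => *; lra.
move=> u0 v0; have [h|h] := leP u v; first exact: main.
by rewrite distrC [leRHS]distrC; apply: main => //; exact: ltW.
Qed.

Lemma ratio_close (R : realType) (T T' q pj K a b : R) : 0 < pj -> `|T - T'| <= a -> a <= 1 ->
  `|T'| <= K -> `|q - pj| <= b -> b <= pj / 2 ->
  `|T ^+ 2 / (2 * q) - T' ^+ 2 / (2 * pj)| <= pj^-1 * (a * (2 * K + 1)) + pj^-1 ^+ 2 * (K ^+ 2 * b).
Proof.
move=> p0 hT a1 hK hq hb.
have qp : pj / 2 <= q by move: hq; rewrite ler_norml => /andP[? ?]; lra.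
have q0 : 0 < q by apply: lt_le_trans qp; rewrite divr_gt0.
have a0 : 0 <= a by exact: le_trans (normr_ge0 _) hT.
have K0 : 0 <= K by exact: le_trans (normr_ge0 _) hK.
have b0 : 0 <= b by exact: le_trans (normr_ge0 _) hq.
have -> : T ^+ 2 / (2 * q) - T' ^+ 2 / (2 * pj) =
    (2 * q)^-1 * ((T - T') * (T + T')) + (2 * pj * q)^-1 * (T' ^+ 2 * (pj - q)).
  by field; rewrite !gt_eqF.
apply: (le_trans (ler_normD _ _)); rewrite !normrM; apply: lerD.
  apply: ler_pM; rewrite ?mulr_ge0//.
    by rewrite gtr0_norm ?invr_gt0 ?mulr_gt0// lef_pV2 ?posrE ?mulr_gt0//; lra.
  apply: ler_pM => //; rewrite (_ : T + T' = (T - T') + 2 * T'); last by ring.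
  apply: (le_trans (ler_normD _ _)); rewrite normrM (ger0_norm (_ : 0 <= 2))// addrC.
  by apply: lerD; [rewrite ler_wpM2l|exact: le_trans hT a1].
apply: ler_pM; rewrite ?mulr_ge0//.
  rewrite gtr0_norm ?invr_gt0 ?mulr_gt0// exprVn lef_pV2 ?posrE ?mulr_gt0 ?exprn_gt0//.
  rewrite expr2 [leRHS](_ : _ = pj * (2 * q)); last by ring.
  by rewrite ler_wpM2l ?(ltW p0)//; lra.
rewrite distrC; apply: ler_pM => //.
by rewrite expr2 ler_pM.
Qed.

(** Since division by 0 gives 0, the identity also covers an empty cell, and no event has to be
    excluded for it. *)
Lemma scaled_ratio (R : realType) (s y z : R) : s != 0 ->
  z ^+ 2 / (2 * y) = (s * z) ^+ 2 / (2 * (s * (s * y))).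
Proof.
move=> s0; have [->|y0] := eqVneq y 0; first by rewrite !mulr0 invr0 !mulr0.
by field; rewrite s0 y0.
Qed.

Lemma cell_close (R : realType) (F1 F2 F3 F4 E1 E2 E3 E4 d1 d2 d3 d4 m1 m2 m3 m4 r s a K D0 Rb pj : R) :
  0 < s -> r * s = 1 ->
  `|F1 - E1 - d1| <= a -> `|F2 - E2 - d2| <= a -> `|F3 - E3 - d3| <= a -> `|F4 - E4 - d4| <= a ->
  `|E1 - r * m1| <= K -> `|E2 - r * m2| <= K -> `|E3 - r * m3| <= K -> `|E4 - r * m4| <= K ->
  `|d1| <= D0 -> `|d2| <= D0 -> `|d3| <= D0 -> `|d4| <= D0 ->
  `|r * (m1 - m2 - (m3 - m4))| <= 2 * Rb -> `|m1 - m2 - pj| <= 2 * (Rb * s) ->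
  [/\ `|(F1 - F2 - (F3 - F4)) - (E1 - E2 - (E3 - E4) + (d1 - d2 - (d3 - d4)))| <= 4 * a,
      `|E1 - E2 - (E3 - E4) + (d1 - d2 - (d3 - d4))| <= 4 * K + 2 * Rb + 4 * D0 &
      `|s * (F1 - F2) - pj| <= s * (2 * a + 2 * D0 + 2 * K + 2 * Rb)].
Proof.
move=> s0 rs.
rewrite !ler_norml => /andP[? ?] /andP[? ?] /andP[? ?] /andP[? ?] /andP[? ?] /andP[? ?].
move=> /andP[? ?] /andP[? ?] /andP[? ?] /andP[? ?] /andP[? ?] /andP[? ?] hm hp.
split.
- by apply/andP; split; lra.
- by move: hm; rewrite !mulrBr => /andP[? ?]; apply/andP; split; lra.
have h : s * (F1 - F2) - pj = s * ((F1 - E1 - d1) - (F2 - E2 - d2) + (d1 - d2) +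
    ((E1 - r * m1) - (E2 - r * m2))) + (m1 - m2 - pj).
  rewrite (_ : m1 - m2 - pj = (r * s) * (m1 - m2) - pj); last by rewrite rs mul1r.
  by ring.
rewrite -ler_norml h; apply: (le_trans (ler_normD _ _)).
rewrite [leRHS](_ : _ = s * (2 * a + 2 * D0 + 2 * K) + 2 * (Rb * s)); last by ring.
apply: lerD; last by rewrite ler_norml.
rewrite normrM (gtr0_norm s0) ler_pM2l// ler_norml; apply/andP; split; lra.
Qed.

Lemma fin_eventually (T : finType) (P : T -> nat -> Prop) :
  (forall k, exists N : nat, forall n, (N <= n)%N -> P k n) ->
  exists N : nat, forall n, (N <= n)%N -> forall k, P k n.
Proof.
move=> h; have [f hf] := choice h; exists (\max_k f k) => n hn k; apply: hf.
by apply: leq_trans hn; exact: leq_bigmax.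
Qed.

(** * Convergence of the Laplace transform of the statistic *)

Section CoreLaplace.
Context (R : realType) (p : nat) (beta : 'I_p -> R) (muP muQ Pi : probability R R)
  (m : nat) (xs : nat -> \bar R) (LP LQ MP MQ : R).
Hypotheses (st : stable_AR beta) (crP : cdf_reg (df_of muP) LP MP)
  (crQ : cdf_reg (df_of muQ) LQ MQ) (sy : symmetric_law muP)
  (xs0 : xs 0%N = 0%E) (xsS : forall j, (j < m)%N -> (xs j < xs j.+1)%E)
  (pp : forall j, (1 <= j <= m)%N -> 0 < p_plus muP xs j).

(** All endpoints of the positive and negative cells, indexed by a finite type for the union
    bounds. *)
Definition thr (k : 'I_m.+1 * bool) : \bar R := if k.2 then xs k.1 else (- xs k.1)%E.

Definition drift (r g : R) (j : nat) : R :=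
  r * (q_plus muQ xs j - q_minus muQ xs j) + g * delta_j beta muP Pi xs j.

(* The chi-square statistic evaluated at the unobservable innovations, recentred by
   the effect of the contamination. *)
Definition chi2_innov (d : measure_display) (Omega : measurableType d) (n : nat) (g : R)
  (eps : int -> Omega -> R) (w : Omega) : R :=
  \sum_(j < m) ((Num.sqrt n%:R)^-1 * (\sum_(0 <= t < n) Dcell xs j.+1 (eps t.+1%:Z w)) +
     g * delta_j beta muP Pi xs j.+1) ^+ 2 / (2 * p_plus muP xs j.+1).

Definition kp1 : R := \sum_(j < m) (p_plus muP xs j.+1)^-1.
Definition kp2 : R := \sum_(j < m) (p_plus muP xs j.+1)^-1 ^+ 2.

(** The deterministic part: the empirical comparison and the fluctuation bounds are assumed at every
    endpoint. [b] bounds the error of the relative frequency of a cell, and [b * kp1 <= 1 / 2] keeps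
    that frequency above half of p_j^+, where the quotient is stable. *)
Lemma chi2_close (d : measure_display) (Omega : measurableType d)
  (u B xi : int -> Omega -> R) (n : nat) (Gam Rb g r a K : R) (bh : 'I_p -> R) (w : Omega) :
  let s := (Num.sqrt n%:R)^-1 in let D0 := Gam * p.+1%:R in
  let K4 := 4 * K + 2 * Rb + 4 * D0 in let b := s * (2 * a + 2 * D0 + 2 * K + 2 * Rb) in
  (0 < n)%N -> 0 <= g <= Gam -> 0 <= r <= Rb -> rate r n = r * s -> rate r n <= 1 ->
  4 * a <= 1 -> b * kp1 <= 1 / 2 ->
  (forall k, `|s * (\sum_(0 <= t < n) (Ind (thr k) (resid bh (yobs u B xi ^~ w) t.+1%:Z) -
      Ind (thr k) (innov beta u t.+1%:Z w))) - g * DeltaPi beta muP Pi (thr k)| <= a) ->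
  (forall k, `|s * \sum_(0 <= t < n) (Ind (thr k) (innov beta u t.+1%:Z w) -
      mixE muP muQ (rate r n) (thr k))| <= K) ->
  `|chi2_stat n m bh (yobs u B xi ^~ w) xs - chi2_innov n g (innov beta u) w| <=
  kp1 * (4 * a * (2 * K4 + 1)) + kp2 * (K4 ^+ 2 * b).
Proof.
move=> s D0 K4 b n0 /andP[g0 gG] /andP[r0 rR] er er1 a1 hb hA hK.
have q0 : 0 < Num.sqrt n%:R :> R by rewrite sqrtr_gt0 ltr0n.
have s0 : 0 < s by rewrite invr_gt0.
have rs : Num.sqrt n%:R * s = 1 by rewrite mulfV// gt_eqF.
have sn : s * n%:R = Num.sqrt n%:R.
  have rr : Num.sqrt n%:R ^+ 2 = n%:R :> R by rewrite sqr_sqrtr.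
  transitivity (s * Num.sqrt n%:R ^+ 2); first by rewrite rr.
  by rewrite expr2 mulrA [s * _]mulrC rs mul1r.
have w01 : 0 <= rate r n <= 1 by exact: rate01.
rewrite /chi2_stat big_add1 big_mkord /chi2_innov -sumrB.
apply: (le_trans (ler_norm_sum _ _ _)); rewrite /kp1 /kp2 !mulr_suml -big_split/=.
apply: ler_sum => j _.
have jm : (1 <= j.+1 <= m)%N by rewrite ltn_ord.
have p0 : 0 < p_plus muP xs j.+1 by exact: pp.
have ej : (xs j.+1.-1 <= xs j.+1)%E by exact/ltW/xsS.
pose F x := s * \sum_(0 <= t < n) Ind x (resid bh (yobs u B xi ^~ w) t.+1%:Z).
pose Ee x := s * \sum_(0 <= t < n) Ind x (innov beta u t.+1%:Z w).
pose mx x := mixE muP muQ (rate r n) x.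
have j1 : (j.+1 < m.+1)%N by rewrite ltnS; exact: ltn_ord.
have j0 : (j < m.+1)%N by exact: ltnW.
have FA k : `|F (thr k) - Ee (thr k) - g * DeltaPi beta muP Pi (thr k)| <= a.
  by have := hA k; rewrite sumrB mulrBr.
have EK k : `|Ee (thr k) - Num.sqrt n%:R * mx (thr k)| <= K.
  by have := hK k; rewrite sumrB sumr_const_nat subn0 -[_ *+ n]mulr_natl mulrBr mulrA sn.
have gD x : `|g * DeltaPi beta muP Pi x| <= D0.
  by rewrite normrM (ger0_norm g0) ler_pM//; exact: DeltaPi_norm.
have emu : mx (xs j.+1) - mx (xs j) - (mx (- xs j)%E - mx (- xs j.+1)%E) =
    mucell muQ (rate r n) xs j.+1.
  rewrite /mx /mixE !(cdfE_symm _ sy crP) /mucell /q_plus /q_minus/=.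
  by ring.
have h1 : `|Num.sqrt n%:R * (mx (xs j.+1) - mx (xs j) - (mx (- xs j)%E - mx (- xs j.+1)%E))| <= 2 * Rb.
  rewrite emu normrM (gtr0_norm q0); apply: (@le_trans _ _ (Num.sqrt n%:R * (2 * rate r n))).
    by rewrite ler_pM2l//; exact: mucell_norm.
  rewrite er (_ : _ * (2 * (r * s)) = (Num.sqrt n%:R * s) * (2 * r)); last by ring.
  by rewrite rs mul1r ler_wpM2l.
have h2 : `|mx (xs j.+1) - mx (xs j) - p_plus muP xs j.+1| <= 2 * (Rb * s).
  have w0 : 0 <= rate r n by case/andP: w01.
  have := mixE_dist muP muQ (xs j.+1) w0; have := mixE_dist muP muQ (xs j) w0.
  have : rate r n <= Rb * s by rewrite er ler_wpM2r// ltW.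
  rewrite /p_plus/= /mx !ler_norml; 
  move: (Rb * s) (rate r n) (mixE muP muQ (rate r n) (xs j)) (mixE muP muQ (rate r n) (xs j.+1))
    (cdfE muP (xs j)) (cdfE muP (xs j.+1)).
  by move=> ? ? ? ? ? ? ? /andP[? ?] /andP[? ?]; apply/andP; split; lra.
have [c1 c2 c3] := cell_close s0 rs (FA (Ordinal j1, true)) (FA (Ordinal j0, true))
  (FA (Ordinal j0, false)) (FA (Ordinal j1, false)) (EK (Ordinal j1, true)) (EK (Ordinal j0, true))
  (EK (Ordinal j0, false)) (EK (Ordinal j1, false)) (gD _) (gD _) (gD _) (gD _) h1 h2.
have nuE : (nu_plus n bh (yobs u B xi ^~ w) xs j.+1 - nu_minus n bh (yobs u B xi ^~ w) xs j.+1) ^+ 2 /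
    (2 * nu_plus n bh (yobs u B xi ^~ w) xs j.+1) =
   (F (xs j.+1) - F (xs j) - (F (- xs j)%E - F (- xs j.+1)%E)) ^+ 2 /
   (2 * (s * (F (xs j.+1) - F (xs j)))).
  rewrite (nu_plusE _ _ _ ej) (nu_minusE _ _ _ ej) /= !sumrB /F -!mulrBr.
  by apply: scaled_ratio; rewrite gt_eqF.
have DE : s * (\sum_(0 <= t < n) Dcell xs j.+1 (innov beta u t.+1%:Z w)) +
     g * delta_j beta muP Pi xs j.+1 =
   Ee (xs j.+1) - Ee (xs j) - (Ee (- xs j)%E - Ee (- xs j.+1)%E) +
   (g * DeltaPi beta muP Pi (xs j.+1) - g * DeltaPi beta muP Pi (xs j) -
    (g * DeltaPi beta muP Pi (- xs j)%E - g * DeltaPi beta muP Pi (- xs j.+1)%E)).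
  by rewrite /Dcell !sumrB /Ee /delta_j/=; ring.
rewrite nuE DE.
apply: (ratio_close p0 c1 a1 c2 c3).
rewrite ler_pdivlMr//.
have k1 : (p_plus muP xs j.+1)^-1 <= kp1.
  rewrite /kp1 (bigD1 j)//= lerDl sumr_ge0// => i _; rewrite invr_ge0 ltW//.
  by apply: pp; rewrite ltn_ord.
have b0 : 0 <= b by exact: le_trans (normr_ge0 _) c3.
have : b * (p_plus muP xs j.+1)^-1 <= 1 / 2.
  by apply: le_trans hb; rewrite ler_wpM2l.
by rewrite ler_pdivrMr// -/b; move: (b) => b'; lra.
Qed.

Lemma kp1_ge0 : 0 <= kp1.
Proof. by apply: sumr_ge0 => i _; rewrite invr_ge0 ltW//; apply: pp; rewrite ltn_ord. Qed.

Lemma kp2_ge0 : 0 <= kp2.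
Proof. by apply: sumr_ge0 => i _; exact: sqr_ge0. Qed.

Lemma wnorm2_ge0 v : 0 <= wnorm2 m muP xs v.
Proof.
rewrite /wnorm2 big_add1 big_mkord; apply: sumr_ge0 => j _.
by rewrite mulr_ge0 ?sqr_ge0// invr_ge0 mulr_ge0// ltW//; apply: pp; rewrite ltn_ord.
Qed.

(** [X] is tied to the statistic, and the estimator to the ball, only outside a small event;
    identifications valid almost surely and Condition (iv) thus enter through a single
    hypothesis. *)
Lemma core_laplace (sg2 Gam Rb M sL eta : R) :
  0 <= Gam -> 0 <= Rb -> 0 <= M -> 0 < sL -> 0 < eta -> 0 <= sg2 ->
  exists N0 : nat, forall n, (N0 <= n)%N ->
  forall (d : measure_display) (Omega : measurableType d) (Pr : probability Omega R)
    (u B xi : int -> Omega -> R) (g r : R) (X : Omega -> R) (bh : Omega -> 'I_p -> R),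
  0 <= g <= Gam -> 0 <= r <= Rb ->
  (forall t, measurable_fun setT (u t)) -> strictly_stationary Pr u ->
  noise_model Pr (innov beta u) B xi (mixF (df_of muP) (df_of muQ) (rate r n)) (rate g n) sg2 Pi ->
  measurable_fun setT X -> (forall w, 0 <= X w) ->
  prob_le Pr [set w | ~ (X w = chi2_stat n m (bh w) (yobs u B xi ^~ w) xs /\
     forall i, `|Num.sqrt n%:R * (bh w i - beta i)| <= M)] (eta / 4) ->
  `|Ex Pr (fun w => expR (- sL * X w)) - chi2_laplace m (wnorm2 m muP xs (drift r g)) sL| <= eta.
Proof.
move=> Gam0 Rb0 M0 sL0 eta0 sg0.
pose T : finType := ('I_m.+1 * bool)%type.
pose e2 := eta / 8 / #|T|.+1%:R.
have e20 : 0 < e2 by rewrite !divr_gt0.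
(* By Chebyshev's inequality a normalised centred indicator sum reaches [K] with probability at most
   1/K^2, which is at most [e2]. *)
pose K := 1 + e2^-1.
have K1 : 1 <= K by rewrite lerDl invr_ge0 ltW.
have K0 : 0 < K by exact: lt_le_trans K1.
have eK : 1 <= e2 * K ^+ 2.
  apply: (@le_trans _ _ (e2 * K)); first by rewrite /K mulrDr mulr1 mulfV ?gt_eqF// lerDr ltW.
  by rewrite ler_wpM2l ?(ltW e20)// expr2 ler_peMl// ltW.
pose D0 := Gam * p.+1%:R; have D00 : 0 <= D0 by rewrite mulr_ge0.
pose K4 := 4 * K + 2 * Rb + 4 * D0.
have K40 : 0 <= K4 by rewrite /K4 !addr_ge0// mulr_ge0// ltW.
have k10 := kp1_ge0; have k20 := kp2_ge0.
(* The two statistics will differ by at most 2 D1 on the good event, and sL times this is at most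
   eta/8. *)
pose D1 := eta / 16 / (sL + 1).
have sL1 : 0 < sL + 1 by rewrite ltr_wpDl// ltW.
have D10 : 0 < D1 by rewrite !divr_gt0.
pose A1 := kp1 * (4 * (2 * K4 + 1)).
have A10 : 0 <= A1 by rewrite /A1 !mulr_ge0// addr_ge0// mulr_ge0.
pose a := Num.min (1 / 4) (D1 / (A1 + 1)).
have a0 : 0 < a by rewrite lt_min divr_gt0//= divr_gt0// ltr_wpDl.
have a4 : 4 * a <= 1.
  have : a <= 1 / 4 by rewrite ge_min lexx.
  by move: (a) => a'; lra.
have aA : a * A1 <= D1 by apply: small_mul => //; [exact: ltW|rewrite ge_min lexx orbT].
pose K5 := 2 * a + 2 * D0 + 2 * K + 2 * Rb.
have K50 : 0 <= K5 by rewrite /K5 !addr_ge0// mulr_ge0// ltW.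
have c0 : 0 < sL / (1 + 2 * sL) by rewrite divr_gt0// ltr_wpDr// mulr_ge0// ltW.
have [C [C0 hC]] := @gauss_poly_bound R m _ c0.
pose lc := lind_cst m sL C (1 + 3 * Kp muP m xs + 8 * Rb * Kp muP m xs ^+ 2).
have e8 : 0 < eta / 8 by rewrite divr_gt0.
pose sm := Num.min (Num.min ((1 / 2) / (K5 * kp1 + 1)) (D1 / (kp2 * (K4 ^+ 2 * K5) + 1)))
   (eta / 8 / (`|lc| + 1)).
have K5k : 0 <= K5 * kp1 by rewrite mulr_ge0.
have K5q : 0 <= kp2 * (K4 ^+ 2 * K5) by rewrite mulr_ge0// mulr_ge0// sqr_ge0.
have h20 : 0 < 1 / 2 :> R by rewrite divr_gt0.
have sm0 : 0 < sm.
  by rewrite /sm !lt_min; apply/andP; split; [apply/andP; split|]; rewrite divr_gt0// ltr_wpDl.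
have [N1 hN1] := inv_sqrt_small sm0; have [N2 hN2] := rateE Gam0; have [N3 hN3] := rateE Rb0.
have [N4 hN4] := fin_eventually (fun k : T =>
  emp_ext Pi crP crQ (thr k) st Gam0 Rb0 M0 a0 e20 sg0).
exists (maxn (maxn N1 N2) (maxn N3 N4)) => n; rewrite !geq_max => /andP[/andP[n1 n2] /andP[n3 n4]].
move=> d Omega Pr u B xi g r X bh hg hr um ust nm mX X0 bad.
have [n0 hs] := hN1 n n1; have er := hN3 n n3 r hr.
set s : R := (Num.sqrt n%:R)^-1 in hs er.
have q0 : 0 < Num.sqrt n%:R :> R by rewrite sqrtr_gt0 ltr0n.
have s0 : 0 < s by rewrite invr_gt0.
move: hs; rewrite /sm !le_min => /andP[/andP[hs1 hs2] hs3].
have {}hs1 := small_mul K5k h20 (ltW s0) hs1.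
have {}hs2 := small_mul K5q D10 (ltW s0) hs2.
have {}hs3 := small_mul (normr_ge0 lc) e8 (ltW s0) hs3.
have w01 : 0 <= rate r n <= 1 by apply: rate01; case/andP: hr.
have cardT : forall y, 0 < y -> \sum_(k : T) y / 8 / #|T|.+1%:R <= y / 8 :> R.
  move=> y y0; rewrite sumr_const -[_ *+ _]mulr_natr -mulrA ler_piMr ?divr_ge0 ?(ltW y0)//.
  by rewrite mulrC ler_pdivrMr ?ltr0Sn// mul1r ler_nat.
have ev1 := prob_le_bigcup (fun k : T => hN4 n n4 k d Omega Pr u B xi g r hg hr um ust nm).
have {}ev1 := prob_le_le (cardT eta eta0) ev1.
have ev2 := prob_le_bigcup (fun k : T => Ind_cheb w01 nm (thr k) n0 K0 eK).
have {}ev2 := prob_le_le (cardT eta eta0) ev2.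
have ev := prob_leU (prob_leU bad ev1) ev2.
pose Q := chi2_innov n g (innov beta u).
have p0 (j : 'I_m) : 0 < 2 * p_plus muP xs j.+1.
  by rewrite mulr_gt0//; apply: pp; rewrite ltn_ord.
have Q0 w : 0 <= Q w.
  by apply: sumr_ge0 => j _; rewrite mulr_ge0 ?sqr_ge0// invr_ge0 ltW.
have meps t : measurable_fun setT (innov beta u t) := nm_meas nm (None, t).
have mQ : measurable_fun setT Q.
  apply: measurable_sum => j; apply: measurable_funM => //; apply: measurable_funX.
  apply: measurable_funD => //; apply: measurable_funM => //; apply: measurable_sum => t.
  by apply: measurable_funB; apply: measurable_funB; apply: (measurableT_comp (measurable_Ind _)).
have mexp (Y : Omega -> R) : measurable_fun setT Y -> measurable_fun setT (fun w => expR (- sL * Y w)).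
  by move=> mY; apply: measurableT_comp => //; apply: measurable_funM.
have e01 (Y : Omega -> R) : (forall w, 0 <= Y w) -> forall w, 0 <= expR (- sL * Y w) <= 1.
  move=> Y0 w; rewrite expR_ge0/= -[leRHS]expR0 ler_expR mulNr oppr_le0 mulr_ge0//.
  exact: ltW.
have close : `|Ex Pr (fun w => expR (- sL * X w)) - Ex Pr (fun w => expR (- sL * Q w))| <=
    eta / 8 + (eta / 4 + eta / 8 + eta / 8).
  apply: Ex_close; [exact: mexp|exact: mexp|exact: e01|exact: e01|exact: ltW|].
  apply: prob_le_sub ev => w /= hw; apply: contrapT => /not_orP[/not_orP[h1 h2] h3].
  move/contrapT: h1 => [h1 h1'].
  suff hX : `|X w - Q w| <= D1 + D1.
    move: hw; rewrite ltNge => /negP; apply.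
    rewrite !mulNr; apply: (le_trans (expRN_lip _ _)); rewrite ?mulr_ge0 ?(ltW sL0)//.
    rewrite -mulrBr normrM (gtr0_norm sL0).
    apply: (@le_trans _ _ ((sL + 1) * (D1 + D1))).
      by apply: ler_pM => //; [exact: ltW|rewrite lerDl].
    rewrite /D1 -mulrDl mulrC divfK ?gt_eqF// -mulrDl.
    by rewrite [leRHS](_ : eta / 8 = (eta + eta) / 16); [exact: lexx|field].
  rewrite h1.
  have hb : s * K5 * kp1 <= 1 / 2 by rewrite -mulrA.
  have er1 : rate r n <= 1 by case/andP: w01.
  have hA k : `|s * (\sum_(0 <= t < n) (Ind (thr k) (resid (bh w) (yobs u B xi ^~ w) t.+1%:Z) -
      Ind (thr k) (innov beta u t.+1%:Z w))) - g * DeltaPi beta muP Pi (thr k)| <= a.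
    rewrite leNgt; apply/negP => hlt; apply: h2; exists k; exists (bh w); split => //.
  have hK k : `|s * \sum_(0 <= t < n) (Ind (thr k) (innov beta u t.+1%:Z w) -
      mixE muP muQ (rate r n) (thr k))| <= K.
    by apply: ltW; rewrite ltNge; apply/negP => hlt; apply: h3; exists k.
  apply: (le_trans (chi2_close n0 hg hr er er1 a4 hb hA hK)).
  rewrite -/D0 -/K4; apply: lerD.
    by apply: le_trans aA; rewrite /A1 [leLHS](_ : _ = a * (kp1 * (4 * (2 * K4 + 1))))//; ring.
  by apply: le_trans hs2; rewrite -/s -/K5 [leLHS](_ : _ = s * (kp2 * (K4 ^+ 2 * K5)))//; ring.
have wR : rate r n <= Rb * (Num.sqrt n%:R)^-1.
  by rewrite er ler_wpM2r ?(ltW s0)//; case/andP: hr.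
have clt := clt_cells w01 nm sy crP xs0 xsS pp (fun j => g * delta_j beta muP Pi xs j)
  sL0 n0 Rb0 hC wR.
rewrite -/lc -/s in clt.
have lamE : \sum_(j < m) (Num.sqrt n%:R * mucell muQ (rate r n) xs j.+1 +
      g * delta_j beta muP Pi xs j.+1) ^+ 2 / (2 * p_plus muP xs j.+1) =
    wnorm2 m muP xs (drift r g).
  rewrite /wnorm2 big_add1 big_mkord; apply: eq_bigr => j _; congr (_ ^+ 2 / _).
  rewrite /drift /mucell er; congr (_ + _).
  by rewrite mulrA mulrCA mulfV ?gt_eqF// mulr1.
rewrite lamE in clt.
have clt2 : `|Ex Pr (fun w => expR (- sL * Q w)) - chi2_laplace m (wnorm2 m muP xs (drift r g)) sL| <= eta / 8.
  apply: (le_trans clt); apply: le_trans hs3; rewrite mulrC ler_wpM2l ?(ltW s0)//.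
  exact: ler_norm.
move: close clt2; rewrite !ler_norml.
move: (Ex Pr _) (Ex Pr _) (chi2_laplace _ _ _) => y1 y2 y3.
by move=> /andP[? ?] /andP[? ?]; apply/andP; split; lra.
Qed.

End CoreLaplace.

(** * Modification of processes on null events *)

Section AlmostSure.
Context (R : realType) (d : measure_display) (Omega : measurableType d)
  (Pr : probability Omega R).

Lemma Pr_setI1 (A N : set Omega) : measurable A -> measurable N -> Pr N = 1%E ->
  Pr (A `&` N) = Pr A.
Proof.
move=> mA mN N1; apply/eqP; rewrite eq_le; apply/andP; split.
  by apply: le_measure; rewrite ?inE//; exact: measurableI.
have N0 : Pr (~` N) = 0%E by rewrite probability_setC// N1 subee.
rewrite -[leRHS]adde0 -N0.
apply: (@le_trans _ _ (Pr ((A `&` N) `|` ~` N))).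
  apply: le_measure; rewrite ?inE//.
    by apply: measurableU; [exact: measurableI|exact: measurableC].
  by move=> w Aw; have [Nw|Nw] := pselect (N w); [left|right].
by apply: measureU2; [exact: measurableI|exact: measurableC].
Qed.

Lemma Pr_eq_as (A A' N : set Omega) : measurable A -> measurable A' -> measurable N ->
  Pr N = 1%E -> (forall w, N w -> (A w <-> A' w)) -> Pr A = Pr A'.
Proof.
move=> mA mA' mN N1 h; rewrite -(Pr_setI1 mA mN N1) -(Pr_setI1 mA' mN N1).
by congr (Pr _); apply/seteqP; split => w [Aw Nw]; split => //; apply/h.
Qed.

Lemma measurable_eqset (f g : Omega -> R) : measurable_fun setT f -> measurable_fun setT g ->
  measurable [set w | f w = g w].
Proof.
move=> mf mg; rewrite (_ : [set w | _] = [set w | f w == g w]).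
  by apply: measurable_bset; apply: measurable_fun_eqr.
by apply/seteqP; split => w /= /eqP.
Qed.

Lemma as_eq_seq (X Y : int -> Omega -> R) (s : seq int) :
  (forall t, measurable_fun setT (X t)) -> (forall t, measurable_fun setT (Y t)) ->
  (forall t, Pr [set w | X t w = Y t w] = 1%E) ->
  exists N, [/\ measurable N, Pr N = 1%E & forall w, N w -> forall t, t \in s -> X t w = Y t w].
Proof.
move=> mX mY h; elim: s => [|t s [N [mN N1 hN]]].
  by exists setT; split => //; exact: probability_setT.
have mt : measurable [set w | X t w = Y t w] by exact: measurable_eqset.
exists ([set w | X t w = Y t w] `&` N); split.
- exact: measurableI.
- by rewrite Pr_setI1.
- by move=> w [/= e Nw] r; rewrite inE => /orP[/eqP ->//|]; exact: hN.
Qed.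

Lemma measurable_fdd (X : int -> Omega -> R) s a :
  (forall t, measurable_fun setT (X t)) -> measurable (fdd_event X s a).
Proof. by move=> mX; exact: (@measurable_cyl_event _ _ _ _ X). Qed.

Lemma fdd_event1 (X : int -> Omega -> R) t a : fdd_event X [:: t] a = [set w | X t w <= a t].
Proof. by apply/seteqP; split => w; rewrite /fdd_event/= andbT. Qed.

(** Finitely many coordinates are involved, so the almost sure equalities hold jointly. *)
Lemma fdd_as (X Y : int -> Omega -> R) (s : seq int) a (C : set Omega) :
  (forall t, measurable_fun setT (X t)) -> (forall t, measurable_fun setT (Y t)) ->
  (forall t, Pr [set w | X t w = Y t w] = 1%E) -> measurable C ->
  Pr (fdd_event X s a `&` C) = Pr (fdd_event Y s a `&` C).
Proof.
move=> mX mY h mC; have [N [mN N1 hN]] := as_eq_seq s mX mY h.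
apply: (@Pr_eq_as _ _ N) => //; try by apply: measurableI => //; exact: measurable_fdd.
move=> w Nw; split => -[/allP hs Cw]; split => //; apply/allP => t ts.
  by rewrite -hN//; exact: hs.
by rewrite hN//; exact: hs.
Qed.

Lemma mutually_indep_as (X Y : int -> Omega -> R) :
  (forall t, measurable_fun setT (X t)) -> (forall t, measurable_fun setT (Y t)) ->
  (forall t, Pr [set w | X t w = Y t w] = 1%E) -> mutually_indep Pr X -> mutually_indep Pr Y.
Proof.
move=> mX mY h ind s a us.
have e := fdd_as _ _ mX mY h measurableT.
have := e s a; rewrite !setIT => <-; rewrite ind//; apply: eq_bigr => t _.
by have := e [:: t] a; rewrite !setIT !fdd_event1 => ->.
Qed.

End AlmostSure.

(** * From the contaminated model to the noise family *)

Section Model.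
Context (R : realType) (d : measure_display) (Omega : measurableType d)
  (Pr : probability Omega R) (p : nat) (beta : 'I_p -> R) (muP muQ Pi : probability R R)
  (w gn : R) (u eps z xi : int -> Omega -> R).
Hypotheses (w01 : 0 <= w <= 1) (zP : zero_mean_finite_var muP) (zQ : zero_mean_finite_var muQ)
  (md : contaminated_AR_model Pr beta (mixF (df_of muP) (df_of muQ) w) gn Pi u eps z xi).

(** [z] takes the values 0 and 1 only almost surely; this version does so everywhere. *)
Definition bern (t : int) (o : Omega) : R := (z t o == 1)%:R.

Let mu t : measurable_fun setT (u t). Proof. by case: md => h _ _ _ _; case: (h t). Qed.
Let mep t : measurable_fun setT (eps t). Proof. by case: md => h _ _ _ _; case: (h t). Qed.
Let mz t : measurable_fun setT (z t). Proof. by case: md => h _ _ _ _; case: (h t). Qed.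
Let mxi t : measurable_fun setT (xi t). Proof. by case: md => h _ _ _ _; case: (h t). Qed.

Let minn t : measurable_fun setT (innov beta u t).
Proof.
apply: measurable_funB => //; apply: measurable_sum => i.
by apply: measurable_funM.
Qed.

Let mbern t : measurable_fun setT (bern t).
Proof. by apply: measurable_ind; apply: measurable_fun_eqr. Qed.

Lemma innov_as t : Pr [set o | eps t o = innov beta u t o] = 1%E.
Proof.
case: md => _ _ [h _] _ _; rewrite -(h t); congr (Pr _); apply/seteqP; split => o /=.
  by rewrite /innov => ->; rewrite addrC subrK.
by rewrite /innov => ->; rewrite addrAC subrr add0r.
Qed.

Lemma bern_as t : Pr [set o | z t o = bern t o] = 1%E.
Proof.
case: md => _ _ _ [h _] _; have [h1 h0] := h t.
rewrite (_ : [set o | z t o = bern t o] = [set o | z t o = 1] `|` [set o | z t o = 0]).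
  transitivity (Pr [set o | z t o = 1%R] + Pr [set o | z t o = 0%R])%E.
    apply: measureU; [exact: measurable_eqset|exact: measurable_eqset|].
    by apply/seteqP; split => o //= [-> /eqP]; rewrite oner_eq0.
  by rewrite h1 h0 -EFinD addrC subrK.
apply/seteqP; split => o /=; rewrite /bern.
  by case: eqP => [-> _|_ ->]; [left|right].
by move=> [] ->; rewrite ?eqxx// eq_sym oner_eq0.
Qed.

(** The model factorises events of u, z and xi, whereas innovations are functions of u. With the
    events of z and xi fixed, the product formula extends from cylinders of u to the sigma-algebra
    they generate, which contains the innovation events. *)
Lemma noise_factor s1 s2 s3 a b c :
  fine (Pr (fdd_event (innov beta u) s1 a `&` fdd_event bern s2 b `&` fdd_event xi s3 c)) =
  fine (Pr (fdd_event (innov beta u) s1 a)) * fine (Pr (fdd_event bern s2 b)) *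
  fine (Pr (fdd_event xi s3 c)).
Proof.
case: md => _ _ _ _ [_ _ i3].
have mF X s f : (forall t, measurable_fun setT (X t)) -> measurable (fdd_event X s f).
  by move=> mX; exact: measurable_fdd.
have swap (C : set Omega) : measurable C -> Pr (fdd_event bern s2 b `&` C) = Pr (fdd_event z s2 b `&` C).
  by move=> mC; apply/esym; apply: fdd_as => // t; exact: bern_as.
have -> : Pr (fdd_event bern s2 b) = Pr (fdd_event z s2 b).
  by have := swap setT measurableT; rewrite !setIT.
have -> : fdd_event (innov beta u) s1 a `&` fdd_event bern s2 b `&` fdd_event xi s3 c =
    fdd_event bern s2 b `&` (fdd_event (innov beta u) s1 a `&` fdd_event xi s3 c).
  by rewrite setIA [X in X `&` _]setIC.
rewrite swap; last by apply: measurableI; exact: mF.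
have -> : fdd_event z s2 b `&` (fdd_event (innov beta u) s1 a `&` fdd_event xi s3 c) =
    fdd_event (innov beta u) s1 a `&` (fdd_event z s2 b `&` fdd_event xi s3 c).
  by rewrite setIA [X in X `&` _]setIC -setIA.
set C := fdd_event z s2 b `&` fdd_event xi s3 c.
have mC : measurable C by apply: measurableI; exact: mF.
have fE (X : int -> Omega -> R) f : fdd_event X [::] f = setT by apply/seteqP; split.
have i2 : fine (Pr C) = fine (Pr (fdd_event z s2 b)) * fine (Pr (fdd_event xi s3 c)).
  have := i3 [::] s2 s3 a b c; rewrite fE setTI => ->.
  by rewrite probability_setT/= mul1r.
have key : (Pr (fdd_event (innov beta u) s1 a `&` C) = Pr (fdd_event (innov beta u) s1 a) * Pr C)%E.
  pose J (_ : int) := True.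
  have Gm : cyl u J `<=` measurable by exact: cyl_measurable.
  apply: (pi_system_sigma_half Gm).
  - exact: cyl_setI.
  - exact: cyl_setT.
  - exact: mC.
  - move=> _ [s [f [_ ->]]].
    have := i3 s s2 s3 f b c; rewrite -setIA -/C -mulrA -i2 => e.
    have mU : measurable (cyl_event u s f) by exact: mF.
    rewrite -(Pr_fine Pr mU) -(Pr_fine Pr mC) -(Pr_fine Pr (measurableI _ _ mU mC)) -EFinM.
    by congr EFin.
  - have mI t : measurable_fun setT (innov beta u t : g_sigma_algebraType (cyl u J) -> R).
      apply: measurable_funB; first exact: (@sigm_cyl _ _ _ _ u J).
      apply: measurable_sum => i; apply: measurable_funM => //.
      exact: (@sigm_cyl _ _ _ _ u J).
    exact: (@measurable_cyl_event _ _ (g_sigma_algebraType (cyl u J)) _ (innov beta u) mI s1 a).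
have mI : measurable (fdd_event (innov beta u) s1 a) by exact: mF.
rewrite key -(Pr_fine Pr mI) -(Pr_fine Pr mC) -EFinM/= i2.
by rewrite mulrA.
Qed.

(** For independence, a list of indices is split by tag: [noise_factor] separates the three parts
    and mutual independence handles each. The moments of the innovations are read off from their
    mixture law. *)
Lemma model_noise : noise_model Pr (innov beta u) bern xi (mixF (df_of muP) (df_of muQ) w) gn
  (Ex muP (fun x => x ^+ 2) + Ex muQ (fun x => x ^+ 2)) Pi.
Proof.
have cdf t x : fine (Pr [set o | innov beta u t o <= x]) = mixF (df_of muP) (df_of muQ) w x.
  case: (md) => _ [h _] _ _ _; rewrite -(h t x); congr fine.
  have := fdd_as [:: t] (fun=> x) mep minn innov_as measurableT.
  by rewrite !setIT !fdd_event1 => ->.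
have mom t := mixture_moments (minn t) w01 (cdf t) zP zQ.
split.
- by move=> [[[]|] t]; [exact: mbern|exact: mxi|exact: minn].
- have indI : mutually_indep Pr (innov beta u).
    by apply: (mutually_indep_as mep minn innov_as); case: md => _ [].
  have indB : mutually_indep Pr bern.
    by apply: (mutually_indep_as mz mbern bern_as); case: md => _ _ _ [].
  have indX : mutually_indep Pr xi by case: md => _ _ _ _ [].
  move=> s a us.
  pose sub (o : option bool) := [seq k.2 | k <- s & k.1 == o].
  have usub o : uniq (sub o).
    rewrite map_inj_in_uniq ?filter_uniq// => -[k1 k2] [l1 l2].
    by rewrite !mem_filter/= => /andP[/eqP -> _] /andP[/eqP -> _] ->.
  have prodE (F : option bool * int -> R) : \prod_(k <- s) F k =
      (\prod_(t <- sub None) F (None, t)) * (\prod_(t <- sub (Some true)) F (Some true, t)) *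
      (\prod_(t <- sub (Some false)) F (Some false, t)).
    rewrite /sub !big_map !big_filter; elim: (s) => [|[[[]|] t] l IH]; first by rewrite !big_nil !mulr1.
    - by rewrite !big_cons/= IH; ring.
    - by rewrite !big_cons/= IH; ring.
    - by rewrite !big_cons/= IH; ring.
  have -> : cyl_event (noise (innov beta u) bern xi) s a =
    fdd_event (innov beta u) (sub None) (fun t => a (None, t)) `&`
    fdd_event bern (sub (Some true)) (fun t => a (Some true, t)) `&`
    fdd_event xi (sub (Some false)) (fun t => a (Some false, t)).
    apply/seteqP; split => o /=.
      move=> /allP h; split; first split.
      + by apply/allP => t /mapP[[k1 k2]]; rewrite mem_filter/= => /andP[/eqP -> ks] ->; exact: (h _ ks).
      + by apply/allP => t /mapP[[k1 k2]]; rewrite mem_filter/= => /andP[/eqP -> ks] ->; exact: (h _ ks).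
      + by apply/allP => t /mapP[[k1 k2]]; rewrite mem_filter/= => /andP[/eqP -> ks] ->; exact: (h _ ks).
    move=> [[/allP h1 /allP h2] /allP h3]; apply/allP => -[[[]|] t] ks.
    + by apply: h2; apply/mapP; exists (Some true, t) => //; rewrite mem_filter.
    + by apply: h3; apply/mapP; exists (Some false, t) => //; rewrite mem_filter.
    + by apply: h1; apply/mapP; exists (None, t) => //; rewrite mem_filter.
  by rewrite noise_factor prodE indI// indB// indX.
- exact: cdf.
- by move=> t; case: (mom t).
- by move=> t; case: (mom t).
- by move=> t; case: (mom t).
- by move=> t o; rewrite /bern; case: (_ == _); [right|left].
- move=> t; rewrite /bern Ex_ind; last by apply: measurable_fun_eqr.
  case: md => _ _ _ [h _] _; have [h1 _] := h t.
  rewrite (_ : [set o | z t o == 1] = [set o | z t o = 1]) ?h1//.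
  by apply/seteqP; split => o /= /eqP.
- by move=> t A mA; case: md => _ _ _ _ [h _ _]; exact: h.
Qed.

End Model.

(** * Assembly of both claims *)

Section Assembly.
Context (R : realType) (p : nat) (beta : 'I_p -> R).

Lemma resids_ext (n : nat) (bh : 'I_p -> R) (y y' : int -> R) :
  (forall (k : 'I_n) (i : 'I_p.+1), y (k.+1%:Z - i%:Z) = y' (k.+1%:Z - i%:Z)) ->
  resids n bh y = resids n bh y'.
Proof.
move=> h; apply/eq_in_map => k; rewrite mem_iota => /andP[k1 kn].
have kn' : (k.-1 < n)%N by lia.
have e : k = k.-1.+1 by lia.
rewrite /resid e; congr (_ - _); first by have := h (Ordinal kn') ord0; rewrite !subr0.
apply: eq_bigr => i _; congr (_ * _).
exact: (h (Ordinal kn') (lift ord0 i)).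
Qed.

Lemma le_eucl (v : 'I_p -> R) i : `|v i| <= eucl v.
Proof.
rewrite /eucl -sqrtr_sqr ler_sqrt ?sumr_ge0//; last by move=> j _; exact: sqr_ge0.
by rewrite (bigD1 i)//= lerDl sumr_ge0// => j _; exact: sqr_ge0.
Qed.

Lemma chi2_stat_ge0 (n m : nat) (bh : 'I_p -> R) (y : int -> R) xs :
  0 <= chi2_stat n m bh y xs.
Proof. by apply: sumr_ge0 => j _; rewrite mulr_ge0 ?sqr_ge0// invr_ge0 mulr_ge0. Qed.

(** The denominator is a count between 0 and n, so its inverse is a finite sum over its possible
    values; this also covers the value 0. *)
Lemma measurable_chi2 (d : measure_display) (Omega : measurableType d) (n m : nat)
  (bh : Omega -> 'I_p -> R) (y : int -> Omega -> R) (xs : nat -> \bar R) :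
  (forall j, (j < m)%N -> (xs j < xs j.+1)%E) ->
  (forall i, measurable_fun setT (fun w => bh w i)) ->
  (forall t, measurable_fun setT (y t)) ->
  measurable_fun setT (fun w => chi2_stat n m (bh w) (y^~ w) xs).
Proof.
move=> xsS mb my.
have mr t : measurable_fun setT (fun w => resid (bh w) (y^~ w) t).
  apply: measurable_funB => //; apply: measurable_sum => i.
  exact: measurable_funM.
rewrite /chi2_stat (_ : (fun w => _) = (fun w => \sum_(j < m)
  ((nu_plus n (bh w) (y^~ w) xs j.+1 - nu_minus n (bh w) (y^~ w) xs j.+1) ^+ 2 *
   (\sum_(k < n.+1) (nu_plus n (bh w) (y^~ w) xs j.+1 == k%:R)%:R * (2 * k%:R)^-1)))); last first.
  apply/funext => w; rewrite big_add1 big_mkord; apply: eq_bigr => j _; congr (_ * _).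
  have cn : (count (in_Bplus xs j.+1) (resids n (bh w) (y^~ w)) < n.+1)%N.
    by rewrite ltnS (leq_trans (count_size _ _))// size_map size_iota.
  rewrite (bigD1 (Ordinal cn))//= /nu_plus eqxx mul1r big1 ?addr0// => k kn.
  rewrite eqr_nat (_ : _ == _ = false) ?mul0r//; apply/negbTE; apply: contra kn => /eqP e.
  by apply/eqP/val_inj.
have ej (j : 'I_m) : (xs j.+1.-1 <= xs j.+1)%E by apply: ltW; apply: xsS; exact: ltn_ord.
have mI (x : \bar R) t : measurable_fun setT (fun w => Ind x (resid (bh w) (y^~ w) t)).
  exact: (measurableT_comp (measurable_Ind x)).
have mp (j : 'I_m) : measurable_fun setT (fun w => nu_plus n (bh w) (y^~ w) xs j.+1).
  under eq_fun do rewrite (nu_plusE _ _ _ (ej j)).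
  by apply: measurable_sum => t; apply: measurable_funB.
have mn (j : 'I_m) : measurable_fun setT (fun w => nu_minus n (bh w) (y^~ w) xs j.+1).
  under eq_fun do rewrite (nu_minusE _ _ _ (ej j)).
  by apply: measurable_sum => t; apply: measurable_funB.
apply: measurable_sum => j; apply: measurable_funM.
  by apply: measurable_funX; apply: measurable_funB.
apply: measurable_sum => k; apply: measurable_funM => //.
by apply: measurable_ind; apply: measurable_fun_eqr.
Qed.

Lemma chi2_laplace0 m lam : chi2_laplace m lam 0 = 1 :> R.
Proof. by rewrite /chi2_laplace !mulr0 addr0 sqrtr1 invr1 expr1n mul0r expR0 mulr1. Qed.

Context (m : nat) (xs : nat -> \bar R) (muP muQ Pi : probability R R)
  (est : nat -> seq R -> 'I_p -> R) (Gam Rb : R).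
Hypotheses (st : stable_AR beta) (m0 : (0 < m)%N) (xs0 : xs 0%N = 0%E)
  (xsS : forall j, (j < m)%N -> (xs j < xs j.+1)%E)
  (pp : forall j, (1 <= j <= m)%N -> 0 < p_plus muP xs j)
  (Gam0 : 0 <= Gam) (Rb0 : 0 <= Rb) (sy : symmetric_law muP)
  (zP : zero_mean_finite_var muP) (zQ : zero_mean_finite_var muQ)
  (tP : twice_diff_bdd (df_of muP)) (tQ : twice_diff_bdd (df_of muQ)).
Context (d : measure_display) (Omega : measurableType d)
  (Pr : nat -> R -> R -> probability Omega R)
  (u eps z xi : nat -> R -> R -> int -> Omega -> R).
Hypotheses
  (md : forall n g r, 0 <= g -> 0 <= r <= Rb ->
     contaminated_AR_model (Pr n g r) beta (mixF (df_of muP) (df_of muQ) (rate r n))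
       (rate g n) Pi (u n g r) (eps n g r) (z n g r) (xi n g r))
  (mest : forall n g r (i : 'I_p), 0 <= g -> 0 <= r <= Rb ->
     measurable_fun setT (fun w => est_at n est (u n g r) (z n g r) (xi n g r) w i))
  (tight : forall e : R, 0 < e -> exists (M : R) (N : nat),
     forall n g r, (N <= n)%N -> 0 <= g <= Gam -> 0 <= r <= Rb ->
       fine (Pr n g r [set w | M < Num.sqrt n%:R *
          eucl (fun i => est_at n est (u n g r) (z n g r) (xi n g r) w i - beta i)]) <= e).

(** Noncentralities stay below a [Lam] determined by [Gam] and [Rb], so one finite set [S] of
    Laplace arguments serves all rates, and [core_laplace] is applied at each positive element of
    it. *)
Lemma chi2_limit (e : R) : 0 < e -> exists N : nat, forall n, (N <= n)%N ->
  forall x g r : R, 0 <= g <= Gam -> 0 <= r <= Rb ->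
  `|fine (Pr n g r [set w | chi2_at n m est xs (u n g r) (z n g r) (xi n g r) w <= x])
    - ncchi2_cdf m (wnorm2 m muP xs (drift beta muP muQ Pi xs r g)) x| <= e.
Proof.
move=> e0.
have [MP crP] := df_reg tP; have [MQ crQ] := df_reg tQ.
pose sg2 := Ex muP (fun x => x ^+ 2) + Ex muQ (fun x => x ^+ 2).
have sg0 : 0 <= sg2 by rewrite addr_ge0//; apply: Ex_ge0 => x; exact: sqr_ge0.
pose Dd := Rb * 2 + Gam * (4 * p.+1%:R).
pose Lam := \sum_(j < m) Dd ^+ 2 / (2 * p_plus muP xs j.+1).
have ip j : (j < m)%N -> 0 <= (2 * p_plus muP xs j.+1)^-1.
  by move=> jm; rewrite invr_ge0 mulr_ge0// ltW//; apply: pp.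
have Lam0 : 0 <= Lam.
  by apply: sumr_ge0 => j _; rewrite mulr_ge0 ?sqr_ge0// ip.
have lamL g r : 0 <= g <= Gam -> 0 <= r <= Rb ->
    0 <= wnorm2 m muP xs (drift beta muP muQ Pi xs r g) <= Lam.
  move=> /andP[g0 gG] /andP[r0 rR]; rewrite (wnorm2_ge0 pp)/= /wnorm2 big_add1 big_mkord.
  apply: ler_sum => j _; rewrite ler_wpM2r ?ip// -real_normK ?num_real//.
  rewrite lerXn2r ?nnegrE//; first by rewrite /Dd addr_ge0// !mulr_ge0.
  apply: (le_trans (ler_normD _ _)); rewrite !normrM (ger0_norm g0) (ger0_norm r0).
  apply: lerD; apply: ler_pM => //.
    have w11 : 0 <= (1 : R) <= 1 by rewrite ler01 lexx.
    by have := mucell_norm muQ w11 xs j.+1; rewrite /mucell mul1r mulr1.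
  rewrite /delta_j.
  have h x := DeltaPi_norm beta muP Pi x.
  have := h (xs j.+1); have := h (xs j.+1.-1); have := h (- xs j.+1.-1)%E; have := h (- xs j.+1)%E.
  rewrite !ler_norml; move: (DeltaPi _ _ _ _) (DeltaPi _ _ _ _) (DeltaPi _ _ _ _) (DeltaPi _ _ _ _) (p.+1%:R).
  by move=> ? ? ? ? ? /andP[? ?] /andP[? ?] /andP[? ?] /andP[? ?]; apply/andP; split; lra.
have [S [eta [eta0 S0 hS]]] := laplace_to_cdf m0 Lam0 e0.
have eta4 : 0 < eta / 4 by rewrite divr_gt0.
have [M1 [N1 hM]] := tight eta4.
have [N2 hN2] : exists N2 : nat, forall n, (N2 <= n)%N -> forall k : 'I_(size S), 0 < S`_k ->
    forall (B : int -> Omega -> R) g r (X : Omega -> R) (bh : Omega -> 'I_p -> R),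
    0 <= g <= Gam -> 0 <= r <= Rb ->
    (forall t, measurable_fun setT (u n g r t)) -> strictly_stationary (Pr n g r) (u n g r) ->
    noise_model (Pr n g r) (innov beta (u n g r)) B (xi n g r)
      (mixF (df_of muP) (df_of muQ) (rate r n)) (rate g n) sg2 Pi ->
    measurable_fun setT X -> (forall w, 0 <= X w) ->
    prob_le (Pr n g r) [set w | ~ (X w = chi2_stat n m (bh w) (yobs (u n g r) B (xi n g r) ^~ w) xs /\
     forall i, `|Num.sqrt n%:R * (bh w i - beta i)| <= `|M1|)] (eta / 4) ->
    `|Ex (Pr n g r) (fun w => expR (- S`_k * X w)) -
      chi2_laplace m (wnorm2 m muP xs (drift beta muP muQ Pi xs r g)) S`_k| <= eta.
  apply: fin_eventually => k.
  have [k0|k0] := ltP 0 S`_k; last by exists 0%N.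
  have [N0 hN0] := core_laplace (muQ := muQ) Pi st crP crQ sy xs0 xsS pp Gam0 Rb0
    (normr_ge0 M1) k0 eta0 sg0.
  by exists N0 => n nN _ B g r X bh; exact: hN0.
exists (maxn N1 N2) => n; rewrite geq_max => /andP[n1 n2] x g r hg hr.
have g0 : 0 <= g by case/andP: hg.
have w01 : 0 <= rate r n <= 1 by apply: rate01; case/andP: hr.
have mod := md n g0 hr.
have nm := model_noise w01 zP zQ mod.
have [mm _ [_ ust] _ _] := mod.
set u' := u n g r in mod nm mm ust *; set z' := z n g r in mod nm mm *.
set xi' := xi n g r in mod nm mm *.
pose bh w := est_at n est u' z' xi' w.
have mbh i : measurable_fun setT (fun w => bh w i) by exact: mest.
have mX : measurable_fun setT (chi2_at n m est xs u' z' xi').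
  apply: measurable_chi2 => // t; apply: measurable_funD; first by case: (mm t).
  by apply: measurable_funM; case: (mm t).
have X0 w : 0 <= chi2_at n m est xs u' z' xi' w by exact: chi2_stat_ge0.
apply: (hS _ (lamL g r hg hr) d Omega (Pr n g r) _ mX X0) => s sS.
(* At s = 0 both transforms are 1, while [core_laplace] asks for a positive argument. *)
have [s0|s0] := ltP 0 s; last first.
  have -> : s = 0 by apply/eqP; rewrite eq_le s0 (allP S0).
  rewrite chi2_laplace0 (_ : (fun w => _) = fun=> 1); first by rewrite Ex_cst subrr normr0 ltW.
  by apply/funext => w; rewrite oppr0 mul0r expR0.
have ks : (index s S < size S)%N by rewrite index_mem.
have sE : S`_(Ordinal ks) = s by rewrite /= nth_index.
rewrite -sE; apply: (hN2 n n2 (Ordinal ks) _ (bern z') g r _ bh hg hr _ ust nm mX X0).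
  by rewrite sE.
  by move=> t; case: (mm t).
(* The observations contain [z], the noise family its version [bern]. Over the finitely many times
   used by the residuals the two differ on a null event only. *)
pose NZ (k : 'I_n * 'I_p.+1) : set Omega :=
  [set w | z' (k.1.+1%:Z - k.2%:Z) w <> bern z' (k.1.+1%:Z - k.2%:Z) w].
have hNZ k : prob_le (Pr n g r) (NZ k) 0.
  have as1 := bern_as mod (k.1.+1%:Z - k.2%:Z).
  have mA : measurable [set w | z' (k.1.+1%:Z - k.2%:Z) w = bern z' (k.1.+1%:Z - k.2%:Z) w].
    apply: measurable_eqset; first by case: (mm (k.1.+1%:Z - k.2%:Z)).
    exact: (nm_meas nm (Some true, k.1.+1%:Z - k.2%:Z)).
  exists (~` [set w | z' (k.1.+1%:Z - k.2%:Z) w = bern z' (k.1.+1%:Z - k.2%:Z) w]); split => //.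
    exact: measurableC.
  by rewrite probability_setC// as1 subee.
have ev1 := prob_le_bigcup hNZ; rewrite big1// in ev1.
have ev2 : prob_le (Pr n g r) [set w | M1 < Num.sqrt n%:R * eucl (fun i => bh w i - beta i)] (eta / 4).
  apply: prob_le_meas; last exact: hM.
  apply: measurable_bset; apply: measurable_fun_ltr => //; apply: measurable_funM => //.
  apply: (measurableT_comp (continuous_measurable_fun (@sqrt_continuous R))); apply: measurable_sum => i.
  by apply: measurable_funX; apply: measurable_funB.
rewrite -[eta / 4]add0r; apply: prob_le_sub (prob_leU ev1 ev2).
move=> w /= hw; apply: contrapT => /not_orP[h1 h2]; apply: hw; split.
  rewrite /chi2_at /chi2_stat /nu_plus /nu_minus -/(bh w).
  rewrite (@resids_ext n (bh w) _ (yobs u' (bern z') xi' ^~ w))// => k i.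
  rewrite /yobs; congr (_ + _ * _); apply: contrapT => hn; apply: h1.
  by exists (k, i).
move=> i; rewrite normrM (ger0_norm (sqrtr_ge0 _)).
(* The bound supplied by Condition (iv) may be negative, hence the absolute value. *)
apply: (@le_trans _ _ M1); last exact: ler_norm.
apply: (@le_trans _ _ (Num.sqrt n%:R * eucl (fun i => bh w i - beta i))).
  by rewrite ler_wpM2l ?sqrtr_ge0//; exact: (le_eucl (fun i => bh w i - beta i)).
by rewrite leNgt; apply/negP.
Qed.

End Assembly.

Theorem theorem3p1 (R : realType) (p : nat) (beta : 'I_p -> R) (m : nat)
    (xs : nat -> \bar R) (muP Pi : probability R R)
    (est : nat -> seq R -> 'I_p -> R) (Gam : R) :
  stable_AR beta ->
  (0 < m)%N ->
  xs 0%N = 0%E -> xs m = +oo%E ->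
  (forall j, (j < m)%N -> (xs j < xs j.+1)%E) ->
  (forall j, (1 <= j <= m)%N -> 0 < p_plus muP xs j) ->
  0 <= Gam ->
  (* ---------------- Part 1: hypothesis S (rho = 0) ---------------- *)
  (forall (d : measure_display) (Omega : measurableType d)
      (Pr : nat -> R -> probability Omega R)
      (u eps z xi : nat -> R -> int -> Omega -> R),
    symmetric_law muP ->
    zero_mean_finite_var muP ->
    twice_diff_bdd (df_of muP) ->
    (forall n g, 0 <= g ->
       contaminated_AR_model (Pr n g) beta (df_of muP) (rate g n) Pi
         (u n g) (eps n g) (z n g) (xi n g)) ->
    (forall n g (i : 'I_p), 0 <= g ->
       measurable_fun setT (fun w => est_at n est (u n g) (z n g) (xi n g) w i)) ->
    (* Condition (iv) with rho = 0 *)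
    (forall Gb e : R, 0 < e -> exists (M : R) (N : nat),
       forall n g, (N <= n)%N -> 0 <= g <= Gb ->
         fine (Pr n g [set w | M < Num.sqrt n%:R *
            eucl (fun i => est_at n est (u n g) (z n g) (xi n g) w i - beta i)])
         <= e) ->
    forall e : R, 0 < e -> exists N : nat, forall n, (N <= n)%N ->
      forall x g : R, 0 <= g <= Gam ->
        `| fine (Pr n g [set w | chi2_at n m est xs (u n g) (z n g) (xi n g) w <= x])
           - ncchi2_cdf m (g ^+ 2 * wnorm2 m muP xs (delta_j beta muP Pi xs)) x |
        <= e)
  /\
  (* ---------------- Part 2: local alternatives A_n(rho) ----------- *)
  (forall (muQ : probability R R) (Rb : R)
      (d : measure_display) (Omega : measurableType d)
      (Pr : nat -> R -> R -> probability Omega R)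
      (u eps z xi : nat -> R -> R -> int -> Omega -> R),
    0 <= Rb ->
    symmetric_law muP ->
    ~ symmetric_law muQ ->
    (* Condition (i) *)
    zero_mean_finite_var muP -> zero_mean_finite_var muQ ->
    (* Condition (ii) *)
    twice_diff_bdd (df_of muP) -> twice_diff_bdd (df_of muQ) ->
    (forall n g r, 0 <= g -> 0 <= r ->
       contaminated_AR_model (Pr n g r) beta
         (fun x => (1 - rate r n) * df_of muP x + rate r n * df_of muQ x)
         (rate g n) Pi (u n g r) (eps n g r) (z n g r) (xi n g r)) ->
    (forall n g r (i : 'I_p), 0 <= g -> 0 <= r ->
       measurable_fun setT
         (fun w => est_at n est (u n g r) (z n g r) (xi n g r) w i)) ->
    (* Condition (iv) *)
    (forall Rb' Gb e : R, 0 < e -> exists (M : R) (N : nat),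
       forall n g r, (N <= n)%N -> 0 <= g <= Gb -> 0 <= r <= Rb' ->
         fine (Pr n g r [set w | M < Num.sqrt n%:R *
            eucl (fun i => est_at n est (u n g r) (z n g r) (xi n g r) w i - beta i)])
         <= e) ->
    forall e : R, 0 < e -> exists N : nat, forall n, (N <= n)%N ->
      forall x g r : R, 0 <= g <= Gam -> 0 <= r <= Rb ->
        `| fine (Pr n g r
               [set w | chi2_at n m est xs (u n g r) (z n g r) (xi n g r) w <= x])
           - ncchi2_cdf m
               (wnorm2 m muP xs (fun j => r * (q_plus muQ xs j - q_minus muQ xs j)
                                         + g * delta_j beta muP Pi xs j)) x |
        <= e).

Proof.
move=> st m0 xs0 _ xsS pp G0; split.
  move=> d Omega Pr u eps z xi sy zP tP md mest tight e e0.
  (* The symmetric case is the mixture of P with itself and [Rb = 0]. The drift is then [g] times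
     [delta_j], and its weighted squared norm scales by g^2. *)
  have mixPP w : mixF (df_of muP) (df_of muP) w = df_of muP.
    by apply/funext => x; rewrite /mixF; ring.
  have [|||N hN] := @chi2_limit R p beta m xs muP muP Pi est Gam 0 st m0 xs0 xsS pp G0 (lexx 0)
    sy zP zP tP tP d Omega (fun n g _ => Pr n g) (fun n g _ => u n g) (fun n g _ => eps n g)
    (fun n g _ => z n g) (fun n g _ => xi n g) _ _ _ e e0.
  - by move=> n g r g0 _; rewrite mixPP; exact: md.
  - by move=> n g r i g0 _; exact: mest.
  - by move=> a a0; have [M [N h]] := tight Gam a a0; exists M, N => n g r nN hg _; exact: h.
  exists N => n nN x g hg.
  have := hN n nN x g 0 hg; rewrite lexx => /(_ isT).
  rewrite (_ : wnorm2 m muP xs (drift _ _ _ _ _ _ _) =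
    g ^+ 2 * wnorm2 m muP xs (delta_j beta muP Pi xs))//.
  rewrite /wnorm2 mulr_sumr; apply: eq_bigr => j _.
  by rewrite /drift mul0r add0r exprMn mulrA.
move=> muQ Rb d Omega Pr u eps z xi Rb0 sy _ zP zQ tP tQ md mest tight e e0.
apply: (@chi2_limit R p beta m xs muP muQ Pi est Gam Rb st m0 xs0 xsS pp G0 Rb0
  sy zP zQ tP tQ d Omega Pr u eps z xi _ _ _ e e0).
- by move=> n g r g0 /andP[r0 _]; exact: md.
- by move=> n g r i g0 /andP[r0 _]; exact: mest.
- by move=> a a0; exact: tight.
Qed.
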